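(* Every real analytic $5$-dimensional local CR-generic submanifold $M^5\subset\mathbb C^4$ of codimension $3$ which is maximally minimal, namely which satisfies that $D^1M=T^cM$ has rank $2$, $D^2M=T^cM+[T^cM,T^cM]$ has rank $3$, and $D^3M=T^cM+[T^cM,T^cM]+[T^cM,[T^cM,T^cM]]$ has maximal possible rank $5$, may be represented, in suitable holomorphic coordinates $(z,w_1,w_2,w_3)$, by three complex defining equations of the form $$w_1-\overline w_1=2i\,z\overline z+\Pi_1(z,\overline z,\overline w_1,\overline w_2,\overline w_3),$$ $$w_2-\overline w_2=2i\,z\overline z(z+\overline z)+\Pi_2(z,\overline z,\overline w_1,\overline w_2,\overline w_3),$$ $$w_3-\overline w_3=2\,z\overline z(z-\overline z)+\Pi_3(z,\overline z,\overline w_1,\overline w_2,\overline w_3),$$ where the three remainders $\Pi_1,\Pi_2,\Pi_3$ are analytic near the origin, are all an $\mathrm O(|z|^4)+z\overline z\,\mathrm O(|w|)$, and satisfy both the reality condition and the two normality conditions $0\equiv\Pi_j(0,\overline z,\overline w_1,\overline w_2,\overline w_3)\equiv\Pi_j(z,0,\overline w_1,\overline w_2,\overline w_3)$ for $j=1,2,3$. Conversely, for any choice of three such analytic functions $\Pi_1,\Pi_2,\Pi_3$ enjoying these conditions, the zero-locus of the three equations above represents a real analytic $5$-dimensional local CR-generic submanifold $M^5\subset\mathbb C^4$ of codimension $3$ which is maximally minimal.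
   Context: Here $T^cM=TM\cap J(TM)$ with $J$ the standard complex structure of $T\mathbb C^4$; $M$ is CR-generic if $T_pM+J(T_pM)=T_p\mathbb C^4$ for all $p\in M$. Sums of brackets denote the distributions spanned over real analytic functions by iterated Lie brackets of local sections of $T^cM$. ''Local'' means in a neighborhood of a reference point, taken as origin. Reality condition: writing the $j$-th equation as $w_j=\Theta_j(z,\overline z,\overline w)$ with $\overline w=(\overline w_1,\overline w_2,\overline w_3)$, one requires the power series identity $w_j\equiv\Theta_j\big(z,\overline z,\overline\Theta(\overline z,z,w)\big)$ for $j=1,2,3$ in the independent variables $z,\overline z,w$, where $\overline\Theta=(\overline\Theta_1,\overline\Theta_2,\overline\Theta_3)$ is obtained by conjugating the Taylor coefficients of $\Theta$. *)

(* Defs.v *)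
From HB Require Import structures.
From mathcomp Require Import all_boot all_order all_algebra.
From mathcomp Require Import complex.
From mathcomp Require Import all_classical all_reals all_analysis.

Set Implicit Arguments.
Unset Strict Implicit.
Unset Printing Implicit Defensive.

Import Order.TTheory GRing.Theory Num.Theory.
Import numFieldNormedType.Exports.

Local Open Scope classical_set_scope.
Local Open Scope ring_scope.

(* The topology of C, which the library only provides for abstract number
   fields. *)
HB.instance Definition _ (R : rcfType) := NormedModule.copy R[i] R[i]^o.

Section Analytic.
Context {K : numFieldType} {n : nat}.
Implicit Types (c : {ffun 'I_n -> nat} -> K) (p x : 'rV[K]_n).

Definition monomial x (a : {ffun 'I_n -> nat}) : K := \prod_i x 0 i ^+ a i.

(* Sum over the multi-indices all of whose entries are < N.  For an absolutely
   convergent series, the limit does not depend on this choice of partial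
   sums. *)
Definition box_sum c (N : nat) : K :=
  \sum_(a : {ffun 'I_n -> 'I_N}) c [ffun i => a i : nat].

(* c is the family of Taylor coefficients of f at p: the series is absolutely
   convergent, with sum f, on a polydisc centred at p (the norm of 'rV[K]_n is
   the sup norm). *)
Definition taylor_series p c (f : 'rV[K]_n -> K) : Prop :=
  exists r : K, [/\ 0 < r,
    exists B : K, forall N,
      box_sum (fun a => `|c a| * r ^+ (\sum_i a i)%N) N <= B
  & forall x, `|x - p| < r ->
      (fun N => box_sum (fun a => c a * monomial (x - p) a) N) @ \oo --> f x].

(* Real analytic for K = R, holomorphic for K = R[i]; both are germ notions. *)
Definition analytic_at p (f : 'rV[K]_n -> K) : Prop :=
  exists c, taylor_series p c f.

Definition analytic_map_at p m (F : 'rV[K]_n -> 'rV[K]_m) : Prop :=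
  forall j, analytic_at p (fun x => F x 0 j).

End Analytic.

Section LieBrackets.
Context {R : realType} {n : nat}.
Notation vfield := ('rV[R]_n -> 'rV[R]_n).
Implicit Types (N : set 'rV[R]_n) (T : 'rV[R]_n -> 'M[R]_n) (p : 'rV[R]_n).

(* 'jacobian' is transposed, the differential being v |-> v *m jacobian F p. *)
Definition lie_bracket (X Y : vfield) : vfield :=
  fun p => X p *m jacobian Y p - Y p *m jacobian X p.

(* Germs at p of sections over N of the distribution whose fibre at q is the
   row space of T q.  A vector field on N is represented by an ambient analytic
   extension: if T q is contained in the tangent space of N at q, then the
   brackets of such extensions, restricted to N, do not depend on them. *)
Definition local_section N T p (X : vfield) : Prop :=
  analytic_map_at p X /\ \forall q \near p, N q -> (X q <= T q)%MS.

(* Brackets [X_1, [X_2, ... [X_l, X_(l+1)]]] of l + 1 sections. *)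
Fixpoint iterated_bracket N T p (l : nat) (W : vfield) : Prop :=
  match l with
  | 0 => local_section N T p W
  | l'.+1 => exists X V : vfield, [/\ local_section N T p X,
      iterated_bracket N T p l' V & W = lie_bracket X V]
  end.

(* The span over analytic functions of the brackets of at most k sections. *)
Definition bracket_distribution N T p (k : nat) (X : vfield) : Prop :=
  exists m (f : 'I_m -> 'rV[R]_n -> R) (W : 'I_m -> vfield),
    [/\ forall i, analytic_at p (f i),
        forall i, exists2 l, (l < k)%N & iterated_bracket N T p l (W i)
      & X = fun q => \sum_i f i q *: W i q].

Definition bracket_fibre N T (k : nat) p : set 'rV[R]_n :=
  [set v | exists2 X, bracket_distribution N T p k X & v = X p].

Definition has_rank (V : set 'rV[R]_n) (r : nat) : Prop :=
  exists B : 'M[R]_(r, n), row_free B /\ forall v, V v <-> (v <= B)%MS.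

End LieBrackets.

Section CRGeometry.
Context {R : realType}.
Local Notation C := R[i].

(* R^2n = C^n by (x, y) |-> x + i y; in these coordinates the standard complex
   structure is (x, y) |-> (- y, x), acting on row vectors from the right. *)
Definition complex_point n (v : 'rV[R]_(n + n)) : 'rV[C]_n :=
  \row_j (lsubmx v 0 j +i* rsubmx v 0 j)%C.

Definition cplx_structure n : 'M[R]_(n + n) := block_mx 0 1%:M (- 1%:M) 0.

Definition tangent n d (rho : 'rV[R]_n -> 'rV[R]_d) (p : 'rV[R]_n) : 'M[R]_n :=
  kermx (jacobian rho p).

Definition complex_tangent n d (rho : 'rV[R]_(n + n) -> 'rV[R]_d)
    (p : 'rV[R]_(n + n)) : 'M[R]_(n + n) :=
  (tangent rho p :&: tangent rho p *m cplx_structure n)%MS.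

(* The germ at 0 of M is a real analytic submanifold of real codimension d
   through 0, with equation rho = 0. *)
Definition local_equation n d (M : set 'rV[C]_n)
    (rho : 'rV[R]_(n + n) -> 'rV[R]_d) : Prop :=
  [/\ M 0, analytic_map_at 0 rho,
      \forall p \near (0 : 'rV[R]_(n + n)), M (complex_point p) <-> rho p = 0
    & \forall p \near (0 : 'rV[R]_(n + n)), M (complex_point p) ->
        \rank (jacobian rho p) = d].

Definition CR_generic n d (M : set 'rV[C]_n)
    (rho : 'rV[R]_(n + n) -> 'rV[R]_d) : Prop :=
  \forall p \near (0 : 'rV[R]_(n + n)), M (complex_point p) ->
    row_full (tangent rho p + tangent rho p *m cplx_structure n)%MS.

Definition maximally_minimal n d (M : set 'rV[C]_n)
    (rho : 'rV[R]_(n + n) -> 'rV[R]_d) : Prop :=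
  let N := @complex_point n @^-1` M in
  \forall p \near (0 : 'rV[R]_(n + n)), M (complex_point p) ->
    [/\ \rank (complex_tangent rho p) = 2%N,
        has_rank (bracket_fibre N (complex_tangent rho) 2 p) 3
      & has_rank (bracket_fibre N (complex_tangent rho) 3 p) 5].

Definition maximally_minimal_CR_generic_M5 (M : set 'rV[C]_(1 + 3)) : Prop :=
  exists rho : 'rV[R]_((1 + 3) + (1 + 3)) -> 'rV[R]_3,
    [/\ local_equation M rho, CR_generic M rho & maximally_minimal M rho].

End CRGeometry.

Section DefiningEquations.
Context {R : realType}.
Local Notation C := R[i].

Definition local_coordinates n (Phi : 'rV[C]_n -> 'rV[C]_n) : Prop :=
  [/\ analytic_map_at 0 Phi, Phi 0 = 0
    & exists Psi : 'rV[C]_n -> 'rV[C]_n,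
      [/\ analytic_map_at 0 Psi, Psi 0 = 0,
          \forall p \near (0 : 'rV[C]_n), Psi (Phi p) = p
        & \forall q \near (0 : 'rV[C]_n), Phi (Psi q) = q]].

Definition zcoord (p : 'rV[C]_(1 + 3)) : C := lsubmx p 0 0.
Definition wcoord (p : 'rV[C]_(1 + 3)) : 'rV[C]_3 := rsubmx p.

Definition cvec m (w : 'rV[C]_m) : 'rV[C]_m := map_mx Num.conj w.

(* C^5, with independent coordinates (z, zeta, omega), where (zeta, omega) are
   the complexifications of the conjugates of z and w. *)
Definition triple (z zeta : C) (omega : 'rV[C]_3) : 'rV[C]_(1 + (1 + 3)) :=
  row_mx z%:M (row_mx zeta%:M omega).

Implicit Types (Pi Theta : 'rV[C]_(1 + (1 + 3)) -> 'rV[C]_3).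

Definition cubic_model (z zeta : C) : 'rV[C]_3 :=
  \row_(j < 3) [:: 2 * 'i * z * zeta;
                   2 * 'i * z * zeta * (z + zeta);
                   2 * z * zeta * (z - zeta)]`_j.

Definition defining_equations Pi (p : 'rV[C]_(1 + 3)) : Prop :=
  let z := zcoord p in let w := wcoord p in
  w - cvec w = cubic_model z z^* + Pi (triple z z^* (cvec w)).

(* The right-hand side of the equations solved for w. *)
Definition solved_rhs Pi (x : 'rV[C]_(1 + (1 + 3))) : 'rV[C]_3 :=
  let z := lsubmx x 0 0 in
  let zeta := lsubmx (rsubmx x) 0 0 in
  let omega := rsubmx (rsubmx x) in
  omega + cubic_model z zeta + Pi x.

Definition conjugate_taylor
    (Theta Thetabar : 'rV[C]_(1 + (1 + 3)) -> 'rV[C]_3) : Prop :=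
  forall j : 'I_3, exists c : {ffun 'I_(1 + (1 + 3)) -> nat} -> C,
    taylor_series 0 c (fun x => Theta x 0 j) /\
    taylor_series 0 (fun a => (c a)^*) (fun x => Thetabar x 0 j).

(* Identities between convergent power series are stated as identities between
   their sums, near 0, in independent complex variables. *)
Definition reality_condition Theta : Prop :=
  exists2 Thetabar : 'rV[C]_(1 + (1 + 3)) -> 'rV[C]_3, conjugate_taylor Theta Thetabar &
    \forall x \near (0 : 'rV[C]_(1 + (1 + 3))),
      let z := lsubmx x 0 0 in
      let zeta := lsubmx (rsubmx x) 0 0 in
      let w := rsubmx (rsubmx x) in
      w = Theta (triple z zeta (Thetabar (triple zeta z w))).

Definition normality_conditions Pi : Prop :=
  \forall x \near (0 : 'rV[C]_(1 + (1 + 3))),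
    let z := lsubmx x 0 0 in
    let zeta := lsubmx (rsubmx x) 0 0 in
    let omega := rsubmx (rsubmx x) in
    Pi (triple 0 zeta omega) = 0 /\ Pi (triple z 0 omega) = 0.

(* Pi is O(|z|^4) + z zbar O(|w|) at points where zeta and omega are the
   conjugates of z and w. *)
Definition remainder_order Pi : Prop :=
  exists A B : 'rV[C]_(1 + 3) -> 'rV[C]_3,
    [/\ \forall p \near (0 : 'rV[C]_(1 + 3)),
          Pi (triple (zcoord p) (zcoord p)^* (cvec (wcoord p))) =
          A p + (zcoord p * (zcoord p)^*) *: B p,
        A =O_ (0 : 'rV[C]_(1 + 3)) (fun p => zcoord p ^+ 4)
      & B =O_ (0 : 'rV[C]_(1 + 3)) wcoord].

Definition admissible_remainder Pi : Prop :=
  [/\ analytic_map_at 0 Pi, remainder_order Pi,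
      reality_condition (solved_rhs Pi) & normality_conditions Pi].

End DefiningEquations.

(* Main.v *)
(* Brackets are computed by test functions.  If, on M, the real part u of a holomorphic function
   has an imaginary part equal to f, then X u = (J X) f on M for all sections X of T^c M; hence
   the derivative of u along an iterated bracket only depends on the jet of f.  For
   f = |z|^2 g, the value of g at 0 governs [X, V] u, and when it vanishes, the derivative of g
   along T^c M governs [X, [Y, V]] u.

   In the model, f is |z|^2 (1, 2 x, 2 y) to leading order for the three coordinates u = Re w_j,
   so that an explicit frame L1, L2 of T^c M yields five independent fields; every bracket of two
   sections is a combination of L1, L2 and [L1, L2].  That the three complex equations define
   the real manifold Im (w - Theta) = 0 follows from the reality condition, which makes
   |w - Theta| small compared with itself when w - Theta is real.

   Conversely, the complexified real equations are solved for w and normalized so that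
   w = wbar + z zbar Q(z, zbar, wbar), where reality gives
   Q(z, zbar, 0) = i (alpha + beta x + gamma y) + O(|z|^2) with real alpha, beta, gamma in R^3.
   If a real covector c killed alpha, beta and gamma, then Re (c . w) would be killed by all
   brackets of length at most three at 0, so D^3 M would have rank less than 5.  So a real linear
   change of w turns alpha, beta, gamma into the coefficients of the model.

   Analyticity over C is handled through uniform approximation by polynomials on polydiscs, over R
   through complexification. *)

Require Import Defs.
From mathcomp Require Import all_boot all_order all_algebra.
From mathcomp Require Import complex.
From mathcomp Require Import all_classical all_reals all_analysis.
From mathcomp Require Import ring lra zify.
From mathcomp Require cyclic separable cyclotomic.
Import Order.TTheory GRing.Theory Num.Theory.
Import numFieldNormedType.Exports.

Local Open Scope classical_set_scope.
Local Open Scope ring_scope.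

Set Implicit Arguments.
Unset Strict Implicit.
Unset Printing Implicit Defensive.

(** * Norms on C and C^n *)

(** A section of T^c M is an ambient field constrained only on M, so an identity such as X u = (J X)
    f holds on M only, and it can be differentiated again only along vectors tangent to M. Hence
    brackets must be known to be tangent before they serve as derivations; the pairs (rho_j, 0) give
    this inside the formalism of test functions.

    The ranks of D^2 M and D^3 M are asked at all points of M near the origin, while jets can be
    computed only at the origin. Lower bounds spread to nearby points through a nonvanishing minor;
    upper bounds are proved at each point, from the frame for D^2 and from the dimension of the
    tangent space for D^3.

    The analytic work rests on Hadamard quotients, f(x) - f(y) = sum_i (x_i - y_i) S_i(x, y) with
    S_i analytic on the doubled space: strict derivatives, Lipschitz bounds, symmetry of second
    derivatives and division by coordinates are all read off from the S_i.

    Strict derivatives, where both points vary, are what the contraction argument behind the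
    implicit function theorem consumes directly. *)

Definition cn {R : realType} (z : R[i]) : R := ComplexField.Normc.normc z.

Section ComplexNorm.
Context {R : realType}.
Local Notation C := R[i].
Implicit Types x y z : C.

(** The norm of [R[i]] takes values in [R[i]], whose order is partial; [cn] is the same modulus in
    [R], where real arithmetic applies. *)
Lemma normCE z : `|z| = (cn z)%:C%C. Proof. by []. Qed.

Lemma cnE z : cn z = Num.sqrt (complex.Re z ^+ 2 + complex.Im z ^+ 2).
Proof. by case: z. Qed.

Lemma cn_ge0 z : 0 <= cn z. Proof. by rewrite cnE sqrtr_ge0. Qed.
Lemma cn0 : cn (0 : C) = 0. Proof. exact: ComplexField.Normc.normc0. Qed.
Lemma cn1 : cn (1 : C) = 1. Proof. exact: ComplexField.Normc.normc1. Qed.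
Lemma cnM x y : cn (x * y) = cn x * cn y.
Proof. exact: ComplexField.Normc.normcM. Qed.
Lemma cnV x : cn x^-1 = (cn x)^-1.
Proof. exact: ComplexField.Normc.normcV. Qed.
Lemma cnX x n : cn (x ^+ n) = cn x ^+ n.
Proof. by elim: n => [|n IH]; rewrite ?expr0 ?cn1 // !exprS cnM IH. Qed.
Lemma cnN x : cn (- x) = cn x. Proof. by rewrite !cnE; case: x => a b /=; rewrite !sqrrN. Qed.
Lemma cnD x y : cn (x + y) <= cn x + cn y.
Proof. by have := ler_normD x y; rewrite !normCE -rmorphD /= lecR. Qed.
Lemma cnB x y : cn (x - y) <= cn x + cn y.
Proof. by rewrite -(cnN y) cnD. Qed.
Lemma cn_distC x y : cn (x - y) = cn (y - x).
Proof. by rewrite -cnN opprB. Qed.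
Lemma cn_eq0 z : (cn z == 0) = (z == 0).
Proof. by apply/eqP/eqP => [/ComplexField.Normc.eq0_normc//|->]; rewrite cn0. Qed.
Lemma cn_gt0 z : (0 < cn z) = (z != 0).
Proof. by rewrite lt_neqAle cn_ge0 andbT eq_sym cn_eq0. Qed.
Lemma cn_real (a : R) : cn a%:C%C = `|a|.
Proof. by rewrite cnE /= expr0n addr0 sqrtr_sqr. Qed.
Lemma cn_conj z : cn z^* = cn z.
Proof. by rewrite !cnE; case: z => a b /=; rewrite sqrrN. Qed.
Lemma Re_le_cn z : `|complex.Re z| <= cn z.
Proof. by rewrite cnE -sqrtr_sqr ler_wsqrtr // lerDl sqr_ge0. Qed.
Lemma Im_le_cn z : `|complex.Im z| <= cn z.
Proof. by rewrite cnE -sqrtr_sqr ler_wsqrtr // lerDr sqr_ge0. Qed.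
Lemma cn_le_ReIm z : cn z <= `|complex.Re z| + `|complex.Im z|.
Proof.
rewrite {1}(complexE z); apply: le_trans (cnD _ _) _.
by rewrite cnM !cn_real cnE /= expr0n expr1n add0r sqrtr1 mul1r.
Qed.
Lemma cn_sum (I : Type) (r : seq I) (P : pred I) (F : I -> C) :
  cn (\sum_(i <- r | P i) F i) <= \sum_(i <- r | P i) cn (F i).
Proof.
elim/big_rec2 : _ => [|i u v _ uv]; first by rewrite cn0.
by apply: le_trans (cnD _ _) _; rewrite lerD2l.
Qed.
Lemma cn_prod (I : Type) (r : seq I) (P : pred I) (F : I -> C) :
  cn (\prod_(i <- r | P i) F i) = \prod_(i <- r | P i) cn (F i).
Proof. by elim/big_rec2 : _ => [|i u v _ <-]; rewrite ?cn1 ?cnM. Qed.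
Lemma cn_nat n : cn (n%:R : C) = n%:R.
Proof. by rewrite -(rmorph_nat (real_complex R)) cn_real normr_nat. Qed.

Lemma eq_cn_le z : (forall e, 0 < e -> cn z <= e) -> z = 0.
Proof.
move=> ze; apply/eqP; rewrite -cn_eq0; apply/eqP/le_anti; rewrite cn_ge0 andbT.
by apply/ler_addgt0Pl => e e0; rewrite addr0; exact: ze.
Qed.

Lemma cvgCP (u : nat -> C) (l : C) :
  (u @ \oo --> l) <-> forall e : R, 0 < e -> exists N, forall n, (N <= n)%N -> cn (u n - l) <= e.
Proof.
split=> [/cvgrPdist_le ul e e0|ul].
  have [|N _ NP] := ul e%:C%C; first by rewrite ltcR.
  by exists N => n Nn; have := NP _ Nn; rewrite normCE lecR cn_distC.
apply/cvgrPdist_le => e; rewrite ltcE => /andP[/eqP /= Ie Re0].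
have [N NP] := ul _ Re0; exists N => // n /= Nn.
by rewrite normCE lecE /= Ie eqxx cn_distC NP.
Qed.

Lemma cauchyC (u : nat -> C) :
  (forall e : R, 0 < e -> exists N, forall n, (N <= n)%N -> cn (u n - u N) <= e) ->
  exists l : C, u @ \oo --> l.
Proof.
move=> uc.
have cauchyR (v : nat -> R) : (forall n m, `|v n - v m| <= cn (u n - u m)) -> exists l : R, v @ \oo --> l.
  move=> vu; suff : cvg (v @ \oo) by move=> /cvg_ex.
  apply: cauchy_cvg; suff : cauchy_ex (v @ \oo) by exact: cauchy_exP.
  move=> e e0.
  have [N NP] := uc _ (divr_gt0 e0 (ltr0Sn _ 1)).
  exists (v N); exists N => // n /= Nn; rewrite /ball_ /=.
  apply: le_lt_trans (vu _ _) _; rewrite cn_distC; apply: le_lt_trans (NP _ Nn) _.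
  by rewrite ltr_pdivrMr // ltr_pMr // ltr1n.
have [|a /cvgrPdist_le ua] := cauchyR (fun n => complex.Re (u n)).
  by move=> n m; rewrite -raddfB Re_le_cn.
have [|b /cvgrPdist_le ub] := cauchyR (fun n => complex.Im (u n)).
  by move=> n m; rewrite -raddfB Im_le_cn.
exists (a +i* b)%C; apply/cvgCP => e e0.
have e20 : 0 < e / 2 by rewrite divr_gt0.
have [N _ NP] := ua _ e20; have [M _ MP] := ub _ e20.
exists (maxn N M) => n; rewrite geq_max => /andP[Nn Mn].
apply: le_trans (cn_le_ReIm _) _; rewrite !raddfB /=.
rewrite (splitr e); apply: lerD.
  by rewrite distrC; exact: NP.
by rewrite distrC; exact: MP.
Qed.

End ComplexNorm.

Section Polydisc.
Context {R : realType}.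
Local Notation C := R[i].

Definition pd n (p : 'rV[C]_n) (r : R) (x : 'rV[C]_n) : Prop :=
  forall i, cn (x 0 i - p 0 i) < r.

Lemma pdS n (p : 'rV[C]_n) r s x : r <= s -> pd p r x -> pd p s x.
Proof. by move=> rs px i; apply: lt_le_trans (px i) rs. Qed.

Lemma pd_center n (p : 'rV[C]_n) r : 0 < r -> pd p r p.
Proof. by move=> r0 i; rewrite subrr cn0. Qed.

Lemma pdP n (p : 'rV[C]_n) (r : R) x : 0 < r -> `|x - p| < r%:C%C <-> pd p r x.
Proof.
move=> r0; rewrite distrC -[X in X <-> _]/(ball_ (fun x => `| x |) p r%:C%C x).
rewrite -mx_norm_ball; split=> [[_ h] i|h].
  have := h 0 i; rewrite /ball/= /ball_ /=.
  by rewrite normCE ltcR cn_distC.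
split=> [|i j]; first by rewrite ltcR.
by rewrite (ord1 i) /ball/= /ball_ /= normCE ltcR cn_distC.
Qed.

Lemma near_pd n (p : 'rV[C]_n) (P : set 'rV[C]_n) :
  (\forall x \near p, P x) <-> exists2 r : R, 0 < r & forall x, pd p r x -> P x.
Proof.
split=> [/nbhs_ballP[e /= e0 eP]|[r r0 rP]].
  move: e0; rewrite ltcE => /andP[/eqP /= Ie Re0].
  have ee : e = (complex.Re e)%:C%C by apply/eqP; rewrite eq_complex /= Ie !eqxx.
  exists (complex.Re e) => // x px; apply: eP; rewrite mx_norm_ball /ball_ /= ee distrC.
  exact/pdP.
apply/nbhs_ballP; exists r%:C%C => /=; first by rewrite ltcR.
move=> x; rewrite mx_norm_ball /ball_ /= distrC => h; exact/rP/pdP.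
Qed.

(** The l^1 norm: unlike the sup norm it is additive on [row_mx], so that displacements in a product
    of spaces split exactly. *)
Definition nrm n (x : 'rV[C]_n) : R := \sum_i cn (x 0 i).

Lemma nrm_ge0 n (x : 'rV[C]_n) : 0 <= nrm x.
Proof. by apply: sumr_ge0 => i _; exact: cn_ge0. Qed.
Lemma nrm0 n : nrm (0 : 'rV[C]_n) = 0.
Proof. by apply: big1 => i _; rewrite mxE cn0. Qed.
Lemma nrmD n (x y : 'rV[C]_n) : nrm (x + y) <= nrm x + nrm y.
Proof. by rewrite /nrm -big_split; apply: ler_sum => i _; rewrite mxE cnD. Qed.
Lemma nrmN n (x : 'rV[C]_n) : nrm (- x) = nrm x.
Proof. by apply: eq_bigr => i _; rewrite mxE cnN. Qed.
Lemma nrmZ n a (x : 'rV[C]_n) : nrm (a *: x) = cn a * nrm x.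
Proof. by rewrite /nrm mulr_sumr; apply: eq_bigr => i _; rewrite mxE cnM. Qed.
Lemma nrm_distC n (x y : 'rV[C]_n) : nrm (x - y) = nrm (y - x).
Proof. by rewrite -nrmN opprB. Qed.
Lemma nrm_triangle n (y x z : 'rV[C]_n) : nrm (x - z) <= nrm (x - y) + nrm (y - z).
Proof. by rewrite -[x - z](subrKA y) nrmD. Qed.
Lemma cn_le_nrm n (x : 'rV[C]_n) i : cn (x 0 i) <= nrm x.
Proof. by rewrite /nrm (bigD1 i) //= lerDl sumr_ge0 // => j _; exact: cn_ge0. Qed.
Lemma nrm_eq0 n (x : 'rV[C]_n) : nrm x = 0 -> x = 0.
Proof.
move=> x0; apply/rowP => i; apply/eqP; rewrite mxE -cn_eq0; apply/eqP/le_anti.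
by rewrite cn_ge0 andbT -x0 cn_le_nrm.
Qed.
Lemma nrm_sum n (I : Type) (r : seq I) (P : pred I) (F : I -> 'rV[C]_n) :
  nrm (\sum_(i <- r | P i) F i) <= \sum_(i <- r | P i) nrm (F i).
Proof.
elim/big_rec2 : _ => [|i u v _ uv]; first by rewrite nrm0.
by apply: le_trans (nrmD _ _) _; rewrite lerD2l.
Qed.
Lemma nrm_row_mx n m (x : 'rV[C]_n) (y : 'rV[C]_m) : nrm (row_mx x y) = nrm x + nrm y.
Proof.
by rewrite /nrm big_split_ord /=; congr (_ + _); apply: eq_bigr => i _; rewrite ?row_mxEl ?row_mxEr.
Qed.
Lemma nrm_mulmx n m (A : 'M[C]_(n, m)) : exists2 K, 0 <= K & forall x, nrm (x *m A) <= K * nrm x.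
Proof.
exists (\sum_i nrm (row i A)); first by apply: sumr_ge0 => i _; exact: nrm_ge0.
move=> x; rewrite mulmx_sum_row; apply: le_trans (nrm_sum _ _ _) _.
rewrite mulr_suml; apply: ler_sum => i _; rewrite nrmZ mulrC.
by apply: ler_wpM2l; [exact: nrm_ge0|exact: cn_le_nrm].
Qed.
Lemma nrm_pd n (p x : 'rV[C]_n) r : nrm (x - p) < r -> pd p r x.
Proof. by move=> h i; apply: le_lt_trans h; have := cn_le_nrm (x - p) i; rewrite !mxE. Qed.
Lemma pd_nrm n (p x : 'rV[C]_n) r : 0 < r -> pd p (r / n.+1%:R) x -> nrm (x - p) < r.
Proof.
move=> r0 h; have : nrm (x - p) <= \sum_(i < n) (r / n.+1%:R).
  by apply: ler_sum => i _; have := ltW (h i); rewrite !mxE.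
rewrite sumr_const card_ord => /le_lt_trans; apply.
by rewrite -[X in X < _]mulr_natr -mulrA gtr_pMr // mulrC ltr_pdivrMr // mul1r ltr_nat.
Qed.
Lemma near_nrm n (p : 'rV[C]_n) (P : set 'rV[C]_n) :
  (\forall x \near p, P x) <-> exists2 r : R, 0 < r & forall x, nrm (x - p) < r -> P x.
Proof.
split=> [/near_pd[r r0 rP]|[r r0 rP]].
  by exists r => // x /nrm_pd; exact: rP.
apply/near_pd; exists (r / n.+1%:R); first by rewrite divr_gt0.
by move=> x /pd_nrm => /(_ r0); exact: rP.
Qed.

End Polydisc.

(** * Analytic functions as uniform limits of polynomials *)

Section UniformApproximation.
Context {R : realType}.
Local Notation C := R[i].

(** Polynomial functions, generated inductively so that boundedness, composition and conjugation are
    inductions; coefficients appear only in [pfun_box]. *)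
Inductive pfun n : ('rV[C]_n -> C) -> Prop :=
| pfun_cst c : pfun (fun=> c)
| pfun_coord i : pfun (fun x => x 0 i)
| pfunD f g : pfun f -> pfun g -> pfun (fun x => f x + g x)
| pfunM f g : pfun f -> pfun g -> pfun (fun x => f x * g x).

Arguments pfun_cst {n} c.

Lemma eq_pfun n (f g : 'rV[C]_n -> C) : f =1 g -> pfun f -> pfun g.
Proof. by move=> /funext ->. Qed.

Lemma pfun_sum n (I : Type) (r : seq I) (P : pred I) (F : I -> 'rV[C]_n -> C) :
  (forall i, pfun (F i)) -> pfun (fun x => \sum_(i <- r | P i) F i x).
Proof.
move=> FP; elim: r => [|i r IH]; first by apply: (eq_pfun _ (pfun_cst 0)) => x; rewrite big_nil.
case Pi : (P i); last by apply: (eq_pfun _ IH) => x; rewrite big_cons Pi.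
by apply: (eq_pfun _ (pfunD (FP i) IH)) => x; rewrite big_cons Pi.
Qed.

Lemma pfun_prod n (I : Type) (r : seq I) (P : pred I) (F : I -> 'rV[C]_n -> C) :
  (forall i, pfun (F i)) -> pfun (fun x => \prod_(i <- r | P i) F i x).
Proof.
move=> FP; elim: r => [|i r IH]; first by apply: (eq_pfun _ (pfun_cst 1)) => x; rewrite big_nil.
case Pi : (P i); last by apply: (eq_pfun _ IH) => x; rewrite big_cons Pi.
by apply: (eq_pfun _ (pfunM (FP i) IH)) => x; rewrite big_cons Pi.
Qed.

Lemma pfunX n k (f : 'rV[C]_n -> C) : pfun f -> pfun (fun x => f x ^+ k).
Proof.
move=> fP; elim: k => [|k IH]; first by apply: (eq_pfun _ (pfun_cst 1)) => x; rewrite expr0.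
by apply: (eq_pfun _ (pfunM fP IH)) => x; rewrite exprS.
Qed.

Lemma pfun_comp n m (f : 'rV[C]_m -> C) (G : 'rV[C]_n -> 'rV[C]_m) :
  pfun f -> (forall j, pfun (fun x => G x 0 j)) -> pfun (f \o G).
Proof.
move=> fP GP; elim: fP => [c|i|g h _ IHg _ IHh|g h _ IHg _ IHh].
- exact: pfun_cst.
- exact: GP.
- exact: pfunD.
- exact: pfunM.
Qed.

Lemma pfun_shift n p (f : 'rV[C]_n -> C) : pfun f -> pfun (fun x => f (x + p)).
Proof.
move=> fP; apply: (pfun_comp fP) => j.
by apply: (eq_pfun _ (pfunD (pfun_coord j) (pfun_cst (p 0 j)))) => x; rewrite mxE.
Qed.

Lemma pfun_monomial n p (a : {ffun 'I_n -> nat}) :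
  pfun (fun x : 'rV[C]_n => monomial (x - p) a).
Proof.
apply: (@pfun_shift _ _ (monomial^~ a)).
by apply: pfun_prod => i; apply/pfunX/pfun_coord.
Qed.

Lemma pfun_bounded n p r (f : 'rV[C]_n -> C) :
  pfun f -> exists B, forall x, pd p r x -> cn (f x) <= B.
Proof.
elim=> [c|i|g h _ [B gB] _ [B' hB]|g h _ [B gB] _ [B' hB]].
- by exists (cn c).
- exists (r + cn (p 0 i)) => x /(_ i) /ltW px.
  by rewrite -[x 0 i](subrK (p 0 i)); apply: le_trans (cnD _ _) _; rewrite lerD2r.
- by exists (B + B') => x px; apply: le_trans (cnD _ _) (lerD _ _); [exact: gB|exact: hB].
- exists (B * B') => x px; rewrite cnM.
  by apply: ler_pM; rewrite ?cn_ge0 ?gB ?hB.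
Qed.

(** On polydiscs this amounts to holomorphy ([analyticP]). Unlike a power series expansion, it
    passes to products, compositions and uniform limits without any rearrangement of series. *)
Definition Ua n (D : set 'rV[C]_n) (f : 'rV[C]_n -> C) : Prop :=
  forall e : R, 0 < e -> exists2 P, pfun P & forall x, D x -> cn (f x - P x) <= e.

Definition bounded_dom n (D : set 'rV[C]_n) := exists p r, forall x, D x -> pd p r x.

Lemma bounded_pd n (p : 'rV[C]_n) r : bounded_dom (pd p r).
Proof. by exists p, r. Qed.

Lemma Ua_pfun n D (f : 'rV[C]_n -> C) : pfun f -> Ua D f.
Proof. by move=> fP e e0; exists f => // x _; rewrite subrr cn0 ltW. Qed.

Lemma Ua_lim n D (f : 'rV[C]_n -> C) :
  (forall e : R, 0 < e -> exists2 g, Ua D g & forall x, D x -> cn (f x - g x) <= e) -> Ua D f.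
Proof.
move=> fl e e0; have e20 : 0 < e / 2 by rewrite divr_gt0.
have [g gU fg] := fl _ e20; have [P PP gP] := gU _ e20.
exists P => // x Dx; rewrite -[f x - P x](subrKA (g x)) (splitr e).
by apply: le_trans (cnD _ _) (lerD _ _); [exact: fg|exact: gP].
Qed.

Lemma Ua_eq n (D : set 'rV[C]_n) f g : (forall x, D x -> f x = g x) -> Ua D f -> Ua D g.
Proof. by move=> fg fU e /fU[P PP fP]; exists P => // x Dx; rewrite -fg ?fP. Qed.

Lemma Ua_sub n (D E : set 'rV[C]_n) f : (forall x, E x -> D x) -> Ua D f -> Ua E f.
Proof. by move=> ED fU e /fU[P PP fP]; exists P => // x /ED; exact: fP. Qed.

Lemma UaD n (D : set 'rV[C]_n) f g : Ua D f -> Ua D g -> Ua D (fun x => f x + g x).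
Proof.
move=> fU gU e e0; have e20 : 0 < e / 2 by rewrite divr_gt0.
have [P PP fP] := fU _ e20; have [Q QP gQ] := gU _ e20.
exists (fun x => P x + Q x); first exact: pfunD.
move=> x Dx; rewrite opprD addrACA (splitr e).
by apply: le_trans (cnD _ _) (lerD _ _); [exact: fP|exact: gQ].
Qed.

Lemma Ua_bounded n (D : set 'rV[C]_n) f : bounded_dom D -> Ua D f ->
  exists2 B, 0 < B & forall x, D x -> cn (f x) <= B.
Proof.
move=> [p [r Dpr]] /(_ 1 ltr01)[P PP fP]; have [B PB] := pfun_bounded p r PP.
exists (1 + `|B|) => [|x Dx]; first by rewrite ltr_wpDr.
rewrite -[f x](subrK (P x)); apply: le_trans (cnD _ _) (lerD _ _); first exact: fP.
by apply: le_trans (PB _ (Dpr _ Dx)) _; exact: ler_norm.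
Qed.

Lemma UaM n (D : set 'rV[C]_n) f g : bounded_dom D ->
  Ua D f -> Ua D g -> Ua D (fun x => f x * g x).
Proof.
move=> Db fU gU e e0.
have [A A0 fA] := Ua_bounded Db fU; have [B B0 gB] := Ua_bounded Db gU.
(* The bound 1 keeps [P] below [A + 1] on [D], as the second half of the error requires. *)
have [P PP fP] : exists2 P, pfun P & forall x, D x -> cn (f x - P x) <= Num.min 1 (e / 2 / B).
  by apply: fU; rewrite lt_min ltr01 !divr_gt0.
have [Q QP gQ] : exists2 P, pfun P & forall x, D x -> cn (g x - P x) <= e / 2 / (A + 1).
  by apply: gU; rewrite !divr_gt0 // addr_gt0.
exists (fun x => P x * Q x); first exact: pfunM.
move=> x Dx; have -> : f x * g x - P x * Q x = (f x - P x) * g x + P x * (g x - Q x) by ring.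
have := fP x Dx; rewrite le_min => /andP[fP1 fP2].
rewrite (splitr e); apply: le_trans (cnD _ _) (lerD _ _); rewrite cnM.
  rewrite -[leRHS](divfK (lt0r_neq0 B0)); apply: ler_pM; rewrite ?cn_ge0 //; exact: gB.
rewrite mulrC -[leRHS](@divfK _ (A + 1)) ?gt_eqF // ?addr_gt0 //.
apply: ler_pM; rewrite ?cn_ge0 //; first exact: gQ.
rewrite -[P x](subKr (f x)); apply: le_trans (cnB _ _) (lerD _ _) => //; exact: fA.
Qed.

Lemma Ua_pcomp n m (D : set 'rV[C]_n) (f : 'rV[C]_m -> C) (G : 'rV[C]_n -> 'rV[C]_m) :
  bounded_dom D -> pfun f -> (forall j, Ua D (fun x => G x 0 j)) -> Ua D (f \o G).
Proof.
move=> Db fP GU; elim: fP => [c|i|g h _ IHg _ IHh|g h _ IHg _ IHh].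
- exact/Ua_pfun/pfun_cst.
- exact: GU.
- exact: UaD.
- exact: UaM.
Qed.

Lemma Ua_comp n m (D : set 'rV[C]_n) (E : set 'rV[C]_m) (f : 'rV[C]_m -> C)
    (G : 'rV[C]_n -> 'rV[C]_m) :
  bounded_dom D -> Ua E f -> (forall j, Ua D (fun x => G x 0 j)) ->
  (forall x, D x -> E (G x)) -> Ua D (f \o G).
Proof.
move=> Db fU GU DE; apply: Ua_lim => e /fU[P PP fP].
by exists (P \o G); [exact: Ua_pcomp|move=> x /DE; exact: fP].
Qed.

(** The two conjugations compensate each other: a polynomial goes to the polynomial with conjugate
    coefficients. *)
Lemma Ua_conj n (D : set 'rV[C]_n) f : Ua D f ->
  Ua (fun x => D (cvec x)) (fun x => (f (cvec x))^*).
Proof.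
move=> fU e /fU[P PP fP]; exists (fun x => (P (cvec x))^*); last first.
  by move=> x /fP; rewrite -rmorphB cn_conj.
elim: PP {fP} => [c|i|g h _ IHg _ IHh|g h _ IHg _ IHh].
- exact: pfun_cst.
- by apply: (eq_pfun _ (pfun_coord i)) => x; rewrite mxE conjCK.
- by apply: (eq_pfun _ (pfunD IHg IHh)) => x; rewrite rmorphD.
- by apply: (eq_pfun _ (pfunM IHg IHh)) => x; rewrite rmorphM.
Qed.

End UniformApproximation.

(** * Absolutely convergent power series *)

Section BoxSums.
Context {R : realType}.
Local Notation C := R[i].

(** Box sums of different sizes range over different index types; embedding the smaller box in the
    larger one lets them be subtracted termwise. *)
Lemma box_sum_widen (K : numFieldType) n (c : {ffun 'I_n -> nat} -> K) N M : (N <= M)%N ->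
  box_sum c N = \sum_(a : {ffun 'I_n -> 'I_M} | [forall i, a i < N]%N) c [ffun i => a i : nat].
Proof.
move=> NM; pose h (a : {ffun 'I_n -> 'I_N}) := [ffun i => widen_ord NM (a i)].
have hi : injective h.
  move=> a b /ffunP ab; apply/ffunP => i; apply: val_inj.
  by have := ab i; rewrite !ffunE => /(congr1 val).
rewrite (eq_bigl (mem (h @: predT))).
  rewrite big_imset /=; last by move=> ? ? _ _; exact: hi.
  by apply: eq_big => [a|a _]; [by []|congr c; apply/ffunP => i; rewrite !ffunE].
move=> b; apply/forallP/imsetP => [bN|[a _ ->] i]; last by rewrite ffunE /= ltn_ord.
exists [ffun i => Ordinal (bN i)] => //.
by apply/ffunP => i; rewrite !ffunE; exact: val_inj.
Qed.

Lemma box_sumB (K : numFieldType) n (c : {ffun 'I_n -> nat} -> K) N M : (N <= M)%N ->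
  box_sum c M - box_sum c N =
  \sum_(a : {ffun 'I_n -> 'I_M} | ~~ [forall i, a i < N]%N) c [ffun i => a i : nat].
Proof.
move=> NM; rewrite (box_sum_widen c NM) /box_sum.
apply: (canLR (addrK _)); rewrite addrC.
exact: (bigID (fun a : {ffun 'I_n -> 'I_M} => [forall i, a i < N]%N)).
Qed.

Lemma cn_box_sumB n (c : {ffun 'I_n -> nat} -> C) (d : {ffun 'I_n -> nat} -> R) N M :
  (forall a, cn (c a) <= d a) -> (N <= M)%N ->
  cn (box_sum c M - box_sum c N) <= box_sum d M - box_sum d N.
Proof.
by move=> cd NM; rewrite !box_sumB //; apply: le_trans (cn_sum _ _ _) (ler_sum _ _) => a _.
Qed.

Lemma cn_box_sum n (c : {ffun 'I_n -> nat} -> C) (d : {ffun 'I_n -> nat} -> R) N :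
  (forall a, cn (c a) <= d a) -> cn (box_sum c N) <= box_sum d N.
Proof. by move=> cd; apply: le_trans (cn_sum _ _ _) (ler_sum _ _) => a _. Qed.

Lemma bounded_nondecreasing_tail (b : nat -> R) B :
  (forall N M, (N <= M)%N -> b N <= b M) -> (forall N, b N <= B) ->
  forall e, 0 < e -> exists N, forall M, (N <= M)%N -> b M - b N <= e.
Proof.
move=> bh bB e e0; have sb : has_sup (range b).
  by split; [exists (b 0%N), 0%N|exists B => _ [N _ <-]].
have [_ [N _ <-] h] := sup_adherent e0 sb.
exists N => M _; rewrite lerBlDr -lerBlDl; apply: ltW; apply: le_lt_trans h.
by rewrite lerD2r; apply: sup_upper_bound => //; exists M.
Qed.

Lemma cvgC_le (u : nat -> C) (l a : C) (e : R) N :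
  (u @ \oo --> l) -> (forall n, (N <= n)%N -> cn (u n - a) <= e) -> cn (l - a) <= e.
Proof.
move=> /cvgCP ul ua; apply/ler_addgt0Pr => d /ul[M MP].
rewrite -[l - a](subrKA (u (maxn N M))); apply: le_trans (cnD _ _) _; rewrite addrC.
by apply: lerD; [exact/ua/leq_maxl|rewrite cn_distC; exact/MP/leq_maxr].
Qed.

Lemma cvgC_unique (u : nat -> C) (l l' : C) : (u @ \oo --> l) -> (u @ \oo --> l') -> l = l'.
Proof.
move=> ul /cvgCP ul'; apply/eqP; rewrite -subr_eq0; apply/eqP/eq_cn_le => e /ul'[N NP].
exact: cvgC_le ul NP.
Qed.

(** The Weierstrass M-test. The polynomials [phi a] need not be monomials, so that the same
    statement serves Taylor series, complexified real series and Hadamard quotients. *)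
Lemma Ua_series n m (D : set 'rV[C]_m) (c : {ffun 'I_n -> nat} -> C)
    (phi : {ffun 'I_n -> nat} -> 'rV[C]_m -> C) (d : {ffun 'I_n -> nat} -> R) B :
  (forall a, pfun (phi a)) -> (forall a, 0 <= d a) ->
  (forall a x, D x -> cn (c a * phi a x) <= d a) -> (forall N, box_sum d N <= B) ->
  exists2 S, Ua D S &
    forall x, D x -> (fun N => box_sum (fun a => c a * phi a x) N) @ \oo --> S x.
Proof.
move=> phiP d0 cd dB.
have dh N M : (N <= M)%N -> box_sum d N <= box_sum d M.
  by move=> NM; rewrite -subr_ge0 box_sumB // sumr_ge0.
have dt := bounded_nondecreasing_tail dh dB.
pose u x N := box_sum (fun a => c a * phi a x) N.
have uB x N M : D x -> (N <= M)%N -> cn (u x M - u x N) <= box_sum d M - box_sum d N.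
  by move=> Dx; apply: cn_box_sumB => a; exact: cd.
have ux x : exists l : C, D x -> u x @ \oo --> l.
  (* Off [D] nothing is known about convergence; the value 0 there is arbitrary. *)
  have [Dx|nDx] := pselect (D x); last by exists 0 => /nDx.
  have [l ul] : exists l : C, u x @ \oo --> l.
    by apply: cauchyC => e /dt[N NP]; exists N => M NM; exact: le_trans (uB _ _ _ Dx NM) (NP _ NM).
  by exists l.
have [S SP] := choice ux; exists S => // e /dt[N NP]; exists (fun x => u x N).
  by apply: pfun_sum => a; apply: pfunM; [exact: pfun_cst|exact: phiP].
move=> x Dx; apply: (cvgC_le (N := N) (SP x Dx)) => M NM.
exact: le_trans (uB _ _ _ Dx NM) (NP _ NM).
Qed.

Lemma cn_monomial_le n (x : 'rV[C]_n) (r : R) a :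
  (forall i, cn (x 0 i) <= r) -> cn (monomial x a) <= r ^+ (\sum_i a i)%N.
Proof.
move=> xr; rewrite /monomial cn_prod expr_sum; apply: ler_prod => i _.
by rewrite cn_ge0 cnX lerXn2r ?nnegrE ?cn_ge0 // (le_trans (cn_ge0 _) (xr i)).
Qed.

Lemma taylorP n (p : 'rV[C]_n) c f : taylor_series p c f <->
  exists r : R, [/\ 0 < r,
    exists B : R, forall N, box_sum (fun a => cn (c a) * r ^+ (\sum_i a i)%N) N <= B
  & forall x, pd p r x -> (fun N => box_sum (fun a => c a * monomial (x - p) a) N) @ \oo --> f x].
Proof.
have bC (r : R) N : box_sum (fun a => `|c a| * r%:C%C ^+ (\sum_i a i)%N) N =
    (box_sum (fun a => cn (c a) * r ^+ (\sum_i a i)%N) N)%:C%C.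
  by rewrite /box_sum rmorph_sum /=; apply: eq_bigr => a _; rewrite rmorphM rmorphXn.
split=> [[r [r0 [B rB] rf]]|[r [r0 [B rB] rf]]].
  move: r0; rewrite ltcE => /andP[/eqP /= Ie Re0].
  have re : r = (complex.Re r)%:C%C by apply/eqP; rewrite eq_complex /= Ie !eqxx.
  exists (complex.Re r); split=> //.
    by exists (complex.Re B) => N; have := rB N; rewrite re bC lecE => /andP[].
  by move=> x xr; apply: rf; rewrite re; apply/pdP.
exists r%:C%C; split; first by rewrite ltcR.
  by exists B%:C%C => N; rewrite bC lecR.
by move=> x /pdP-/(_ r0); exact: rf.
Qed.

Lemma Ua_analytic n (p : 'rV[C]_n) f : analytic_at p f -> exists2 r, 0 < r & Ua (pd p r) f.
Proof.
move=> [c /taylorP[r [r0 [B rB] rf]]]; exists r => //.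
have [|||S SU Sf] := @Ua_series n n (pd p r) c (fun a x => monomial (x - p) a)
    (fun a => cn (c a) * r ^+ (\sum_i a i)%N) B _ _ _ rB.
- exact: pfun_monomial.
- by move=> a; rewrite mulr_ge0 ?cn_ge0 // exprn_ge0 // ltW.
- move=> a x px; rewrite cnM ler_wpM2l ?cn_ge0 //; apply: cn_monomial_le => i.
  by rewrite !mxE ltW.
by apply: Ua_eq SU => x px; apply: cvgC_unique (Sf x px) (rf x px).
Qed.

End BoxSums.

(** * Cauchy estimates and the polynomial characterization of analyticity *)

Section CauchyEstimates.
Context {R : realType}.
Local Notation C := R[i].

(** X^n - 1 splits with n distinct roots, and a finite group of roots of unity is cyclic. *)
Lemma C_prim_root n : (0 < n)%N -> exists z : C, n.-primitive_root z.
Proof.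
pose p : {poly C} := 'X^n - 1; have [r Dp] := closed_field_poly_normal p.
move=> n_gt0; rewrite (monicP _) ?monicXnsubC // scale1r in Dp.
have rn1: all n.-unity_root r by apply/allP=> z; rewrite -root_prod_XsubC -Dp.
have sz_r: (n < (size r).+1)%N by rewrite -(size_prod_XsubC r id) -Dp size_XnsubC.
have [|z] := hasP (cyclic.has_prim_root n_gt0 rn1 _ sz_r); last by exists z.
by rewrite -separable.separable_prod_XsubC -Dp cyclotomic.separable_Xn_sub_1 // pnatr_eq0 -lt0n.
Qed.

(** Orthogonality of characters: for a distinct from b the terms are a geometric progression whose
    ratio differs from 1 and has n-th power 1. *)
Lemma sum_prim_root n (w : C) (a b : 'I_n) : n.-primitive_root w ->
  \sum_(j < n) w ^+ (a * j) / w ^+ (b * j) = (a == b)%:R * n%:R.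
Proof.
move=> wn; have w0 : w != 0.
  by rewrite (prim_root_eq0 wn) -lt0n (leq_ltn_trans _ (ltn_ord a)).
pose z := w ^+ a / w ^+ b.
have zj (j : 'I_n) : w ^+ (a * j) / w ^+ (b * j) = z ^+ j by rewrite exprMn exprVn !exprM.
rewrite (eq_bigr _ (fun j _ => zj j)).
have [ab|ab] := eqVneq a b.
  rewrite /z ab divff ?expf_neq0 // mul1r.
  by under eq_bigr do rewrite expr1n; rewrite sumr_const card_ord.
have z1 : z - 1 != 0.
  rewrite subr_eq0; apply: contra ab => /eqP z1.
  have /eqP : w ^+ a = w ^+ b by rewrite -[RHS]mul1r -z1 divfK // expf_neq0.
  by rewrite (eq_prim_root_expr wn) !modn_small.
apply: (mulfI z1); rewrite -subrX1 exprMn exprVn -!exprM !(mulnC _ n) !exprM (prim_expr_order wn).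
by rewrite !expr1n invr1 mulr1 subrr mul0r mulr0.
Qed.

(* Averaging over a grid of roots of unity replaces the Cauchy integral. *)
Lemma cauchy_estimate n M (c : {ffun 'I_n -> nat} -> C) (r B : R) (b : {ffun 'I_n -> nat}) :
  0 < r -> (0 < M)%N -> (forall i, (b i < M)%N) ->
  (forall x : 'rV[C]_n, (forall i, cn (x 0 i) <= r) ->
     cn (box_sum (fun a => c a * monomial x a) M) <= B) ->
  cn (c b) * r ^+ (\sum_i b i)%N <= B.
Proof.
move=> r0 M0 bM fB; have [w wM] := C_prim_root M0.
have nw : cn w = 1.
  apply/eqP; rewrite -(@pexpr_eq1 _ _ M) ?cn_ge0 ?cn1 //.
  by rewrite -cnX (prim_expr_order wM) cn1.
have w0 : w != 0 by rewrite -cn_eq0 nw oner_eq0.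
pose b' := [ffun i => Ordinal (bM i)] : {ffun 'I_n -> 'I_M}.
have b'E : [ffun i => b' i : nat] = b by apply/ffunP => i; rewrite !ffunE.
pose X (k : {ffun 'I_n -> 'I_M}) : 'rV[C]_n := \row_i (r%:C%C * w ^+ k i).
pose f x := box_sum (fun a => c a * monomial x a) M.
(* Weighting by inverse characters isolates the index b. There is no aliasing, because all exponents
   in the box are below M. *)
have key : \sum_(k : {ffun 'I_n -> 'I_M}) (\prod_i (w ^+ (b' i * k i)%N)^-1) * f (X k) =
    c b * r%:C%C ^+ (\sum_i b i)%N * M%:R ^+ n.
  transitivity (\sum_(a : {ffun 'I_n -> 'I_M}) c [ffun i => a i : nat] * r%:C%C ^+ (\sum_i a i)%N *
      \prod_i ((a i == b' i)%:R * M%:R)); last first.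
    rewrite (bigD1 b') //= b'E [X in _ + X]big1 ?addr0; last first.
      move=> a ab; have [i ai] : exists i, a i != b' i.
        by apply/existsP; apply: contraNT ab; rewrite negb_exists => /forallP h;
           apply/eqP/ffunP => i; apply/eqP; rewrite -[_ == _]negbK h.
      by rewrite [X in _ * X](bigD1 i) //= (negbTE ai) !mul0r mulr0.
    congr (_ * _); first by congr (_ * _ ^+ _); apply: eq_bigr => i _; rewrite ffunE.
    rewrite (eq_bigr (fun=> M%:R)); last by move=> i _; rewrite eqxx mul1r.
    by rewrite prodr_const card_ord.
  have E (a : {ffun 'I_n -> 'I_M}) : \prod_i ((a i == b' i)%:R * M%:R) =
      \sum_(k : {ffun 'I_n -> 'I_M}) \prod_i (w ^+ (a i * k i) / w ^+ (b' i * k i)).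
    rewrite -(bigA_distr_bigA (fun i (j : 'I_M) => w ^+ (a i * j) / w ^+ (b' i * j))).
    by apply: eq_bigr => i _; rewrite (sum_prim_root _ _ wM).
  rewrite [RHS](eq_bigr _ (fun a _ => congr1 _ (E a))).
  rewrite [RHS](eq_bigr _ (fun a _ => mulr_sumr _ _ _ _)).
  rewrite exchange_big /=; apply: eq_bigr => k _; rewrite /f /box_sum mulr_sumr.
  apply: eq_bigr => a _; rewrite big_split /= /monomial.
  have -> : \prod_i X k 0 i ^+ [ffun i => a i : nat] i =
      r%:C%C ^+ (\sum_i a i)%N * \prod_i w ^+ (a i * k i)%N.
    rewrite expr_sum -big_split; apply: eq_bigr => i _.
    by rewrite /X mxE ffunE exprMn -exprM mulnC.
  by ring.
have MM : 0 < M%:R ^+ n :> R by rewrite exprn_gt0 // ltr0n.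
have : cn (\sum_(k : {ffun 'I_n -> 'I_M}) (\prod_i (w ^+ (b' i * k i)%N)^-1) * f (X k)) <= B * M%:R ^+ n.
  apply: (le_trans (cn_sum _ _ _)).
  have h (k : {ffun 'I_n -> 'I_M}) : cn ((\prod_i (w ^+ (b' i * k i)%N)^-1) * f (X k)) <= B.
    rewrite cnM cn_prod big1 ?mul1r; last by move=> i _; rewrite cnV cnX nw expr1n invr1.
    by apply: fB => i; rewrite mxE cnM cnX nw expr1n mulr1 cn_real gtr0_norm.
  apply: le_trans (ler_sum _ (fun k _ => h k)) _.
  by rewrite sumr_const card_ffun !card_ord -natrX mulr_natr.
by rewrite key !cnM !cnX cn_real cn_nat (gtr0_norm r0) ler_pM2r.
Qed.

Lemma pfun_box n (f : 'rV[C]_n -> C) : pfun f ->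
  exists c M0, forall M, (M0 <= M)%N -> forall x, f x = box_sum (fun a => c a * monomial x a) M.
Proof.
move=> fP.
(* A list of terms in which exponents may repeat is stable under concatenation and products; equal
   exponents are collected only afterwards. *)
have [s sP] : exists s : seq (C * {ffun 'I_n -> nat}), forall x, f x = \sum_(t <- s) t.1 * monomial x t.2.
  elim: fP => [c|i|g h _ [s1 h1] _ [s2 h2]|g h _ [s1 h1] _ [s2 h2]].
  - exists [:: (c, [ffun=> 0%N])] => x; rewrite big_seq1 /monomial /= big1 ?mulr1 // => i _.
    by rewrite ffunE expr0.
  - exists [:: (1, [ffun j => (j == i : nat)])] => x.
    rewrite big_seq1 /monomial /= mul1r (bigD1 i) //= ffunE eqxx expr1 big1 ?mulr1 // => j ji.
    by rewrite ffunE (negbTE ji) expr0.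
  - by exists (s1 ++ s2) => x; rewrite big_cat h1 h2.
  - exists [seq (t.1 * u.1, [ffun i => t.2 i + u.2 i]%N) | t : C * {ffun 'I_n -> nat} <- s1,
        u : C * {ffun 'I_n -> nat} <- s2] => x.
    rewrite big_allpairs_dep h1 h2 mulr_suml; apply: eq_bigr => t _.
    rewrite mulr_sumr; apply: eq_bigr => u _ /=.
    rewrite mulrACA; congr (_ * _); rewrite /monomial -big_split; apply: eq_bigr => i _.
    by rewrite ffunE exprD.
exists (fun a => \sum_(t <- s | t.2 == a) t.1).
exists (\max_(t <- s) \max_i t.2 i).+1 => M MM x.
rewrite sP /box_sum.
under [RHS]eq_bigr do rewrite mulr_suml big_mkcond.
rewrite exchange_big /= big_seq [RHS]big_seq; apply: eq_bigr => t ts.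
have tM i : (t.2 i < M)%N.
  apply: leq_trans MM; rewrite ltnS.
  apply: (@leq_trans (\max_i t.2 i)); first exact: leq_bigmax.
  exact: (@leq_bigmax_seq _ s xpredT (fun t => \max_i t.2 i)).
rewrite (bigD1 [ffun i => Ordinal (tM i)]) //= big1 ?addr0.
  suff <- : t.2 = [ffun i => [ffun i0 => Ordinal (tM i0)] i : nat] by rewrite eqxx.
  by apply/ffunP => i; rewrite !ffunE.
move=> a; apply: contraNeq; case: ifPn => [/eqP ta _|_ /eqP//].
by apply/eqP/ffunP => i; apply: val_inj; rewrite ffunE /= ta ffunE.
Qed.

(** The sum over the box factors into n geometric sums of ratio 1/2, each at most 2. *)
Lemma box_sum_geom n N : box_sum (fun a : {ffun 'I_n -> nat} => (1 / 2 : R) ^+ (\sum_i a i)%N) N <= 2 ^+ n.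
Proof.
rewrite /box_sum.
rewrite (eq_bigr (fun a : {ffun 'I_n -> 'I_N} => \prod_i (1 / 2 : R) ^+ a i)); last first.
  by move=> a _; rewrite expr_sum; apply: eq_bigr => i _; rewrite ffunE.
rewrite -(bigA_distr_bigA (fun _ (j : 'I_N) => (1 / 2 : R) ^+ j)) prodr_const card_ord.
have S0 : 0 <= \sum_(j < N) (1 / 2 : R) ^+ j by apply: sumr_ge0 => j _; rewrite exprn_ge0.
apply: lerXn2r; rewrite ?nnegrE // {S0}.
have := subrX1 (1 / 2 : R) N; have : 0 <= (1 / 2 : R) ^+ N by rewrite exprn_ge0.
set S := \sum_(i < N) _; set T := _ ^+ N; lra.
Qed.

(** By the Cauchy estimates on radius r/2, each coefficient of the approximating polynomials
    converges. The limits are the Taylor coefficients, and halving the radius once more bounds the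
    sums over boxes by geometric ones. *)
Lemma analytic_Ua n (p : 'rV[C]_n) r f : 0 < r -> Ua (pd p r) f -> analytic_at p f.
Proof.
move=> r0 fU.
pose e k : R := k.+1%:R^-1; have e0 k : 0 < e k by rewrite invr_gt0.
have eh k l : (k <= l)%N -> e l <= e k by move=> kl; rewrite lef_pV2 ?posrE // ler_nat.
have arch (d : R) : 0 < d -> exists k, e k <= d.
  move=> d0; exists (Num.truncn d^-1); rewrite /e -[leRHS]invrK lef_pV2 ?posrE ?invr_gt0 //.
  exact/ltW/truncnS_gt.
have /choice[P Pf] k : exists P, pfun P /\ forall x, pd p r x -> cn (f x - P x) <= e k.
  by have [Q ? ?] := fU _ (e0 k); exists Q.
have Pbox k : exists cM : ({ffun 'I_n -> nat} -> C) * nat, forall M, (cM.2 <= M)%N -> forall x,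
    P k (x + p) = box_sum (fun a => cM.1 a * monomial x a) M.
  have [c [M cM]] := pfun_box (pfun_shift p (Pf k).1); by exists (c, M).
have {Pbox} [cM cMP] := choice Pbox; pose c k := (cM k).1; pose m k := (cM k).2.
pose s := r / 2; have s0 : 0 < s by rewrite divr_gt0.
have sr : s < r by rewrite /s ltr_pdivrMr // mulrDr mulr1 ltrDl.
have inpd (x : 'rV[C]_n) : (forall i, cn (x 0 i) <= s) -> pd p r (x + p).
  by move=> xs i; rewrite !mxE addrK; exact: le_lt_trans (xs i) sr.
have cc k l a : cn (c k a - c l a) * s ^+ (\sum_i a i)%N <= e k + e l.
  pose M := (maxn (maxn (m k) (m l)) (\max_i a i).+1).
  apply: (@cauchy_estimate _ M (fun a => c k a - c l a)) => //.
  - by rewrite /M leq_max orbT.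
  - by move=> i; rewrite /M leq_max ltnS [X in _ || X]leq_bigmax orbT.
  move=> x xs; have -> : box_sum (fun a => (c k a - c l a) * monomial x a) M =
      P k (x + p) - P l (x + p).
    rewrite (cMP k M) ?(cMP l M) /M ?leq_max ?leqnn ?orbT //.
    by rewrite /box_sum -sumrB; apply: eq_bigr => ? _; rewrite mulrBl.
  rewrite -(subrKA (f (x + p))); apply: le_trans (cnD _ _) (lerD _ _).
    by rewrite cn_distC; apply: (Pf k).2; exact: inpd.
  by apply: (Pf l).2; exact: inpd.
have cl a : exists l : C, (fun k => c k a) @ \oo --> l.
  have sa : 0 < s ^+ (\sum_i a i)%N by rewrite exprn_gt0.
  apply: cauchyC => d d0; have [k kd] := arch _ (divr_gt0 (mulr_gt0 d0 sa) (ltr0Sn _ 1)).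
  exists k => l kl; rewrite -(ler_pM2r sa); apply: le_trans (cc _ _ _) _.
  by rewrite (splitr (d * _)); apply: lerD => //; apply: le_trans (eh _ _ kl) kd.
have {cl} [c' c'P] := choice cl.
have cc' k a : cn (c' a - c k a) * s ^+ (\sum_i a i)%N <= e k + e k.
  have sa : 0 < s ^+ (\sum_i a i)%N by rewrite exprn_gt0.
  rewrite -ler_pdivlMr //; apply: (cvgC_le (N := k) (c'P a)) => l kl.
  rewrite ler_pdivlMr //; apply: le_trans (cc _ _ _) _; by rewrite lerD2r eh.
have [B B0 fB] := Ua_bounded (bounded_pd p r) fU.
have cB a : cn (c' a) * s ^+ (\sum_i a i)%N <= B + 3.
  have ce : cn (c 0%N a) * s ^+ (\sum_i a i)%N <= B + 1.
    pose M := (maxn (m 0) (\max_i a i).+1).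
    apply: (@cauchy_estimate _ M) => //.
    - by rewrite /M leq_max orbT.
    - by move=> i; rewrite /M leq_max ltnS [X in _ || X]leq_bigmax orbT.
    move=> x xs; rewrite -(cMP 0%N M) ?leq_maxl // -[P _ _](subKr (f (x + p))).
    apply: le_trans (cnB _ _) (lerD _ _); first exact/fB/inpd.
    by apply: le_trans ((Pf 0%N).2 _ (inpd _ xs)) _; rewrite /e invr1.
  rewrite -[c' a](subrK (c 0%N a)).
  apply: (@le_trans _ _ ((cn (c' a - c 0%N a) + cn (c 0%N a)) * s ^+ (\sum_i a i)%N)).
    by rewrite ler_pM2r ?exprn_gt0 // cnD.
  rewrite mulrDl; have := cc' 0%N a; rewrite /e invr1 => h; lra.
pose t := s / 2; have t0 : 0 < t by rewrite divr_gt0.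
have geom (d : {ffun 'I_n -> nat} -> R) D N : (forall a, d a * s ^+ (\sum_i a i)%N <= D) -> 0 <= D ->
    box_sum (fun a => d a * t ^+ (\sum_i a i)%N) N <= D * 2 ^+ n.
  move=> dD D0; apply: (@le_trans _ _ (box_sum (fun a : {ffun 'I_n -> nat} => D * (1 / 2 : R) ^+ (\sum_i a i)%N) N)).
    apply: ler_sum => a _; rewrite (_ : t = s * (1 / 2)) ?mul1r //.
    by rewrite exprMn mulrA; apply: ler_wpM2r; rewrite ?exprn_ge0 ?dD // invr_ge0.
  by rewrite /box_sum -mulr_sumr; apply: ler_wpM2l => //; exact: box_sum_geom.
exists c'; apply/taylorP; exists t; split=> //.
  by exists ((B + 3) * 2 ^+ n) => N; apply: geom => //; rewrite addr_ge0 // ltW.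
move=> x xt; apply/cvgCP => d d0.
(* The coefficient errors contribute 2 [e k] 2^n through the geometric sums, and the distance from f
   to [P k] contributes another [e k]. *)
pose K : R := 1 + 2 * 2 ^+ n; have K0 : 0 < K by rewrite addr_gt0 // mulr_gt0 // exprn_gt0.
have [k kd] := arch _ (divr_gt0 d0 K0).
exists (m k) => N Nk.
have xs i : cn ((x - p) 0 i) <= s.
  rewrite !mxE; apply: le_trans (ltW (xt i)) _; rewrite /t ler_pdivrMr //; lra.
rewrite -(subrKA (P k x)); apply: (@le_trans _ _ ((e k + e k) * 2 ^+ n + e k)); last first.
  by move: kd; rewrite ler_pdivlMr // /K => kd; lra.
apply: le_trans (cnD _ _) (lerD _ _); last first.
  by rewrite cn_distC; apply: (Pf k).2; rewrite -[x](subrK p); exact: inpd.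
rewrite -{2}[x](subrK p) (cMP k N) //.
have -> : box_sum (fun a => c' a * monomial (x - p) a) N - box_sum (fun a => (cM k).1 a * monomial (x - p) a) N
   = box_sum (fun a => (c' a - c k a) * monomial (x - p) a) N.
  by rewrite /box_sum -sumrB; apply: eq_bigr => ? _; rewrite mulrBl.
apply: le_trans (geom (fun a => cn (c' a - c k a)) _ _ (cc' k) _); last by rewrite addr_ge0 // ltW.
apply: cn_box_sum => a; rewrite cnM; apply: ler_wpM2l; first exact: cn_ge0.
by apply: cn_monomial_le => i; rewrite !mxE; exact: ltW.
Qed.

Lemma analyticP n (p : 'rV[C]_n) f : analytic_at p f <-> exists2 r, 0 < r & Ua (pd p r) f.
Proof. by split=> [/Ua_analytic//|[r r0]]; exact: analytic_Ua. Qed.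

End CauchyEstimates.

(** * Hadamard quotients *)

Section Hadamard.
Context {R : realType}.
Local Notation C := R[i].

(** The letters x_j are replaced by y_j one at a time, and [m i] collects the cofactors of x_i - y_i
    as polynomials on the doubled space. The bound is multiplied by r so that the empty word needs
    no negative power. *)
Lemma word_diff n (w : seq 'I_n) : exists m : 'I_n -> 'rV[C]_(n + n) -> C,
  [/\ forall i, pfun (m i),
      forall x y : 'rV[C]_n, \prod_(j <- w) x 0 j - \prod_(j <- w) y 0 j =
        \sum_i (x 0 i - y 0 i) * m i (row_mx x y)
    & forall (r : R) i (z : 'rV[C]_(n + n)), 0 < r -> (forall j, cn (z 0 j) <= r) ->
        cn (m i z) * r <= (size w)%:R * r ^+ size w].
Proof.
elim: w => [|j w [m [mP mE mB]]].
  exists (fun _ _ => 0); split=> [i|x y|r i z r0 _]; first exact: pfun_cst.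
    by rewrite !big_nil subrr big1 // => i _; rewrite mulr0.
  by rewrite cn0 mul0r mulr_ge0 // ?exprn_ge0 // ltW.
exists (fun (i : 'I_n) (z : 'rV[C]_(n + n)) => (i == j)%:R * \prod_(k <- w) z 0 (lshift n k) + z 0 (rshift n j) * m i z).
split=> [i|x y|r i z r0 zr].
- apply: pfunD; apply: pfunM => //; [exact: pfun_cst|apply: pfun_prod => k|]; exact: pfun_coord.
- rewrite !big_cons.
  have -> : x 0 j * \prod_(k <- w) x 0 k - y 0 j * \prod_(k <- w) y 0 k =
     (x 0 j - y 0 j) * \prod_(k <- w) x 0 k +
     y 0 j * (\prod_(k <- w) x 0 k - \prod_(k <- w) y 0 k) by ring.
  rewrite mE; under [RHS]eq_bigr do rewrite mulrDr; rewrite big_split /=; congr (_ + _).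
    rewrite [RHS](bigD1 j) //= eqxx mul1r [X in _ = _ + X]big1 ?addr0 => [|i ij].
      by congr (_ * _); apply: eq_bigr => k _; rewrite row_mxEl.
    by rewrite (negbTE ij) mul0r mulr0.
  by rewrite mulr_sumr; apply: eq_bigr => i _; rewrite row_mxEr mulrCA.
- have P : cn (\prod_(k <- w) z 0 (lshift n k)) <= r ^+ size w.
    rewrite cn_prod; elim: w {m mP mE mB} => [|k w IH] /=; first by rewrite big_nil expr0.
    by rewrite big_cons exprS; apply: ler_pM; rewrite ?cn_ge0 ?zr // prodr_ge0 // => *; rewrite cn_ge0.
  have E : cn ((i == j)%:R * \prod_(k <- w) z 0 (lshift n k)) <= r ^+ size w.
    rewrite cnM cn_nat; apply: le_trans P; case: eqP => _; rewrite ?mul1r ?mul0r //.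
    exact: cn_ge0.
  have := mB r i z r0 zr; have := zr (rshift n j) => zj mz.
  rewrite /= -natr1 mulrDl mul1r exprSr mulrA [X in _ <= X]addrC.
  apply: (@le_trans _ _ ((cn ((i == j)%:R * \prod_(k <- w) z 0 (lshift n k)) +
     cn (z 0 (rshift n j) * m i z)) * r)).
    by rewrite ler_pM2r // cnD.
  rewrite mulrDl; apply: lerD; first by rewrite ler_pM2r.
  rewrite cnM -mulrA [leRHS]mulrC; apply: ler_pM => //; rewrite ?mulr_ge0 ?cn_ge0 //; exact: ltW.
Qed.

(** The number of letters k of the word is at most 2^k, so the factor counting the exchanges is
    absorbed by doubling the radius. *)
Lemma monomial_diff n (a : {ffun 'I_n -> nat}) : exists m : 'I_n -> 'rV[C]_(n + n) -> C,
  [/\ forall i, pfun (m i),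
      forall x y : 'rV[C]_n, monomial x a - monomial y a =
        \sum_i (x 0 i - y 0 i) * m i (row_mx x y)
    & forall (r : R) i (z : 'rV[C]_(n + n)), 0 < r -> (forall j, cn (z 0 j) <= r) ->
        cn (m i z) * r <= (r * 2) ^+ (\sum_i a i)%N].
Proof.
pose w := flatten [seq nseq (a i) i | i <- index_enum 'I_n].
have wm (x : 'rV[C]_n) : \prod_(j <- w) x 0 j = monomial x a.
  rewrite big_flatten big_map; apply: eq_bigr => i _.
  by rewrite big_nseq iter_mulr_1.
have sw : size w = (\sum_i a i)%N.
  rewrite size_flatten /shape -map_comp sumnE big_map; apply: eq_bigr => i _ /=.
  by rewrite size_nseq.
have [m [mP mE mB]] := word_diff w; exists m; split=> // [x y|r i z r0 zr].
  by rewrite -!wm.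
apply: le_trans (mB r i z r0 zr) _; rewrite sw exprMn mulrC ler_wpM2l ?exprn_ge0 ?(ltW r0) //.
by rewrite -natrX ler_nat ltnW // ltn_expl.
Qed.

Lemma cvgCZ (u : nat -> C) (l k : C) :
  (u @ \oo --> l) -> (fun N => k * u N) @ \oo --> (k * l : C).
Proof.
move=> /cvgCP ul; apply/cvgCP => e e0.
have k0 : 0 < cn k + 1 by rewrite ltr_wpDl ?cn_ge0.
have [N NP] := ul _ (divr_gt0 e0 k0); exists N => n /NP.
rewrite -mulrBr cnM ler_pdivlMr // mulrC => h; apply: le_trans h.
by rewrite ler_wpM2r ?cn_ge0 // lerDl.
Qed.

Lemma cvgCD (u v : nat -> C) (l k : C) :
  (u @ \oo --> l) -> (v @ \oo --> k) -> (fun N => u N + v N) @ \oo --> (l + k : C).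
Proof.
move=> /cvgCP ul /cvgCP vk; apply/cvgCP => e e0.
have e20 : 0 < e / 2 by rewrite divr_gt0.
have [N NP] := ul _ e20; have [M MP] := vk _ e20; exists (maxn N M) => n.
rewrite geq_max => /andP[/NP h1 /MP h2]; rewrite opprD addrACA (splitr e).
exact: le_trans (cnD _ _) (lerD h1 h2).
Qed.

Lemma cvgC_sum (I : Type) (r : seq I) (u : I -> nat -> C) (l : I -> C) :
  (forall i, u i @ \oo --> l i) ->
  (fun N => \sum_(i <- r) u i N) @ \oo --> (\sum_(i <- r) l i : C).
Proof.
move=> ul; elim: r => [|i r IH].
  by apply/cvgCP => e e0; exists 0%N => n _; rewrite !big_nil subrr cn0 ltW.
rewrite big_cons; have -> : (fun N => \sum_(j <- i :: r) u j N) =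
  (fun N => u i N + \sum_(j <- r) u j N) by apply/funext => N; rewrite big_cons.
exact: (cvgCD (ul i) IH).
Qed.

(** The difference of monomials is factored termwise, and the M-test makes the cofactors sum to
    analytic functions of (x, y). All differential calculus below derives from this
    factorization. *)
Lemma hadamard n (p : 'rV[C]_n) f : analytic_at p f ->
  exists S : 'I_n -> 'rV[C]_(n + n) -> C, (forall i, analytic_at (row_mx p p) (S i)) /\
  exists2 r : R, 0 < r & forall x y, pd p r x -> pd p r y ->
    f x - f y = \sum_i (x 0 i - y 0 i) * S i (row_mx x y).
Proof.
move=> [c /taylorP[r [r0 [B rB] rf]]].
have [m mP] := choice (@monomial_diff n).
(* [monomial_diff] costs a factor 2 in the radius of convergence. *)
pose s := r / 2; have s0 : 0 < s by rewrite divr_gt0.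
have sr : s <= r by rewrite /s ler_pdivrMr //; lra.
have key i : exists2 S, Ua (pd (row_mx p p) s) S & forall z, pd (row_mx p p) s z ->
    (fun N => box_sum (fun a => c a * m a i (z - row_mx p p)) N) @ \oo --> S z.
  have [||||S SU Sf] := @Ua_series _ n _ (pd (row_mx p p) s) c (fun a z => m a i (z - row_mx p p))
      (fun a => s^-1 * (cn (c a) * r ^+ (\sum_i a i)%N)) (s^-1 * B).
  - by move=> a; have [h _ _] := mP a; exact: pfun_shift.
  - by move=> a; rewrite !mulr_ge0 ?cn_ge0 ?exprn_ge0 ?invr_ge0 // ltW.
  - move=> a z zs; have [_ _ h] := mP a.
    rewrite cnM mulrCA ler_wpM2l ?cn_ge0 // mulrC ler_pdivlMr //.
    have := h s i (z - row_mx p p) s0; rewrite {2}/s divfK ?pnatr_eq0 //; apply => j.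
    by have := ltW (zs j); rewrite !mxE.
  - by move=> N; rewrite /box_sum -mulr_sumr ler_wpM2l ?invr_ge0 ?(ltW s0) //; exact: rB.
  by exists S.
have {}key i : exists S, Ua (pd (row_mx p p) s) S /\ forall z, pd (row_mx p p) s z ->
    (fun N => box_sum (fun a => c a * m a i (z - row_mx p p)) N) @ \oo --> S z.
  by have [S ? ?] := key i; exists S.
have [S SP] := choice key; exists S; split=> [i|]; first by apply/analyticP; exists s => //; case: (SP i).
exists s => // x y px py.
have pz : pd (row_mx p p) s (row_mx x y).
  by move=> j; case: (split_ordP j) => k ->; rewrite ?row_mxEl ?row_mxEr.
have h1 : (fun N => \sum_i (x 0 i - y 0 i) * box_sum (fun a => c a * m a i (row_mx x y - row_mx p p)) N)
    @ \oo --> (\sum_i (x 0 i - y 0 i) * S i (row_mx x y) : C).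
  by apply: cvgC_sum => i; apply: cvgCZ; exact: (SP i).2.
have h2 := cvgCD (rf x (pdS sr px)) (cvgCZ (k := -1) (rf y (pdS sr py))).
rewrite mulN1r in h2; apply: cvgC_unique h2 _.
have eqcvg (u v : nat -> C) (l : C) : u =1 v -> (v @ \oo --> l) -> (u @ \oo --> l) by move=> /funext ->.
apply: (eqcvg _ _ _ _ h1) => N; rewrite mulN1r /box_sum -sumrB.
under [RHS]eq_bigr do rewrite mulr_sumr; rewrite [RHS]exchange_big /=; apply: eq_bigr => a _.
rewrite -mulrBr; have [_ -> _] := mP [ffun i => a i : nat].
rewrite mulr_sumr; apply: eq_bigr => i _.
by rewrite opp_row_mx add_row_mx !mxE mulrCA; congr (_ * (_ * _)); ring.
Qed.

End Hadamard.

(** * Stability properties of holomorphic germs *)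

Section AnalyticClosure.
Context {R : realType}.
Local Notation C := R[i].

(* Equivalent to [analytic_at] over C, see [holo_analytic]; an inductive type is
   not unfolded by conversion checks. *)
Inductive holo n (p : 'rV[C]_n) (f : 'rV[C]_n -> C) : Prop :=
  Holo r of 0 < r & Ua (pd p r) f.

Definition holom n m (p : 'rV[C]_n) (F : 'rV[C]_n -> 'rV[C]_m) : Prop :=
  forall j, holo p (fun x => F x 0 j).

Lemma holoP n (p : 'rV[C]_n) f : holo p f <-> exists2 r, 0 < r & Ua (pd p r) f.
Proof. by split=> [[r]|[r]]; exists r. Qed.

Lemma holo_analytic n (p : 'rV[C]_n) f : analytic_at p f <-> holo p f.
Proof. by rewrite holoP; exact: analyticP. Qed.

Lemma holom_analytic n m (p : 'rV[C]_n) (F : 'rV[C]_n -> 'rV[C]_m) :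
  analytic_map_at p F <-> holom p F.
Proof. by split=> h j; apply/holo_analytic; exact: h. Qed.

(** Finitely many germ statements share a radius. The initial value 1 of the minimum keeps it
    positive for an empty family. *)
Lemma common_radius m (P : 'I_m -> R -> Prop) :
  (forall j r s, s <= r -> P j r -> P j s) ->
  (forall j, exists2 r : R, 0 < r & P j r) -> exists2 r : R, 0 < r & forall j, P j r.
Proof.
move=> mono h.
have {}h j : exists r : R, 0 < r /\ P j r by have [r ? ?] := h j; exists r.
have [r rP] := choice h; exists (\big[Num.min/1]_j r j).
  by apply: lt_bigmin => // j _; exact: (rP j).1.
by move=> j; apply: mono (rP j).2; exact: bigmin_le_cond.
Qed.

Lemma eqf_holo n (p : 'rV[C]_n) f g : (forall x, f x = g x) -> holo p f -> holo p g.
Proof. by move=> /funext ->. Qed.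

Lemma holo_near n (p : 'rV[C]_n) f : holo p f -> \forall q \near p, holo q f.
Proof.
move=> /holoP[r r0 fU]; have r20 : 0 < r / 2 by rewrite divr_gt0.
apply/near_pd; exists (r / 2) => // q pq; apply/holoP; exists (r / 2) => //.
apply: Ua_sub fU => x qx i; rewrite -(subrKA (q 0 i)) (splitr r).
exact: le_lt_trans (cnD _ _) (ltrD (qx i) (pq i)).
Qed.

Lemma holo_pfun n (p : 'rV[C]_n) f : pfun f -> holo p f.
Proof. by move=> fP; apply/holoP; exists 1 => //; exact: Ua_pfun. Qed.

Lemma holo_cst n (p : 'rV[C]_n) (c : C) : holo p (fun=> c).
Proof. exact/holo_pfun/pfun_cst. Qed.

Lemma holo_coord n (p : 'rV[C]_n) i : holo p (fun x => x 0 i).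
Proof. exact/holo_pfun/pfun_coord. Qed.

Lemma holo_op2 n (p : 'rV[C]_n) f g (h : C -> C -> C) :
  (forall (D : set 'rV[C]_n) f g, bounded_dom D -> Ua D f -> Ua D g -> Ua D (fun x => h (f x) (g x))) ->
  holo p f -> holo p g -> holo p (fun x => h (f x) (g x)).
Proof.
move=> hU /holoP[r r0 fU] /holoP[s s0 gU]; apply/holoP.
exists (Num.min r s); first by rewrite lt_min r0.
apply: hU; first exact: bounded_pd.
  by apply: Ua_sub fU => x; apply: pdS; rewrite ge_min lexx.
by apply: Ua_sub gU => x; apply: pdS; rewrite ge_min lexx orbT.
Qed.

Lemma holoD n (p : 'rV[C]_n) f g :
  holo p f -> holo p g -> holo p (fun x => f x + g x).
Proof. by apply: holo_op2 => D f' g' _; exact: UaD. Qed.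

Lemma holoM n (p : 'rV[C]_n) f g :
  holo p f -> holo p g -> holo p (fun x => f x * g x).
Proof. by apply: holo_op2 => D f' g'; exact: UaM. Qed.

Lemma holoZ n (p : 'rV[C]_n) (c : C) f : holo p f -> holo p (fun x => c * f x).
Proof. by move=> fP; apply: holoM => //; exact: holo_cst. Qed.

Lemma holoN n (p : 'rV[C]_n) f : holo p f -> holo p (fun x => - f x).
Proof. by move=> /(holoZ (-1)); apply: eqf_holo => x; rewrite mulN1r. Qed.

Lemma holoB n (p : 'rV[C]_n) f g :
  holo p f -> holo p g -> holo p (fun x => f x - g x).
Proof. by move=> fP gP; apply: holoD => //; exact: holoN. Qed.

Lemma holo_sum n (p : 'rV[C]_n) (I : Type) (r : seq I) (P : pred I) (F : I -> 'rV[C]_n -> C) :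
  (forall i, holo p (F i)) -> holo p (fun x => \sum_(i <- r | P i) F i x).
Proof.
move=> FP; elim: r => [|i r IH].
  by apply: eqf_holo (holo_cst _ 0) => x; rewrite big_nil.
case Pi : (P i); last by apply: eqf_holo IH => x; rewrite big_cons Pi.
by apply: eqf_holo (holoD (FP i) IH) => x; rewrite big_cons Pi.
Qed.

Lemma holo_hadamard n (p : 'rV[C]_n) f : holo p f ->
  exists S : 'I_n -> 'rV[C]_(n + n) -> C, (forall i, holo (row_mx p p) (S i)) /\
  exists2 r : R, 0 < r & forall x y, pd p r x -> pd p r y ->
    f x - f y = \sum_i (x 0 i - y 0 i) * S i (row_mx x y).
Proof.
by move=> /holo_analytic/hadamard[S [SP h]]; exists S; split => // i; apply/holo_analytic.
Qed.

Lemma holo_lipschitz n (p : 'rV[C]_n) f : holo p f -> exists K r : R,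
  [/\ 0 < K, 0 < r & forall x y, pd p r x -> pd p r y -> cn (f x - f y) <= K * nrm (x - y)].
Proof.
move=> /holo_hadamard[S [SP [r r0 rS]]].
have {}SP i : exists B s : R, [/\ 0 < s, 0 <= B & forall z, pd (row_mx p p) s z -> cn (S i z) <= B].
  have /holoP[s s0 SU] := SP i; have [B B0 SB] := Ua_bounded (bounded_pd _ _) SU.
  by exists B, s; split => //; exact: ltW.
have {SP} /choice[B BP] := SP.
have [s s0 sP] : exists2 s : R, 0 < s & forall i, 0 <= B i /\ forall z, pd (row_mx p p) s z -> cn (S i z) <= B i.
  apply: common_radius => [i a b ba [B0 h]|i].
    by split=> // z /(pdS ba); exact: h.
  by have [s [s0 B0 h]] := BP i; exists s.
exists (1 + \sum_i B i), (Num.min r s); split.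
- by rewrite ltr_pwDl // sumr_ge0 // => i _; exact: (sP i).1.
- by rewrite lt_min r0.
move=> x y px py; rewrite rS; try by apply: pdS px + apply: pdS py; rewrite ge_min lexx.
apply: le_trans (cn_sum _ _ _) _; rewrite mulrDl mul1r mulr_suml.
apply: ler_wpDl; first exact: nrm_ge0.
apply: ler_sum => i _; rewrite cnM mulrC; apply: ler_pM; rewrite ?cn_ge0 //.
  apply: (sP i).2 => j; have ms : Num.min r s <= s by rewrite ge_min lexx orbT.
  by case: (split_ordP j) => k ->; rewrite ?row_mxEl ?row_mxEr; apply: lt_le_trans ms.
by have := cn_le_nrm (x - y) i; rewrite !mxE.
Qed.

Lemma holo_cont n (p : 'rV[C]_n) f : holo p f -> forall e : R, 0 < e ->
  exists2 d : R, 0 < d & forall x, pd p d x -> cn (f x - f p) < e.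
Proof.
move=> /holo_lipschitz[K [r [K0 r0 h]]] e e0.
have /near_pd[d d0 dP] : \forall x \near p, nrm (x - p) < Num.min (e / K) r.
  by apply/near_nrm; exists (Num.min (e / K) r) => //; rewrite lt_min r0 divr_gt0.
exists d => // x /dP; rewrite lt_min => /andP[h1 /nrm_pd h2].
apply: le_lt_trans (h _ _ h2 (pd_center p r0)) _.
by rewrite mulrC -ltr_pdivlMr.
Qed.

Lemma holo_map_cont n m (p : 'rV[C]_n) (G : 'rV[C]_n -> 'rV[C]_m) :
  holom p G -> forall e : R, 0 < e ->
  exists2 d : R, 0 < d & forall x, pd p d x -> pd (G p) e (G x).
Proof.
move=> GP e e0.
have [d d0 dP] : exists2 d : R, 0 < d & forall j x, pd p d x -> cn (G x 0 j - G p 0 j) < e.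
  apply: common_radius => [j a b ba h x /(pdS ba)|j]; first exact: h.
  exact: holo_cont (GP j) _ e0.
by exists d => // x px j; exact: dP.
Qed.

Lemma near_holo n m (p : 'rV[C]_n) (G : 'rV[C]_n -> 'rV[C]_m) (P : set 'rV[C]_m) :
  holom p G -> (\forall y \near G p, P y) -> \forall x \near p, P (G x).
Proof.
move=> /holo_map_cont Gc /near_pd[e e0 eP]; apply/near_pd.
by have [d d0 dP] := Gc _ e0; exists d => // x /dP; exact: eP.
Qed.

Lemma holo_comp n m (p : 'rV[C]_n) (f : 'rV[C]_m -> C) (G : 'rV[C]_n -> 'rV[C]_m) :
  holom p G -> holo (G p) f -> holo p (fun x => f (G x)).
Proof.
move=> GP /holoP[r r0 fU]; apply/holoP.
have [d d0 dG] := holo_map_cont GP r0.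
have [s s0 GU] : exists2 s : R, 0 < s & forall j, Ua (pd p s) (fun x => G x 0 j).
  apply: common_radius => [j a b ba|j]; first by apply: Ua_sub => x; exact: pdS.
  exact/holoP.
exists (Num.min d s); first by rewrite lt_min d0.
apply: (Ua_comp (bounded_pd _ _) fU) => [j|x px].
  by apply: Ua_sub (GU j) => x; apply: pdS; rewrite ge_min lexx orbT.
by apply: dG; apply: pdS px; rewrite ge_min lexx.
Qed.

Lemma holo_conj n (p : 'rV[C]_n) f : holo (cvec p) f ->
  holo p (fun x => (f (cvec x))^*).
Proof.
move=> /holoP[r r0 fU]; apply/holoP; exists r => //.
by apply: Ua_sub (Ua_conj fU) => x px i; rewrite !mxE -rmorphB cn_conj.
Qed.

Lemma holom_comp n m k (p : 'rV[C]_n) (F : 'rV[C]_m -> 'rV[C]_k) (G : 'rV[C]_n -> 'rV[C]_m) :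
  holom p G -> holom (G p) F -> holom p (fun x => F (G x)).
Proof. by move=> GP FP j; apply: (holo_comp (f := fun y => F y 0 j)). Qed.

Lemma holom_id n (p : 'rV[C]_n) : holom p (fun x => x).
Proof. by move=> j; exact: holo_coord. Qed.

Lemma holom_cst n m (p : 'rV[C]_n) (c : 'rV[C]_m) : holom p (fun=> c).
Proof. by move=> j; exact: holo_cst. Qed.

Lemma holom_mulmxr n m k (p : 'rV[C]_n) (F : 'rV[C]_n -> 'rV[C]_m) (A : 'M[C]_(m, k)) :
  holom p F -> holom p (fun x => F x *m A).
Proof.
move=> FP j.
have : holo p (fun x => \sum_i F x 0 i * A i j).
  by apply: holo_sum => i; apply: holoM; [exact: FP|exact: holo_cst].
by apply: eqf_holo => x; rewrite mxE.
Qed.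

Lemma holomD n m (p : 'rV[C]_n) (F G : 'rV[C]_n -> 'rV[C]_m) :
  holom p F -> holom p G -> holom p (fun x => F x + G x).
Proof.
by move=> FP GP j; apply: eqf_holo (holoD (FP j) (GP j)) => x; rewrite mxE.
Qed.

Lemma holomZf n m (p : 'rV[C]_n) (f : 'rV[C]_n -> C) (F : 'rV[C]_n -> 'rV[C]_m) :
  holo p f -> holom p F -> holom p (fun x => f x *: F x).
Proof.
by move=> fP FP j; apply: eqf_holo (holoM fP (FP j)) => x; rewrite mxE.
Qed.

Lemma holomZ n m (p : 'rV[C]_n) (c : C) (F : 'rV[C]_n -> 'rV[C]_m) :
  holom p F -> holom p (fun x => c *: F x).
Proof. by apply: holomZf; exact: holo_cst. Qed.

Lemma holomN n m (p : 'rV[C]_n) (F : 'rV[C]_n -> 'rV[C]_m) :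
  holom p F -> holom p (fun x => - F x).
Proof. by move=> FP j; apply: eqf_holo (holoN (FP j)) => x; rewrite mxE. Qed.

Lemma holomB n m (p : 'rV[C]_n) (F G : 'rV[C]_n -> 'rV[C]_m) :
  holom p F -> holom p G -> holom p (fun x => F x - G x).
Proof. by move=> FP GP; apply: holomD => //; exact: holomN. Qed.

Lemma holom_row_mx n m k (p : 'rV[C]_n) (F : 'rV[C]_n -> 'rV[C]_m) (G : 'rV[C]_n -> 'rV[C]_k) :
  holom p F -> holom p G -> holom p (fun x => row_mx (F x) (G x)).
Proof.
move=> FP GP j; case: (split_ordP j) => i ->.
  by apply: eqf_holo (FP i) => x; rewrite row_mxEl.
by apply: eqf_holo (GP i) => x; rewrite row_mxEr.
Qed.

Lemma holom_lsub n m k (p : 'rV[C]_n) (F : 'rV[C]_n -> 'rV[C]_(m + k)) :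
  holom p F -> holom p (fun x => lsubmx (F x)).
Proof. by move=> FP j; apply: eqf_holo (FP (lshift k j)) => x; rewrite mxE. Qed.

Lemma holom_rsub n m k (p : 'rV[C]_n) (F : 'rV[C]_n -> 'rV[C]_(m + k)) :
  holom p F -> holom p (fun x => rsubmx (F x)).
Proof. by move=> FP j; apply: eqf_holo (FP (rshift m j)) => x; rewrite mxE. Qed.

Lemma holom_conj n m (p : 'rV[C]_n) (F : 'rV[C]_n -> 'rV[C]_m) :
  holom (cvec p) F -> holom p (fun x => cvec (F (cvec x))).
Proof.
move=> FP j; apply: eqf_holo (holo_conj (f := fun x => F x 0 j) (FP j)) => x.
by rewrite mxE.
Qed.

Lemma cvecK n (x : 'rV[C]_n) : cvec (cvec x) = x.
Proof. by apply/rowP => i; rewrite !mxE conjCK. Qed.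
Lemma cvec0 n : cvec (0 : 'rV[C]_n) = 0.
Proof. by apply/rowP => i; rewrite !mxE rmorph0. Qed.
Lemma cvecD n (x y : 'rV[C]_n) : cvec (x + y) = cvec x + cvec y.
Proof. by apply/rowP => i; rewrite !mxE rmorphD. Qed.
Lemma cvecB n (x y : 'rV[C]_n) : cvec (x - y) = cvec x - cvec y.
Proof. by apply/rowP => i; rewrite !mxE rmorphB. Qed.
Lemma cvecZ n (a : C) (x : 'rV[C]_n) : cvec (a *: x) = a^* *: cvec x.
Proof. by apply/rowP => i; rewrite !mxE rmorphM. Qed.
Lemma cvec_row_mx n m (x : 'rV[C]_n) (y : 'rV[C]_m) : cvec (row_mx x y) = row_mx (cvec x) (cvec y).
Proof. exact: map_row_mx. Qed.
Lemma nrm_cvec n (x : 'rV[C]_n) : nrm (cvec x) = nrm x.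
Proof. by apply: eq_bigr => i _; rewrite mxE cn_conj. Qed.

Lemma near_cvec n (p : 'rV[C]_n) (P : set 'rV[C]_n) :
  (\forall y \near cvec p, P y) -> \forall x \near p, P (cvec x).
Proof.
move=> /near_nrm[r r0 rP]; apply/near_nrm; exists r => // x h; apply: rP.
by rewrite -cvecB nrm_cvec.
Qed.

End AnalyticClosure.

(** * Strict derivatives and the implicit function theorem *)

Section StrictDerivative.
Context {R : realType}.
Local Notation C := R[i].

(** The strict derivative: x and y both vary near q, so that the remainder f - d has arbitrarily
    small Lipschitz constants near q, a property the implicit function theorem uses as a
    contraction. *)
Definition sd n (q : 'rV[C]_n) (f : 'rV[C]_n -> C) (d : 'I_n -> C) : Prop :=
  forall e : R, 0 < e -> exists2 r : R, 0 < r & forall x y, pd q r x -> pd q r y ->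
    cn (f x - f y - \sum_i (x 0 i - y 0 i) * d i) <= e * nrm (x - y).

Definition sdm n m (q : 'rV[C]_n) (F : 'rV[C]_n -> 'rV[C]_m) (A : 'M[C]_(n, m)) : Prop :=
  forall j, sd q (fun x => F x 0 j) (fun i => A i j).

Lemma sd_eq n (q : 'rV[C]_n) f g d : (\forall x \near q, f x = g x) -> sd q f d -> sd q g d.
Proof.
move=> /near_pd[s s0 fg] fd e e0; have [r r0 h] := fd _ e0.
have m1 : Num.min r s <= r by rewrite ge_min lexx.
have m2 : Num.min r s <= s by rewrite ge_min lexx orbT.
exists (Num.min r s); first by rewrite lt_min r0.
move=> x y px py; rewrite -!fg; [exact: h (pdS m1 px) (pdS m1 py)|exact: pdS m2 py|exact: pdS m2 px].
Qed.

Lemma sd_unique n (q : 'rV[C]_n) f d d' : sd q f d -> sd q f d' -> d =1 d'.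
Proof.
move=> h h' i; apply/eqP; rewrite -subr_eq0; apply/eqP/eq_cn_le => e e0.
have e20 : 0 < e / 2 by rewrite divr_gt0.
have [r r0 rP] := h _ e20; have [s s0 sP] := h' _ e20.
pose t : R := Num.min r s / 2; have ms : 0 < Num.min r s by rewrite lt_min r0.
have t0 : 0 < t by rewrite divr_gt0.
have tm : t < Num.min r s by rewrite /t ltr_pdivrMr // mulrDr mulr1 ltrDl.
pose x := q + \row_j (t%:C%C * (j == i)%:R).
have xq j : x 0 j - q 0 j = t%:C%C * (j == i)%:R by rewrite !mxE addrC addKr.
have px : pd q (Num.min r s) x.
  move=> j; rewrite xq cnM cn_real gtr0_norm // cn_nat; apply: le_lt_trans tm.
  by rewrite ler_piMr ?(ltW t0) // lern1 leq_b1.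
have nx : nrm (x - q) = t.
  rewrite /nrm (eq_bigr (fun j => cn (t%:C%C * (j == i)%:R))) => [|j _]; last by rewrite -xq !mxE.
  rewrite (bigD1 i) //= eqxx mulr1 cn_real gtr0_norm // big1 ?addr0 // => j ji.
  by rewrite (negbTE ji) mulr0 cn0.
have S (c : 'I_n -> C) : \sum_j (x 0 j - q 0 j) * c j = t%:C%C * c i.
  rewrite (bigD1 i) //= big1 ?addr0 => [|j ji]; rewrite xq ?eqxx ?mulr1 //.
  by rewrite (negbTE ji) mulr0 mul0r.
have m1 : Num.min r s <= r by rewrite ge_min lexx.
have m2 : Num.min r s <= s by rewrite ge_min lexx orbT.
have := rP _ _ (pdS m1 px) (pd_center q r0); have := sP _ _ (pdS m2 px) (pd_center q s0).
rewrite nx !S => h1 h2; rewrite -(ler_pM2l t0).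
have -> : t * cn (d i - d' i) = cn (t%:C%C * (d i - d' i)) by rewrite cnM cn_real gtr0_norm.
have -> : t%:C%C * (d i - d' i) = (f x - f q - t%:C%C * d' i) - (f x - f q - t%:C%C * d i) by ring.
by apply: le_trans (cnB _ _) _; lra.
Qed.

Lemma sdm_unique n m (q : 'rV[C]_n) (F : 'rV[C]_n -> 'rV[C]_m) A A' :
  sdm q F A -> sdm q F A' -> A = A'.
Proof. by move=> h h'; apply/matrixP => i j; exact: sd_unique (h j) (h' j) i. Qed.

Lemma sdm_eq n m (q : 'rV[C]_n) (F G : 'rV[C]_n -> 'rV[C]_m) A :
  (\forall x \near q, F x = G x) -> sdm q F A -> sdm q G A.
Proof. by move=> FG h j; apply: sd_eq (h j); apply: filterS FG => x ->. Qed.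

Lemma eqf_sdm n m (q : 'rV[C]_n) (F G : 'rV[C]_n -> 'rV[C]_m) A :
  (forall x, F x = G x) -> sdm q F A -> sdm q G A.
Proof. by move=> /funext ->. Qed.

Lemma sdm_nrm n m (q : 'rV[C]_n) (F : 'rV[C]_n -> 'rV[C]_m) A : sdm q F A <->
  forall e : R, 0 < e -> exists2 r : R, 0 < r & forall x y, pd q r x -> pd q r y ->
    nrm (F x - F y - (x - y) *m A) <= e * nrm (x - y).
Proof.
have E x y j : (F x - F y - (x - y) *m A) 0 j =
    F x 0 j - F y 0 j - \sum_i (x 0 i - y 0 i) * A i j.
  by rewrite !mxE; congr (_ - _); apply: eq_bigr => i _; rewrite !mxE.
split=> [h e e0|h j e e0].
  have e'0 : 0 < e / m.+1%:R by rewrite divr_gt0.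
  have [r r0 rP] : exists2 r : R, 0 < r & forall j x y, pd q r x -> pd q r y ->
      cn (F x 0 j - F y 0 j - \sum_i (x 0 i - y 0 i) * A i j) <= e / m.+1%:R * nrm (x - y).
    apply: common_radius => [j a b ba g x y /(pdS ba) px /(pdS ba) py|j]; first exact: g.
    exact: h.
  exists r => // x y px py.
  apply: (@le_trans _ _ (\sum_(j < m) (e / m.+1%:R * nrm (x - y)))).
    by apply: ler_sum => j _; rewrite E; exact: rP.
  rewrite sumr_const card_ord -mulrnAl ler_wpM2r ?nrm_ge0 //.
  rewrite -[X in X <= _]mulr_natr -mulrA ler_piMr ?(ltW e0) //.
  by rewrite mulrC ler_pdivrMr // mul1r ler_nat.
have [r r0 rP] := h _ e0; exists r => // x y px py.
by rewrite -E; apply: le_trans (cn_le_nrm _ _) (rP _ _ px py).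
Qed.

Lemma sdm_lipschitz n m (q : 'rV[C]_n) (F : 'rV[C]_n -> 'rV[C]_m) A : sdm q F A ->
  exists K r : R, [/\ 0 < K, 0 < r & forall x y, pd q r x -> pd q r y ->
    nrm (F x - F y) <= K * nrm (x - y)].
Proof.
move=> /sdm_nrm /(_ 1 ltr01)[r r0 h]; have [K K0 AK] := nrm_mulmx A.
exists (1 + K), r; split=> // [|x y px py]; first by rewrite ltr_pwDl.
rewrite -[F x - F y](subrK ((x - y) *m A)); apply: le_trans (nrmD _ _) _.
by rewrite mulrDl; apply: lerD; [exact: h|exact: AK].
Qed.

Lemma sdm_comp n m k (q : 'rV[C]_n) (G : 'rV[C]_n -> 'rV[C]_m) (F : 'rV[C]_m -> 'rV[C]_k) A B :
  sdm q G A -> sdm (G q) F B -> sdm q (fun x => F (G x)) (A *m B).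
Proof.
move=> hG hF; apply/sdm_nrm => e e0.
have [K [r [K0 r0 GK]]] := sdm_lipschitz hG.
have [L L0 BL] := nrm_mulmx B; have L1 : 0 < L + 1 by rewrite ltr_wpDl.
have e1 : 0 < e / 2 / K by rewrite !divr_gt0.
have e2 : 0 < e / 2 / (L + 1) by rewrite !divr_gt0.
move/sdm_nrm : (hG) => /(_ _ e2)[s s0 sP].
move/sdm_nrm : hF => /(_ _ e1)[t t0 tP].
have /near_pd[u u0 uP] : \forall x \near q, nrm (x - q) < t / K.
  by apply/near_nrm; exists (t / K) => //; rewrite divr_gt0.
pose d := Num.min (Num.min r s) u.
have dr : d <= r by rewrite /d !ge_min lexx.
have ds : d <= s by rewrite /d !ge_min lexx orbT.
have du : d <= u by rewrite /d !ge_min lexx orbT.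
have tG x : pd q d x -> pd (G q) t (G x).
  move=> px; apply: nrm_pd; apply: le_lt_trans (GK _ _ (pdS dr px) (pd_center q r0)) _.
  by rewrite mulrC -ltr_pdivlMr //; exact/uP/(pdS du px).
exists d; first by rewrite !lt_min r0 s0.
move=> x y px py.
have -> : F (G x) - F (G y) - (x - y) *m (A *m B) =
  (F (G x) - F (G y) - (G x - G y) *m B) + (G x - G y - (x - y) *m A) *m B.
  by rewrite (mulmxBl (G x - G y)) mulmxA subrKA.
apply: le_trans (nrmD _ _) _; rewrite (splitr e) mulrDl; apply: lerD.
  apply: le_trans (tP _ _ (tG _ px) (tG _ py)) _.
  rewrite -mulrA ler_wpM2l ?divr_ge0 ?(ltW e0) //.
  rewrite mulrC ler_pdivrMr // mulrC; exact: GK (pdS dr px) (pdS dr py).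
apply: le_trans (BL _) _; have := sP _ _ (pdS ds px) (pdS ds py).
set a := nrm (G x - G y - _); set b := nrm (x - y) => h.
apply: (@le_trans _ _ ((L + 1) * (e / 2 / (L + 1) * b))).
  by apply: ler_pM => //; rewrite ?nrm_ge0 // lerDl.
by rewrite mulrA [X in X * _]mulrC divfK ?gt_eqF.
Qed.

Lemma sdm_affine n m (q : 'rV[C]_n) (A : 'M[C]_(n, m)) c : sdm q (fun x => x *m A + c) A.
Proof.
apply/sdm_nrm => e e0; exists 1 => // x y _ _.
by rewrite opprD addrACA subrr addr0 -mulmxBl subrr nrm0 mulr_ge0 ?nrm_ge0 // ltW.
Qed.

Lemma sdm_linear n m (q : 'rV[C]_n) (A : 'M[C]_(n, m)) : sdm q (fun x => x *m A) A.
Proof. by apply: eqf_sdm (sdm_affine q A 0) => x; rewrite addr0. Qed.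

Lemma sdm_cst n m (q : 'rV[C]_n) (c : 'rV[C]_m) : sdm q (fun=> c) 0.
Proof. by apply: eqf_sdm (sdm_affine q 0 c) => x; rewrite mulmx0 add0r. Qed.

Lemma sdm_id n (q : 'rV[C]_n) : sdm q (fun x => x) 1%:M.
Proof. by apply: eqf_sdm (sdm_linear q 1%:M) => x; rewrite mulmx1. Qed.

Lemma sdm_row_mx n m k (q : 'rV[C]_n) (F : 'rV[C]_n -> 'rV[C]_m) (G : 'rV[C]_n -> 'rV[C]_k) A B :
  sdm q F A -> sdm q G B -> sdm q (fun x => row_mx (F x) (G x)) (row_mx A B).
Proof.
move=> hF hG j e e0; case: (split_ordP j) => i ->.
  have [r r0 h] := hF i e e0; exists r => // x y px py.
  by under eq_bigr do rewrite row_mxEl; rewrite !row_mxEl; exact: h.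
have [r r0 h] := hG i e e0; exists r => // x y px py.
by under eq_bigr do rewrite row_mxEr; rewrite !row_mxEr; exact: h.
Qed.

Lemma sdmD n m (q : 'rV[C]_n) (F G : 'rV[C]_n -> 'rV[C]_m) A B :
  sdm q F A -> sdm q G B -> sdm q (fun x => F x + G x) (A + B).
Proof.
move=> hF hG; have := sdm_comp (sdm_row_mx hF hG) (sdm_linear _ (col_mx 1%:M 1%:M)).
rewrite mul_row_col !mulmx1; apply: eqf_sdm => x.
by rewrite mul_row_col !mulmx1.
Qed.

Lemma sdmZ n m (q : 'rV[C]_n) (F : 'rV[C]_n -> 'rV[C]_m) A c :
  sdm q F A -> sdm q (fun x => c *: F x) (c *: A).
Proof.
move=> hF; have := sdm_comp hF (sdm_linear _ (c%:M)).
by rewrite mul_mx_scalar; apply: eqf_sdm => x; rewrite mul_mx_scalar.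
Qed.

Lemma sdm_mulmxr n m k (q : 'rV[C]_n) (F : 'rV[C]_n -> 'rV[C]_m) A (B : 'M[C]_(m, k)) :
  sdm q F A -> sdm q (fun x => F x *m B) (A *m B).
Proof. by move=> hF; exact: sdm_comp hF (sdm_linear _ B). Qed.

(** The derivative at q is the value of the Hadamard quotients at (q, q), and the error is their
    oscillation near that point. The conclusion holds at all q near p because the [S i] are
    holomorphic near the diagonal. *)
Lemma sd_hadamard n (p : 'rV[C]_n) f (S : 'I_n -> 'rV[C]_(n + n) -> C) :
  (forall i, holo (row_mx p p) (S i)) ->
  (exists2 r : R, 0 < r & forall x y, pd p r x -> pd p r y ->
    f x - f y = \sum_i (x 0 i - y 0 i) * S i (row_mx x y)) ->
  \forall q \near p, sd q f (fun i => S i (row_mx q q)).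
Proof.
move=> SP [r r0 fS].
have dg : holom p (fun x : 'rV[C]_n => row_mx x x) by apply: holom_row_mx; exact: holom_id.
have /near_pd[s s0 sP] : \forall q \near p, forall i, holo (row_mx q q) (S i).
  apply: (near_holo (P := fun z => forall i, holo z (S i)) dg); apply/near_pd.
  have [t t0 h] : exists2 t : R, 0 < t & forall i z, pd (row_mx p p) t z -> holo z (S i).
    apply: common_radius => [j a b ba g x /(pdS ba)|j]; first exact: g.
    exact/near_pd/holo_near.
  by exists t => // z pz i; apply: h.
have r20 : 0 < r / 2 by rewrite divr_gt0.
apply/near_pd; exists (Num.min (r / 2) s); first by rewrite lt_min r20.
move=> q pq e e0.
have qs : pd p s q by apply: pdS pq; rewrite ge_min lexx orbT.
have qr : pd p (r / 2) q by apply: pdS pq; rewrite ge_min lexx.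
have [d d0 dP] : exists2 d : R, 0 < d & forall i z, pd (row_mx q q) d z ->
    cn (S i z - S i (row_mx q q)) < e.
  apply: common_radius => [j a b ba g x /(pdS ba)|j]; first exact: g.
  exact: holo_cont (sP _ qs j) _ e0.
exists (Num.min (r / 2) d); first by rewrite lt_min r20.
move=> x y px py.
have inr z : pd q (Num.min (r / 2) d) z -> pd p r z.
  move=> qz i; rewrite -(subrKA (q 0 i)) (splitr r).
  apply: le_lt_trans (cnD _ _) (ltrD _ (qr i)).
  by apply: lt_le_trans (qz i) _; rewrite ge_min lexx.
rewrite fS; [|exact: inr|exact: inr].
rewrite -sumrB; apply: le_trans (cn_sum _ _ _) _; rewrite /nrm mulr_sumr; apply: ler_sum => i _.
rewrite -mulrBr cnM mulrC !mxE; apply: ler_wpM2r; rewrite ?cn_ge0 //.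
apply/ltW/dP => j; have md : Num.min (r / 2) d <= d by rewrite ge_min lexx orbT.
by case: (split_ordP j) => k ->; rewrite ?row_mxEl ?row_mxEr; apply: lt_le_trans md.
Qed.

Lemma holo_partials n (p : 'rV[C]_n) f : holo p f -> exists g : 'I_n -> 'rV[C]_n -> C,
  (forall i, holo p (g i)) /\ \forall q \near p, sd q f (g^~ q).
Proof.
move=> /holo_hadamard[S [SP fS]]; exists (fun i x => S i (row_mx x x)); split => [i|].
  have dg : holom p (fun x : 'rV[C]_n => row_mx x x) by apply: holom_row_mx; exact: holom_id.
  exact: (holo_comp dg).
exact: sd_hadamard SP fS.
Qed.

Lemma holo_sd n (p : 'rV[C]_n) f : holo p f -> exists d, sd p f d.
Proof. by move=> /holo_partials[g [_ /near_pd[r r0 h]]]; exists (g^~ p); apply/h/pd_center. Qed.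

Lemma holom_sdm n m (p : 'rV[C]_n) (F : 'rV[C]_n -> 'rV[C]_m) : holom p F -> exists A, sdm p F A.
Proof.
move=> FP; have /choice[d dP] j := holo_sd (FP j).
exists (\matrix_(i, j) d j i) => j.
by have -> : (fun i => (\matrix_(i, j) d j i) i j) = d j by apply/funext => i; rewrite mxE.
Qed.

End StrictDerivative.

(** * Symmetry of second derivatives *)

Section SecondDerivative.
Context {R : realType}.
Local Notation C := R[i].

Let dvec n (t : R) (i : 'I_n) : 'rV[C]_n := t%:C%C *: delta_mx 0 i.

(** The second difference of f with steps s in directions i and j is symmetric in i and j. Writing
    one increment as a Hadamard quotient and differentiating the quotient in the other direction
    gives s^2 times a mixed derivative up to o(s^2), for either order. *)
Lemma sd_symmetric n (p : 'rV[C]_n) f (g : 'I_n -> 'rV[C]_n -> C) :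
  holo p f -> (\forall q \near p, sd q f (g^~ q)) ->
  \forall q \near p, forall h : 'I_n -> 'I_n -> C,
    (forall i, sd q (g i) (h i)) -> forall i j, h i j = h j i.
Proof.
move=> fP fg.
have [S [SP [r r0 fS]]] := holo_hadamard fP.
have gS : \forall q \near p, forall i, g i q = S i (row_mx q q).
  have := sd_hadamard SP (ex_intro2 _ _ r r0 fS).
  by apply: filterS2 fg => q h1 h2 i; exact: sd_unique h1 h2 i.
have dg : holom p (fun x : 'rV[C]_n => row_mx x x) by apply: holom_row_mx; exact: holom_id.
have SPn : \forall q \near p, forall i, holo (row_mx q q) (S i).
  apply: (near_holo (P := fun z => forall i, holo z (S i)) dg); apply/near_pd.
  have [t t0 h] : exists2 t : R, 0 < t & forall i z, pd (row_mx p p) t z -> holo z (S i).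
    apply: common_radius => [j a b ba g' x /(pdS ba)|j]; first exact: g'.
    exact/near_pd/holo_near.
  by exists t => // z pz i; apply: h.
have r20 : 0 < r / 2 by rewrite divr_gt0.
have npd : \forall q \near p, pd p (r / 2) q by apply/near_pd; exists (r / 2); first exact: r20.
have gSn : \forall q \near p, \forall x \near q, forall i, g i x = S i (row_mx x x).
  exact: nbhs_interior gS.
move: npd; apply: filterS3 SPn gSn => q {}SPn {}gSn npd h hP i j.
have /choice[d dP] k := holo_sd (SPn k).
(* Near q the partial [g k] is [S k] on the diagonal, so its derivative adds the two blocks of the
   derivative of [S k]; the second difference moves both arguments together and thus sees this
   sum. *)
have hd k l : h k l = d k (lshift n l) + d k (rshift n l).
  have sk : sd q (g k) (fun l => d k (lshift n l) + d k (rshift n l)).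
    apply: (sd_eq (f := fun x => S k (row_mx x x))).
      by apply: filterS gSn => x ->.
    move=> e e0; have e20 : 0 < e / 2 by rewrite divr_gt0.
    have [t t0 tP] := dP k _ e20; exists t => // x y px py.
    have dup z : pd q t z -> pd (row_mx q q) t (row_mx z z).
      by move=> qz m; case: (split_ordP m) => m' ->; rewrite ?row_mxEl ?row_mxEr.
    have := tP _ _ (dup _ px) (dup _ py).
    have -> : \sum_m (row_mx x x 0 m - row_mx y y 0 m) * d k m =
        \sum_l (x 0 l - y 0 l) * (d k (lshift n l) + d k (rshift n l)).
      by rewrite big_split_ord /= -big_split /=; apply: eq_bigr => m _; rewrite !row_mxEl !row_mxEr mulrDr.
    rewrite opp_row_mx add_row_mx nrm_row_mx.
    by move=> /le_trans; apply; rewrite le_eqVlt; apply/orP; left; apply/eqP; lra.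
  exact: sd_unique (hP k) sk l.
apply/eqP; rewrite -subr_eq0; apply/eqP/eq_cn_le => e e0.
have e40 : 0 < e / 4 by rewrite divr_gt0.
have [t t0 tP] : exists2 t : R, 0 < t & forall k x y, pd (row_mx q q) t x -> pd (row_mx q q) t y ->
    cn (S k x - S k y - \sum_l (x 0 l - y 0 l) * d k l) <= e / 4 * nrm (x - y).
  apply: common_radius => [k a b ba g' x y /(pdS ba) px /(pdS ba) py|k]; first exact: g'.
  exact: dP.
pose s := Num.min (r / 2) t / 3.
have m0 : 0 < Num.min (r / 2) t by rewrite lt_min r20.
have s0 : 0 < s by rewrite divr_gt0.
have s3 : s + s < Num.min (r / 2) t by rewrite /s; lra.
have dE (k l : 'I_n) : dvec s k 0 l = s%:C%C * (l == k)%:R by rewrite !mxE eqxx.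
have cdE (k l : 'I_n) : cn (dvec s k 0 l) <= s.
  by rewrite dE cnM cn_real gtr0_norm // cn_nat ler_piMr ?(ltW s0) // lern1 leq_b1.
have ndv (k : 'I_n) : nrm (dvec s k) = s.
  rewrite nrmZ cn_real gtr0_norm // /nrm (bigD1 k) //= big1 => [|l lk].
    by rewrite mxE !eqxx cn1 addr0 mulr1.
  by rewrite mxE (negbTE lk) andbF cn0.
have inq (x : 'rV[C]_n) : (forall l, cn (x 0 l - q 0 l) <= s + s) -> pd q (Num.min (r / 2) t) x.
  by move=> h' l; apply: le_lt_trans (h' l) s3.
have q0 : pd q (Num.min (r / 2) t) q by exact: pd_center.
have q1 k : pd q (Num.min (r / 2) t) (q + dvec s k).
  by apply: inq => l; rewrite mxE [q 0 l + _]addrC addrK; apply: le_trans (cdE k l) _; lra.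
have q2 k l : pd q (Num.min (r / 2) t) (q + dvec s k + dvec s l).
  apply: inq => m; rewrite mxE [(q + _) 0 m]mxE.
  have -> : q 0 m + dvec s k 0 m + dvec s l 0 m - q 0 m = dvec s k 0 m + dvec s l 0 m by ring.
  exact: le_trans (cnD _ _) (lerD (cdE _ _) (cdE _ _)).
have inr z : pd q (Num.min (r / 2) t) z -> pd p r z.
  move=> qz m; rewrite -(subrKA (q 0 m)) (splitr r).
  apply: le_lt_trans (cnD _ _) (ltrD _ (npd m)).
  by apply: lt_le_trans (qz m) _; rewrite ge_min lexx.
have fd k x : pd q (Num.min (r / 2) t) x -> pd q (Num.min (r / 2) t) (x + dvec s k) ->
    f (x + dvec s k) - f x = s%:C%C * S k (row_mx (x + dvec s k) x).
  move=> h1 h2; rewrite fS; [|exact: inr|exact: inr].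
  rewrite (bigD1 k) //= big1 ?addr0 => [|l lk]; rewrite mxE [x 0 _ + _]addrC addrK dE ?eqxx ?mulr1 //.
  by rewrite (negbTE lk) mulr0 mul0r.
have key k l : cn (f (q + dvec s k + dvec s l) - f (q + dvec s k) - f (q + dvec s l) + f q
    - s%:C%C * s%:C%C * h l k) <= s * s * (e / 2).
  have -> : f (q + dvec s k + dvec s l) - f (q + dvec s k) - f (q + dvec s l) + f q
    - s%:C%C * s%:C%C * h l k =
    (f (q + dvec s k + dvec s l) - f (q + dvec s k)) - (f (q + dvec s l) - f q)
     - s%:C%C * s%:C%C * h l k by ring.
  rewrite (fd l) ?(fd l q) // -[_ * _ * h l k]mulrA -!mulrBr cnM cn_real gtr0_norm // -mulrA.
  apply: ler_wpM2l; first exact: ltW.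
  have mt : Num.min (r / 2) t <= t by rewrite ge_min lexx orbT.
  have h1 : pd (row_mx q q) t (row_mx (q + dvec s k + dvec s l) (q + dvec s k)).
    move=> m; case: (split_ordP m) => m' ->; rewrite ?row_mxEl ?row_mxEr; apply: lt_le_trans mt.
      exact: q2. exact: q1.
  have h2 : pd (row_mx q q) t (row_mx (q + dvec s l) q).
    move=> m; case: (split_ordP m) => m' ->; rewrite ?row_mxEl ?row_mxEr; apply: lt_le_trans mt.
      exact: q1. exact: q0.
  have := tP l _ _ h1 h2.
  have -> : row_mx (q + dvec s k + dvec s l) (q + dvec s k) - row_mx (q + dvec s l) q =
    row_mx (dvec s k) (dvec s k).
    rewrite opp_row_mx add_row_mx; congr row_mx; apply/rowP => m; rewrite !mxE; ring.
  have -> : \sum_m (row_mx (q + dvec s k + dvec s l) (q + dvec s k) 0 m -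
      row_mx (q + dvec s l) q 0 m) * d l m = \sum_m dvec s k 0 m * h l m.
    rewrite big_split_ord /= -big_split /=; apply: eq_bigr => m _.
    by rewrite !row_mxEl !row_mxEr hd !mxE; ring.
  rewrite nrm_row_mx ndv.
  rewrite (bigD1 k) //= big1 ?addr0 => [|m mk].
    rewrite dE eqxx mulr1 => /le_trans; apply.
    by rewrite le_eqVlt; apply/orP; left; apply/eqP; lra.
  by rewrite dE (negbTE mk) mulr0 mul0r.
have ss0 : 0 < s * s by rewrite mulr_gt0.
rewrite -(ler_pM2l ss0).
have -> : s * s * cn (h i j - h j i) = cn (s%:C%C * s%:C%C * (h i j - h j i)).
  by rewrite !cnM cn_real gtr0_norm.
have h1 := key j i; have h2 := key i j.
rewrite (_ : s * s * e = s * s * (e / 2) + s * s * (e / 2)); last lra.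
apply: le_trans (lerD h2 h1); apply: le_trans (cnB _ _).
rewrite le_eqVlt; apply/orP; left; apply/eqP; congr cn.
by rewrite (addrAC q (dvec s i)); ring.
Qed.

End SecondDerivative.

(** * Fixed points, implicit and inverse functions *)

Section ImplicitFunction.
Context {R : realType}.
Local Notation C := R[i].

Lemma holom_Ua n m (p : 'rV[C]_n) (F : 'rV[C]_n -> 'rV[C]_m) : holom p F ->
  exists2 r : R, 0 < r & forall j, Ua (pd p r) (fun x => F x 0 j).
Proof.
move=> FP; apply: common_radius => [j a b ba|j]; first by apply: Ua_sub => x; exact: pdS.
exact/holoP.
Qed.

(* Picard iteration; the limit is holomorphic because locally uniform limits of
   uniform limits of polynomials are uniform limits of polynomials. *)
Lemma holomorphic_fixpoint n m (H : 'rV[C]_(n + m) -> 'rV[C]_m) (r : R) :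
  0 < r -> holom 0 H -> H 0 = 0 ->
  (forall x y y', pd 0 r (row_mx x y) -> pd 0 r (row_mx x y') ->
     nrm (H (row_mx x y) - H (row_mx x y')) <= nrm (y - y') / 2) ->
  exists g : 'rV[C]_n -> 'rV[C]_m, [/\ holom 0 g, g 0 = 0 &
    \forall v \near (0 : 'rV[C]_(n + m)), rsubmx v = H v <-> rsubmx v = g (lsubmx v)].
Proof.
move=> r0 Hh H0 Hc.
have [s s0 HU] := holom_Ua Hh.
pose d := Num.min r s; have d0 : 0 < d by rewrite lt_min r0.
have dr : d <= r by rewrite ge_min lexx.
have ds : d <= s by rewrite ge_min lexx orbT.
have h0 : holom (0 : 'rV[C]_n) (fun x => H (row_mx x 0)).
  apply: (holom_comp (F := H)); last by rewrite row_mx0.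
  by apply: holom_row_mx; [exact: holom_id|exact: holom_cst].
have /near_pd[u u0 uP] : \forall x \near (0 : 'rV[C]_n), nrm (H (row_mx x 0)) < d / 4.
  have := near_holo (P := fun y => nrm y < d / 4) h0; apply.
  apply/near_nrm; exists (d / 4); first by rewrite divr_gt0.
  by move=> y; rewrite row_mx0 H0 subr0.
pose o := Num.min u d; have o0 : 0 < o by rewrite lt_min u0.
have ou : o <= u by rewrite ge_min lexx.
have od : o <= d by rewrite ge_min lexx orbT.
have inpd x y : pd 0 o x -> nrm y < d -> pd 0 d (row_mx x y).
  move=> px py j; case: (split_ordP j) => i ->; rewrite ?row_mxEl ?row_mxEr !mxE subr0.
    by have := px i; rewrite mxE subr0 => /lt_le_trans; apply.
  exact: le_lt_trans (cn_le_nrm _ _) py.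
have {}Hc x y y' : pd 0 o x -> nrm y < d -> nrm y' < d ->
    nrm (H (row_mx x y) - H (row_mx x y')) <= nrm (y - y') / 2.
  by move=> px py py'; apply: Hc; apply/(pdS dr)/inpd.
pose g k x := iter k (fun y => H (row_mx x y)) 0.
pose t k : R := 2^-1 ^+ k.
have tS k : t k.+1 = t k / 2 by rewrite /t exprSr.
have t_ge0 k : 0 < t k by rewrite exprn_gt0 // invr_gt0.
(* The first step is at most d/4 and each later one at most half of its predecessor, so that the
   iterates stay within d/2 of 0, inside the domain of the contraction. *)
have gk k x : pd 0 o x -> nrm (g k x) <= d / 2 * (1 - t k) /\ nrm (g k.+1 x - g k x) <= d / 4 * t k.
  move=> px; elim: k => [|k [IH1 IH2]].
    rewrite /t expr0 subrr mulr0 mulr1 /= nrm0 subr0; split => //.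
    exact/ltW/uP/(pdS ou).
  have IH : nrm (g k.+1 x) <= d / 2 * (1 - t k.+1).
    rewrite -[g k.+1 x](subrK (g k x)); apply: le_trans (nrmD _ _) _.
    by rewrite tS; lra.
  split=> //; have td : d / 2 * (1 - t k) < d by have := t_ge0 k; nra.
  have td' : d / 2 * (1 - t k.+1) < d by have := t_ge0 k.+1; nra.
  apply: le_trans (Hc _ _ _ px (le_lt_trans IH td') (le_lt_trans IH1 td)) _.
  by rewrite tS; lra.
have gd k x : pd 0 o x -> nrm (g k x) < d.
  by move=> px; apply: le_lt_trans (gk k x px).1 _; have := t_ge0 k; nra.
have gU k j : Ua (pd 0 o) (fun x => g k x 0 j).
  elim: k j => [|k IH] j /=; first by apply: Ua_pfun; exact: pfun_cst.
  apply: (Ua_comp (f := fun z => H z 0 j) (G := fun x => row_mx x (g k x)) (bounded_pd _ _) (HU j)).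
    move=> i; case: (split_ordP i) => l ->.
      by apply: Ua_pfun; apply: (eq_pfun _ (pfun_coord l)) => x; rewrite row_mxEl.
    by apply: Ua_eq (IH l) => x _; rewrite row_mxEr.
  by move=> x px; apply: (pdS ds); apply: inpd => //; exact: gd.
have gc k l x : (k <= l)%N -> pd 0 o x -> nrm (g l x - g k x) <= d / 2 * (t k - t l).
  move=> kl px; elim: l kl => [|l IH]; first by rewrite leqn0 => /eqP ->; rewrite !subrr mulr0 nrm0.
  rewrite leq_eqVlt => /orP[/eqP ->|]; first by rewrite !subrr mulr0 nrm0.
  rewrite ltnS => /IH {}IH; apply: le_trans (nrm_triangle (g l x) _ _) _.
  by have [_ h] := gk l x px; rewrite tS; lra.
have tlim (e : R) : 0 < e -> exists k, d / 2 * t k <= e.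
  move=> e0; have de : 0 < d / 2 / e by rewrite !divr_gt0.
  exists (Num.truncn (d / 2 / e)).+1; rewrite -ler_pdivlMl ?divr_gt0 //.
  rewrite /t exprVn -[leRHS]invrK lef_pV2 ?posrE ?exprn_gt0 ?invr_gt0 ?mulr_gt0 ?invr_gt0 ?divr_gt0 //.
  rewrite invfM invrK; apply: le_trans (ltW (truncnS_gt _)) _.
  by rewrite -natrX ler_nat ltnW // ltn_expl.
have /choice[G GP] x : exists y : 'rV[C]_m, pd 0 o x -> forall k j, cn (y 0 j - g k x 0 j) <= d / 2 * t k.
  have [px|npx] := pselect (pd 0 o x); last by exists 0 => /npx.
  have gcj k l j : (k <= l)%N -> cn (g l x 0 j - g k x 0 j) <= d / 2 * t k.
    move=> kl; have := cn_le_nrm (g l x - g k x) j; rewrite !mxE => /le_trans; apply.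
    by apply: le_trans (gc _ _ _ kl px) _; have := t_ge0 l; nra.
  have /choice[y yP] j : exists y : C, (fun k => g k x 0 j) @ \oo --> y.
    by apply: cauchyC => e /tlim[k kP]; exists k => l kl; exact: le_trans (gcj _ _ _ kl) kP.
  exists (\row_j y j) => _ k j; rewrite mxE.
  by apply: (cvgC_le (N := k) (yP j)) => l kl; exact: gcj.
have Gn k x : pd 0 o x -> nrm (G x - g k x) <= m%:R * (d / 2 * t k).
  move=> px; apply: (@le_trans _ _ (\sum_(j < m) d / 2 * t k)).
    by apply: ler_sum => j _; have := GP x px k j; rewrite !mxE.
  by rewrite sumr_const card_ord mulr_natl.
have Gl (e : R) x : 0 < e -> pd 0 o x -> exists k, nrm (G x - g k x) <= e /\ nrm (g k.+1 x - g k x) <= e.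
  move=> e0 px; have e1 : 0 < e / m.+1%:R by rewrite divr_gt0.
  have [k kP] := tlim _ e1; exists k; split.
    apply: le_trans (Gn k x px) _; apply: (@le_trans _ _ (m.+1%:R * (e / m.+1%:R))).
      apply: ler_pM => //; first by rewrite !mulr_ge0 ?invr_ge0 ?(ltW d0) // ltW.
      by rewrite ler_nat.
    by rewrite mulrC divfK.
  apply: le_trans (gk k x px).2 _; have e2 : e / m.+1%:R <= e.
    by rewrite ler_pdivrMr // ler_peMr ?(ltW e0) // ler1n.
  apply: le_trans e2; apply: le_trans kP; apply: ler_wpM2r; first exact: ltW.
  by move: d0; lra.
have Gd x : pd 0 o x -> nrm (G x) < d.
  move=> px; have d4 : 0 < d / 4 by rewrite divr_gt0.
  have [k [h _]] := Gl _ _ d4 px; rewrite -[G x](subrK (g k x)); apply: le_lt_trans (nrmD _ _) _.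
  by have [h' _] := gk k x px; have := mulr_gt0 d0 (t_ge0 k); lra.
have Gfix x : pd 0 o x -> G x = H (row_mx x (G x)).
  move=> px; apply/eqP; rewrite -subr_eq0; apply/eqP/nrm_eq0/le_anti; rewrite nrm_ge0 andbT.
  apply/ler_addgt0Pl => e e0; rewrite addr0; have e3 : 0 < e / 3 by rewrite divr_gt0.
  have [k [h1 h2]] := Gl _ _ e3 px.
  apply: le_trans (nrm_triangle (g k x) _ _) _.
  have h3 : nrm (g k x - H (row_mx x (G x))) <= e / 3 + e / 3.
    apply: le_trans (nrm_triangle (g k.+1 x) _ _) _; rewrite nrm_distC; apply: lerD => //.
    rewrite nrm_distC; apply: le_trans (Hc _ _ _ px (Gd x px) (gd k x px)) _; lra.
  lra.
have iffG x y : pd 0 o x -> nrm y < d -> y = H (row_mx x y) <-> y = G x.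
  move=> px py; split=> [yE|->]; last exact: Gfix.
  have := Hc _ _ _ px py (Gd x px); rewrite -yE -(Gfix x px) => h.
  by apply/eqP; rewrite -subr_eq0; apply/eqP/nrm_eq0/le_anti; rewrite nrm_ge0 andbT; lra.
exists G; split.
- move=> j; apply/holoP; exists o => //; apply: Ua_lim => e /tlim[k kP].
  by exists (fun x => g k x 0 j) => // x px; apply: le_trans (GP x px k j) kP.
- by apply/esym/(iffG 0 0); rewrite ?row_mx0 ?H0 ?nrm0 //; exact: pd_center.
apply/near_nrm; exists o => // v; rewrite subr0 -{1}[v]hsubmxK nrm_row_mx => h.
rewrite -[in H v](hsubmxK v); apply: iffG.
  by apply: nrm_pd; rewrite subr0; apply: le_lt_trans h; rewrite lerDl nrm_ge0.
by apply: lt_le_trans od; apply: le_lt_trans h; rewrite lerDr nrm_ge0.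
Qed.

(** Once the derivative in y is the identity, y - F(x, y) has zero derivative in y, and strictness
    of the derivative already makes it a contraction of ratio 1/2; its fixed points are the zeros of
    F. *)
Lemma implicit_function n m (F : 'rV[C]_(n + m) -> 'rV[C]_m) (A : 'M[C]_(n + m, m)) :
  holom 0 F -> F 0 = 0 -> sdm 0 F A -> dsubmx A = 1%:M ->
  exists g : 'rV[C]_n -> 'rV[C]_m, [/\ holom 0 g, g 0 = 0 &
    \forall v \near (0 : 'rV[C]_(n + m)), F v = 0 <-> rsubmx v = g (lsubmx v)].
Proof.
move=> Fh F0 FA A1; pose H v := rsubmx v - F v.
have e2 : 0 < 2^-1 :> R by rewrite invr_gt0.
move/sdm_nrm : FA => /(_ _ e2)[r r0 rP].
have [||x y y' px py|g [gh g0 gP]] := @holomorphic_fixpoint _ _ H r r0.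
- by apply: holomB => //; apply: holom_rsub; exact: holom_id.
- by rewrite /H F0 subr0; apply/rowP => i; rewrite !mxE.
- have := rP _ _ px py; rewrite /H !row_mxKr.
  rewrite opp_row_mx add_row_mx subrr nrm_row_mx nrm0 add0r [2^-1 * _]mulrC => h.
  apply: le_trans h; rewrite -nrmN; rewrite le_eqVlt; apply/orP; left; apply/eqP; congr nrm.
  have -> : row_mx 0 (y - y') *m A = y - y'.
    by rewrite -[A]vsubmxK mul_row_col mul0mx add0r A1 mulmx1.
  by apply/rowP => i; rewrite !mxE; ring.
exists g; split=> //; apply: filterS gP => v [h1 h2]; split=> [Fv|/h2].
  by apply: h1; rewrite /H Fv subr0.
by rewrite /H => /eqP; rewrite -subr_eq0 opprB addrC subrK => /eqP.
Qed.

(** The implicit function theorem for F(y) - x = 0; the two directions of the resulting equivalence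
    give the two composition identities. *)
Lemma inverse_function n (F : 'rV[C]_n -> 'rV[C]_n) : holom 0 F -> F 0 = 0 -> sdm 0 F 1%:M ->
  exists g : 'rV[C]_n -> 'rV[C]_n, [/\ holom 0 g, g 0 = 0,
    \forall p \near (0 : 'rV[C]_n), g (F p) = p & \forall q \near (0 : 'rV[C]_n), F (g q) = q].
Proof.
move=> Fh F0 FA; pose E (v : 'rV[C]_(n + n)) := F (rsubmx v) - lsubmx v.
have h0 : (0 : 'rV[C]_(n + n)) = row_mx 0 0 by rewrite row_mx0.
have [||||g [gh g0 gP]] := @implicit_function n n E (col_mx 0 1%:M - col_mx 1%:M 0).
- apply: holomB; last by apply: holom_lsub; exact: holom_id.
  by apply: holom_comp; [apply: holom_rsub; exact: holom_id|rewrite h0 row_mxKr].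
- by rewrite /E h0 row_mxKr row_mxKl F0 subrr.
- rewrite /E; apply: sdmD.
    have := sdm_comp (sdm_linear (0 : 'rV[C]_(n + n)) (col_mx 0 1%:M)) (F := F) (B := 1%:M).
    rewrite mulmx1 mul0mx => /(_ FA); apply: eqf_sdm => x.
    by rewrite -[x in x *m _]hsubmxK mul_row_col mulmx0 mulmx1 add0r.
  rewrite -scaleN1r; apply: eqf_sdm (sdmZ (-1) (sdm_linear _ (col_mx 1%:M 0))) => x.
  by rewrite scaleN1r -[x in x *m _]hsubmxK mul_row_col mulmx0 mulmx1 addr0.
- by rewrite opp_col_mx add_col_mx col_mxKd oppr0 addr0.
exists g; split=> //.
  have h : holom 0 (fun p : 'rV[C]_n => row_mx (F p) p) by apply: holom_row_mx => //; exact: holom_id.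
  have := near_holo (P := fun v => E v = 0 <-> rsubmx v = g (lsubmx v)) h.
  rewrite F0 -h0 => /(_ gP); apply: filterS => p; rewrite /E row_mxKl row_mxKr => -[+ _].
  by move=> <- //; rewrite subrr.
have h : holom 0 (fun q : 'rV[C]_n => row_mx q (g q)) by apply: holom_row_mx => //; exact: holom_id.
have := near_holo (P := fun v => E v = 0 <-> rsubmx v = g (lsubmx v)) h.
rewrite g0 -h0 => /(_ gP); apply: filterS => q; rewrite /E row_mxKl row_mxKr => -[_ +].
by move=> /(_ erefl)/eqP; rewrite subr_eq0 => /eqP.
Qed.

End ImplicitFunction.

(** * Real analytic functions and vector fields *)

Section RealAnalytic.
Context {R : realType}.
Local Notation C := R[i].

Definition rc n (x : 'rV[R]_n) : 'rV[C]_n := map_mx (real_complex R) x.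

Lemma rc0 n : rc (0 : 'rV[R]_n) = 0. Proof. by apply/rowP => i; rewrite !mxE. Qed.
Lemma rcB n (x y : 'rV[R]_n) : rc (x - y) = rc x - rc y.
Proof. by apply/rowP => i; rewrite !mxE rmorphB. Qed.
Lemma rcZ n a (x : 'rV[R]_n) : rc (a *: x) = a%:C%C *: rc x.
Proof. by apply/rowP => i; rewrite !mxE rmorphM. Qed.
Lemma rc_inj n : injective (@rc n).
Proof. by move=> x y /rowP xy; apply/rowP => i; have := xy i; rewrite !mxE => -[]. Qed.
Lemma conj_real (a : R) : (a%:C%C)^* = a%:C%C :> C.
Proof. by apply/eqP; rewrite eq_complex /= oppr0 !eqxx. Qed.
Lemma cvec_rc n (x : 'rV[R]_n) : cvec (rc x) = rc x.
Proof. by apply/rowP => i; rewrite !mxE conj_real. Qed.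
Lemma cvec_eq_rc n (x : 'rV[C]_n) : cvec x = x -> exists y, x = rc y.
Proof.
move=> /rowP h; exists (\row_i complex.Re (x 0 i)); apply/rowP => i; rewrite !mxE.
have := h i; rewrite mxE; case: (x 0 i) => a b [] /= nb.
by apply/eqP; rewrite eq_complex /= eqxx /=; apply/eqP; lra.
Qed.
Lemma row_mx_rc n m (x : 'rV[R]_n) (y : 'rV[R]_m) : rc (row_mx x y) = row_mx (rc x) (rc y).
Proof. exact: map_row_mx. Qed.
Lemma rc_mulmx n m (x : 'rV[R]_n) (A : 'M[R]_(n, m)) :
  rc (x *m A) = rc x *m map_mx (real_complex R) A.
Proof. exact: map_mxM. Qed.

Lemma near_rc n (p : 'rV[R]_n) (P : set 'rV[R]_n) :
  (\forall x \near p, P x) <-> exists2 r : R, 0 < r & forall x, pd (rc p) r (rc x) -> P x.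
Proof.
have pdE r x : pd (rc p) r (rc x) <-> forall i, `|p 0 i - x 0 i| < r.
  by split=> h i; have := h i; rewrite !mxE -rmorphB cn_real distrC.
split=> [/nbhs_ballP[e /= e0 eP]|[r r0 rP]].
  exists e => // x /pdE px; apply: eP; split => // i j.
  by rewrite (ord1 i) /ball /= /ball_ /=.
apply/nbhs_ballP; exists r => //= x [_ h]; apply: rP; apply/pdE => i.
by have := h 0 i; rewrite /ball /= /ball_ /=.
Qed.

Lemma rc_near n (p : 'rV[R]_n) (P : set 'rV[C]_n) :
  (\forall x \near rc p, P x) -> \forall x \near p, P (rc x).
Proof.
by move=> /near_pd[r r0 rP]; apply/near_rc; exists r => // x; exact: rP.
Qed.

(** Real analytic germs as restrictions of holomorphic germs of the complexification. Values are
    complex, so that z, w and their conjugates, viewed on R^8, are covered along with real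
    functions. *)
Inductive ran n (p : 'rV[R]_n) (f : 'rV[R]_n -> C) : Prop :=
  Ran F of holo (rc p) F & \forall x \near p, f x = F (rc x).

Definition ranm n m (p : 'rV[R]_n) (F : 'rV[R]_n -> 'rV[C]_m) : Prop :=
  forall j, ran p (fun x => F x 0 j).

Definition ra n (p : 'rV[R]_n) (f : 'rV[R]_n -> R) : Prop := ran p (fun x => (f x)%:C%C).

Definition ram n m (p : 'rV[R]_n) (F : 'rV[R]_n -> 'rV[R]_m) : Prop :=
  forall j, ra p (fun x => F x 0 j).

Lemma monomial_rc n (x : 'rV[R]_n) a : monomial (rc x) a = (monomial x a)%:C%C :> C.
Proof. by rewrite /monomial rmorph_prod; apply: eq_bigr => i _; rewrite mxE rmorphXn. Qed.

Lemma real_cvgP (u : nat -> R) (l : R) : (u @ \oo --> l) <-> (fun n => (u n)%:C%C) @ \oo --> (l%:C%C : C).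
Proof.
split=> [/cvgrPdist_le h|/cvgCP h].
  apply/cvgCP => e /h[N _ NP]; exists N => n Nn.
  by rewrite -rmorphB cn_real distrC; exact: NP.
apply/cvgrPdist_le => e /h[N NP]; exists N => // n /= /NP.
by rewrite -rmorphB cn_real distrC.
Qed.

(** A real Taylor series converges on a complex polydisc with the same coefficients. Conversely,
    monomials are real at real points, so the real parts of the coefficients of a holomorphic
    extension represent f. *)
Lemma ra_analytic n (p : 'rV[R]_n) f : analytic_at p f <-> ra p f.
Proof.
have mB x a : monomial (rc x - rc p) a = (monomial (x - p) a)%:C%C :> C by rewrite -rcB monomial_rc.
split=> [[c [r [r0 [B rB] rf]]]|[F Fh fF]].
  have [|||S SU Sf] := @Ua_series _ n n (pd (rc p) r) (fun a => (c a)%:C%C)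
      (fun a x => monomial (x - rc p) a) (fun a => `|c a| * r ^+ (\sum_i a i)%N) B _ _ _ rB.
  - exact: pfun_monomial.
  - by move=> a; rewrite mulr_ge0 ?normr_ge0 // exprn_ge0 // ltW.
  - move=> a x px; rewrite cnM cn_real ler_wpM2l ?normr_ge0 //; apply: cn_monomial_le => i.
    by rewrite !mxE ltW //; have := px i; rewrite mxE.
  apply: (@Ran _ _ _ S); first by apply/holoP; exists r.
  apply/near_rc; exists r => // x px.
  have xr : `|x - p| < r.
    have : ball p r x.
      by split => // i j; rewrite (ord1 i) /ball /= /ball_ /= distrC; have := px j;
         rewrite !mxE -rmorphB cn_real.
    by rewrite mx_norm_ball /ball_ /= distrC.
  apply/esym; apply: (cvgC_unique (Sf _ px)); have /real_cvgP := rf _ xr.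
  have eqcvg (u v : nat -> C) (l : C) : u =1 v -> (v @ \oo --> l) -> (u @ \oo --> l) by move=> /funext ->.
  apply: eqcvg => N; rewrite /box_sum rmorph_sum /=; apply: eq_bigr => a _.
  by rewrite rmorphM mB.
move/holo_analytic : Fh => [c /taylorP[r [r0 [B rB] rf]]].
have /near_rc[s s0 sP] := fF.
pose t := Num.min r s; have t0 : 0 < t by rewrite lt_min r0.
have tr : t <= r by rewrite ge_min lexx.
have ts : t <= s by rewrite ge_min lexx orbT.
exists (fun a => complex.Re (c a)), t; split=> //.
  exists B => N; apply: le_trans (rB N); apply: ler_sum => a _.
  by apply: ler_pM; rewrite ?exprn_ge0 ?(ltW t0) ?Re_le_cn // lerXn2r ?nnegrE ?(ltW t0) ?(ltW r0).
move=> x xt.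
have px : pd (rc p) t (rc x).
  have : ball p t x by rewrite mx_norm_ball /ball_ /= distrC.
  by move=> [_ h] i; have := h 0 i; rewrite /ball /= /ball_ /= !mxE -rmorphB cn_real distrC.
have := rf _ (pdS tr px); rewrite -sP; last exact: pdS ts px.
move=> /cvgCP h; apply/cvgrPdist_le => e /h[N NP]; exists N => // k /= /NP.
rewrite distrC; apply: le_trans; apply: le_trans (Re_le_cn _).
rewrite le_eqVlt; apply/orP; left; apply/eqP; congr (`| _ |).
rewrite raddfB /=; congr (_ - _); rewrite /box_sum raddf_sum; apply: eq_bigr => a _.
by rewrite mB; case: (c _) => u v /=; rewrite mulr0 subr0.
Qed.

Lemma ram_analytic n m (p : 'rV[R]_n) (F : 'rV[R]_n -> 'rV[R]_m) : analytic_map_at p F <-> ram p F.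
Proof. by split=> h j; apply/ra_analytic; exact: h. Qed.

Lemma eq_ran n (p : 'rV[R]_n) f g : (\forall x \near p, f x = g x) -> ran p f -> ran p g.
Proof. by move=> fg [F Fh fF]; apply: (Ran Fh); apply: filterS2 fg fF => x -> ->. Qed.

Lemma eqf_ran n (p : 'rV[R]_n) f g : (forall x, f x = g x) -> ran p f -> ran p g.
Proof. by move=> /funext ->. Qed.

Lemma eq_ra n (p : 'rV[R]_n) f g : (\forall x \near p, f x = g x) -> ra p f -> ra p g.
Proof. by move=> fg; apply: eq_ran; apply: filterS fg => x ->. Qed.

Lemma eqf_ra n (p : 'rV[R]_n) f g : (forall x, f x = g x) -> ra p f -> ra p g.
Proof. by move=> /funext ->. Qed.

Lemma ran_near n (p : 'rV[R]_n) f : ran p f -> \forall q \near p, ran q f.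
Proof.
move=> [F Fh fF].
have h1 := rc_near (holo_near Fh); have h2 := nbhs_interior fF.
by apply: filterS2 h1 h2 => q Fq fq; apply: (Ran Fq).
Qed.

Lemma ra_near n (p : 'rV[R]_n) f : ra p f -> \forall q \near p, ra q f.
Proof. exact: ran_near. Qed.

Lemma near_all (T : topologicalType) m (p : T) (P : 'I_m -> T -> Prop) :
  (forall j, \forall x \near p, P j x) -> \forall x \near p, forall j, P j x.
Proof. by move=> h; apply: filter_forall. Qed.

Lemma ram_near n m (p : 'rV[R]_n) (F : 'rV[R]_n -> 'rV[R]_m) : ram p F -> \forall q \near p, ram q F.
Proof. by move=> FP; apply: (@near_all _ m) => j; exact: ra_near. Qed.

Lemma ran_holo n (p : 'rV[R]_n) F : holo (rc p) F -> ran p (fun x => F (rc x)).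
Proof. by move=> Fh; apply: (Ran Fh); exact: filterE. Qed.

Lemma ran_cst n (p : 'rV[R]_n) (c : C) : ran p (fun=> c).
Proof. by apply: (Ran (holo_cst _ c)); exact: filterE. Qed.

Lemma ran_coord n (p : 'rV[R]_n) i : ran p (fun x => (x 0 i)%:C%C).
Proof. by apply: (Ran (holo_coord (rc p) i)); apply: filterE => x; rewrite mxE. Qed.

Lemma ranD n (p : 'rV[R]_n) f g : ran p f -> ran p g -> ran p (fun x => f x + g x).
Proof.
move=> [F Fh fF] [G Gh gG]; apply: (Ran (holoD Fh Gh)).
by apply: filterS2 fF gG => x -> ->.
Qed.

Lemma ranM n (p : 'rV[R]_n) f g : ran p f -> ran p g -> ran p (fun x => f x * g x).
Proof.
move=> [F Fh fF] [G Gh gG]; apply: (Ran (holoM Fh Gh)).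
by apply: filterS2 fF gG => x -> ->.
Qed.

(** At real points the conjugate of F(x) is the value of the holomorphic germ obtained by
    conjugating both the argument and the value of F. *)
Lemma ran_conj n (p : 'rV[R]_n) f : ran p f -> ran p (fun x => (f x)^*).
Proof.
move=> [F Fh fF]; have := @holo_conj _ _ (rc p) F; rewrite cvec_rc => /(_ Fh) h.
by apply: (Ran h); apply: filterS fF => x ->; rewrite cvec_rc.
Qed.

Lemma ranm_holom n m (p : 'rV[R]_n) (F : 'rV[R]_n -> 'rV[C]_m) : ranm p F ->
  exists G, [/\ holom (rc p) G, \forall x \near p, F x = G (rc x) & F p = G (rc p)].
Proof.
move=> FP.
have /choice[G GP] j : exists G, holo (rc p) G /\ \forall x \near p, F x 0 j = G (rc x).
  by have [G Gh h] := FP j; exists G.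
have h : \forall x \near p, F x = \row_j G j (rc x).
  have : \forall x \near p, forall j, F x 0 j = G j (rc x) by apply: near_all => j; exact: (GP j).2.
  by apply: filterS => x xP; apply/rowP => j; rewrite mxE xP.
exists (fun x => \row_j G j x); split => //.
  by move=> j; apply: eqf_holo (GP j).1 => x; rewrite mxE.
exact: nbhs_singleton h.
Qed.

Lemma ran_comp n m (p : 'rV[R]_n) (f : 'rV[C]_m -> C) (F : 'rV[R]_n -> 'rV[C]_m) :
  ranm p F -> holo (F p) f -> ran p (fun x => f (F x)).
Proof.
move=> /ranm_holom[G [Gh FG ->]] fh; apply: (Ran (holo_comp Gh fh)).
by apply: filterS FG => x ->.
Qed.

Lemma ranm_comp n m k (p : 'rV[R]_n) (H : 'rV[C]_m -> 'rV[C]_k) (F : 'rV[R]_n -> 'rV[C]_m) :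
  ranm p F -> holom (F p) H -> ranm p (fun x => H (F x)).
Proof. by move=> Fr Hh j; apply: (ran_comp (f := fun y => H y 0 j) Fr (Hh j)). Qed.

Lemma ranm_near_comp n m (p : 'rV[R]_n) (F : 'rV[R]_n -> 'rV[C]_m) (P : set 'rV[C]_m) :
  ranm p F -> (\forall y \near F p, P y) -> \forall x \near p, P (F x).
Proof.
move=> /ranm_holom[G [Gh FG ->]] yP; have := rc_near (near_holo Gh yP).
by apply: filterS2 FG => x ->.
Qed.

Lemma ranm_row_mx n m k (p : 'rV[R]_n) (F : 'rV[R]_n -> 'rV[C]_m) (G : 'rV[R]_n -> 'rV[C]_k) :
  ranm p F -> ranm p G -> ranm p (fun x => row_mx (F x) (G x)).
Proof.
move=> FP GP j; case: (split_ordP j) => i ->.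
  by apply: eqf_ran (FP i) => x; rewrite row_mxEl.
by apply: eqf_ran (GP i) => x; rewrite row_mxEr.
Qed.

Lemma ranm_conj n m (p : 'rV[R]_n) (F : 'rV[R]_n -> 'rV[C]_m) : ranm p F -> ranm p (fun x => cvec (F x)).
Proof. by move=> FP j; apply: eqf_ran (ran_conj (FP j)) => x; rewrite mxE. Qed.

Lemma ra_Re n (p : 'rV[R]_n) f : ran p f -> ra p (fun x => complex.Re (f x)).
Proof.
move=> fr; have h := ranM (ran_cst p (2^-1)) (ranD fr (ran_conj fr)).
apply: eqf_ran h => x; case: (f x) => a b; apply/eqP; rewrite eq_complex.
have -> : 2^-1 = (2^-1 : R)%:C%C :> C by rewrite fmorphV rmorph_nat.
by rewrite /=; apply/andP; split; apply/eqP; lra.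
Qed.

Lemma ra_Im n (p : 'rV[R]_n) f : ran p f -> ra p (fun x => complex.Im (f x)).
Proof.
move=> fr; have := ra_Re (ranM (ran_cst p (- 'i)) fr).
by apply: eqf_ra => x; case: (f x) => a b /=; lra.
Qed.

Lemma ra_cst n (p : 'rV[R]_n) c : ra p (fun=> c). Proof. exact: ran_cst. Qed.
Lemma ra_coord n (p : 'rV[R]_n) i : ra p (fun x => x 0 i). Proof. exact: ran_coord. Qed.
Lemma raD n (p : 'rV[R]_n) f g : ra p f -> ra p g -> ra p (fun x => f x + g x).
Proof. by move=> fr gr; apply: eqf_ran (ranD fr gr) => x; rewrite rmorphD. Qed.
Lemma raM n (p : 'rV[R]_n) f g : ra p f -> ra p g -> ra p (fun x => f x * g x).
Proof. by move=> fr gr; apply: eqf_ran (ranM fr gr) => x; rewrite rmorphM. Qed.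
Lemma raN n (p : 'rV[R]_n) f : ra p f -> ra p (fun x => - f x).
Proof. by move=> fr; apply: eqf_ra (raM (ra_cst p (-1)) fr) => x; rewrite mulN1r. Qed.
Lemma raB n (p : 'rV[R]_n) f g : ra p f -> ra p g -> ra p (fun x => f x - g x).
Proof. by move=> fr gr; apply: raD fr (raN gr). Qed.
Lemma ra_sum n (p : 'rV[R]_n) (I : Type) (r : seq I) (P : pred I) (F : I -> 'rV[R]_n -> R) :
  (forall i, ra p (F i)) -> ra p (fun x => \sum_(i <- r | P i) F i x).
Proof.
move=> FP; elim: r => [|i r IH]; first by apply: eqf_ra (ra_cst p 0) => x; rewrite big_nil.
case Pi : (P i); last by apply: eqf_ra IH => x; rewrite big_cons Pi.
by apply: eqf_ra (raD (FP i) IH) => x; rewrite big_cons Pi.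
Qed.
Lemma ra_prod n (p : 'rV[R]_n) (I : Type) (r : seq I) (P : pred I) (F : I -> 'rV[R]_n -> R) :
  (forall i, ra p (F i)) -> ra p (fun x => \prod_(i <- r | P i) F i x).
Proof.
move=> FP; elim: r => [|i r IH]; first by apply: eqf_ra (ra_cst p 1) => x; rewrite big_nil.
case Pi : (P i); last by apply: eqf_ra IH => x; rewrite big_cons Pi.
by apply: eqf_ra (raM (FP i) IH) => x; rewrite big_cons Pi.
Qed.

End RealAnalytic.

(** * Real strict derivatives, Jacobians and gradients *)

Section RealDerivative.
Context {R : realType}.
Local Notation C := R[i].

Definition rsd n (q : 'rV[R]_n) (f : 'rV[R]_n -> R) (d : 'I_n -> R) : Prop :=
  forall e : R, 0 < e -> exists2 r : R, 0 < r & forall x y,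
    pd (rc q) r (rc x) -> pd (rc q) r (rc y) ->
    `|f x - f y - \sum_i (x 0 i - y 0 i) * d i| <= e * nrm (rc (x - y)).

Lemma sd_rsd n (q : 'rV[R]_n) (F : 'rV[C]_n -> C) d : sd (rc q) F d ->
  rsd q (fun x => complex.Re (F (rc x))) (fun i => complex.Re (d i)).
Proof.
move=> h e /h[r r0 rP]; exists r => // x y px py.
have := rP _ _ px py; rewrite -rcB; apply: le_trans.
apply: le_trans (Re_le_cn _); rewrite le_eqVlt; apply/orP; left; apply/eqP; congr (`| _ |).
rewrite [in RHS]raddfB [in RHS]raddfB [in RHS]raddf_sum /=; congr (_ - _); apply: eq_bigr => i _.
by rewrite !mxE -rmorphB; case: (d i) => a b /=; rewrite mul0r subr0.
Qed.

Lemma rsd_eq n (q : 'rV[R]_n) f g d : (\forall x \near q, f x = g x) -> rsd q f d -> rsd q g d.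
Proof.
move=> /near_rc[s s0 fg] fd e e0; have [r r0 h] := fd _ e0.
have m1 : Num.min r s <= r by rewrite ge_min lexx.
have m2 : Num.min r s <= s by rewrite ge_min lexx orbT.
exists (Num.min r s); first by rewrite lt_min r0.
move=> x y px py; rewrite -!fg; [exact: h (pdS m1 px) (pdS m1 py)|exact: pdS m2 py|exact: pdS m2 px].
Qed.

Lemma eq_rsd n (q : 'rV[R]_n) f d d' : d =1 d' -> rsd q f d -> rsd q f d'.
Proof. by move=> /funext ->. Qed.

Lemma rv_norm_le n (x : 'rV[R]_n) (c : R) : 0 <= c -> (forall i, `|x 0 i| <= c) -> `|x| <= c.
Proof.
move=> c0 h; rewrite [`|x|]mx_normrE; apply: bigmax_le => // -[i j] _ /=.
by rewrite (ord1 i).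
Qed.

Lemma rv_norm_ge n (x : 'rV[R]_n) i : `|x 0 i| <= `|x|.
Proof. by rewrite [`|x|]mx_normrE; apply: (le_bigmax _ (fun ij => `|x ij.1 ij.2|) (0, i)). Qed.

(** The bridge to the [jacobian] of the definitions: a strict derivative is in particular a
    differential, and differentials are unique. *)
Lemma rsd_jacobian n m (q : 'rV[R]_n) (F : 'rV[R]_n -> 'rV[R]_m) (A : 'M[R]_(n, m)) :
  (forall j, rsd q (fun x => F x 0 j) (fun i => A i j)) -> jacobian F q = A.
Proof.
move=> h; suff dE : 'd F q = mulmxr A :> ('rV[R]_n -> 'rV[R]_m).
  by apply/row_matrixP => i; rewrite !rowE mul_rV_lin1 /= dE.
have Ac (x : 'rV[R]_n) : `|x *m A| <= (\sum_i `|row i A|) * `|x|.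
  rewrite mulmx_sum_row; apply: le_trans (ler_norm_sum _ _ _) _.
  rewrite mulr_suml; apply: ler_sum => i _; rewrite normrZ mulrC.
  by apply: ler_wpM2l => //; exact: rv_norm_ge.
apply: diff_unique.
  move=> x; apply: (iffRL (@cvgrPdist_le _ _ _ (nbhs x) _ _ _)) => e e0 /=.
  pose K := 1 + \sum_i `|row i A|; have K0 : 0 < K by rewrite ltr_pwDl // sumr_ge0.
  apply/nbhs_ballP; exists (e / K) => /=; first by rewrite divr_gt0.
  move=> y; rewrite mx_norm_ball /ball_ /= => xy.
  rewrite -mulmxBl; apply: le_trans (Ac _) _.
  apply: (@le_trans _ _ (K * `|x - y|)); first by apply: ler_wpM2r; rewrite // /K ler_wpDl.
  by rewrite mulrC -ler_pdivlMr // ltW.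
apply/eqaddoP => e e0.
have e1 : 0 < e / n.+1%:R by rewrite divr_gt0.
have [r r0 rP] : exists2 r : R, 0 < r & forall j x y, pd (rc q) r (rc x) -> pd (rc q) r (rc y) ->
    `|F x 0 j - F y 0 j - \sum_i (x 0 i - y 0 i) * A i j| <= e / n.+1%:R * nrm (rc (x - y)).
  apply: common_radius => [j a b ba g x y /(pdS ba) px /(pdS ba) py|j]; first exact: g.
  exact: h.
have : \forall x \near (0 : 'rV[R]_n), pd (rc 0) r (rc x) by apply/near_rc; exists r.
apply: filterS => x px /=.
have px' : pd (rc q) r (rc (x + q)).
  by move=> i; have := px i; rewrite !mxE -!rmorphB addrK subr0.
apply: rv_norm_le => [|j]; first by rewrite mulr_ge0 // ltW.
have := rP j _ _ px' (pd_center (rc q) r0); rewrite addrK => rj.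
have -> : ((F \o shift q) x - (cst (F q) + mulmxr A) x) 0 j =
   F (x + q) 0 j - F q 0 j - \sum_i ((x + q) 0 i - q 0 i) * A i j.
  rewrite !mxE opprD addrA; congr (_ - _); apply: eq_bigr => i _.
  by rewrite !mxE addrK.
apply: le_trans rj _; rewrite -mulrA ler_wpM2l ?(ltW e0) //.
apply: (@le_trans _ _ (n.+1%:R^-1 * (n%:R * `|x|))).
  rewrite ler_wpM2l ?invr_ge0 //; apply: (@le_trans _ _ (\sum_(i < n) `|x|)).
    by apply: ler_sum => i _; rewrite mxE cn_real; exact: rv_norm_ge.
  by rewrite sumr_const card_ord mulr_natl.
by rewrite mulrA ler_piMl // mulrC ler_pdivrMr // mul1r ler_nat.
Qed.

(* Opaque, as unfolding the jacobian makes conversion checks intractable. *)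
Fact grad_subproof n : {g : ('rV[R]_n -> R) -> 'rV[R]_n -> 'M[R]_(n, 1) |
  forall f q, g f q = jacobian (fun x => (f x)%:M) q}.
Proof. by eexists. Qed.

Definition grad n := sval (grad_subproof n).

Lemma gradE n f (q : 'rV[R]_n) : grad f q = jacobian (fun x => (f x)%:M) q.
Proof. exact: (svalP (grad_subproof n)). Qed.

Lemma rsd_grad n (q : 'rV[R]_n) f d : rsd q f d -> grad f q = \col_i d i.
Proof.
move=> h; rewrite gradE; apply: rsd_jacobian => j; rewrite (ord1 j).
have -> : (fun i => (\col_i d i) i 0) = d by apply/funext => i; rewrite mxE.
by apply: rsd_eq h; apply: filterE => x; rewrite mxE eqxx mulr1n.
Qed.

Lemma rsd_unique n (q : 'rV[R]_n) f d d' : rsd q f d -> rsd q f d' -> d =1 d'.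
Proof.
move=> /rsd_grad h /rsd_grad; rewrite h => /matrixP e i.
by have := e i 0; rewrite !mxE.
Qed.

Lemma ra_partials n (p : 'rV[R]_n) f : ra p f -> exists g : 'I_n -> 'rV[R]_n -> R,
  [/\ forall i, ra p (g i), \forall q \near p, rsd q f (g^~ q)
    & forall h : 'I_n -> 'I_n -> R, (forall i, rsd p (g i) (h i)) -> forall i j, h i j = h j i].
Proof.
move=> [F Fh fF]; have [G [Gh FG]] := holo_partials Fh.
exists (fun i x => complex.Re (G i (rc x))); split.
- by move=> i; apply: ra_Re; exact: ran_holo.
- have := rc_near FG; have := nbhs_interior fF; apply: filterS2 => q fq /sd_rsd.
  by apply: rsd_eq; apply: filterS fq => x; rewrite /= => <-.
have rP := nbhs_singleton (sd_symmetric Fh FG).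
move=> h hP i j.
have /choice[H HP] k := holo_sd (Gh k).
have hH k l : h k l = complex.Re (H k l) by exact: rsd_unique (hP k) (sd_rsd (HP k)) l.
by rewrite !hH (rP H HP).
Qed.

Lemma grad_rsd n (q : 'rV[R]_n) f : ra q f -> rsd q f (fun i => grad f q i 0).
Proof.
move=> /ra_partials[g [_ /nbhs_singleton h _]]; rewrite (rsd_grad h).
by apply: eq_rsd h => i; rewrite mxE.
Qed.

Lemma ra_grad n (p : 'rV[R]_n) f i : ra p f -> ra p (fun q => grad f q i 0).
Proof.
move=> /ra_partials[g [gr h _]]; apply: eq_ra (gr i).
by apply: filterS h => q /rsd_grad ->; rewrite mxE.
Qed.

Lemma grad_eq n (q : 'rV[R]_n) f g : ra q f -> (\forall x \near q, f x = g x) -> grad f q = grad g q.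
Proof. by move=> /grad_rsd h fg; rewrite (rsd_grad (rsd_eq fg h)); exact: rsd_grad h. Qed.

Lemma grad_sym n (p : 'rV[R]_n) f i j : ra p f ->
  grad (fun q => grad f q i 0) p j 0 = grad (fun q => grad f q j 0) p i 0.
Proof.
move=> /ra_partials[g [gr h sym]].
have gE k : \forall q \near p, g k q = grad f q k 0.
  by apply: filterS h => q /rsd_grad ->; rewrite mxE.
rewrite -!(grad_eq (gr _) (gE _)).
exact: (sym (fun i j => grad (g i) p j 0) (fun i => grad_rsd (gr i))).
Qed.

Lemma jacobianE n m (q : 'rV[R]_n) (F : 'rV[R]_n -> 'rV[R]_m) i j : ram q F ->
  jacobian F q i j = grad (fun x => F x 0 j) q i 0.
Proof.
move=> Fr; have := @rsd_jacobian _ _ q F (\matrix_(i, j) grad (fun x => F x 0 j) q i 0).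
move=> -> => [|k]; first by rewrite mxE.
have -> : (fun i => (\matrix_(i, j) grad (fun x => F x 0 j) q i 0) i k) =
  (fun i => grad (fun x => F x 0 k) q i 0) by apply/funext => l; rewrite mxE.
exact: grad_rsd (Fr k).
Qed.

Lemma rsdD n (q : 'rV[R]_n) f g d e : rsd q f d -> rsd q g e ->
  rsd q (fun x => f x + g x) (fun i => d i + e i).
Proof.
move=> hf hg t t0; have t20 : 0 < t / 2 by rewrite divr_gt0.
have [r r0 rP] := hf _ t20; have [s s0 sP] := hg _ t20.
have m1 : Num.min r s <= r by rewrite ge_min lexx.
have m2 : Num.min r s <= s by rewrite ge_min lexx orbT.
exists (Num.min r s); first by rewrite lt_min r0.
move=> x y px py; under eq_bigr do rewrite mulrDr; rewrite big_split /=.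
have := rP _ _ (pdS m1 px) (pdS m1 py); have := sP _ _ (pdS m2 px) (pdS m2 py).
set a := \sum_i _ * e i; set b := \sum_i _ * d i => h1 h2.
have -> : f x + g x - (f y + g y) - (b + a) = (f x - f y - b) + (g x - g y - a) by ring.
by apply: le_trans (ler_normD _ _) _; lra.
Qed.

Lemma sd_mul (a b : C) : sd (row_mx a%:M b%:M : 'rV[C]_(1 + 1)) (fun z => z 0 (lshift 1 0) * z 0 (rshift 1 0))
  (fun i => if i == lshift 1 0 then b else a).
Proof.
move=> e e0; exists e => // x y px py; rewrite big_split_ord !big_ord1 /=.
rewrite /nrm big_split_ord !big_ord1 /= !mxE.
set x0 := x 0 _; set x1 := x 0 _; set y0 := y 0 _; set y1 := y 0 _.
have -> : x0 * x1 - y0 * y1 - ((x0 - y0) * b + (x1 - y1) * a) =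
  (x1 - b) * (x0 - y0) + (y0 - a) * (x1 - y1) by ring.
have px1 := px (rshift 1 0); have py0 := py (lshift 1 0).
rewrite row_mxEr mxE in px1; rewrite row_mxEl mxE in py0.
apply: le_trans (cnD _ _) _; rewrite !cnM mulrDr; apply: lerD.
  by apply: ler_wpM2r; [exact: cn_ge0|exact: ltW].
by apply: ler_wpM2r; [exact: cn_ge0|exact: ltW].
Qed.

Lemma sdM n (q : 'rV[C]_n) f g d e : sd q f d -> sd q g e ->
  sd q (fun x => f x * g x) (fun i => f q * e i + g q * d i).
Proof.
move=> hf hg.
have S (h : 'rV[C]_n -> C) c : sd q h c -> sdm q (fun x => (h x)%:M) (\col_i c i).
  move=> hc j; rewrite (ord1 j); have -> : (fun i => (\col_i c i) i 0) = c by apply/funext => i; rewrite mxE.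
  by apply: sd_eq hc; apply: filterE => x; rewrite mxE eqxx mulr1n.
pose mu (z : 'rV[C]_(1 + 1)) : 'rV[C]_1 := (z 0 (lshift 1 0) * z 0 (rshift 1 0))%:M.
have hmu : sdm (row_mx (f q)%:M (g q)%:M) mu (col_mx (g q)%:M (f q)%:M).
  move=> j; rewrite (ord1 j).
  have -> : (fun i => col_mx (g q)%:M (f q)%:M i 0) = (fun i : 'I_(1 + 1) => if i == lshift 1 0 then g q else f q).
    by apply/funext => i; case: (split_ordP i) => k ->; rewrite (ord1 k) ?col_mxEu ?col_mxEd mxE eqxx.
  by apply: sd_eq (sd_mul _ _); apply: filterE => x; rewrite mxE eqxx mulr1n.
have := sdm_comp (sdm_row_mx (S _ _ hf) (S _ _ hg)) hmu.
move=> /(_ 0); have -> : (fun i => (row_mx (\col_i d i) (\col_i e i) *m col_mx (g q)%:M (f q)%:M) i 0) =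
   (fun i => f q * e i + g q * d i).
  apply/funext => i; rewrite mul_row_col !mul_mx_scalar !mxE addrC; congr (_ + _).
apply: sd_eq; apply: filterE => x.
by rewrite /mu mxE eqxx mulr1n row_mxEl row_mxEr !mxE !mulr1n.
Qed.

Lemma gradD n (q : 'rV[R]_n) f g : ra q f -> ra q g ->
  grad (fun x => f x + g x) q = grad f q + grad g q.
Proof.
move=> fr gr; rewrite (rsd_grad (rsdD (grad_rsd fr) (grad_rsd gr))).
by apply/colP => i; rewrite !mxE.
Qed.

Lemma grad_cst n (q : 'rV[R]_n) c : grad (fun=> c) q = 0.
Proof.
have h : rsd q (fun=> c) (fun=> 0).
  move=> e e0; exists 1 => // x y _ _.
  by rewrite subrr big1 ?subr0 ?normr0 ?mulr_ge0 ?nrm_ge0 ?(ltW e0) // => i _; rewrite mulr0.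
by rewrite (rsd_grad h); apply/colP => i; rewrite !mxE.
Qed.

Lemma grad_linear n (q : 'rV[R]_n) (A : 'M[R]_(n, 1)) : grad (fun x => (x *m A) 0 0) q = A.
Proof.
have h : rsd q (fun x => (x *m A) 0 0) (fun i => A i 0).
  move=> e e0; exists 1 => // x y _ _.
  rewrite !mxE -!sumrB big1 ?normr0 ?mulr_ge0 ?nrm_ge0 ?(ltW e0) // => i _; ring.
by rewrite (rsd_grad h); apply/colP => i; rewrite !mxE.
Qed.

Lemma gradM n (q : 'rV[R]_n) f g : ra q f -> ra q g ->
  grad (fun x => f x * g x) q = f q *: grad g q + g q *: grad f q.
Proof.
move=> fr gr; move: (fr) (gr) => [F Fh fF] [G Gh gG].
have [d Fd] := holo_sd Fh; have [e Ge] := holo_sd Gh.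
have hf : rsd q f (fun i => complex.Re (d i)).
  by apply: rsd_eq (sd_rsd Fd); apply: filterS fF => x <-.
have hg : rsd q g (fun i => complex.Re (e i)).
  by apply: rsd_eq (sd_rsd Ge); apply: filterS gG => x <-.
have hfg : rsd q (fun x => f x * g x) (fun i => f q * complex.Re (e i) + g q * complex.Re (d i)).
  have := sd_rsd (sdM Fd Ge); rewrite -(nbhs_singleton fF) -(nbhs_singleton gG).
  have -> : (fun i => complex.Re ((f q)%:C%C * e i + (g q)%:C%C * d i)) =
    (fun i => f q * complex.Re (e i) + g q * complex.Re (d i)).
    by apply/funext => i; case: (d i) (e i) => ? ? [? ?] /=; rewrite !mul0r !subr0.
  by apply: rsd_eq; apply: filterS2 fF gG => x <- <-; rewrite /= mul0r subr0.
by rewrite (rsd_grad hfg) (rsd_grad hf) (rsd_grad hg); apply/colP => i; rewrite !mxE.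
Qed.

Lemma gradZ n (q : 'rV[R]_n) c f : ra q f -> grad (fun x => c * f x) q = c *: grad f q.
Proof. by move=> fr; rewrite (gradM (ra_cst q c) fr) grad_cst scaler0 addr0. Qed.

Lemma gradN n (q : 'rV[R]_n) f : ra q f -> grad (fun x => - f x) q = - grad f q.
Proof.
move=> fr; rewrite -scaleN1r -(gradZ (-1) fr); congr (grad _ q).
by apply/funext => x; rewrite mulN1r.
Qed.

Lemma gradB n (q : 'rV[R]_n) f g : ra q f -> ra q g ->
  grad (fun x => f x - g x) q = grad f q - grad g q.
Proof. by move=> fr gr; rewrite (gradD fr (raN gr)) (gradN gr). Qed.

Lemma grad_sum n (q : 'rV[R]_n) (I : Type) (r : seq I) (F : I -> 'rV[R]_n -> R) :
  (forall i, ra q (F i)) -> grad (fun x => \sum_(i <- r) F i x) q = \sum_(i <- r) grad (F i) q.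
Proof.
move=> Fr; elim: r => [|i r IH].
  by rewrite big_nil -(grad_cst q 0); congr (grad _ q); apply/funext => x; rewrite big_nil.
rewrite big_cons -IH -(gradD (Fr i) (ra_sum _ _ Fr)).
by congr (grad _ q); apply/funext => x; rewrite big_cons.
Qed.

End RealDerivative.

(** * Derivations along vector fields *)

Section LieDerivative.
Context {R : realType}.
Local Notation C := R[i].

(** Sealed for the same reason as [grad]. *)
Fact Dx_subproof n : {D : ('rV[R]_n -> 'rV[R]_n) -> ('rV[R]_n -> R) -> 'rV[R]_n -> R |
  forall X f q, D X f q = (X q *m grad f q) 0 0}.
Proof. by eexists. Qed.

Definition Dx n := sval (Dx_subproof n).

Lemma Dx_grad n X f (q : 'rV[R]_n) : Dx X f q = (X q *m grad f q) 0 0.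
Proof. exact: (svalP (Dx_subproof n)). Qed.

Lemma DxE n X f (q : 'rV[R]_n) : Dx X f q = \sum_i X q 0 i * grad f q i 0.
Proof. by rewrite Dx_grad mxE. Qed.

Lemma ra_Dx n (p : 'rV[R]_n) X f : ram p X -> ra p f -> ra p (Dx X f).
Proof.
move=> Xr fr; apply: (@eqf_ra _ _ _ (fun q => \sum_i X q 0 i * grad f q i 0)).
  by move=> q; rewrite DxE.
by apply: ra_sum => i; apply: raM; [exact: Xr|exact: ra_grad].
Qed.

Lemma Dx_eq n X f g (q : 'rV[R]_n) : ra q f -> (\forall x \near q, f x = g x) -> Dx X f q = Dx X g q.
Proof. by move=> fr fg; rewrite !Dx_grad (grad_eq fr fg). Qed.

Lemma DxD n X f g (q : 'rV[R]_n) : ra q f -> ra q g -> Dx X (fun x => f x + g x) q = Dx X f q + Dx X g q.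
Proof. by move=> fr gr; rewrite !Dx_grad (gradD fr gr) mulmxDr mxE. Qed.

Lemma DxB n X f g (q : 'rV[R]_n) : ra q f -> ra q g -> Dx X (fun x => f x - g x) q = Dx X f q - Dx X g q.
Proof. by move=> fr gr; rewrite !Dx_grad (gradB fr gr) mulmxBr mxE [X in _ + X]mxE. Qed.

Lemma DxM n X f g (q : 'rV[R]_n) : ra q f -> ra q g ->
  Dx X (fun x => f x * g x) q = f q * Dx X g q + g q * Dx X f q.
Proof.
move=> fr gr; rewrite !Dx_grad (gradM fr gr); move: (grad g q) (grad f q) (X q) (f q) (g q) => a b c s t.
by rewrite mulmxDr -!scalemxAr !mxE.
Qed.

Lemma mulmx_jacobian n m X (Y : 'rV[R]_n -> 'rV[R]_m) (q : 'rV[R]_n) j : ram q Y ->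
  (X q *m jacobian Y q) 0 j = Dx X (fun x => Y x 0 j) q.
Proof. by move=> Yr; rewrite DxE mxE; apply: eq_bigr => i _; rewrite jacobianE. Qed.

Lemma lie_bracketE n X Y (q : 'rV[R]_n) j : ram q X -> ram q Y ->
  lie_bracket X Y q 0 j = Dx X (fun x => Y x 0 j) q - Dx Y (fun x => X x 0 j) q.
Proof.
move=> Xr Yr; rewrite -(mulmx_jacobian X j Yr) -(mulmx_jacobian Y j Xr) /lie_bracket.
by move: (_ *m _) (_ *m _) => a b; rewrite !mxE.
Qed.

Lemma ram_lie n X Y (p : 'rV[R]_n) : ram p X -> ram p Y -> ram p (lie_bracket X Y).
Proof.
move=> Xr Yr j; have := raB (ra_Dx Xr (Yr j)) (ra_Dx Yr (Xr j)).
by apply: eq_ra; apply: filterS2 (ram_near Xr) (ram_near Yr) => q Xq Yq; rewrite (lie_bracketE j Xq Yq).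
Qed.

Lemma Dx_sum n X (I : Type) (r : seq I) (F : I -> 'rV[R]_n -> R) (q : 'rV[R]_n) :
  (forall i, ra q (F i)) -> Dx X (fun x => \sum_(i <- r) F i x) q = \sum_(i <- r) Dx X (F i) q.
Proof.
move=> Fr; rewrite Dx_grad (grad_sum _ Fr) mulmx_sumr summxE.
by apply: eq_bigr => i _; rewrite Dx_grad.
Qed.

Lemma DxDx n X Y f (p : 'rV[R]_n) : ram p X -> ram p Y -> ra p f ->
  Dx X (Dx Y f) p = \sum_j Dx X (fun x => Y x 0 j) p * grad f p j 0 +
    \sum_j \sum_i Y p 0 j * X p 0 i * grad (fun q => grad f q j 0) p i 0.
Proof.
move=> Xr Yr fr; have E : Dx Y f = fun x => \sum_j Y x 0 j * grad f x j 0.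
  by apply/funext => x; rewrite DxE.
have gr j := ra_grad j fr.
rewrite E (Dx_sum _ _ (fun j => raM (Yr j) (gr j))) -big_split /=; apply: eq_bigr => j _.
rewrite (DxM _ (Yr j) (gr j)) [LHS]addrC [X in X + _ = _]mulrC; congr (_ + _).
by rewrite [X in _ * X]DxE mulr_sumr; apply: eq_bigr => i _; rewrite mulrA.
Qed.

(** The second derivatives of f enter [DxDx] through a symmetric form and cancel, leaving the
    derivatives of the components of the fields. *)
Lemma Dx_lie n X Y f (p : 'rV[R]_n) : ram p X -> ram p Y -> ra p f ->
  Dx (lie_bracket X Y) f p = Dx X (Dx Y f) p - Dx Y (Dx X f) p.
Proof.
move=> Xr Yr fr; rewrite (DxDx Xr Yr fr) (DxDx Yr Xr fr).
have E (x y : 'I_n -> R) (H : 'I_n -> 'I_n -> R) : (forall i j, H i j = H j i) ->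
    \sum_j \sum_i x j * y i * H j i = \sum_j \sum_i y j * x i * H j i.
  move=> Hs; rewrite exchange_big /=; apply: eq_bigr => i _; apply: eq_bigr => j _.
  by rewrite Hs [x _ * _]mulrC.
rewrite (E (X p 0) (Y p 0) (fun j i => grad (fun q => grad f q j 0) p i 0) (fun i j => grad_sym i j fr)).
set T := \sum_j \sum_i _; rewrite opprD addrACA [T - T]subrr addr0 DxE -sumrB; apply: eq_bigr => j _.
by rewrite (lie_bracketE j Xr Yr) mulrBl.
Qed.

End LieDerivative.

(** * Complexification and derivatives along real zero sets *)

Section Complexification.
Context {R : realType}.
Local Notation C := R[i].
Local Notation mc := (map_mx (real_complex R)).

Lemma cvec_mulmx n m (x : 'rV[C]_n) (A : 'M[C]_(n, m)) :
  cvec (x *m A) = cvec x *m map_mx Num.conj A.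
Proof.
apply/rowP => j; rewrite !mxE rmorph_sum; apply: eq_bigr => i _.
by rewrite !mxE rmorphM.
Qed.

Lemma cvec_mulmx_real n m (x : 'rV[C]_n) (A : 'M[C]_(n, m)) :
  (forall i j, (A i j)^* = A i j) -> cvec (x *m A) = cvec x *m A.
Proof. by move=> Ar; rewrite cvec_mulmx; congr (_ *m _); apply/matrixP => i j; rewrite mxE. Qed.

Lemma sd_rsd_Im n (q : 'rV[R]_n) (F : 'rV[C]_n -> C) d : sd (rc q) F d ->
  rsd q (fun x => complex.Im (F (rc x))) (fun i => complex.Im (d i)).
Proof.
move=> h; have h0 : sd (rc q) (fun=> - 'i : C) (fun=> 0).
  move=> e e0; exists 1 => // x y _ _.
  by rewrite subrr big1 ?subr0 ?cn0 ?mulr_ge0 ?nrm_ge0 ?(ltW e0) // => i _; rewrite mulr0.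
have := sd_rsd (sdM h0 h); rewrite /=.
have -> : (fun i => complex.Re (- 'i * d i + F (rc q) * 0)) = (fun i => complex.Im (d i)).
  by apply/funext => i; rewrite mulr0 addr0; case: (d i) => a b /=; lra.
by apply: rsd_eq; apply: filterE => x; case: (F _) => a b /=; lra.
Qed.

(** The real and imaginary parts of a complex derivative are the real derivatives of the restriction
    to real points. *)
Lemma real_derivative_eq n m (q : 'rV[R]_n) (F G : 'rV[C]_n -> 'rV[C]_m) A B :
  sdm (rc q) F A -> sdm (rc q) G B -> (\forall x \near q, F (rc x) = G (rc x)) -> A = B.
Proof.
move=> FA GB FG; apply/matrixP => i j; apply/eqP; rewrite eq_complex; apply/andP; split; apply/eqP.
  have h : rsd q (fun x => complex.Re (G (rc x) 0 j)) (fun i => complex.Re (A i j)).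
    by apply: rsd_eq (sd_rsd (FA j)); apply: filterS FG => x ->.
  exact: rsd_unique h (sd_rsd (GB j)) i.
have h : rsd q (fun x => complex.Im (G (rc x) 0 j)) (fun i => complex.Im (A i j)).
  by apply: rsd_eq (sd_rsd_Im (FA j)); apply: filterS FG => x ->.
exact: rsd_unique h (sd_rsd_Im (GB j)) i.
Qed.

(** Averaging an extension with its conjugate makes it commute with conjugation, which later forces
    implicit functions to be real at real arguments. *)
Lemma complexification n m (q : 'rV[R]_n) (rho : 'rV[R]_n -> 'rV[R]_m) : ram q rho ->
  exists F : 'rV[C]_n -> 'rV[C]_m, [/\ holom (rc q) F, forall x, F (cvec x) = cvec (F x),
    \forall x \near q, F (rc x) = rc (rho x), F (rc q) = rc (rho q)
    & sdm (rc q) F (mc (jacobian rho q))].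
Proof.
move=> rr; have rr' : ranm q (fun x => rc (rho x)).
  by move=> j; apply: eqf_ran (rr j) => x; rewrite mxE.
have [G [Gh rG _]] := ranm_holom rr'.
pose F x := 2^-1 *: (G x + cvec (G (cvec x))).
have c2 : (2^-1 : C)^* = 2^-1 by rewrite fmorphV rmorph_nat.
have Fh : holom (rc q) F.
  by apply/holomZ/holomD => //; apply: holom_conj; rewrite cvec_rc.
have Frho : \forall x \near q, F (rc x) = rc (rho x).
  apply: filterS rG => x xG; rewrite /F cvec_rc -xG cvec_rc.
  by apply/rowP => i; rewrite !mxE; field.
exists F; split=> //; first by move=> x; rewrite /F cvecZ cvecD !cvecK c2 addrC.
  exact: nbhs_singleton Frho.
have [A FA] := holom_sdm Fh.
suff -> : mc (jacobian rho q) = A by [].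
apply/matrixP => i j; rewrite mxE (jacobianE i j rr).
have h : rsd q (fun x => rho x 0 j) (fun i => complex.Re (A i j)).
  by apply: rsd_eq (sd_rsd (FA j)); apply: filterS Frho => x ->; rewrite mxE.
have h' : rsd q (fun=> 0) (fun i => complex.Im (A i j)).
  by apply: rsd_eq (sd_rsd_Im (FA j)); apply: filterS Frho => x ->; rewrite mxE.
have := rsd_grad h'; rewrite grad_cst => /colP/(_ i); rewrite !mxE => I0.
by rewrite (rsd_grad h) mxE; apply/eqP; rewrite eq_complex /= -I0 !eqxx.
Qed.

(* Apply the implicit function theorem to the complexification of [rho] to move inside its
   zero set along an analytic curve with velocity [v]. *)
Lemma tangent_derivative n d (q : 'rV[R]_n) (rho : 'rV[R]_n -> 'rV[R]_d) f (v : 'rV[R]_n) :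
  ram q rho -> rho q = 0 -> \rank (jacobian rho q) = d ->
  ra q f -> (\forall x \near q, rho x = 0 -> f x = 0) ->
  v *m jacobian rho q = 0 -> v *m grad f q = 0.
Proof.
move=> rr r0 rk fr f0 v0; set J := jacobian rho q in rk v0.
have [P [Ph Pc Prho Pq PJ]] := complexification rr.
have Jf : row_full J by rewrite /row_full rk.
pose B := pinvmx J; have BJ : B *m J = 1%:M := mulVpmx Jf.
(* A slice through q in the direction v and in directions [B] transverse to the zero set: there the
   complexified equation has derivative 0 in the first variable and the identity in the others. *)
pose L (z : 'rV[C]_(1 + d)) := z *m col_mx (mc v) (mc B) + rc q.
have L0 : L 0 = rc q by rewrite /L mul0mx add0r.
have Lh : holom 0 L by apply: holomD; [apply: holom_mulmxr; exact: holom_id|exact: holom_cst].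
pose F z := P (L z).
have Fh : holom 0 F by apply: (holom_comp Lh); rewrite L0.
have FA : sdm 0 F (col_mx 0 1%:M).
  have := sdm_comp (sdm_affine 0 (col_mx (mc v) (mc B)) (rc q)) (F := P) (B := mc J).
  by rewrite mul0mx add0r => /(_ PJ); rewrite mul_col_mx -!map_mxM v0 BJ map_mx1 map_mx0.
have F0 : F 0 = 0 by rewrite /F L0 Pq r0 rc0.
have [g [gh g0 gP]] := implicit_function Fh F0 FA (col_mxKd _ _).
have Gh : holom (0 : 'rV[C]_1) (fun t => row_mx t (g t)) by apply: holom_row_mx; [exact: holom_id|].
have Fg : \forall t \near (0 : 'rV[C]_1), F (row_mx t (g t)) = 0.
  have := near_holo (P := fun z => F z = 0 <-> rsubmx z = g (lsubmx z)) Gh.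
  rewrite g0 row_mx0 => /(_ gP); apply: filterS => t; rewrite row_mxKl row_mxKr => -[_ h].
  exact: h.
have [A gA] := holom_sdm gh.
(* Differentiating F(t, g(t)) = 0 shows that g has zero derivative, so the curve leaves q with
   velocity exactly v. *)
have A0 : A = 0.
  have h1 := sdm_comp (sdm_row_mx (sdm_id 0) gA) (F := F) (B := col_mx 0 1%:M).
  rewrite g0 row_mx0 in h1; have {}h1 := h1 FA.
  rewrite mul_row_col mulmx0 mulmx1 add0r in h1.
  have h2 : sdm 0 (fun=> 0 : 'rV[C]_d) A by apply: sdm_eq h1.
  exact: sdm_unique h2 (sdm_cst _ _).
have Lc z : L (cvec z) = cvec (L z).
  rewrite /L cvecD cvec_rc -cvec_mulmx_real // => i j.
  by case: (split_ordP i) => k ->; rewrite ?col_mxEu ?col_mxEd mxE conj_real.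
(* At real t the conjugate of g(t) solves the same equation, and solutions are unique; hence the
   curve consists of real points of the zero set. *)
have greal : \forall t \near (0 : 'rV[R]_1), cvec (g (rc t)) = g (rc t).
  have h : \forall t \near (0 : 'rV[C]_1),
     F (cvec (row_mx t (g t))) = 0 <-> rsubmx (cvec (row_mx t (g t))) = g (lsubmx (cvec (row_mx t (g t)))).
    have := near_holo (P := fun z => F (cvec z) = 0 <-> rsubmx (cvec z) = g (lsubmx (cvec z))) Gh.
    rewrite g0 row_mx0; apply.
    by apply: (near_cvec (P := fun z => F z = 0 <-> rsubmx z = g (lsubmx z))); rewrite cvec0.
  have := rc_near (p := (0 : 'rV[R]_1)) (P := fun t => F (row_mx t (g t)) = 0 /\ (F (cvec (row_mx t (g t))) = 0 <->
     rsubmx (cvec (row_mx t (g t))) = g (lsubmx (cvec (row_mx t (g t)))))).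
  rewrite rc0 => /(_ (filterI Fg h)); apply: filterS => t [Ft].
  rewrite {1}/F Lc Pc -/(F _) Ft cvec0 cvec_row_mx row_mxKl row_mxKr cvec_rc => -[h' _].
  exact: h'.
have fr' : ram q (fun x => (f x)%:M : 'rV[R]_1).
  by move=> j; apply: eqf_ra fr => x; rewrite mxE (ord1 j) eqxx mulr1n.
have [Q [Qh Qc Qf Qq QJ]] := complexification fr'.
pose gam t := L (row_mx t (g t)).
have gam0 : gam 0 = rc q by rewrite /gam g0 row_mx0 L0.
have gamh : holom 0 gam by apply: (holom_comp Gh); rewrite g0 row_mx0.
have gamA : sdm 0 gam (mc v).
  have := sdm_comp (sdm_row_mx (sdm_id 0) gA) (sdm_affine _ (col_mx (mc v) (mc B)) (rc q)).
  by rewrite mul_row_col A0 mul0mx addr0 mul1mx.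
have QA : sdm (rc (0 : 'rV[R]_1)) (fun t => Q (gam t)) (mc v *m mc (grad f q)).
  by rewrite rc0; apply: (sdm_comp gamA); rewrite gam0 gradE.
apply: (map_mx_inj (f := real_complex R)); rewrite map_mx0 map_mxM.
apply: (real_derivative_eq QA (sdm_cst _ 0)).
have [d1 d10 hQ] := iffLR (near_rc _ _) Qf.
have [d2 d20 hP] := iffLR (near_rc _ _) Prho.
have [d3 d30 hf] := iffLR (near_rc _ _) f0.
have npd : \forall t \near (0 : 'rV[R]_1), pd (rc q) (Num.min d1 (Num.min d2 d3)) (gam (rc t)).
  have := rc_near (p := (0 : 'rV[R]_1)) (P := fun t => pd (rc q) (Num.min d1 (Num.min d2 d3)) (gam t)).
  rewrite rc0; apply; have := near_holo (P := pd (rc q) (Num.min d1 (Num.min d2 d3))) gamh.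
  rewrite gam0; apply; apply/near_pd; exists (Num.min d1 (Num.min d2 d3)) => //.
  by rewrite !lt_min d10 d20.
have Fg' : \forall t \near (0 : 'rV[R]_1), F (row_mx (rc t) (g (rc t))) = 0.
  by have := rc_near (p := (0 : 'rV[R]_1)) (P := fun t => F (row_mx t (g t)) = 0); rewrite rc0; apply.
apply: filterS3 npd Fg' greal => t ht Ft gt.
have [y yE] := cvec_eq_rc gt.
have [x xE] : exists x, gam (rc t) = rc x.
  apply: cvec_eq_rc; rewrite /gam -Lc cvec_row_mx cvec_rc gt //.
rewrite xE in ht *; rewrite hQ; last by apply: pdS ht; rewrite ge_min lexx.
have rx : rho x = 0.
  apply: rc_inj; rewrite rc0 -hP; last by apply: pdS ht; rewrite !ge_min lexx orbT.
  by rewrite -xE.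
rewrite hf //; last by apply: pdS ht; rewrite !ge_min lexx !orbT.
by apply/rowP => i; rewrite !mxE mul0rn.
Qed.

End Complexification.

(** * Brackets of sections of the complex tangent bundle *)

Section TestFunctions.
Context {R : realType} (n d : nat).
Context (N : set 'rV[R]_(n + n)) (rho : 'rV[R]_(n + n) -> 'rV[R]_d).
Local Notation J := (cplx_structure n : 'M[R]_(n + n)).
Local Notation T := (complex_tangent rho).
Implicit Types (p q v : 'rV[R]_(n + n)) (X V W : 'rV[R]_(n + n) -> 'rV[R]_(n + n)).

Lemma cplx_structureK : J *m J = - 1%:M.
Proof.
rewrite mulmx_block !mulmx0 !mul0mx !mulmx1 mul1mx !addr0 !add0r.
by rewrite (scalar_mx_block n n 1) opp_block_mx !oppr0.
Qed.

Lemma sub_tangent v q : (v <= tangent rho q)%MS = (v *m jacobian rho q == 0).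
Proof. exact: sub_kermx. Qed.

Lemma sub_complex_tangent v q : (v <= T q)%MS =
  (v *m jacobian rho q == 0) && (v *m J *m jacobian rho q == 0).
Proof.
rewrite sub_capmx -!sub_tangent; congr (_ && _); apply/idP/idP => [/submxP[u ->]|/submxP[u uE]].
  by rewrite -!mulmxA cplx_structureK !mulmxN !mulmx1 -mulNmx submxMl.
have -> : v = (- u) *m (tangent rho q *m J).
  by rewrite mulmxA mulNmx -uE mulNmx -mulmxA cplx_structureK mulmxN mulmx1 opprK.
exact: submxMl.
Qed.

Lemma complex_tangentJ v q : (v <= T q)%MS -> (v *m J <= T q)%MS.
Proof.
rewrite !sub_complex_tangent => /andP[/eqP h1 ->] /=.
by rewrite -[v *m J *m J]mulmxA cplx_structureK mulmxN mulmx1 mulNmx h1 oppr0.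
Qed.

Lemma complex_tangent_tangent v q : (v <= T q)%MS -> v *m jacobian rho q = 0.
Proof. by rewrite sub_complex_tangent => /andP[/eqP]. Qed.

(** The equation and rank conditions of [local_equation] at an arbitrary base point, so that they
    pass to nearby points. *)
Definition regular p : Prop := [/\ ram p rho, \forall q \near p, N q <-> rho q = 0
  & \forall q \near p, N q -> \rank (jacobian rho q) = d].

Lemma regular_near p : regular p -> \forall q \near p, regular q.
Proof.
move=> [/ram_near h1 /nbhs_interior h2 /nbhs_interior h3].
by apply: filterS3 h1 h2 h3 => q ? ? ?.
Qed.

(** Tangential derivatives only see restrictions to N: [tangent_derivative] is applied to the
    difference f - h. *)
Lemma eq_derivative q f h v : regular q -> N q -> ra q f -> ra q h ->
  (\forall x \near q, N x -> f x = h x) -> v *m jacobian rho q = 0 ->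
  v *m grad f q = v *m grad h q.
Proof.
move=> [rr Nrho rk] Nq fr hr fh v0; apply/eqP; rewrite -subr_eq0 -mulmxBr -(gradB fr hr); apply/eqP.
apply: (tangent_derivative rr _ _ (raB fr hr) _ v0).
- exact/(nbhs_singleton Nrho).
- exact: (nbhs_singleton rk).
apply: filterS2 Nrho fh => x [_ h1] h2 /h1/h2 ->; exact: subrr.
Qed.

Definition section p X : Prop := ram p X /\ \forall q \near p, N q -> (X q <= T q)%MS.

Lemma local_sectionE p X : local_section N T p X <-> section p X.
Proof. by rewrite /local_section ram_analytic. Qed.

Lemma section_near p X : section p X -> \forall q \near p, section q X.
Proof. by move=> [/ram_near h1 /nbhs_interior h2]; apply: filterS2 h1 h2. Qed.

Lemma section_tangent p X : section p X -> N p -> X p *m jacobian rho p = 0.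
Proof. by move=> [_ /nbhs_singleton h] /h/complex_tangent_tangent. Qed.

Definition rotate X := fun q => X q *m J.

Lemma ram_rotate p X : ram p X -> ram p (rotate X).
Proof.
move=> Xr j; apply: (@eqf_ra _ _ _ (fun q => \sum_i X q 0 i * J i j)).
  by move=> q; rewrite mxE.
by apply: ra_sum => i; apply: raM; [exact: Xr|exact: ra_cst].
Qed.

Lemma section_rotate p X : section p X -> section p (rotate X).
Proof.
move=> [Xr XT]; split; first exact: ram_rotate.
by apply: filterS XT => q h /h; exact: complex_tangentJ.
Qed.

(* [u] and [f] satisfy [X u = (J X) f] on N for every section X; on N, this is the
   Cauchy-Riemann equation when u + i f is the restriction of a holomorphic function. *)
Definition test_pair p (u f : 'rV[R]_(n + n) -> R) : Prop :=
  [/\ ra p u, ra p f & \forall q \near p, N q -> forall v, (v <= T q)%MS ->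
    v *m grad u q = v *m J *m grad f q].

Lemma test_pair_near p u f : test_pair p u f -> \forall q \near p, test_pair q u f.
Proof.
by move=> [/ra_near h1 /ra_near h2 /nbhs_interior h3]; apply: filterS3 h1 h2 h3.
Qed.

Lemma test_section p u f X : test_pair p u f -> section p X ->
  \forall q \near p, N q -> Dx X u q = Dx (rotate X) f q.
Proof.
move=> [_ _ uf] [_ XT]; apply: filterS2 uf XT => q h1 h2 Nq.
by rewrite !Dx_grad (h1 Nq _ (h2 Nq)).
Qed.

(** X V u - V X u with the inner derivatives rewritten through V u = (J V) f and X u = (J X) f. *)
Definition bracket1 f X V q := Dx X (Dx (rotate V) f) q - Dx V (Dx (rotate X) f) q.

Lemma ra_bracket1 p f X V : ra p f -> ram p X -> ram p V -> ra p (bracket1 f X V).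
Proof.
move=> fr Xr Vr; apply: (@eqf_ra _ _ _
  (fun q => Dx X (Dx (rotate V) f) q - Dx V (Dx (rotate X) f) q)) => //.
by apply: raB; apply: ra_Dx => //; apply: ra_Dx => //; exact: ram_rotate.
Qed.

Lemma eq_Dx q f h X : regular q -> N q -> ra q f -> ra q h ->
  (\forall x \near q, N x -> f x = h x) -> X q *m jacobian rho q = 0 -> Dx X f q = Dx X h q.
Proof.
move=> rq Nq fr hr fh X0; rewrite !Dx_grad.
exact: (congr1 (fun M : 'M[R]_1 => M 0 0) (eq_derivative rq Nq fr hr fh X0)).
Qed.

(** The inner derivatives of u and f agree on N only, which is enough because X and V are tangent to
    N. *)
Lemma test_bracket p u f X V : regular p -> test_pair p u f -> section p X -> section p V -> N p ->
  Dx (lie_bracket X V) u p = bracket1 f X V p.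
Proof.
move=> rp uf Xs Vs Np; have [ur fr _] := uf; have [Xr _] := Xs; have [Vr _] := Vs.
rewrite (Dx_lie Xr Vr ur).
have e1 := eq_Dx rp Np (ra_Dx Vr ur) (ra_Dx (ram_rotate Vr) fr) (test_section uf Vs) (section_tangent Xs Np).
have e2 := eq_Dx rp Np (ra_Dx Xr ur) (ra_Dx (ram_rotate Xr) fr) (test_section uf Xs) (section_tangent Vs Np).
by rewrite e1 e2.
Qed.

Lemma grad0 q : grad (fun=> 0) q = 0 :> 'M[R]_(n + n, 1). Proof. exact: grad_cst. Qed.

Lemma Dx0 X q : Dx X (fun=> 0) q = 0.
Proof. by rewrite !Dx_grad grad0 mulmx0 mxE. Qed.

Lemma bracket1_0 X V q : bracket1 (fun=> 0) X V q = 0.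
Proof.
have E (Y : 'rV[R]_(n + n) -> 'rV[R]_(n + n)) : Dx Y (fun=> 0) = fun=> 0 by apply/funext => x; exact: Dx0.
by rewrite /bracket1 !E subrr.
Qed.

(** A component of [rho] is killed by T^c M, so it is paired with 0. The bracket formulas applied to
    this pair show that brackets of sections are tangent to N. *)
Lemma test_pair_rho p j : ram p rho -> test_pair p (fun x => rho x 0 j) (fun=> 0).
Proof.
move=> rr; split; [exact: rr|exact: ra_cst|].
apply: filterS (ram_near rr) => q rq _ v /complex_tangent_tangent v0.
rewrite grad0 mulmx0; apply/matrixP => i k; rewrite (ord1 i) (ord1 k) [RHS]mxE.
have := congr1 (fun M : 'rV[R]_d => M 0 j) v0; rewrite [RHS]mxE => <-.
by rewrite (mulmx_jacobian (fun=> v) j rq) Dx_grad.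
Qed.

Lemma jacobian_eq0 W q : ram q rho -> (forall j, Dx W (fun x => rho x 0 j) q = 0) ->
  W q *m jacobian rho q = 0.
Proof.
move=> rr h; apply/rowP => j.
by rewrite (mulmx_jacobian W j rr) h mxE.
Qed.

Lemma bracket_tangent p X V : regular p -> section p X -> section p V -> N p ->
  lie_bracket X V p *m jacobian rho p = 0.
Proof.
move=> rp Xs Vs Np; have [rr _ _] := rp; apply: jacobian_eq0 => // j.
by rewrite (test_bracket rp (test_pair_rho j rr) Xs Vs Np) bracket1_0.
Qed.

Definition bracket2 f X Y V q :=
  Dx X (bracket1 f Y V) q - Dx (lie_bracket Y V) (Dx (rotate X) f) q.

Lemma test_bracket2 p u f X Y V : regular p -> test_pair p u f ->
  section p X -> section p Y -> section p V -> N p ->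
  Dx (lie_bracket X (lie_bracket Y V)) u p = bracket2 f X Y V p.
Proof.
move=> rp uf Xs Ys Vs Np; have [ur fr _] := uf.
have [Xr _] := Xs; have [Vr _] := Vs; have [Yr _] := Ys; have Wr := ram_lie Yr Vr.
have near1 : \forall x \near p, N x -> Dx (lie_bracket Y V) u x = bracket1 f Y V x.
  have h : \forall x \near p, regular x /\ test_pair x u f.
    by apply: filterS2 (regular_near rp) (test_pair_near uf).
  apply: filterS3 (section_near Ys) (section_near Vs) h => q Yq Vq [rq ufq] Nq.
  exact: test_bracket rq ufq Yq Vq Nq.
have e1 := eq_Dx rp Np (ra_Dx Wr ur) (ra_bracket1 fr Yr Vr) near1 (section_tangent Xs Np).
have e2 := eq_Dx rp Np (ra_Dx Xr ur) (ra_Dx (ram_rotate Xr) fr) (test_section uf Xs) (bracket_tangent rp Ys Vs Np).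
by rewrite (Dx_lie Xr Wr ur) e1 e2.
Qed.

Lemma bracket2_0 X Y V q : bracket2 (fun=> 0) X Y V q = 0.
Proof.
have E (Z : 'rV[R]_(n + n) -> 'rV[R]_(n + n)) : Dx Z (fun=> 0) = fun=> 0 by apply/funext => x; exact: Dx0.
have E' : bracket1 (fun=> 0) Y V = fun=> 0 by apply/funext => x; exact: bracket1_0.
by rewrite /bracket2 E' !E subrr.
Qed.

Lemma bracket2_tangent p X Y V : regular p -> section p X -> section p Y -> section p V -> N p ->
  lie_bracket X (lie_bracket Y V) p *m jacobian rho p = 0.
Proof.
move=> rp Xs Ys Vs Np; have [rr _ _] := rp; apply: jacobian_eq0 => // j.
by rewrite (test_bracket2 rp (test_pair_rho j rr) Xs Ys Vs Np) bracket2_0.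
Qed.

Lemma bracket_fibre_ker k p m (A : 'M[R]_(n + n, m)) :
  (forall l W, (l < k)%N -> iterated_bracket N T p l W -> W p *m A = 0) ->
  forall v, bracket_fibre N T k p v -> v *m A = 0.
Proof.
move=> h v [X [r [f [W [_ Wb ->]]]] ->]; rewrite mulmx_suml big1 // => i _.
by have [l lk Wl] := Wb i; rewrite -scalemxAl (h _ _ lk Wl) scaler0.
Qed.

End TestFunctions.

(** * Derivatives of functions divisible by a squared modulus *)

Section Jets.
Context {R : realType} (n : nat).
Implicit Types (p q : 'rV[R]_n) (X Y Z : 'rV[R]_n -> 'rV[R]_n) (f s g a b : 'rV[R]_n -> R).

(* Sums and products are given by equations, as comparing a variable with an
   explicit product of functions up to conversion is too slow. *)
Lemma seal_fun (f : 'rV[R]_n -> R) : exists g : 'rV[R]_n -> R, forall x, g x = f x.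
Proof. by exists f. Qed.

Lemma DxDE q X f g h : (forall x, h x = f x + g x) -> ra q f -> ra q g -> Dx X h q = Dx X f q + Dx X g q.
Proof. by move=> /funext ->; exact: DxD. Qed.

Lemma DxME q X f g h : (forall x, h x = f x * g x) -> ra q f -> ra q g ->
  Dx X h q = f q * Dx X g q + g q * Dx X f q.
Proof. by move=> /funext ->; exact: DxM. Qed.

Lemma raDE q f g h : (forall x, h x = f x + g x) -> ra q f -> ra q g -> ra q h.
Proof. by move=> /funext ->; exact: raD. Qed.

Lemma raME q f g h : (forall x, h x = f x * g x) -> ra q f -> ra q g -> ra q h.
Proof. by move=> /funext ->; exact: raM. Qed.

Lemma DxDxM p X Y f g h : (forall x, h x = f x * g x) ->
  ram p X -> ram p Y -> ra p f -> ra p g ->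
  Dx X (Dx Y h) p =
  f p * Dx X (Dx Y g) p + Dx Y g p * Dx X f p + (g p * Dx X (Dx Y f) p + Dx Y f p * Dx X g p).
Proof.
move=> hE Xr Yr fr gr; have Yf := ra_Dx Yr fr; have Yg := ra_Dx Yr gr.
have [u uE] := seal_fun (fun x => f x * Dx Y g x).
have [v vE] := seal_fun (fun x => g x * Dx Y f x).
have [w wE] := seal_fun (fun x => u x + v x).
have hw : \forall q \near p, Dx Y h q = w q.
  by apply: filterS2 (ra_near fr) (ra_near gr) => q f' g'; rewrite wE uE vE (DxME Y hE f' g').
have ur := raME uE fr Yg; have vr := raME vE gr Yf.
rewrite (Dx_eq X (ra_Dx Yr (raME hE fr gr)) hw) (DxDE X wE ur vr).
by rewrite (DxME X uE fr Yg) (DxME X vE gr Yf).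
Qed.

Lemma jet2_mul p X Y s g h : (forall x, h x = s x * g x) ->
  ram p X -> ram p Y -> ra p s -> ra p g ->
  s p = 0 -> grad s p = 0 -> Dx X (Dx Y h) p = Dx X (Dx Y s) p * g p.
Proof.
move=> hE Xr Yr sr gr s0 ds; rewrite (DxDxM hE Xr Yr sr gr) s0.
have -> : Dx X s p = 0 by rewrite Dx_grad ds mulmx0 mxE.
have -> : Dx Y s p = 0 by rewrite Dx_grad ds mulmx0 mxE.
by rewrite !mul0r mulr0 !addr0 add0r mulrC.
Qed.

(** In the Leibniz expansion, only terms with at least two derivations on s survive, since s and its
    gradient vanish at p. *)
Lemma jet3_mul p X Y Z s g h : (forall x, h x = s x * g x) ->
  ram p X -> ram p Y -> ram p Z -> ra p s -> ra p g ->
  s p = 0 -> grad s p = 0 ->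
  Dx X (Dx Y (Dx Z h)) p =
  Dx X (Dx Y (Dx Z s)) p * g p + Dx X (Dx Y s) p * Dx Z g p + Dx X (Dx Z s) p * Dx Y g p +
  Dx Y (Dx Z s) p * Dx X g p.
Proof.
move=> hE Xr Yr Zr sr gr s0 ds; have Zs := ra_Dx Zr sr; have Zg := ra_Dx Zr gr.
have [u uE] := seal_fun (fun x => s x * Dx Z g x).
have [v vE] := seal_fun (fun x => g x * Dx Z s x).
have [w wE] := seal_fun (fun x => u x + v x).
have [t tE] := seal_fun (fun x => Dx Y u x + Dx Y v x).
have hw : \forall q \near p, Dx Z h q = w q.
  by apply: filterS2 (ra_near sr) (ra_near gr) => q s' g'; rewrite wE uE vE (DxME Z hE s' g').
have ur := raME uE sr Zg; have vr := raME vE gr Zs.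
have ht : \forall q \near p, Dx Y (Dx Z h) q = t q.
  have h2 := nbhs_interior hw.
  have h3 : \forall q \near p, ra q u /\ ra q v by apply: filterS2 (ra_near ur) (ra_near vr).
  apply: filterS3 h2 h3 (ra_near (ra_Dx Zr (raME hE sr gr))) => q e [u' v'] r'.
  by rewrite (Dx_eq Y r' e) (DxDE Y wE u' v') tE.
rewrite (Dx_eq X (ra_Dx Yr (ra_Dx Zr (raME hE sr gr))) ht).
rewrite (DxDE X tE (ra_Dx Yr ur) (ra_Dx Yr vr)).
rewrite (jet2_mul uE Xr Yr sr Zg s0 ds) (DxDxM vE Xr Yr gr Zs).
have -> : Dx Z s p = 0 by rewrite Dx_grad ds mulmx0 mxE.
ring.
Qed.

Section SquaredModulus.
Context (p : 'rV[R]_n) (a b s : 'rV[R]_n -> R) (ar : ra p a) (br : ra p b) (a0 : a p = 0) (b0 : b p = 0).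
Context (sE : forall x, s x = a x ^+ 2 + b x ^+ 2).

Lemma sqmod_split : exists u v : 'rV[R]_n -> R,
  [/\ forall x, u x = a x * a x, forall x, v x = b x * b x & forall x, s x = u x + v x].
Proof. by exists (fun x => a x * a x), (fun x => b x * b x); split=> // x; rewrite sE. Qed.

Lemma ra_sqmod : ra p s.
Proof.
have [u [v [uE vE suv]]] := sqmod_split.
exact: raDE suv (raME uE ar ar) (raME vE br br).
Qed.

Lemma sqmod0 : s p = 0.
Proof. by rewrite sE a0 b0 expr0n addr0. Qed.

Lemma grad_sqmod : grad s p = 0.
Proof.
have [u [v [uE vE /funext ->]]] := sqmod_split.
rewrite (gradD (raME uE ar ar) (raME vE br br)).
move: uE vE => /funext -> /funext ->; rewrite (gradM ar ar) (gradM br br) a0 b0.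
by rewrite !scale0r !addr0.
Qed.

(** The functions a and b are arbitrary apart from vanishing at p: they are coordinates in the
    model, and the real and imaginary parts of a linear form in the reverse direction. *)
Lemma jet2_sqmod X Y : ram p X -> ram p Y ->
  Dx X (Dx Y s) p = 2 * (Dx X a p * Dx Y a p + Dx X b p * Dx Y b p).
Proof.
move=> Xr Yr; have [u [v [uE vE suv]]] := sqmod_split.
have ur := raME uE ar ar; have vr := raME vE br br.
have [t tE] := seal_fun (fun x => Dx Y u x + Dx Y v x).
have h : \forall q \near p, Dx Y s q = t q.
  by apply: filterS2 (ra_near ur) (ra_near vr) => q u' v'; rewrite tE (DxDE Y suv u' v').
rewrite (Dx_eq X (ra_Dx Yr ra_sqmod) h) (DxDE X tE (ra_Dx Yr ur) (ra_Dx Yr vr)).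
rewrite (DxDxM uE Xr Yr ar ar) (DxDxM vE Xr Yr br br) a0 b0 !mul0r; ring.
Qed.

Lemma jet2_sqmod_mul X Y g f : (forall x, f x = s x * g x) -> ram p X -> ram p Y -> ra p g ->
  Dx X (Dx Y f) p = 2 * (Dx X a p * Dx Y a p + Dx X b p * Dx Y b p) * g p.
Proof.
move=> fE Xr Yr gr.
by rewrite (jet2_mul fE Xr Yr ra_sqmod gr sqmod0 grad_sqmod) (jet2_sqmod Xr Yr).
Qed.

Lemma jet3_sqmod_mul X Y Z g f : (forall x, f x = s x * g x) ->
  ram p X -> ram p Y -> ram p Z -> ra p g -> g p = 0 ->
  Dx X (Dx Y (Dx Z f)) p =
  2 * ((Dx X a p * Dx Y a p + Dx X b p * Dx Y b p) * Dx Z g p +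
       (Dx X a p * Dx Z a p + Dx X b p * Dx Z b p) * Dx Y g p +
       (Dx Y a p * Dx Z a p + Dx Y b p * Dx Z b p) * Dx X g p).
Proof.
move=> fE Xr Yr Zr gr g0; rewrite (jet3_mul fE Xr Yr Zr ra_sqmod gr sqmod0 grad_sqmod).
rewrite (jet2_sqmod Xr Yr) (jet2_sqmod Xr Zr) (jet2_sqmod Yr Zr) g0 mulr0; ring.
Qed.

End SquaredModulus.
End Jets.

Section BracketJets.
Context {R : realType} (n : nat).
Implicit Types (p q : 'rV[R]_(n + n)) (X Y V : 'rV[R]_(n + n) -> 'rV[R]_(n + n)) (f : 'rV[R]_(n + n) -> R).

Lemma bracket2E p f X Y V : ra p f -> ram p X -> ram p Y -> ram p V ->
  bracket2 f X Y V p =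
  Dx X (Dx Y (Dx (rotate V) f)) p - Dx X (Dx V (Dx (rotate Y) f)) p -
  (Dx Y (Dx V (Dx (rotate X) f)) p - Dx V (Dx Y (Dx (rotate X) f)) p).
Proof.
move=> fr Xr Yr Vr; rewrite /bracket2 (Dx_lie Yr Vr (ra_Dx (ram_rotate Xr) fr)).
by rewrite (DxB X (ra_Dx Yr (ra_Dx (ram_rotate Vr) fr)) (ra_Dx Vr (ra_Dx (ram_rotate Yr) fr))).
Qed.

End BracketJets.

(** * Coordinates of C^4 and C^5 *)

Section ComplexPoint.
Context {R : realType}.
Local Notation C := R[i].

Lemma complex_pointE n (v : 'rV[R]_(n + n)) :
  complex_point v = rc (lsubmx v) + 'i *: rc (rsubmx v).
Proof.
apply/rowP => j; rewrite !mxE; apply/eqP; rewrite eq_complex /=.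
by apply/andP; split; apply/eqP; ring.
Qed.

Lemma complex_point_mulmx n (v : 'rV[R]_(n + n)) :
  complex_point v = rc v *m (col_mx 1%:M ('i *: 1%:M) : 'M[C]_(n + n, n)).
Proof.
by rewrite complex_pointE -{3}[v]hsubmxK row_mx_rc mul_row_col mulmx1 -scalemxAr mulmx1.
Qed.

Lemma complex_point0 n : complex_point (0 : 'rV[R]_(n + n)) = 0.
Proof. by rewrite complex_point_mulmx rc0 mul0mx. Qed.

Lemma complex_pointZ n a (v : 'rV[R]_(n + n)) :
  complex_point (a *: v) = a%:C%C *: complex_point v.
Proof. by rewrite !complex_point_mulmx rcZ -scalemxAl. Qed.

Lemma mulmx_cplx_structure n (v : 'rV[R]_(n + n)) :
  v *m cplx_structure n = row_mx (- rsubmx v) (lsubmx v).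
Proof.
rewrite -{1}[v]hsubmxK mul_row_block !mulmx0 !mulmx1 mulmxN mulmx1.
by rewrite add0r addr0.
Qed.

Lemma complex_pointJ n (v : 'rV[R]_(n + n)) :
  complex_point (v *m cplx_structure n) = 'i *: complex_point v.
Proof.
rewrite !complex_pointE mulmx_cplx_structure row_mxKl row_mxKr.
rewrite scalerDr scalerA -expr2 sqrCi scaleN1r addrC.
by congr (_ + _); apply/rowP => j; rewrite !mxE rmorphN.
Qed.

Lemma complex_point_surj n (y : 'rV[C]_n) : exists v, complex_point v = y.
Proof.
exists (row_mx (\row_j complex.Re (y 0 j)) (\row_j complex.Im (y 0 j))).
by apply/rowP => j; rewrite mxE row_mxKl row_mxKr !mxE; case: (y 0 j).
Qed.

Lemma ranm_complex_point n (p : 'rV[R]_(n + n)) : ranm p (@complex_point R n).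
Proof.
move=> j.
apply: (@eqf_ran _ _ _ (fun x => (rc x *m (col_mx 1%:M ('i *: 1%:M) : 'M[C]_(n + n, n))) 0 j)).
  by move=> x; rewrite complex_point_mulmx.
by apply: (ran_holo (F := fun z => (z *m _) 0 j)); apply: holom_mulmxr; exact: holom_id.
Qed.

Lemma sd_comp n m (q : 'rV[C]_n) (G : 'rV[C]_n -> 'rV[C]_m) A f d :
  sdm q G A -> sd (G q) f d -> sd q (fun x => f (G x)) (fun i => \sum_j A i j * d j).
Proof.
move=> GA fd; pose F y : 'rV[C]_1 := (f y)%:M.
have FA : sdm (G q) F (\col_j d j).
  move=> k; rewrite (ord1 k).
  have -> : (fun i => (\col_j d j) i 0) = d by apply/funext => i; rewrite mxE.
  by apply: sd_eq fd; apply: filterE => y; rewrite mxE mulr1n.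
have := sdm_comp GA FA 0.
have -> : (fun i => (A *m \col_j d j) i 0) = (fun i => \sum_j A i j * d j).
  by apply/funext => i; rewrite mxE; apply: eq_bigr => j _; rewrite mxE.
by apply: sd_eq; apply: filterE => x; rewrite mxE mulr1n.
Qed.

Lemma complex_point_grad n (q : 'rV[R]_(n + n)) h d : sd (complex_point q) h d -> forall v : 'rV[R]_(n + n),
  (v *m grad (fun x => complex.Re (h (complex_point x))) q) 0 0 =
    complex.Re (\sum_i complex_point v 0 i * d i) /\
  (v *m grad (fun x => complex.Im (h (complex_point x))) q) 0 0 =
    complex.Im (\sum_i complex_point v 0 i * d i).
Proof.
move=> hd v; pose E : 'M[C]_(n + n, n) := col_mx 1%:M ('i *: 1%:M).
have hE x : h (complex_point x) = h (rc x *m E) by rewrite complex_point_mulmx.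
have fE : sd (rc q) (fun x => h (x *m E)) (fun i => \sum_j E i j * d j).
  by apply: (sd_comp (sdm_linear (rc q) E)); rewrite -complex_point_mulmx.
have sE : \sum_i complex_point v 0 i * d i = \sum_i (v 0 i)%:C%C * \sum_j E i j * d j.
  under [RHS]eq_bigr do rewrite mulr_sumr; rewrite exchange_big /=; apply: eq_bigr => j _.
  rewrite complex_point_mulmx mxE mulr_suml; apply: eq_bigr => i _.
  by rewrite mxE mulrA.
have reM (a : R) (z : C) : complex.Re (a%:C%C * z) = a * complex.Re z.
  by case: z => x y /=; rewrite mul0r subr0.
have imM (a : R) (z : C) : complex.Im (a%:C%C * z) = a * complex.Im z.
  by case: z => x y /=; rewrite mul0r addr0.
split.
  have := rsd_grad (sd_rsd fE).
  have -> : (fun x : 'rV[R]_(n + n) => complex.Re (h (rc x *m E))) = (fun x => complex.Re (h (complex_point x))).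
    by apply/funext => x; rewrite hE.
  move=> ->; rewrite sE mxE raddf_sum; apply: eq_bigr => i _.
  by rewrite mxE [RHS]reM.
have := rsd_grad (sd_rsd_Im fE).
have -> : (fun x : 'rV[R]_(n + n) => complex.Im (h (rc x *m E))) = (fun x => complex.Im (h (complex_point x))).
  by apply/funext => x; rewrite hE.
move=> ->; rewrite sE mxE raddf_sum; apply: eq_bigr => i _.
by rewrite mxE [RHS]imM.
Qed.

(** The structure J acts as multiplication by i, and the real part of a number is the imaginary part
    of its product with i. This is how holomorphic functions produce test pairs. *)
Lemma cauchy_riemann n (q : 'rV[R]_(n + n)) h : holo (complex_point q) h -> forall v : 'rV[R]_(n + n),
  v *m grad (fun x => complex.Re (h (complex_point x))) q =
  v *m cplx_structure n *m grad (fun x => complex.Im (h (complex_point x))) q.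
Proof.
move=> /holo_sd[d hd] v; apply/matrixP => i j; rewrite (ord1 i) (ord1 j).
rewrite (complex_point_grad hd v).1 (complex_point_grad hd _).2 complex_pointJ.
have -> : \sum_i ('i *: complex_point v) 0 i * d i = 'i * \sum_i complex_point v 0 i * d i.
  by rewrite mulr_sumr; apply: eq_bigr => k _; rewrite mxE mulrA.
by case: (\sum_i _) => a b /=; ring.
Qed.

End ComplexPoint.

(** * Division by coordinates *)

Section Division.
Context {R : realType}.
Local Notation C := R[i].

Definition zero_at n (i : 'I_n) (x : 'rV[C]_n) : 'rV[C]_n := x *m (1%:M - delta_mx i i).

Lemma zero_atE n (i : 'I_n) x j : zero_at i x 0 j = if j == i then 0 else x 0 j.
Proof.
rewrite /zero_at mulmxBr mulmx1 !mxE (bigD1 i) //= big1 => [|k ki].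
  by rewrite !mxE eqxx /=; case: eqP => [->|_]; rewrite ?mulr1 ?mulr0 addr0 ?subrr ?subr0.
by rewrite mxE (negbTE ki) mulr0.
Qed.

Lemma holom_zero_at n (i : 'I_n) p : holom p (@zero_at n i).
Proof. by apply: holom_mulmxr; exact: holom_id. Qed.

Lemma zero_at0 n (i : 'I_n) : zero_at i 0 = 0. Proof. exact: mul0mx. Qed.

(** The Hadamard factorization between x and its projection to x_i = 0 retains only its i-th
    term. *)
Lemma holo_div n (i : 'I_n) f : holo 0 f -> exists2 g, holo 0 g &
  \forall x \near (0 : 'rV[C]_n), f x - f (zero_at i x) = x 0 i * g x.
Proof.
move=> /holo_hadamard[S [SP [r r0 rS]]].
have h : holom (0 : 'rV[C]_n) (fun x => row_mx x (zero_at i x)).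
  by apply: holom_row_mx; [exact: holom_id|exact: holom_zero_at].
exists (fun x => S i (row_mx x (zero_at i x))).
  by apply: (holo_comp h); rewrite zero_at0.
apply/near_pd; exists r => // x px; rewrite rS //; last first.
  move=> j; rewrite zero_atE; case: eqP => _ //.
  by rewrite mxE subrr cn0.
rewrite (bigD1 i) //= big1 ?addr0 => [|j ji]; rewrite zero_atE ?eqxx ?subr0 //.
by rewrite (negbTE ji) subrr mul0r.
Qed.

(* g - g(x_j = 0) still satisfies f = x_i g, and is divisible by x_j. *)
Lemma holo_div2 n (i j : 'I_n) f : i != j -> holo 0 f ->
  (\forall x \near (0 : 'rV[C]_n), f (zero_at i x) = 0 /\ f (zero_at j x) = 0) ->
  exists2 g, holo 0 g & \forall x \near (0 : 'rV[C]_n), f x = x 0 i * x 0 j * g x.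
Proof.
move=> ij fh f0; have [g gh fg] := holo_div i fh; have [k kh gk] := holo_div j gh.
exists k => //.
have fg' : \forall x \near (0 : 'rV[C]_n), f (zero_at j x) - f (zero_at i (zero_at j x)) =
    zero_at j x 0 i * g (zero_at j x).
  have := near_holo (p := 0 : 'rV[C]_n) (P := fun x => f x - f (zero_at i x) = x 0 i * g x) (@holom_zero_at n j 0).
  by rewrite zero_at0; apply.
have f0' : \forall x \near (0 : 'rV[C]_n), f (zero_at i (zero_at j x)) = 0.
  have := near_holo (p := 0 : 'rV[C]_n) (P := fun x => f (zero_at i x) = 0 /\ f (zero_at j x) = 0) (@holom_zero_at n j 0).
  by rewrite zero_at0 => /(_ f0); apply: filterS => x [].
have h2 : \forall x \near (0 : 'rV[C]_n), [/\ f x - f (zero_at i x) = x 0 i * g x,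
    g x - g (zero_at j x) = x 0 j * k x & f (zero_at i (zero_at j x)) = 0].
  by apply: filterS3 fg gk f0' => x.
apply: filterS3 h2 fg' f0 => x [e1 e2 e3] e4 [e5 e6].
move: e1 e4; rewrite e3 e5 e6 !subr0 zero_atE (negbTE ij) => e1 e4.
by rewrite -mulrA -e2 mulrBr -e1 -e4 subr0.
Qed.

End Division.

(** * Conjugation of Taylor coefficients *)

Section ConjugateTaylor.
Context {R : realType}.
Local Notation C := R[i].

Lemma taylor_conj n (c : {ffun 'I_n -> nat} -> C) f : taylor_series 0 c f ->
  taylor_series 0 (fun a => (c a)^*) (fun x => (f (cvec x))^*).
Proof.
move=> /taylorP[r [r0 [B rB] rf]]; apply/taylorP; exists r; split; first exact: r0.
  by exists B => N; apply: le_trans (rB N); apply: ler_sum => a _; rewrite cn_conj.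
move=> x px; have px' : pd 0 r (cvec x).
  by move=> i; have := px i; rewrite !mxE !subr0 cn_conj.
move/cvgCP : (rf _ px') => h; apply/cvgCP => e /h[N NP]; exists N => k /NP.
rewrite -cn_conj rmorphB /= => hk; apply: le_trans hk; rewrite le_eqVlt; apply/orP; left; apply/eqP.
congr (cn (_ - _)); rewrite /box_sum rmorph_sum /=; apply: eq_bigr => a _.
rewrite rmorphM /monomial rmorph_prod /= !subr0; congr (_ * _); apply: eq_bigr => i _.
by rewrite mxE rmorphXn /= conjCK.
Qed.

Lemma taylor_unique n (p : 'rV[C]_n) c f g : taylor_series p c f -> taylor_series p c g ->
  \forall x \near p, f x = g x.
Proof.
move=> /taylorP[r [r0 _ rf]] /taylorP[s [s0 _ sg]].
apply/near_pd; exists (Num.min r s); first by rewrite lt_min r0.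
move=> x px; apply: (cvgC_unique (rf x _) (sg x _)); apply: pdS px; rewrite ge_min lexx ?orbT //.
Qed.

End ConjugateTaylor.

(** * Normality and growth of remainders *)

Section Remainder.
Context {R : realType}.
Local Notation C := R[i].
Local Notation vec := 'rV[C]_(1 + (1 + 3)).

Lemma norm_le_cn n (x : 'rV[C]_n) (c : R) : 0 <= c ->
  `|x| <= c%:C%C <-> forall i, cn (x 0 i) <= c.
Proof.
move=> c0; split=> [xc i|h].
  apply/ler_addgt0Pr => e e0; have ce0 : 0 < c + e by rewrite ltr_wpDl.
  have : pd 0 (c + e) x by apply/pdP => //; rewrite subr0 (le_lt_trans xc) // ltcR ltrDl.
  by move=> /(_ i); rewrite mxE subr0 => /ltW.
have [x0|/mx_norm_neq0[[i j] e]] := eqVneq (mx_norm x) 0.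
  by rewrite [`|x|]x0 -[0]/((0 : R)%:C%C) lecR.
by rewrite [`|x|]e (ord1 i) normCE lecR.
Qed.

Lemma pos_real (k : C) : 0 < k -> exists2 a : R, 0 < a & k = a%:C%C.
Proof.
rewrite ltcE => /andP[/eqP /= Ik Rk]; exists (complex.Re k) => //.
by apply/eqP; rewrite eq_complex /= Ik !eqxx.
Qed.

Lemma bigO_scalarP n m (A : 'rV[C]_n -> 'rV[C]_m) (g : 'rV[C]_n -> C) :
  A =O_ (0 : 'rV[C]_n) g <-> exists2 K : R, 0 < K &
    \forall x \near (0 : 'rV[C]_n), forall j, cn (A x 0 j) <= K * cn (g x).
Proof.
rewrite eqO_exP; split=> [[_ /pos_real[K K0 ->] h]|[K K0 h]].
  exists K => //; apply: filterS h => x; rewrite normCE -rmorphM => /norm_le_cn; apply.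
  by rewrite mulr_ge0 ?cn_ge0 // ltW.
exists K%:C%C; first by rewrite ltcR.
apply: filterS h => x h; rewrite normCE -rmorphM; apply/norm_le_cn => //.
by rewrite mulr_ge0 ?cn_ge0 // ltW.
Qed.

Lemma bigO_vectorP n m k (A : 'rV[C]_n -> 'rV[C]_m) (g : 'rV[C]_n -> 'rV[C]_k) :
  A =O_ (0 : 'rV[C]_n) g <-> exists2 K : R, 0 < K &
    \forall x \near (0 : 'rV[C]_n), forall j, cn (A x 0 j) <= K * nrm (g x).
Proof.
have nn (x : 'rV[C]_k) : exists2 t : R, 0 <= t & `|x| = t%:C%C.
  exists (complex.Re `|x|); have := normr_ge0 x; rewrite lecE => /andP[/eqP /= Ik Rk] //.
  by apply/eqP; rewrite eq_complex /= Ik !eqxx.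
rewrite eqO_exP; split=> [[_ /pos_real[K K0 ->] h]|[K K0 h]].
  exists K => //; apply: filterS h => x; have [t t0 xt] := nn (g x).
  rewrite xt -rmorphM => /norm_le_cn-/(_ (mulr_ge0 (ltW K0) t0)) h j.
  apply: le_trans (h j) _; rewrite ler_wpM2l ?(ltW K0) // -lecR -xt.
  by apply/norm_le_cn => [|i]; [exact: nrm_ge0|exact: cn_le_nrm].
exists (K * k.+1%:R)%:C%C; first by rewrite ltcR mulr_gt0.
apply: filterS h => x h; have [t t0 xt] := nn (g x).
rewrite xt -rmorphM; apply/norm_le_cn => [|j]; first by rewrite !mulr_ge0 // ltW.
apply: le_trans (h j) _; rewrite -mulrA ler_wpM2l ?(ltW K0) //.
have ht : forall i, cn (g x 0 i) <= t by apply/norm_le_cn => //; rewrite xt.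
apply: (@le_trans _ _ (\sum_(i < k) t)); first exact: ler_sum.
by rewrite sumr_const card_ord -[X in X <= _]mulr_natl ler_wpM2r // ler_nat.
Qed.

Definition zi : 'I_(1 + (1 + 3)) := lshift _ 0.
Definition zetai : 'I_(1 + (1 + 3)) := rshift 1 (lshift 3 0).

Lemma zi_neq : zi != zetai. Proof. by []. Qed.
Lemma zcE (x : vec) : lsubmx x 0 0 = x 0 zi. Proof. by rewrite mxE. Qed.
Lemma zetaE (x : vec) : lsubmx (rsubmx x) 0 0 = x 0 zetai. Proof. by rewrite !mxE. Qed.
Lemma scalar_mx11 (A : 'M[C]_1) : (A 0 0)%:M = A.
Proof. by apply/matrixP => i j; rewrite (ord1 i) (ord1 j) mxE mulr1n. Qed.
Lemma triple_eta (x : vec) : triple (x 0 zi) (x 0 zetai) (rsubmx (rsubmx x)) = x.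
Proof. by rewrite /triple -zcE -zetaE !scalar_mx11 !hsubmxK. Qed.
Lemma triple_z z zeta w : triple z zeta w 0 zi = z :> C.
Proof. by rewrite /triple row_mxEl mxE mulr1n. Qed.
Lemma triple_zeta z zeta w : triple z zeta w 0 zetai = zeta :> C.
Proof. by rewrite /triple row_mxEr row_mxEl mxE mulr1n. Qed.
Lemma triple_w z zeta w : rsubmx (rsubmx (triple z zeta w)) = w :> 'rV[C]_3.
Proof. by rewrite /triple !row_mxKr. Qed.
Lemma triple0 : triple 0 0 0 = 0 :> vec.
Proof. by rewrite /triple raddf0 !row_mx0. Qed.
Lemma zero_at_z (x : vec) : zero_at zi x = triple 0 (x 0 zetai) (rsubmx (rsubmx x)).
Proof.
apply/rowP => i; rewrite zero_atE; case: (split_ordP i) => k ->.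
  by rewrite (ord1 k) eqxx triple_z.
rewrite -{1}(triple_eta x); case: (split_ordP k) => l ->.
  by rewrite (ord1 l) -/zetai !triple_zeta.
by rewrite /triple !row_mxEr.
Qed.
Lemma zero_at_zeta (x : vec) : zero_at zetai x = triple (x 0 zi) 0 (rsubmx (rsubmx x)).
Proof.
apply/rowP => i; rewrite zero_atE; case: (split_ordP i) => k ->.
  by rewrite (ord1 k) -/zi !triple_z.
rewrite -{1}(triple_eta x); case: (split_ordP k) => l ->.
  by rewrite (ord1 l) -/zetai !triple_zeta eqxx.
by rewrite /triple !row_mxEr.
Qed.

Lemma normal_factor (Pi : vec -> 'rV[C]_3) : holom 0 Pi -> normality_conditions Pi ->
  exists h : 'I_3 -> vec -> C, (forall j, holo 0 (h j)) /\
    \forall x \near (0 : vec), forall j, Pi x 0 j = x 0 zi * x 0 zetai * h j x.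
Proof.
move=> Pih nP.
have H j : exists h, holo 0 h /\ \forall x \near (0 : vec), Pi x 0 j = x 0 zi * x 0 zetai * h x.
  have [|h hh hP] := @holo_div2 _ _ zi zetai (fun x => Pi x 0 j) zi_neq (Pih j).
    apply: filterS nP => x; rewrite /= zcE zetaE zero_at_z zero_at_zeta => -[-> ->].
    by rewrite mxE.
  by exists h.
have [h hP] := choice H; exists h; split => [j|]; first exact: (hP j).1.
by apply: near_all => j; exact: (hP j).2.
Qed.

(** At w = 0 the part z zbar O(|w|) vanishes and leaves O(|z|^4); division by |z|^2 gives the bound
    on the quotient, for nonzero z. *)
Lemma remainder_bound (Pi : vec -> 'rV[C]_3) (h : 'I_3 -> vec -> C) :
  (\forall x \near (0 : vec), forall j, Pi x 0 j = x 0 zi * x 0 zetai * h j x) ->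
  remainder_order Pi -> exists K r : R, [/\ 0 < K, 0 < r &
    forall (z : C) j, z != 0 -> cn z < r -> cn (h j (triple z z^* 0)) <= K * cn z ^+ 2].
Proof.
move=> Pih [A [B [PiAB /bigO_scalarP[K K0 AK] /bigO_vectorP[L L0 BL]]]].
have [r1 r10 h1] := iffLR (near_pd _ _) Pih.
have [r2 r20 h2] := iffLR (near_pd _ _) PiAB.
have [r3 r30 h3] := iffLR (near_pd _ _) AK.
have [r4 r40 h4] := iffLR (near_pd _ _) BL.
pose r := Num.min (Num.min r1 r2) (Num.min r3 r4).
exists K, r; split=> //; first by rewrite !lt_min r10 r20 r30.
move=> z j z0 zr.
pose p : 'rV[C]_(1 + 3) := row_mx z%:M 0.
have zp : zcoord p = z by rewrite /zcoord row_mxKl mxE mulr1n.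
have wp : wcoord p = 0 by rewrite /wcoord row_mxKr.
have pr : pd 0 r p.
  move=> i; rewrite [in X in _ - X]mxE subr0; case: (split_ordP i) => k ->.
    by rewrite row_mxEl (ord1 k) mxE mulr1n.
  by rewrite row_mxEr mxE cn0; apply: le_lt_trans zr; exact: cn_ge0.
have tr : pd 0 r (triple z z^* 0).
  move=> i; rewrite [in X in _ - X]mxE subr0 /triple; case: (split_ordP i) => k ->.
    by rewrite row_mxEl (ord1 k) mxE mulr1n.
  rewrite row_mxEr; case: (split_ordP k) => l ->.
    by rewrite row_mxEl (ord1 l) mxE mulr1n cn_conj.
  by rewrite row_mxEr mxE cn0; apply: le_lt_trans zr; exact: cn_ge0.
have rr1 : r <= r1 by rewrite !ge_min lexx.
have rr2 : r <= r2 by rewrite !ge_min lexx orbT.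
have rr3 : r <= r3 by rewrite !ge_min lexx !orbT.
have rr4 : r <= r4 by rewrite !ge_min lexx !orbT.
have e1 := h1 _ (pdS rr1 tr) j; have e2 := h2 _ (pdS rr2 pr).
have e3 := h3 _ (pdS rr3 pr) j; have e4 := h4 _ (pdS rr4 pr) j.
rewrite triple_z triple_zeta in e1; rewrite zp wp cvec0 in e2.
have B0 : B p 0 j = 0.
  by apply/eqP; rewrite -cn_eq0 -(le_anti (_ : 0 <= cn (B p 0 j) <= 0)) // cn_ge0 /=;
     move: e4; rewrite wp nrm0 mulr0.
have := congr1 (fun M : 'rV[C]_3 => M 0 j) e2; rewrite e1 [RHS]mxE [X in _ = _ + X]mxE B0 mulr0 addr0 => e5.
move: e3; rewrite -e5 zp cnX !cnM cn_conj.
have z2 : 0 < cn z * cn z by rewrite mulr_gt0 // cn_gt0.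
move=> e3; rewrite -(ler_pM2l z2); apply: le_trans e3 _.
by rewrite le_eqVlt; apply/orP; left; apply/eqP; ring.
Qed.

End Remainder.

Lemma mulmx_eq (K : nzRingType) k m (A B : 'M[K]_(k, m)) :
  (forall u : 'rV_k, u *m A = u *m B) -> A = B.
Proof. by move=> h; apply/row_matrixP => i; rewrite !rowE h. Qed.

(** * Manifolds in normal form are maximally minimal *)

Section MatrixFunctions.
Context {R : realType} (n : nat).
Implicit Type p : 'rV[R]_n.

Definition rmx p k l (M : 'rV[R]_n -> 'M[R]_(k, l)) : Prop := forall i j, ra p (fun x => M x i j).

Lemma rmx_cst p k l (A : 'M[R]_(k, l)) : rmx p (fun=> A).
Proof. by move=> i j; exact: ra_cst. Qed.

Lemma rmx_mul p k l m (M : 'rV[R]_n -> 'M[R]_(k, l)) (N : 'rV[R]_n -> 'M[R]_(l, m)) :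
  rmx p M -> rmx p N -> rmx p (fun x => M x *m N x).
Proof.
move=> Mr Nr i j; apply: (@eqf_ra _ _ _ (fun x => \sum_a M x i a * N x a j)).
  by move=> x; rewrite mxE.
by apply: ra_sum => a; exact: raM (Mr _ _) (Nr _ _).
Qed.

Lemma rmx_row_mx p k l m (M : 'rV[R]_n -> 'M[R]_(k, l)) (N : 'rV[R]_n -> 'M[R]_(k, m)) :
  rmx p M -> rmx p N -> rmx p (fun x => row_mx (M x) (N x)).
Proof.
move=> Mr Nr i j; case: (split_ordP j) => a ->.
  by apply: eqf_ra (Mr i a) => x; rewrite row_mxEl.
by apply: eqf_ra (Nr i a) => x; rewrite row_mxEr.
Qed.

Lemma ra_det p k (M : 'rV[R]_n -> 'M[R]_k) : rmx p M -> ra p (fun x => \det (M x)).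
Proof.
move=> Mr; apply: ra_sum => s; apply: raM; first exact: ra_cst.
by apply: ra_prod => i; exact: Mr.
Qed.

Lemma rmx_adj p k (M : 'rV[R]_n -> 'M[R]_k) : rmx p M -> rmx p (fun x => \adj (M x)).
Proof.
move=> Mr i j.
apply: (@eqf_ra _ _ _ (fun x => (-1) ^+ (j + i) * \det (row' j (col' i (M x))))).
  by move=> x; rewrite mxE.
apply: raM; first exact: ra_cst.
by apply: ra_det => a b; apply: eqf_ra (Mr (lift j a) (lift i b)) => x; rewrite !mxE.
Qed.

Lemma rmx_jacobian p m (F : 'rV[R]_n -> 'rV[R]_m) : ram p F -> rmx p (jacobian F).
Proof.
move=> Fr i j; apply: eq_ra (ra_grad i (Fr j)).
by apply: filterS (ram_near Fr) => q Fq; rewrite (jacobianE i j Fq).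
Qed.

Lemma ra_cont p f (e : R) : ra p f -> 0 < e -> \forall x \near p, `|f x - f p| < e.
Proof.
move=> fr e0; have [F Fh fF] := fr.
have [d d0 dP] := holo_cont Fh e0.
have := rc_near (p := p) (P := fun z => cn (F z - F (rc p)) < e).
move=> /(_ (iffRL (near_pd _ _) (ex_intro2 _ _ d d0 dP))).
have fp := nbhs_singleton fF.
by apply: filterS2 fF => x fx; rewrite -fx -fp -rmorphB cn_real.
Qed.

Lemma ra_neq0 p f : ra p f -> f p != 0 -> \forall x \near p, f x != 0.
Proof.
move=> fr f0; have e0 : 0 < `|f p| by rewrite normr_gt0.
apply: filterS (ra_cont fr e0) => x; apply: contraTneq => ->.
by rewrite sub0r normrN ltxx.
Qed.

End MatrixFunctions.

Section CoordinateGradient.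
Context {R : realType} (n : nat).

Lemma grad_coord (q : 'rV[R]_n) i (v : 'rV[R]_n) : (v *m grad (fun x => x 0 i) q) 0 0 = v 0 i.
Proof.
have E : (fun x : 'rV[R]_n => x 0 i) = (fun x => (x *m (delta_mx i 0 : 'M[R]_(n, 1))) 0 0).
  apply/funext => x; rewrite mxE (bigD1 i) //= big1 => [|j ji].
    by rewrite mxE !eqxx mulr1 addr0.
  by rewrite mxE (negbTE ji) mulr0.
by rewrite E grad_linear mxE (bigD1 i) //= big1 => [|j ji]; rewrite mxE ?(negbTE ji) ?eqxx ?mulr0 ?mulr1 ?addr0.
Qed.

Lemma Dx_coord X (q : 'rV[R]_n) i : Dx X (fun x => x 0 i) q = X q 0 i.
Proof. by rewrite Dx_grad grad_coord. Qed.


End CoordinateGradient.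

(** * An explicit frame of the complex tangent bundle *)

Section Frame.
Context {R : realType}.
Local Notation V8 := 'rV[R]_((1 + 3) + (1 + 3)).
Local Notation J := (cplx_structure (1 + 3) : 'M[R]_((1 + 3) + (1 + 3))).

(* Indices of the real coordinates Re z, Im z, Re w_j, Im w_j. *)
Definition ix : 'I_((1 + 3) + (1 + 3)) := lshift (1 + 3) (lshift 3 0).
Definition iy : 'I_((1 + 3) + (1 + 3)) := rshift (1 + 3) (lshift 3 0).
Definition iu (j : 'I_3) : 'I_((1 + 3) + (1 + 3)) := lshift (1 + 3) (rshift 1 j).
Definition iv (j : 'I_3) : 'I_((1 + 3) + (1 + 3)) := rshift (1 + 3) (rshift 1 j).

Lemma mulmxJ_x (v : V8) : (v *m J) 0 ix = - v 0 iy.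
Proof. by rewrite mulmx_cplx_structure row_mxEl !mxE. Qed.
Lemma mulmxJ_y (v : V8) : (v *m J) 0 iy = v 0 ix.
Proof. by rewrite mulmx_cplx_structure row_mxEr !mxE. Qed.
Lemma mulmxJ_u (v : V8) j : (v *m J) 0 (iu j) = - v 0 (iv j).
Proof. by rewrite mulmx_cplx_structure row_mxEl !mxE. Qed.
Lemma mulmxJ_v (v : V8) j : (v *m J) 0 (iv j) = v 0 (iu j).
Proof. by rewrite mulmx_cplx_structure row_mxEr !mxE. Qed.

Lemma row8P (v w : V8) : v 0 ix = w 0 ix -> v 0 iy = w 0 iy ->
  (forall j, v 0 (iu j) = w 0 (iu j)) -> (forall j, v 0 (iv j) = w 0 (iv j)) -> v = w.
Proof.
move=> hx hy hu hv; apply/rowP => i.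
case: (split_ordP i) => k ->; case: (split_ordP k) => l ->; rewrite ?(ord1 l).
- exact: hx.
- exact: hu.
- exact: hy.
- exact: hv.
Qed.

Definition Ew : 'M[R]_(3 + 3, (1 + 3) + (1 + 3)) := block_mx (row_mx 0 1%:M) 0 0 (row_mx 0 1%:M).

Lemma mul_Ew (a b : 'rV[R]_3) : row_mx a b *m Ew = row_mx (row_mx 0 a) (row_mx 0 b).
Proof.
by rewrite mul_row_block !mulmx0 addr0 add0r !mul_mx_row !mulmx0 !mulmx1. Qed.

Context (rho : V8 -> 'rV[R]_3).
Context (p : V8) (rho_ram : ram p rho).
Context (rho0 : forall v : V8, v *m jacobian rho 0 = \row_j v 0 (iv j)).

(** A vector v lies in the complex tangent space exactly when both v and v J are killed by the
    differential of [rho]; [Kmx] stacks the two conditions, and [Kw] restricts them to the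
    w-directions. *)
Definition Kmx (q : V8) : 'M[R]_((1 + 3) + (1 + 3), 3 + 3) := row_mx (jacobian rho q) (J *m jacobian rho q).
Definition Kw (q : V8) : 'M[R]_(3 + 3) := Ew *m Kmx q.
Definition ex : V8 := delta_mx 0 ix.
(* Cramer's rule gives the w-components that put the z-direction [ex] into the complex tangent
   space, up to the factor \det Kw, so that no division is needed. *)
Definition frame1 (q : V8) : V8 := \det (Kw q) *: ex - ex *m Kmx q *m \adj (Kw q) *m Ew.
Definition frame2 := rotate frame1.

Lemma rmx_Kmx : rmx p Kmx.
Proof.
apply: rmx_row_mx; first exact: rmx_jacobian.
by apply: rmx_mul; [exact: rmx_cst|exact: rmx_jacobian].
Qed.

Lemma rmx_Kw : rmx p Kw.
Proof. by apply: rmx_mul; [exact: rmx_cst|exact: rmx_Kmx]. Qed.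

Lemma ra_detKw : ra p (fun q => \det (Kw q)). Proof. exact: ra_det rmx_Kw. Qed.

Lemma ram_frame1 : ram p frame1.
Proof.
move=> j.
have h : rmx p (fun q => ex *m Kmx q *m \adj (Kw q) *m Ew).
  apply: rmx_mul; last exact: rmx_cst.
  by apply: rmx_mul; [apply: rmx_mul; [exact: rmx_cst|exact: rmx_Kmx]|exact/rmx_adj/rmx_Kw].
apply: eqf_ra (raB (raM ra_detKw (ra_cst p (ex 0 j))) (h 0 j)) => q.
by rewrite /frame1 [RHS]mxE [X in _ = X + _]mxE [X in _ = _ + X]mxE.
Qed.

Lemma ram_frame2 : ram p frame2. Proof. exact: ram_rotate ram_frame1. Qed.

(** At 0 the differential of [rho] is that of Im w, so [Kw 0] exchanges Re w and Im w and is its own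
    inverse. *)
Lemma detKw0 : \det (Kw 0) != 0.
Proof.
have E (a b : 'rV[R]_3) : row_mx a b *m Kw 0 = row_mx b a.
  rewrite mulmxA mul_Ew mul_mx_row mulmxA !rho0; congr row_mx; apply/rowP => j; rewrite mxE.
    by rewrite /iv !row_mxEr.
  by rewrite mulmxJ_v /iu row_mxEl row_mxEr.
have : Kw 0 *m Kw 0 = 1%:M.
  by apply: mulmx_eq => u; rewrite mulmxA -[u]hsubmxK !E mulmx1.
by move=> /mulmx1_unit[]; rewrite unitmxE unitfE.
Qed.

Lemma sub_Kmx (v q : V8) : (v <= complex_tangent rho q)%MS = (v *m Kmx q == 0).
Proof.
rewrite sub_complex_tangent mul_mx_row mulmxA; apply/andP/eqP => [[/eqP -> /eqP ->]|h].
  by rewrite row_mx0.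
by have [-> ->] : v *m jacobian rho q = 0 /\ v *m J *m jacobian rho q = 0
  by apply: eq_row_mx; rewrite h row_mx0.
Qed.

Lemma frame1_sub q : (frame1 q <= complex_tangent rho q)%MS.
Proof.
rewrite sub_Kmx /frame1 mulmxBl -scalemxAl -(mulmxA _ Ew) -/(Kw q) -mulmxA mul_adj_mx.
by rewrite mul_mx_scalar subrr.
Qed.

Lemma frame2_sub q : (frame2 q <= complex_tangent rho q)%MS.
Proof. exact/complex_tangentJ/frame1_sub. Qed.

Lemma mul_Ew_z (u : 'rV[R]_(3 + 3)) : (u *m Ew) 0 ix = 0 /\ (u *m Ew) 0 iy = 0.
Proof. by rewrite -[u]hsubmxK mul_Ew row_mxEl row_mxEr !row_mxEl !mxE. Qed.

Lemma frame1_x q : frame1 q 0 ix = \det (Kw q).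
Proof. by rewrite mxE [X in _ + X]mxE (mul_Ew_z _).1 !mxE !eqxx mulr1 subr0. Qed.
Lemma frame1_y q : frame1 q 0 iy = 0.
Proof. by rewrite mxE [X in _ + X]mxE (mul_Ew_z _).2 !mxE /= mulr0 subr0. Qed.
Lemma frame2_x q : frame2 q 0 ix = 0.
Proof. by rewrite /frame2 /rotate mulmxJ_x frame1_y oppr0. Qed.
Lemma frame2_y q : frame2 q 0 iy = \det (Kw q).
Proof. by rewrite /frame2 /rotate mulmxJ_y frame1_x. Qed.

(** The difference of the two sides is a complex tangent vector without z-components, that is, a
    combination of w-directions in the kernel of the invertible matrix [Kw q]. *)
Lemma frame_span (q v : V8) : \det (Kw q) != 0 -> (v <= complex_tangent rho q)%MS ->
  \det (Kw q) *: v = v 0 ix *: frame1 q + v 0 iy *: frame2 q.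
Proof.
move=> d0 vT; apply/eqP; rewrite -subr_eq0; set e := _ - _; apply/eqP.
have eK : e *m Kmx q = 0.
  apply/eqP; rewrite -sub_Kmx; apply: addmx_sub; first exact: scalemx_sub.
  rewrite eqmx_opp; apply: addmx_sub; apply: scalemx_sub; [exact: frame1_sub|exact: frame2_sub].
have entry (a b c : R) (x y z : V8) i : (a *: x - (b *: y + c *: z)) 0 i = a * x 0 i - (b * y 0 i + c * z 0 i).
  by rewrite !mxE.
have ex0 : e 0 ix = 0 by rewrite entry frame1_x frame2_x; ring.
have ey0 : e 0 iy = 0 by rewrite entry frame1_y frame2_y; ring.
pose u := row_mx (\row_j e 0 (iu j)) (\row_j e 0 (iv j)).
have eE : e = u *m Ew.
  apply: row8P; rewrite mul_Ew.
  - by rewrite ex0 row_mxEl row_mxEl mxE.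
  - by rewrite ey0 row_mxEr row_mxEl mxE.
  - by move=> j; rewrite /iu row_mxEl row_mxEr [RHS]mxE.
  - by move=> j; rewrite /iv row_mxEr row_mxEr [RHS]mxE.
have : u *m Kw q = 0 by rewrite /Kw mulmxA -eE; exact: eK.
have Ku : Kw q \in unitmx by rewrite unitmxE unitfE.
by move=> /(congr1 (mulmx^~ (invmx (Kw q)))); rewrite (mulmxK Ku) mul0mx eE => ->; rewrite mul0mx.
Qed.

Lemma rank_Kmx q : \det (Kw q) != 0 -> \rank (Kmx q) = 6%N.
Proof.
move=> d0; apply/eqP; rewrite eqn_leq rank_leq_col /=.
have : \rank (Kw q) = 6%N by apply/eqP; rewrite -[_ == _]/(row_free (Kw q)) row_free_unit unitmxE unitfE.
by move=> <-; exact: mxrankM_maxr.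
Qed.

(** The rank 6 of [Kmx] is at most twice the rank of the Jacobian, which has three columns. *)
Lemma rank_jacobian q : \det (Kw q) != 0 -> \rank (jacobian rho q) = 3%N.
Proof.
move=> /rank_Kmx rk; apply/eqP; rewrite eqn_leq rank_leq_col /=.
have : (\rank (Kmx q) <= \rank (jacobian rho q) + \rank (J *m jacobian rho q))%N.
  by rewrite -mxrank_tr tr_row_mx -addsmxE -[in leqRHS]mxrank_tr -[X in (_ <= _ + X)%N]mxrank_tr mxrank_adds_leqif.
have := mxrankM_maxr J (jacobian rho q); rewrite rk; move: (\rank _) (\rank _) => a b; lia.
Qed.

Lemma rank_tangent q : \det (Kw q) != 0 -> \rank (tangent rho q) = 5%N.
Proof. by move=> d0; rewrite mxrank_ker rank_jacobian. Qed.

Lemma rank_complex_tangent q : \det (Kw q) != 0 -> \rank (complex_tangent rho q) = 2%N.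
Proof.
move=> d0; have -> : \rank (complex_tangent rho q) = \rank (kermx (Kmx q)).
  apply/eqP; rewrite eqn_leq; apply/andP; split; apply: mxrankS; apply/rV_subP => v.
    by rewrite sub_Kmx sub_kermx.
  by rewrite sub_Kmx sub_kermx.
by rewrite mxrank_ker rank_Kmx.
Qed.

(** The intersection of T and T J is the complex tangent space, so their sum has dimension 5 + 5 - 2
    = 8. *)
Lemma generic_at q : \det (Kw q) != 0 ->
  row_full (tangent rho q + tangent rho q *m J)%MS.
Proof.
move=> d0; have := mxrank_sum_cap (tangent rho q) (tangent rho q *m J).
have -> : \rank (tangent rho q :&: tangent rho q *m J)%MS = 2%N by exact: rank_complex_tangent.
have Ju : row_free J.
  by rewrite row_free_unit; have /mulmx1_unit[] : J *m (- J) = 1%:M by rewrite mulmxN cplx_structureK opprK.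
rewrite (mxrankMfree _ Ju) (rank_tangent d0) /row_full; lia.
Qed.

End Frame.

Section BracketFrames.
Context {R : realType} (n : nat).
Context (N : set 'rV[R]_n) (T : 'rV[R]_n -> 'M[R]_n) (k : nat) (q : 'rV[R]_n).

Lemma frame_bracket_fibre m (W : 'I_m -> 'rV[R]_n -> 'rV[R]_n) v :
  (forall i, exists2 l, (l < k)%N & iterated_bracket N T q l (W i)) ->
  (v <= \matrix_i W i q)%MS -> bracket_fibre N T k q v.
Proof.
move=> Wb /submxP[c ->]; exists (fun x => \sum_i c 0 i *: W i x).
  exists m, (fun i _ => c 0 i), W; split=> // i.
  exact: (iffRL (ra_analytic _ _) (ra_cst _ _)).
apply/rowP => j; rewrite mxE summxE; apply: eq_bigr => i _.
by rewrite [in RHS]mxE; congr (_ * _); rewrite mxE.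
Qed.

Lemma has_rank_frame m (W : 'I_m -> 'rV[R]_n -> 'rV[R]_n) :
  (forall i, exists2 l, (l < k)%N & iterated_bracket N T q l (W i)) ->
  row_free (\matrix_i W i q) ->
  (forall v, bracket_fibre N T k q v -> (v <= \matrix_i W i q)%MS) ->
  has_rank (bracket_fibre N T k q) m.
Proof.
move=> Wb Wf h; exists (\matrix_i W i q); split=> // v.
by split; [exact: h|exact: frame_bracket_fibre].
Qed.

End BracketFrames.

Lemma combination_mulmx (K : comNzRingType) n (A : 'M[K]_(n, 1)) a b c (x y z : 'rV[K]_n) :
  a *: x = b *: y + c *: z ->
  a * (x *m A) 0 0 = b * (y *m A) 0 0 + c * (z *m A) 0 0.
Proof.
have E (t : K) (v : 'rV[K]_n) : (t *: v *m A) 0 0 = t * (v *m A) 0 0 by rewrite -scalemxAl mxE.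
by move=> h; rewrite -!E h mulmxDl [LHS]mxE.
Qed.

(** * Real equations Im w = |z|^2 g *)

Section RealModel.
Context {R : realType} (M : set 'rV[R[i]]_(1 + 3)).
Local Notation V8 := 'rV[R]_((1 + 3) + (1 + 3)).
Local Notation J := (cplx_structure (1 + 3) : 'M[R]_((1 + 3) + (1 + 3))).
Local Notation N := (@complex_point R (1 + 3) @^-1` M).

Context (g : 'I_3 -> V8 -> R) (gr : forall j, ra 0 (g j)).
Context (s : V8 -> R) (sE : forall x, s x = x 0 ix ^+ 2 + x 0 iy ^+ 2).
Context (f : 'I_3 -> V8 -> R) (fE : forall j x, f j x = s x * g j x).
Context (rho : V8 -> 'rV[R]_3) (rhoE : forall x j, rho x 0 j = x 0 (iv j) - f j x).
Context (Nrho : \forall q \near (0 : V8), N q <-> rho q = 0).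

Let xr : ra 0 (fun x : V8 => x 0 ix) := ra_coord 0 ix.
Let yr : ra 0 (fun x : V8 => x 0 iy) := ra_coord 0 iy.
Let x0 : (0 : V8) 0 ix = 0. Proof. by rewrite mxE. Qed.
Let y0 : (0 : V8) 0 iy = 0. Proof. by rewrite mxE. Qed.
Let sr : ra 0 s := ra_sqmod xr yr sE.
Let s0 : s 0 = 0 := sqmod0 x0 y0 sE.
Let ds0 : grad s 0 = 0 := grad_sqmod xr yr x0 y0 sE.

Lemma model_ra j : ra 0 (f j).
Proof. exact: raME (fE j) sr (gr j). Qed.

Lemma model_rho_coordinate j : (fun x => rho x 0 j) = (fun x : V8 => x 0 (iv j) - f j x).
Proof. by apply/funext => x; exact: rhoE. Qed.

Lemma model_ram : ram 0 rho.
Proof. by move=> j; rewrite model_rho_coordinate; apply: raB; [exact: ra_coord|exact: model_ra]. Qed.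

Lemma model_derivative q j (v : V8) : ra q (f j) ->
  (v *m grad (fun x => rho x 0 j) q) 0 0 = v 0 (iv j) - (v *m grad (f j) q) 0 0.
Proof.
move=> fr; rewrite model_rho_coordinate (gradB (ra_coord q (iv j)) fr) mulmxBr.
by rewrite -(grad_coord q) [LHS]mxE [X in _ + X]mxE.
Qed.

Lemma model_jacobian0 (v : V8) : v *m jacobian rho 0 = \row_j v 0 (iv j).
Proof.
apply/rowP => j; rewrite (mulmx_jacobian (fun=> v) j model_ram) Dx_grad.
rewrite (model_derivative _ (model_ra j)) [RHS]mxE.
have -> : f j = fun x => s x * g j x by apply/funext.
by rewrite (gradM sr (gr j)) s0 ds0 scale0r scaler0 addr0 mulmx0 [X in _ - X]mxE subr0.
Qed.

Let D q := \det (Kw rho q).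
Let D0 : D 0 != 0 := detKw0 model_jacobian0.

Lemma model_near_det : \forall q \near (0 : V8), D q != 0.
Proof. exact: ra_neq0 (ra_detKw model_ram) D0. Qed.

Lemma model_regular : regular N rho 0.
Proof.
split; [exact: model_ram|exact: Nrho|].
by apply: filterS model_near_det => q Dq _; exact: rank_jacobian.
Qed.

Lemma model_mem0 : N 0.
Proof.
apply/(nbhs_singleton Nrho)/rowP => j.
by rewrite rhoE fE s0 mul0r subr0 !mxE.
Qed.

(** For v in T^c M, the vector v J is tangent too, so d rho_j (v J) = 0; as J carries the
    u_j-component of v to the v_j-component, this says that v u_j = (v J) f_j. *)
Lemma model_test_pair j : test_pair N rho 0 (fun x => x 0 (iu j)) (f j).
Proof.
split; [exact: ra_coord|exact: model_ra|].
apply: filterS2 (ra_near (model_ra j)) (ram_near model_ram) => q fr rr _ v vT.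
have := congr1 (fun A : 'rV[R]_3 => A 0 j) (complex_tangent_tangent (complex_tangentJ vT)).
rewrite (mulmx_jacobian (fun=> v *m J) j rr) Dx_grad (model_derivative _ fr) [RHS]mxE mulmxJ_v => /subr0_eq h.
by apply/matrixP => a b; rewrite (ord1 a) (ord1 b) grad_coord h.
Qed.

Let L1 := frame1 rho.
Let L2 := frame2 rho.
Let W3 := lie_bracket L1 L2.
Let W4 := lie_bracket L1 W3.
Let W5 := lie_bracket L2 W3.


Lemma model_section1 : section N rho 0 L1.
Proof.
split; first exact: ram_frame1 model_ram.
by apply: filterE => q _; exact: frame1_sub.
Qed.

Lemma model_section2 : section N rho 0 L2.
Proof. exact: section_rotate model_section1. Qed.

Section NearbyPoint.
Context (q : V8) (qreg : regular N rho q) (Nq : N q) (Dq : D q != 0).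
Context (s1 : section N rho q L1) (s2 : section N rho q L2).

Lemma Dx_frame X h : (X q <= complex_tangent rho q)%MS ->
  D q * Dx X h q = X q 0 ix * Dx L1 h q + X q 0 iy * Dx L2 h q.
Proof.
by move=> /(frame_span Dq); rewrite !Dx_grad; exact: combination_mulmx.
Qed.

Section LinearForm.
Context (A : 'M[R]_((1 + 3) + (1 + 3), 1)).
Context (A1 : L1 q *m A = 0) (A2 : L2 q *m A = 0) (A3 : W3 q *m A = 0).
Let u (x : V8) := (x *m A) 0 0.

Lemma ra_linear_form p : ra p u.
Proof.
apply: (@eqf_ra _ _ _ (fun x => \sum_i x 0 i * A i 0)) => [x|]; first by rewrite /u mxE.
by apply: ra_sum => i; apply: raM; [exact: ra_coord|exact: ra_cst].
Qed.

Lemma Dx_linear_form Y p : Dx Y u p = (Y p *m A) 0 0.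
Proof. by rewrite Dx_grad grad_linear. Qed.

(* On N, D X = X_x L1 + X_y L2 for every section X; differentiating this relation shows that
   a linear form which kills L1, L2 and [L1, L2] at q kills every [X, V] at q. *)
Lemma second_derivative_frame X V : section N rho q X -> section N rho q V ->
  D q ^+ 2 * Dx X (Dx V u) q =
  V q 0 ix * (X q 0 ix * Dx L1 (Dx L1 u) q + X q 0 iy * Dx L2 (Dx L1 u) q) +
  V q 0 iy * (X q 0 ix * Dx L1 (Dx L2 u) q + X q 0 iy * Dx L2 (Dx L2 u) q).
Proof.
move=> Xs Vs; have [Xr XT] := Xs; have [Vr VT] := Vs.
have [rr _ _] := qreg; have [L1r _] := s1; have [L2r _] := s2; have ur := ra_linear_form q.
have Dr : ra q D by exact: ra_detKw.
have XTq := nbhs_singleton XT Nq; have VTq := nbhs_singleton VT Nq.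
have [a aE] := seal_fun (fun x => D x * Dx V u x).
have [b bE] := seal_fun (fun x => V x 0 ix * Dx L1 u x).
have [c cE] := seal_fun (fun x => V x 0 iy * Dx L2 u x).
have [d dE] := seal_fun (fun x => b x + c x).
have Vu := ra_Dx Vr ur; have u1 := ra_Dx L1r ur; have u2 := ra_Dx L2r ur.
have ar := raME aE Dr Vu; have br := raME bE (Vr ix) u1; have cr := raME cE (Vr iy) u2.
have dr := raDE dE br cr.
have ad : \forall x \near q, N x -> a x = d x.
  apply: filterS2 VT (ra_neq0 Dr Dq) => x Vx Dx0 Nx; rewrite aE dE bE cE !Dx_linear_form.
  exact: combination_mulmx (frame_span Dx0 (Vx Nx)).
have := eq_Dx qreg Nq ar dr ad (section_tangent Xs Nq).
rewrite (DxME X aE Dr Vu) (DxDE X dE br cr) (DxME X bE (Vr ix) u1) (DxME X cE (Vr iy) u2).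
have z1 : Dx L1 u q = 0 by rewrite Dx_linear_form A1 mxE.
have z2 : Dx L2 u q = 0 by rewrite Dx_linear_form A2 mxE.
have zV : Dx V u q = 0.
  by apply: (mulfI Dq); rewrite (Dx_frame _ VTq) z1 z2 !mulr0 addr0.
rewrite z1 z2 zV !mul0r !addr0 expr2 -mulrA => ->.
have e1 := Dx_frame (Dx L1 u) XTq; have e2 := Dx_frame (Dx L2 u) XTq.
by rewrite -e1 -e2; ring.
Qed.

(** Antisymmetrizing [second_derivative_frame] in X and V leaves a multiple of L1 L2 u - L2 L1 u =
    W3 u, which vanishes at q. *)
Lemma bracket_linear_form X V : section N rho q X -> section N rho q V ->
  lie_bracket X V q *m A = 0.
Proof.
move=> Xs Vs; have [Xr _] := Xs; have [Vr _] := Vs.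
have [L1r _] := s1; have [L2r _] := s2; have ur := ra_linear_form q.
have e := Dx_lie Xr Vr ur; have e3 := Dx_lie L1r L2r ur.
have h1 := second_derivative_frame Xs Vs; have h2 := second_derivative_frame Vs Xs.
apply/matrixP => i j; rewrite (ord1 i) (ord1 j) [RHS]mxE -Dx_linear_form e.
have D2 : D q ^+ 2 != 0 by rewrite expf_neq0.
apply: (mulfI D2); rewrite mulr0 mulrBr h1 h2.
have : Dx W3 u q = 0 by rewrite Dx_linear_form A3 mxE.
rewrite e3 => /subr0_eq ->; ring.
Qed.

End LinearForm.

Let F3 := nth (fun=> 0) [:: L1; L2; W3].
Let F5 := nth (fun=> 0) [:: L1; L2; W3; W4; W5].

(** By duality: the columns of the cokernel are linear forms killing L1, L2 and W3. Testing with
    them avoids expanding X and V along the frame as fields, an expansion valid on N only. *)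
Lemma bracket_sub X V : section N rho q X -> section N rho q V ->
  (lie_bracket X V q <= \matrix_(i < 3) F3 i q)%MS.
Proof.
move=> Xs Vs; set B := \matrix_(_ < _) _.
have BF (i : 'I_3) : row i B = F3 i q by apply/rowP => j; rewrite !mxE.
have Bk (i : 'I_3) j : F3 i q *m col j (cokermx B) = 0.
  by rewrite -BF !colE mulmxA -(row_mul i B) mulmx_coker row0 mul0mx.
rewrite submxE; apply/eqP/rowP => j; rewrite [RHS]mxE.
have := bracket_linear_form (Bk 0 j) (Bk 1 j) (Bk 2 j) Xs Vs.
by move=> /(congr1 (fun A : 'M[R]_1 => A 0 0)); rewrite [RHS]mxE colE mulmxA -colE mxE.
Qed.

End NearbyPoint.

Section NormalizedModel.
Context (g1 : g 0 0 = 1) (g2 : g 1 0 = 0) (g3 : g 2 0 = 0).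
Context (dg2 : forall v : V8, (forall j, v 0 (iu j) = 0) -> (forall j, v 0 (iv j) = 0) ->
  (v *m grad (g 1) 0) 0 0 = 2 * v 0 ix).
Context (dg3 : forall v : V8, (forall j, v 0 (iu j) = 0) -> (forall j, v 0 (iv j) = 0) ->
  (v *m grad (g 2) 0) 0 0 = 2 * v 0 iy).

Let R2 := rotate L2.
Let L1r : ram 0 L1 := ram_frame1 model_ram.
Let L2r : ram 0 L2 := ram_frame2 model_ram.
Let R2r : ram 0 R2 := ram_rotate L2r.
Let W3r : ram 0 W3 := ram_lie L1r L2r.

Lemma L1_horizontal : (forall j, L1 0 0 (iu j) = 0) /\ (forall j, L1 0 0 (iv j) = 0).
Proof.
have exK : ex *m Kmx rho 0 = 0 :> 'rV[R]_(3 + 3).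
  rewrite mul_mx_row mulmxA !(model_jacobian0).
  rewrite -[RHS](@row_mx0 _ 1 3 3); congr row_mx; apply/rowP => j.
    by rewrite !mxE.
  by rewrite mxE mulmxJ_v !mxE.
have L10 : L1 0 = D 0 *: ex by rewrite /L1 /frame1 exK !mul0mx subr0.
by split=> j; rewrite L10 !mxE mulr0.
Qed.

Lemma rotate_horizontal (v : V8) : (forall j, v 0 (iu j) = 0) /\ (forall j, v 0 (iv j) = 0) ->
  (forall j, (v *m J) 0 (iu j) = 0) /\ (forall j, (v *m J) 0 (iv j) = 0).
Proof. by move=> [h1 h2]; split=> j; rewrite ?mulmxJ_u ?mulmxJ_v ?h1 ?h2 ?oppr0. Qed.

Let L2h := rotate_horizontal L1_horizontal.
Let R2h := rotate_horizontal L2h.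

Lemma R2_x : R2 0 0 ix = - D 0.
Proof. by rewrite /R2 /rotate mulmxJ_x frame2_y. Qed.
Lemma R2_y : R2 0 0 iy = 0.
Proof. by rewrite /R2 /rotate mulmxJ_y frame2_x. Qed.

Lemma model_jet2 j X Y : ram 0 X -> ram 0 Y ->
  Dx X (Dx Y (f j)) 0 = 2 * (X 0 0 ix * Y 0 0 ix + X 0 0 iy * Y 0 0 iy) * g j 0.
Proof.
by move=> Xr Yr; rewrite (jet2_sqmod_mul xr yr x0 y0 sE (fE j) Xr Yr (gr j)) !Dx_coord.
Qed.

Lemma model_jet3 j X Y Z : ram 0 X -> ram 0 Y -> ram 0 Z -> g j 0 = 0 ->
  Dx X (Dx Y (Dx Z (f j))) 0 =
  2 * ((X 0 0 ix * Y 0 0 ix + X 0 0 iy * Y 0 0 iy) * Dx Z (g j) 0 +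
       (X 0 0 ix * Z 0 0 ix + X 0 0 iy * Z 0 0 iy) * Dx Y (g j) 0 +
       (Y 0 0 ix * Z 0 0 ix + Y 0 0 iy * Z 0 0 iy) * Dx X (g j) 0).
Proof.
move=> Xr Yr Zr g0.
by rewrite (jet3_sqmod_mul xr yr x0 y0 sE (fE j) Xr Yr Zr (gr j) g0) !Dx_coord.
Qed.

(** The rotation of [L1] is [L2], and that of [L2] has z-part (- D 0, 0); the two terms of
    [bracket1] each contribute - 2 D^2 g. *)
Lemma W3_u j : W3 0 0 (iu j) = - 4 * D 0 ^+ 2 * g j 0.
Proof.
rewrite -Dx_coord (test_bracket model_regular (model_test_pair j) model_section1 model_section2 model_mem0).
rewrite /bracket1 -/R2 -/L2 (model_jet2 j L1r R2r) (model_jet2 j L2r L2r).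
by rewrite R2_x R2_y frame1_x frame1_y frame2_x frame2_y -/(D 0); ring.
Qed.

(** Since J^2 = -1, [R2] is - L1, so the right-hand side is - 8 D^2 L1 g, the counterpart of
    [W5_u]. *)
Lemma W4_u j : g j 0 = 0 ->
  W4 0 0 (iu j) = 2 * D 0 ^+ 2 * (Dx R2 (g j) 0 - 3 * Dx L1 (g j) 0).
Proof.
move=> g0; rewrite -Dx_coord.
rewrite (test_bracket2 model_regular (model_test_pair j) model_section1 model_section1 model_section2 model_mem0).
rewrite (bracket2E (model_ra j) L1r L1r L2r) -/R2 -/L2.
rewrite (model_jet3 L1r L1r R2r g0) (model_jet3 L1r L2r L2r g0) (model_jet3 L2r L1r L2r g0).
by rewrite R2_x R2_y frame1_x frame1_y frame2_x frame2_y -/(D 0); ring.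
Qed.

Lemma W5_u j : g j 0 = 0 -> W5 0 0 (iu j) = - 8 * D 0 ^+ 2 * Dx L2 (g j) 0.
Proof.
move=> g0; rewrite -Dx_coord.
rewrite (test_bracket2 model_regular (model_test_pair j) model_section2 model_section1 model_section2 model_mem0).
rewrite (bracket2E (model_ra j) L2r L1r L2r) -/R2 -/L2.
rewrite (model_jet3 L2r L1r R2r g0) (model_jet3 L2r L2r L2r g0) (model_jet3 L1r L2r R2r g0).
by rewrite R2_x R2_y frame1_x frame1_y frame2_x frame2_y -/(D 0); ring.
Qed.

Let F3 := nth (fun=> 0) [:: L1; L2; W3].
Let F5 := nth (fun=> 0) [:: L1; L2; W3; W4; W5].
Let sigma := nth ix [:: ix; iy; iu 0; iu 1; iu 2].
Let minor q : 'M[R]_5 := \matrix_(i, j) F5 i q 0 (sigma j).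

(* In the coordinates x, y, u_1, u_2, u_3 the frame is lower triangular at 0. *)
Lemma minor0 : \det (minor 0) != 0.
Proof.
have z2 : (2 : 'I_3) = Ordinal (isT : (2 < 3)%N) by apply/val_inj.
have e1 : Dx L1 (g 1) 0 = 2 * D 0 by rewrite Dx_grad (dg2 L1_horizontal.1 L1_horizontal.2) frame1_x.
have e2 : Dx R2 (g 1) 0 = - (2 * D 0) by rewrite Dx_grad (dg2 R2h.1 R2h.2) R2_x mulrN.
have e3 : Dx L1 (g 2) 0 = 0 by rewrite Dx_grad (dg3 L1_horizontal.1 L1_horizontal.2) frame1_y mulr0.
have e4 : Dx R2 (g 2) 0 = 0 by rewrite Dx_grad (dg3 R2h.1 R2h.2) R2_y mulr0.
have e5 : Dx L2 (g 2) 0 = 2 * D 0 by rewrite Dx_grad (dg3 L2h.1 L2h.2) frame2_y.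
have trig : is_trig_mx (minor 0).
  apply/is_trig_mxP => i j ij; rewrite mxE; move: i j ij.
  case=> [[|[|[|[|[|//]]]]] ip]; case=> [[|[|[|[|[|//]]]]] jp] //= _.
  - exact: frame1_y.
  - exact: L1_horizontal.1.
  - exact: L1_horizontal.1.
  - exact: L1_horizontal.1.
  - exact: L2h.1.
  - exact: L2h.1.
  - exact: L2h.1.
  - by rewrite /sigma /= W3_u g2 mulr0.
  - by rewrite /sigma /= W3_u g3 mulr0.
  - by rewrite /sigma /= (W4_u g3) e3 e4 mulr0 subr0 mulr0.
rewrite (det_trig trig); apply/prodf_neq0 => i _; rewrite mxE; move: i.
have D0' : D 0 != 0 := D0.
case=> [[|[|[|[|[|//]]]]] ip]; rewrite /F5 /sigma /=.
- by rewrite frame1_x.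
- by rewrite frame2_y.
- by rewrite W3_u g1 mulr1 mulf_neq0 ?expf_neq0 // oppr_eq0 pnatr_eq0.
- rewrite (W4_u g2) e1 e2.
  rewrite (_ : 2 * _ * _ = - 16%:R * D 0 ^+ 3); last by ring.
  by rewrite mulf_neq0 ?expf_neq0 // oppr_eq0 pnatr_eq0.
- rewrite (W5_u g3) e5.
  rewrite (_ : - 8 * _ * _ = - 16%:R * D 0 ^+ 3); last by ring.
  by rewrite mulf_neq0 ?expf_neq0 // oppr_eq0 pnatr_eq0.
Qed.

Lemma minor_near : \forall q \near (0 : V8), \det (minor q) != 0.
Proof.
apply: ra_neq0 minor0; apply: ra_det => i j.
have Fr : ram 0 (F5 i).
  case: i => [[|[|[|[|[|//]]]]] ip]; rewrite /F5 /=.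
  - exact: L1r.
  - exact: L2r.
  - exact: W3r.
  - exact: ram_lie L1r W3r.
  - exact: ram_lie L2r W3r.
by apply: eqf_ra (Fr (sigma j)) => q; rewrite mxE.
Qed.

Lemma frame5_free q : \det (minor q) != 0 -> row_free (\matrix_(i < 5) F5 i q).
Proof.
move=> d0; apply: inj_row_free => u u0.
have mu : minor q \in unitmx by rewrite unitmxE unitfE.
rewrite -[u](mulmxK mu) -[RHS](mul0mx _ (invmx (minor q))); congr (_ *m _).
apply/rowP => j; rewrite [RHS]mxE.
have := congr1 (fun A : V8 => A 0 (sigma j)) u0; rewrite [RHS]mxE => <-.
by rewrite !mxE; apply: eq_bigr => i _; rewrite !mxE.
Qed.

Lemma frame3_free q : row_free (\matrix_(i < 5) F5 i q) -> row_free (\matrix_(i < 3) F3 i q).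
Proof.
have E : (\matrix_(i < 5) F5 i q) = col_mx (\matrix_(i < 3) F3 i q) (\matrix_(i < 2) F5 (3 + i) q) :> 'M[R]_(3 + 2, _).
  apply/matrixP => i j; case: (split_ordP i) => k ->.
    by rewrite col_mxEu !mxE; case: k => [[|[|[|//]]] kp].
  by rewrite col_mxEd !mxE.
rewrite E => fr; apply: inj_row_free => u u0.
have h : row_mx u 0 *m col_mx (\matrix_(i < 3) F3 i q) (\matrix_(i < 2) F5 (3 + i) q) = 0.
  by rewrite mul_row_col u0 mul0mx addr0.
have z : row_mx u 0 = 0 :> 'rV[R]_(3 + 2) by apply: (row_free_inj fr); rewrite h mul0mx.
by rewrite -[u](@row_mxKl _ 1 3 2 u 0) z; apply/rowP => j; rewrite !mxE.
Qed.

Let good q := [/\ regular N rho q, section N rho q L1, section N rho q L2, D q != 0 & \det (minor q) != 0].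

Lemma good_near : \forall q \near (0 : V8), good q.
Proof.
have h : \forall q \near (0 : V8), D q != 0 /\ \det (minor q) != 0.
  by apply: filterS2 model_near_det minor_near => q.
have h' : \forall q \near (0 : V8), section N rho q L1 /\ section N rho q L2.
  by apply: filterS2 (section_near model_section1) (section_near model_section2) => q.
by apply: filterS3 (regular_near model_regular) h h' => q rq [? ?] [? ?].
Qed.

Lemma good_rank2 q : good q -> N q ->
  has_rank (bracket_fibre N (complex_tangent rho) 2 q) 3.
Proof.
move=> [rq s1 s2 Dq mq] Nq; have fr := frame3_free (frame5_free mq).
apply: (has_rank_frame (W := fun i : 'I_3 => F3 i)) => // [i|v vN].
  have l1 := iffRL (local_sectionE _ _ _ _) s1; have l2 := iffRL (local_sectionE _ _ _ _) s2.
  case: i => [[|[|[|//]]] ip].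
  - by exists 0%N.
  - by exists 0%N.
  - by exists 1%N => //; exists L1, L2.
set B := \matrix_(_ < _) _.
have BF (i : 'I_3) : row i B = F3 i q by apply/rowP => j; rewrite !mxE.
rewrite submxE; apply/eqP; apply: bracket_fibre_ker vN => l W.
case: l => [|[|//]] _.
  move=> /local_sectionE[_ /nbhs_singleton /(_ Nq)] Ws; apply/eqP; rewrite -submxE.
  have := frame_span Dq Ws; rewrite -/L1 -/L2 -[L1 q](BF 0) -[L2 q](BF 1) => e.
  rewrite -[W q](scalerK Dq) [D q *: W q]e; apply: scalemx_sub.
  by apply: addmx_sub; apply: scalemx_sub; exact: row_sub.
move=> [X [V [/local_sectionE Xs /local_sectionE Vs ->]]]; apply/eqP; rewrite -submxE.
exact: bracket_sub.
Qed.

Lemma iterated_tangent q l W : regular N rho q -> N q -> (l < 3)%N ->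
  iterated_bracket N (complex_tangent rho) q l W -> W q *m jacobian rho q = 0.
Proof.
move=> rq Nq; case: l => [|[|[|//]]] _.
- by move=> /local_sectionE Ws; exact: section_tangent Ws Nq.
- by move=> [X [V [/local_sectionE Xs /local_sectionE Vs ->]]]; exact: bracket_tangent rq Xs Vs Nq.
- move=> [X [V [/local_sectionE Xs [Y [Z [/local_sectionE Ys /local_sectionE Zs ->]]] ->]]].
  exact: bracket2_tangent rq Xs Ys Zs Nq.
Qed.

(** The upper bound needs no relation between triple brackets: all brackets involved are tangent to
    N, and the five independent ones already fill the tangent space of dimension 5. *)
Lemma good_rank3 q : good q -> N q ->
  has_rank (bracket_fibre N (complex_tangent rho) 3 q) 5.
Proof.
move=> [rq s1 s2 Dq mq] Nq; have fr := frame5_free mq.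
have Fb (i : 'I_5) : exists2 l, (l < 3)%N & iterated_bracket N (complex_tangent rho) q l (F5 i).
  have l1 := iffRL (local_sectionE _ _ _ _) s1; have l2 := iffRL (local_sectionE _ _ _ _) s2.
  have l3 : iterated_bracket N (complex_tangent rho) q 1 W3.
    by exists L1, L2; split; [exact: l1|exact: l2|].
  have l4 : iterated_bracket N (complex_tangent rho) q 2 W4.
    by exists L1, W3; split; [exact: l1|exact: l3|].
  have l5 : iterated_bracket N (complex_tangent rho) q 2 W5.
    by exists L2, W3; split; [exact: l2|exact: l3|].
  case: i => [[|[|[|[|[|//]]]]] ip]; rewrite /F5 /=.
  - by exists 0%N; [|exact: l1].
  - by exists 0%N; [|exact: l2].
  - by exists 1%N; [|exact: l3].
  - by exists 2%N; [|exact: l4].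
  - by exists 2%N; [|exact: l5].
apply: (has_rank_frame (W := fun i : 'I_5 => F5 i)) => // v vN.
have vT : (v <= tangent rho q)%MS.
  rewrite sub_tangent; apply/eqP; apply: bracket_fibre_ker vN => l W.
  exact: iterated_tangent.
apply: submx_trans vT _; set B := \matrix_(_ < _) _.
have BT : (B <= tangent rho q)%MS.
  apply/row_subP => i; rewrite sub_tangent; apply/eqP.
  have [l lk Wl] := Fb i; rewrite -(iterated_tangent rq Nq lk Wl); congr (_ *m _).
  by apply/rowP => j; rewrite !mxE.
by rewrite -(mxrank_leqif_sup BT).2 (rank_tangent Dq); move: fr; rewrite /row_free => /eqP ->.
Qed.

Lemma model_maximally_minimal :
  [/\ local_equation M rho, CR_generic M rho & maximally_minimal M rho].
Proof.
have E0 : M 0.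
  have := model_mem0; rewrite /preimage /=; congr M.
  by apply/rowP => j; rewrite !mxE.
split.
- split; [exact: E0| |exact: Nrho|].
    exact: (iffRL (ram_analytic _ _) model_ram).
  by apply: filterS model_near_det => q Dq _; exact: rank_jacobian.
- by apply: filterS model_near_det => q Dq _; exact: generic_at.
apply: filterS good_near => q gq Nq; split; [|exact: good_rank2|exact: good_rank3].
by have [_ _ _ Dq _] := gq; exact: rank_complex_tangent.
Qed.

End NormalizedModel.
End RealModel.

(** * First-order data from estimates along rays *)

Section FirstOrder.
Context {R : realType}.

Lemma small_affine_eq0 (a b : R) :
  (forall e, 0 < e -> exists2 r, 0 < r & forall t, 0 < t < r -> `|a + t * b| <= e * t) ->
  a = 0 /\ b = 0.
Proof.
move=> h; have a0 : a = 0.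
  apply/eqP; apply: contraT => an; have [r r0 rh] := h 1 ltr01.
  have A0 : 0 < `|a| by rewrite normr_gt0.
  have B0 : 0 < 2 * (1 + `|b|) by rewrite mulr_gt0 // ltr_pwDl.
  pose t := Num.min (r / 2) (`|a| / (2 * (1 + `|b|))).
  have t0 : 0 < t by rewrite lt_min !divr_gt0.
  have tr : t < r by rewrite /t gt_min ltr_pdivrMr // ltr_pMr // ltr1n.
  have tA : t * (2 * (1 + `|b|)) <= `|a| by rewrite -ler_pdivlMr // ge_min lexx orbT.
  have := rh t; rewrite t0 tr => /(_ isT); rewrite mul1r => h1.
  have : `|a| <= `|a + t * b| + `|t * b|.
    by rewrite -{1}[a](addrK (t * b)) ler_normB.
  by rewrite normrM (gtr0_norm t0) => h2; exfalso; nra.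
split=> //; apply/eqP; rewrite -normr_le0; apply/ler_addgt0Pr => e /h[r r0 rh].
have := rh (r / 2); rewrite divr_gt0 // ltr_pdivrMr // ltr_pMr // ltr1n => /(_ isT).
rewrite a0 !add0r normrM gtr0_norm ?divr_gt0 // mulrC ler_pM2r //; exact: divr_gt0.
Qed.

(** Estimates on the open ray t > 0 determine both the value at 0 and the derivative; this suits
    bounds obtained after division by |z|^2. *)
Lemma directional_derivative_unique n (g : 'rV[R]_n -> R) (v : 'rV[R]_n) (b a : R) : ra 0 g ->
  (forall e, 0 < e -> exists2 r, 0 < r & forall t, 0 < t < r -> `|g (t *: v) - b - t * a| <= e * t) ->
  g 0 = b /\ (v *m grad g 0) 0 0 = a.
Proof.
move=> gr gK; have gd := grad_rsd gr.
have dE : (v *m grad g 0) 0 0 = \sum_i v 0 i * grad g 0 i 0 by rewrite mxE.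
have [e1 e2] : g 0 - b = 0 /\ (v *m grad g 0) 0 0 - a = 0; last by rewrite (subr0_eq e1) (subr0_eq e2).
apply: small_affine_eq0 => e e0.
have N0 : 0 <= nrm (rc v) by exact: nrm_ge0.
have f0 : 0 < e / (2 * (1 + nrm (rc v))) by rewrite divr_gt0 // mulr_gt0 // ltr_pwDl.
have [s s0 sP] := gd _ f0.
have [r r0 rP] := gK (e / 2) (divr_gt0 e0 (ltr0n _ 2)).
pose u := Num.min r (s / (1 + nrm (rc v))).
have u0 : 0 < u by rewrite !lt_min r0 divr_gt0 ?ltr_pwDl.
exists u => // t /andP[t0 tu].
have tr : t < r by apply: lt_le_trans tu _; rewrite !ge_min lexx.
have ts : t * (1 + nrm (rc v)) < s.
  by rewrite -ltr_pdivlMr ?ltr_pwDl //; apply: lt_le_trans tu _; rewrite !ge_min lexx orbT.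
have nv : nrm (rc (t *: v)) = t * nrm (rc v) by rewrite rcZ nrmZ cn_real gtr0_norm.
have p1 : pd (rc 0) s (rc (t *: v)).
  by apply: nrm_pd; rewrite -rcB subr0 nv; nra.
have := sP _ _ p1 (pd_center (rc 0) s0); rewrite subr0 nv.
have -> : \sum_i ((t *: v) 0 i - (0 : 'rV[R]_n) 0 i) * grad g 0 i 0 = t * (v *m grad g 0) 0 0.
  by rewrite dE mulr_sumr; apply: eq_bigr => i _; rewrite !mxE subr0 mulrA.
have := rP t; rewrite t0 tr => /(_ isT).
set G := (v *m grad g 0) 0 0; set y := g (t *: v) => h1 h2.
have -> : g 0 - b + t * (G - a) = (y - b - t * a) - (y - g 0 - t * G) by ring.
apply: le_trans (ler_normB _ _) _.
have h3 : e / (2 * (1 + nrm (rc v))) * (t * nrm (rc v)) <= e * t / 2.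
  rewrite mulrAC ler_pdivrMr ?mulr_gt0 ?ltr_pwDl //.
  by have := mulr_gt0 e0 t0; nra.
lra.
Qed.

Lemma first_order_unique n (g : 'rV[R]_n -> R) (v : 'rV[R]_n) (b a K r : R) : ra 0 g -> 0 < r ->
  (forall t, 0 < t < r -> `|g (t *: v) - b - t * a| <= K * t ^+ 2) ->
  g 0 = b /\ (v *m grad g 0) 0 0 = a.
Proof.
move=> gr r0 gK; apply: (directional_derivative_unique gr) => e e0.
have K1 : 0 < `|K| + 1 by rewrite ltr_wpDl.
exists (Num.min r (e / (`|K| + 1))); first by rewrite lt_min r0 divr_gt0.
move=> t /andP[t0]; rewrite lt_min ltr_pdivlMr // => /andP[tr te].
apply: le_trans (gK t _) _; first by rewrite t0.
have := ler_norm K; rewrite expr2 mulrA ler_pM2r //; nra.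
Qed.

End FirstOrder.

(** * Complexified points and the reality condition *)

Section Triples.
Context {R : realType}.
Local Notation C := R[i].
Local Notation vec := 'rV[C]_(1 + (1 + 3)).
Local Notation V8 := 'rV[R]_((1 + 3) + (1 + 3)).

Lemma holom_triple n (p : 'rV[C]_n) f g (W : 'rV[C]_n -> 'rV[C]_3) : holo p f -> holo p g -> holom p W ->
  holom p (fun x => triple (f x) (g x) (W x)).
Proof.
move=> fh gh Wh; apply: holom_row_mx; first by move=> j; apply: eqf_holo fh => x; rewrite (ord1 j) mxE mulr1n.
by apply: holom_row_mx Wh; move=> j; apply: eqf_holo gh => x; rewrite (ord1 j) mxE mulr1n.
Qed.

Lemma holom_omega n m (p : 'rV[C]_(1 + (n + m))) : holom p (fun x => rsubmx (rsubmx x)).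
Proof.
move=> j; apply: eqf_holo (holo_coord p (rshift 1 (rshift n j))) => x.
by rewrite !mxE.
Qed.

Lemma cvec_triple z zeta w : cvec (triple z zeta w) = triple z^* zeta^* (cvec w) :> vec.
Proof.
rewrite /triple !cvec_row_mx; congr row_mx; last congr row_mx.
  by apply/matrixP => i j; rewrite (ord1 i) (ord1 j) !mxE.
by apply/matrixP => i j; rewrite (ord1 i) (ord1 j) !mxE.
Qed.

Definition swap (x : vec) : vec := triple (x 0 zetai) (x 0 zi) (rsubmx (rsubmx x)).

Lemma holom_swap p : holom p swap.
Proof. by apply: holom_triple; [exact: holo_coord|exact: holo_coord|exact: holom_omega]. Qed.

Lemma swap0 : swap 0 = 0.
Proof. by rewrite /swap !mxE !raddf0 triple0. Qed.

(** Taylor coefficients determine a germ, so the conjugate series is necessarily the germ obtained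
    by conjugating argument and value of [Theta]. *)
Lemma reality_conditionP (Theta : vec -> 'rV[C]_3) : holom 0 Theta ->
  reality_condition Theta <-> \forall x \near (0 : vec),
    rsubmx (rsubmx x) = Theta (triple (x 0 zi) (x 0 zetai) (cvec (Theta (cvec (swap x))))).
Proof.
move=> Th; split=> [[Tb TbT h]|h].
  have e : \forall x \near (0 : vec), forall j, Tb x 0 j = (Theta (cvec x) 0 j)^*.
    by apply: near_all => j; have [c [c1 c2]] := TbT j; exact: taylor_unique c2 (taylor_conj c1).
  have e' : \forall x \near (0 : vec), Tb (swap x) = cvec (Theta (cvec (swap x))).
    have := near_holo (p := 0 : vec) (P := fun x => forall j, Tb x 0 j = (Theta (cvec x) 0 j)^*) (@holom_swap 0).
    by rewrite swap0 => /(_ e); apply: filterS => x ex; apply/rowP => j; rewrite ex mxE.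
  by apply: filterS2 h e' => x; rewrite /= zcE zetaE => hx ex; rewrite {1}hx -ex.
exists (fun x => cvec (Theta (cvec x))).
  move=> j; have [c cT] := iffRL (holo_analytic _ _) (Th j); exists c; split; first exact: cT.
  have := taylor_conj cT; congr taylor_series; apply/funext => x.
  by rewrite [RHS]mxE.
by apply: filterS h => x; rewrite /= zcE zetaE.
Qed.

Definition conj_point (p : 'rV[C]_(1 + 3)) : vec := triple (zcoord p) (zcoord p)^* (cvec (wcoord p)).

Lemma defining_equationsP (Pi : vec -> 'rV[C]_3) p :
  defining_equations Pi p <-> wcoord p = solved_rhs Pi (conj_point p).
Proof.
rewrite /defining_equations /solved_rhs /conj_point !triple_w zcE zetaE triple_z triple_zeta.
move: (zcoord _) (wcoord _) => z w.
split=> [e|e]; first by rewrite -addrA -e addrCA subrr addr0.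
by apply/eqP; rewrite subr_eq [X in _ == X]addrC addrA -e.
Qed.

Definition diagonal_point (q : V8) : vec := conj_point (complex_point q).

Lemma ran_z p : ran p (fun q : V8 => zcoord (complex_point q)).
Proof. by apply: eqf_ran (ranm_complex_point p (lshift 3 0)) => q; rewrite /zcoord [RHS]mxE. Qed.

Lemma ranm_w p : ranm p (fun q : V8 => wcoord (complex_point q)).
Proof. by move=> j; apply: eqf_ran (ranm_complex_point p (rshift 1 j)) => q; rewrite /wcoord [RHS]mxE. Qed.

Lemma ranm_triple n (p : 'rV[R]_n) f g (W : 'rV[R]_n -> 'rV[C]_3) : ran p f -> ran p g -> ranm p W ->
  ranm p (fun x => triple (f x) (g x) (W x)).
Proof.
move=> fh gh Wh; apply: ranm_row_mx; first by move=> j; apply: eqf_ran fh => x; rewrite (ord1 j) mxE mulr1n.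
by apply: ranm_row_mx Wh; move=> j; apply: eqf_ran gh => x; rewrite (ord1 j) mxE mulr1n.
Qed.

Lemma ranm_diagonal p : ranm p diagonal_point.
Proof.
apply: ranm_triple; [exact: ran_z|exact: ran_conj (ran_z p)|].
exact: ranm_conj (ranm_w p).
Qed.

Lemma diagonal0 : diagonal_point 0 = 0.
Proof.
rewrite /diagonal_point /conj_point complex_point0 /zcoord /wcoord !raddf0 mxE rmorph0.
by rewrite cvec0 triple0.
Qed.

Lemma zcoord_complex_point (q : V8) : zcoord (complex_point q) = (q 0 ix +i* q 0 iy)%C.
Proof. by rewrite /zcoord !mxE. Qed.

Lemma wcoord_complex_point (q : V8) j : wcoord (complex_point q) 0 j = (q 0 (iu j) +i* q 0 (iv j))%C.
Proof. by rewrite /wcoord !mxE. Qed.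

End Triples.

(** * From the complex equations to real ones *)

Section Converse.
Context {R : realType}.
Local Notation C := R[i].
Local Notation vec := 'rV[C]_(1 + (1 + 3)).
Local Notation V8 := 'rV[R]_((1 + 3) + (1 + 3)).

Definition model_factor (j : 'I_3) (z zeta : C) : C :=
  [:: 2 * 'i; 2 * 'i * (z + zeta); 2 * (z - zeta)]`_j.

Lemma cubic_modelE j z zeta : cubic_model z zeta 0 j = z * zeta * model_factor j z zeta :> C.
Proof. by rewrite mxE /model_factor; case: j => [[|[|[|//]]] jp] /=; ring. Qed.

Lemma holo_model_factor j p : holo p (fun x : vec => model_factor j (x 0 zi) (x 0 zetai)).
Proof.
have hz := holo_coord p zi; have hzeta := holo_coord p zetai.
rewrite /model_factor; case: j => [[|[|[|//]]] jp] /=.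
- exact: holo_cst.
- by apply: holoM; [exact: holo_cst|exact: holoD].
- by apply: holoM; [exact: holo_cst|exact: holoB].
Qed.

Lemma holom_solved_rhs (Pi : vec -> 'rV[C]_3) : holom 0 Pi -> holom 0 (solved_rhs Pi).
Proof.
move=> Pih; apply: holomD Pih; apply: holomD; first exact: holom_omega.
move=> j; apply: (@eqf_holo _ _ _ (fun x : vec => x 0 zi * x 0 zetai * model_factor j (x 0 zi) (x 0 zetai))).
  by move=> x; rewrite cubic_modelE zcE zetaE.
by apply: holoM; [apply: holoM; exact: holo_coord|exact: holo_model_factor].
Qed.

(* If F = w - Theta(z, zbar, wbar) is real, the reality condition evaluated at
   (z, zbar, w) bounds 2 F by |z|^2 times the variation of (Theta - wbar) / |z|^2
   over a displacement of size |F|. *)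
Lemma real_defect_eq0 (Theta : vec -> 'rV[C]_3) (k : 'I_3 -> vec -> C) :
  holom 0 Theta -> (forall j, holo 0 (k j)) ->
  (\forall x \near (0 : vec), forall j, Theta x 0 j = rsubmx (rsubmx x) 0 j + x 0 zi * x 0 zetai * k j x) ->
  reality_condition Theta ->
  \forall q \near (0 : V8), let F := wcoord (complex_point q) - Theta (diagonal_point q) in
    cvec F = F -> F = 0.
Proof.
move=> Th kh TE /(iffLR (reality_conditionP Th)) re.
have T0 : Theta 0 = 0.
  by apply/rowP => j; rewrite (nbhs_singleton TE) !mxE !mul0r addr0.
have tr := ranm_diagonal (0 : V8).
(* The diagonal point with wbar replaced by the conjugate of Theta. When F is real, the two points
   differ by F in the last block only. *)
pose tau' (q : V8) : vec := let p := complex_point q in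
  triple (zcoord p) (zcoord p)^* (cvec (Theta (diagonal_point q))).
have tr' : ranm 0 tau'.
  apply: ranm_triple; [exact: ran_z|exact: ran_conj (ran_z _)|].
  by apply/ranm_conj/(ranm_comp tr); rewrite diagonal0.
have tau'0 : tau' 0 = 0.
  rewrite /tau' diagonal0 T0 complex_point0 /zcoord raddf0 mxE rmorph0.
  by rewrite cvec0 triple0.
(* Here w itself, not its conjugate, fills the third slot: the reality condition at this triple
   reads w = Theta([tau' q]). *)
pose sg (q : V8) : vec := let p := complex_point q in triple (zcoord p) (zcoord p)^* (wcoord p).
have sgr : ranm 0 sg.
  by apply: ranm_triple; [exact: ran_z|exact: ran_conj (ran_z _)|exact: ranm_w].
have sg0 : sg 0 = 0.
  by rewrite /sg complex_point0 /zcoord /wcoord !raddf0 mxE rmorph0 triple0.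
have [L [r [L0 r0 kL]]] : exists L r : R, [/\ 0 < L, 0 < r & forall j x y,
    pd 0 r x -> pd 0 r y -> cn (k j x - k j y) <= L * nrm (x - y)].
  have H j : exists Lr : R * R, [/\ 0 < Lr.1, 0 < Lr.2 & forall x y,
      pd 0 Lr.2 x -> pd 0 Lr.2 y -> cn (k j x - k j y) <= Lr.1 * nrm (x - y)].
    by have [L [r [? ? ?]]] := holo_lipschitz (kh j); exists (L, r).
  have [a aP] := choice H.
  exists (\sum_j (a j).1), (Num.min (a 0).2 (Num.min (a 1).2 (a 2).2)).
  have rj j : Num.min (a 0).2 (Num.min (a 1).2 (a 2).2) <= (a j).2.
    have z2 : (2 : 'I_3) = Ordinal (isT : (2 < 3)%N) by apply/val_inj.
    case: j => [[|[|[|//]]] jp].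
    - by rewrite (_ : Ordinal jp = 0) ?ge_min ?lexx //; apply/val_inj.
    - by rewrite (_ : Ordinal jp = 1) ?ge_min ?lexx ?orbT //; apply/val_inj.
    - by rewrite (_ : Ordinal jp = 2) ?ge_min ?lexx ?orbT //; apply/val_inj.
  have a1 j : 0 < (a j).1 by have [] := aP j.
  split.
  - by rewrite (bigD1 0) //= ltr_pwDl // sumr_ge0 // => j _; exact: ltW.
  - by rewrite !lt_min; have [_ -> _] := aP 0; have [_ -> _] := aP 1; have [_ -> _] := aP 2.
  - move=> j x y px py; have [_ _ h] := aP j.
    apply: le_trans (h x y (pdS (rj j) px) (pdS (rj j) py)) _.
    rewrite ler_wpM2r ?nrm_ge0 // (bigD1 j) //= lerDl sumr_ge0 // => i _; exact: ltW.
have n1 : \forall q \near (0 : V8), (forall j, Theta (diagonal_point q) 0 j =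
    rsubmx (rsubmx (diagonal_point q)) 0 j + diagonal_point q 0 zi * diagonal_point q 0 zetai * k j (diagonal_point q))
    /\ pd 0 r (diagonal_point q).
  have p1 := iffRL (near_pd (0 : vec) _) (ex_intro2 _ _ r r0 (fun x h => h)).
  apply: (ranm_near_comp (P := fun x => (forall j, Theta x 0 j =
    rsubmx (rsubmx x) 0 j + x 0 zi * x 0 zetai * k j x) /\ pd 0 r x) tr).
  by rewrite diagonal0; apply: filterS2 TE p1.
have n2 : \forall q \near (0 : V8), (forall j, Theta (tau' q) 0 j =
    rsubmx (rsubmx (tau' q)) 0 j + tau' q 0 zi * tau' q 0 zetai * k j (tau' q)) /\ pd 0 r (tau' q).
  have p1 := iffRL (near_pd (0 : vec) _) (ex_intro2 _ _ r r0 (fun x h => h)).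
  apply: (ranm_near_comp (P := fun x => (forall j, Theta x 0 j =
    rsubmx (rsubmx x) 0 j + x 0 zi * x 0 zetai * k j x) /\ pd 0 r x) tr').
  by rewrite tau'0; apply: filterS2 TE p1.
have n3 : \forall q \near (0 : V8), wcoord (complex_point q) = Theta (tau' q).
  have := ranm_near_comp (P := fun x : vec => rsubmx (rsubmx x) =
    Theta (triple (x 0 zi) (x 0 zetai) (cvec (Theta (cvec (swap x)))))) sgr.
  rewrite sg0 => /(_ re); apply: filterS => q.
  by rewrite triple_w triple_z triple_zeta /swap triple_w triple_z triple_zeta cvec_triple conjCK.
(* The three component bounds add up to 2 |F| <= 3 L |z|^2 |F|, so this smallness forces F = 0. The
   minimum with 1 allows |z|^2 to be bounded by |z|. *)
have n4 : \forall q \near (0 : V8), 3 * L * cn (zcoord (complex_point q)) ^+ 2 < 1.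
  have e0 : 0 < Num.min 1 (1 / (3 * L)) by rewrite lt_min ltr01 divr_gt0 // mulr_gt0.
  have zh : holo 0 (fun x : 'rV[C]_(1 + 3) => zcoord x).
    by apply: eqf_holo (holo_coord 0 (lshift 3 0)) => x; rewrite /zcoord mxE.
  have [d d0 dP] := holo_cont zh e0.
  have p1 := iffRL (near_pd (0 : 'rV[C]_(1 + 3)) _) (ex_intro2 _ _ d d0 dP).
  have := ranm_near_comp (P := fun x : 'rV[C]_(1 + 3) => cn (zcoord x - zcoord 0) < Num.min 1 (1 / (3 * L)))
    (ranm_complex_point (0 : V8)).
  rewrite complex_point0 => /(_ p1); apply: filterS => q.
  rewrite [zcoord 0]/zcoord raddf0 mxE subr0 lt_min ltr_pdivlMr ?mulr_gt0 // => /andP[].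
  by have := cn_ge0 (zcoord (complex_point q)); nra.
have n12 : \forall q \near (0 : V8), wcoord (complex_point q) = Theta (tau' q) /\
    3 * L * cn (zcoord (complex_point q)) ^+ 2 < 1 by apply: filterS2 n3 n4.
apply: filterS3 n1 n2 n12 => q [h1 p1] [h2 p2] [h3 h4] /=; set F := _ - _ => FR.
set p := complex_point q in F FR h1 h2 h3 h4 *.
have TF : cvec (Theta (diagonal_point q)) = cvec (wcoord p) - F.
  by rewrite -FR /F cvecB opprB addrC subrK.
have dist : diagonal_point q - tau' q = triple 0 0 F.
  rewrite /tau' -/p TF /diagonal_point /conj_point -/p /triple !opp_row_mx !add_row_mx.
  by rewrite !subrr opprB addrCA subrr addr0 raddf0.
have Fj j : 2 * F 0 j = zcoord p * (zcoord p)^* * (k j (tau' q) - k j (diagonal_point q)).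
  have e1 := h1 j; have e2 := h2 j.
  have : F 0 j = wcoord p 0 j - Theta (diagonal_point q) 0 j by rewrite /F !mxE.
  rewrite {1}h3 e1 e2 {1 2 3}/diagonal_point {1 2 3}/conj_point {1 2 3}/tau' -/p !triple_z !triple_zeta !triple_w TF.
  rewrite [(_ - F) 0 j]mxE [(- F) 0 j]mxE => e; rewrite mulr_natl mulr2n {1}e; ring.
apply: nrm_eq0; apply/eqP; rewrite eq_le nrm_ge0 andbT.
have Fn j : 2 * cn (F 0 j) <= cn (zcoord p) ^+ 2 * (L * nrm F).
  have -> : 2 * cn (F 0 j) = cn (2 * F 0 j) by rewrite cnM cn_nat.
  rewrite Fj !cnM cn_conj expr2 ler_wpM2l ?mulr_ge0 ?cn_ge0 //.
  apply: le_trans (kL j _ _ p2 p1) _; rewrite nrm_distC dist /triple !nrm_row_mx.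
  by rewrite raddf0 !nrm0 !add0r.
have : 2 * nrm F <= 3 * (cn (zcoord p) ^+ 2 * (L * nrm F)).
  rewrite /nrm mulr_sumr; apply: le_trans (ler_sum _ (fun j _ => Fn j)) _.
  by rewrite sumr_const card_ord mulr_natl.
by have := nrm_ge0 F; nra.
Qed.

End Converse.

Section ConverseTheorem.
Context {R : realType}.
Local Notation C := R[i].
Local Notation vec := 'rV[C]_(1 + (1 + 3)).
Local Notation V8 := 'rV[R]_((1 + 3) + (1 + 3)).

Lemma diagonal_horizontal t (v : V8) : (forall j, v 0 (iu j) = 0) -> (forall j, v 0 (iv j) = 0) ->
  diagonal_point (t *: v) = triple (t%:C%C * zcoord (complex_point v)) (t%:C%C * zcoord (complex_point v))^* 0.
Proof.
move=> hu hv; rewrite /diagonal_point /conj_point complex_pointZ.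
have -> : zcoord (t%:C%C *: complex_point v) = t%:C%C * zcoord (complex_point v) by rewrite /zcoord !mxE.
have -> : wcoord (t%:C%C *: complex_point v) = 0; last by rewrite cvec0.
have w0 : wcoord (complex_point v) = 0.
  by apply/rowP => j; rewrite wcoord_complex_point hu hv mxE.
apply/rowP => j; have := congr1 (fun A : 'rV[C]_3 => A 0 j) w0.
by rewrite /wcoord !mxE => ->; rewrite mulr0.
Qed.

Lemma admissible_maximally_minimal (Pi : vec -> 'rV[C]_3) : admissible_remainder Pi ->
  maximally_minimal_CR_generic_M5 [set p | defining_equations Pi p].
Proof.
move=> [/holom_analytic Pih order re nP].
have [h [hh hP]] := normal_factor Pih nP.
have [K [r0 [K0 r00 hK]]] := remainder_bound hP order.
pose k (j : 'I_3) (x : vec) := model_factor j (x 0 zi) (x 0 zetai) + h j x.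
have kh j : holo 0 (k j) by apply: holoD; [exact: holo_model_factor|exact: hh].
have TE : \forall x \near (0 : vec), forall j,
    solved_rhs Pi x 0 j = rsubmx (rsubmx x) 0 j + x 0 zi * x 0 zetai * k j x.
  apply: filterS hP => x hx j; rewrite [LHS]mxE [X in X + _ = _]mxE cubic_modelE hx zcE zetaE.
  by rewrite /k mulrDr addrA.
have defect := real_defect_eq0 (holom_solved_rhs Pih) kh TE re.
(* The imaginary part of w - wbar - |z|^2 k is 2 Im w - |z|^2 Im k, whence the division by 2. *)
pose g (j : 'I_3) (q : V8) : R := complex.Im (k j (diagonal_point q)) / 2.
have gr j : ra 0 (g j).
  apply: raM; last exact: ra_cst.
  by apply: ra_Im; apply: (ran_comp (ranm_diagonal _)); rewrite diagonal0; exact: kh.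
pose s (q : V8) : R := q 0 ix ^+ 2 + q 0 iy ^+ 2.
pose f (j : 'I_3) (q : V8) : R := s q * g j q.
pose rho (q : V8) : 'rV[R]_3 := \row_j (q 0 (iv j) - f j q).
have rhoE q j : rho q 0 j = q 0 (iv j) - f j q by rewrite mxE.
have TEq : \forall q \near (0 : V8), forall j, solved_rhs Pi (diagonal_point q) 0 j =
    rsubmx (rsubmx (diagonal_point q)) 0 j +
    diagonal_point q 0 zi * diagonal_point q 0 zetai * k j (diagonal_point q).
  have := ranm_near_comp (P := fun x => forall j, solved_rhs Pi x 0 j =
    rsubmx (rsubmx x) 0 j + x 0 zi * x 0 zetai * k j x) (ranm_diagonal (0 : V8)).
  by rewrite diagonal0; apply.
have Nrho : \forall q \near (0 : V8), (@complex_point R (1 + 3) @^-1` [set p | defining_equations Pi p]) q <-> rho q = 0.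
  apply: filterS2 defect TEq => q; set F := _ - _ => FR Tq.
  have NF : (@complex_point R (1 + 3) @^-1` [set p | defining_equations Pi p]) q <-> F = 0.
    rewrite /preimage /= defining_equationsP -/(diagonal_point q) /F.
    by split=> [->|/subr0_eq //]; rewrite subrr.
  have ImF j : complex.Im (F 0 j) = 2 * rho q 0 j.
    have -> : F 0 j = wcoord (complex_point q) 0 j - solved_rhs Pi (diagonal_point q) 0 j by rewrite !mxE.
    rewrite Tq rhoE /f /s /g; move: (k j _) => kq.
    rewrite /diagonal_point /conj_point triple_w triple_z triple_zeta [cvec _ 0 _]mxE zcoord_complex_point wcoord_complex_point.
    by case: kq => a b /=; field.
  rewrite NF; split=> [F0|r0'].
    apply/rowP => j; have := ImF j; rewrite F0 ![(0 : 'rV[_]_3) 0 j]mxE /= => /esym/eqP.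
    by rewrite mulf_eq0 pnatr_eq0 /= => /eqP.
  apply: FR; apply/rowP => j; rewrite mxE; have := ImF j.
  rewrite r0' [(0 : 'rV[_]_3) 0 j]mxE mulr0; case: (F 0 j) => a b /= ->.
  by apply/eqP; rewrite eq_complex /= oppr0 !eqxx.
exists rho.
(* On rays with w = 0 the quotient h is O(|z|^2), so that g has the first-order jet of the model: 1,
   2 x and 2 y are half the imaginary parts of 2i, 2i(z + zbar) and 2(z - zbar). *)
have values j (v : V8) : (forall j, v 0 (iu j) = 0) -> (forall j, v 0 (iv j) = 0) ->
    zcoord (complex_point v) != 0 ->
    g j 0 = [:: 1; 0; 0]`_j /\ (v *m grad (g j) 0) 0 0 = [:: 0; 2 * v 0 ix; 2 * v 0 iy]`_j.
  move=> hu hv nu0; set nu := zcoord _ in nu0.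
  apply: (first_order_unique (K := K * cn nu ^+ 2) (r := r0 / cn nu) (gr j)).
    by rewrite divr_gt0 // cn_gt0.
  move=> t /andP[t0]; rewrite ltr_pdivlMr ?cn_gt0 // => tr.
  have tnu : cn (t%:C%C * nu) = t * cn nu by rewrite cnM cn_real gtr0_norm.
  have tn0 : t%:C%C * nu != 0 by rewrite -cn_gt0 tnu mulr_gt0 // cn_gt0.
  have := hK (t%:C%C * nu) j tn0; rewrite tnu => /(_ tr) hb.
  rewrite /g /k (diagonal_horizontal t hu hv) -/nu triple_z triple_zeta.
  set hx := h j _ in hb *.
  have -> : complex.Im (model_factor j (t%:C%C * nu) (t%:C%C * nu)^* + hx) / 2 - [:: 1; 0; 0]`_j -
      t * [:: 0; 2 * v 0 ix; 2 * v 0 iy]`_j = complex.Im hx / 2.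
    rewrite /nu zcoord_complex_point /model_factor.
    by case: (hx) => a b; case: j {hb hx} => [[|[|[|//]]] jp] /=; field.
  rewrite normrM; have := Im_le_cn hx; have := normr_ge0 (complex.Im hx).
  have -> : `|2^-1| = 2^-1 :> R by rewrite gtr0_norm // invr_gt0.
  by lra.
have valuesD j (v : V8) : (forall j, v 0 (iu j) = 0) -> (forall j, v 0 (iv j) = 0) ->
    (v *m grad (g j) 0) 0 0 = [:: 0; 2 * v 0 ix; 2 * v 0 iy]`_j.
  move=> hu hv; have [nu0|nu0] := eqVneq (zcoord (complex_point v)) 0; last by exact: (values j v hu hv nu0).2.
  move: nu0 => /eqP; rewrite zcoord_complex_point eq_complex /= => /andP[/eqP vx /eqP vy].
  have -> : v = 0 by apply: row8P => [||i|i]; rewrite ?vx ?vy ?hu ?hv mxE.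
  by rewrite mul0mx !mxE; case: j => [[|[|[|//]]] jp] /=; rewrite ?mulr0.
have exh : (forall j, (ex : V8) 0 (iu j) = 0) /\ (forall j, (ex : V8) 0 (iv j) = 0).
  by split=> j; rewrite mxE.
have exn : zcoord (complex_point (ex : V8)) != 0.
  by rewrite zcoord_complex_point eq_complex /= !mxE !eqxx /= oner_eq0.
have gv j := (values j ex exh.1 exh.2 exn).1.
apply: (model_maximally_minimal gr (fun=> erefl) (fun _ _ => erefl) rhoE Nrho).
- exact: (gv 0).
- exact: (gv 1).
- exact: (gv 2).
- by move=> v hu hv; exact: (valuesD 1 v hu hv).
- by move=> v hu hv; exact: (valuesD 2 v hu hv).
Qed.

End ConverseTheorem.

(** * Complex defining equations and normal coordinates *)

Section GenericRank.
Context {R : realType}.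
Local Notation C := R[i].
Local Notation mc := (map_mx (real_complex R)).

(** Genericity as complex independence of the holomorphic differentials, half of Ax - i Ay. If this
    matrix kills c1 + i c2, then A c1 = - J A c2, so A c1 vanishes on T and on T J, hence
    everywhere. *)
Lemma generic_complex_rank n d (A : 'M[R]_(n + n, d)) : \rank A = d ->
  row_full (kermx A + kermx A *m cplx_structure n)%MS ->
  forall c : 'cV[C]_d, (mc (usubmx A) - 'i *: mc (dsubmx A)) *m c = 0 -> c = 0.
Proof.
move=> rA full c.
pose c1 : 'cV[R]_d := \col_i complex.Re (c i 0); pose c2 : 'cV[R]_d := \col_i complex.Im (c i 0).
have cE : c = mc c1 + 'i *: mc c2.
  apply/colP => i; rewrite !mxE; apply/eqP; rewrite eq_complex /=.
  by apply/andP; split; apply/eqP; ring.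
set Ax := usubmx A; set Ay := dsubmx A => e0.
have mc_inj k (x y : 'cV[R]_k) : mc x + 'i *: mc y = 0 -> x = 0 /\ y = 0.
  move=> h; have e i : x i 0 = 0 /\ y i 0 = 0.
    move/colP/(_ i): h; rewrite !mxE => /eqP; rewrite eq_complex /= => /andP[/eqP h1 /eqP h2].
    by split; lra.
  by split; apply/colP => i; rewrite mxE (e i).1 || rewrite mxE (e i).2.
have [h1 h2] : Ax *m c1 + Ay *m c2 = 0 /\ Ax *m c2 - Ay *m c1 = 0.
  apply: mc_inj; rewrite -[RHS]e0 cE mulmxDr !mulmxBl -!scalemxAl -!scalemxAr scalerA -expr2 sqrCi.
  rewrite map_mxD map_mxB !map_mxM /=.
  move: (mc Ax *m mc c1) (mc Ax *m mc c2) (mc Ay *m mc c1) (mc Ay *m mc c2) => s t u v.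
  by apply/colP => i; rewrite !mxE; ring.
have JA : cplx_structure n *m A = col_mx Ay (- Ax).
  by rewrite -[A]vsubmxK mul_block_col !mul0mx !mul1mx mulNmx mul1mx add0r addr0.
have jA : A *m c1 = - (cplx_structure n *m A *m c2).
  rewrite JA -[A in LHS]vsubmxK !mul_col_mx mulNmx opp_col_mx opprK; congr col_mx.
    by apply/eqP; rewrite -addr_eq0; apply/eqP.
  exact/esym/subr0_eq.
have A1 : A *m c1 = 0.
  have z : (kermx A + kermx A *m cplx_structure n <= kermx (A *m c1))%MS.
    rewrite addsmx_sub; apply/andP; split; apply/sub_kermxP.
      by rewrite mulmxA mulmx_ker mul0mx.
    rewrite jA mulmxN !mulmxA -(mulmxA (kermx A)) cplx_structureK mulmxN mulmx1.
    by rewrite mulNmx mulmx_ker oppr0 mul0mx oppr0.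
  have := submx_full 1%:M full => s; have := submx_trans s z => /sub_kermxP.
  by rewrite mul1mx.
have A2 : A *m c2 = 0.
  have : cplx_structure n *m (A *m c1) = A *m c2.
    by rewrite jA mulmxN !mulmxA cplx_structureK mulNmx mul1mx mulNmx opprK.
  by rewrite A1 mulmx0.
have inj (x : 'cV[R]_d) : A *m x = 0 -> x = 0.
  have : row_full A by rewrite /row_full rA.
  by move=> /row_fullP[Y YA] /(congr1 (mulmx Y)); rewrite mulmxA YA mul1mx mulmx0.
by rewrite cE (inj _ A1) (inj _ A2) !map_mx0 scaler0 addr0.
Qed.

(** The first row spans the left kernel of B, which becomes the z-direction; the other rows are k
    times a left inverse of B. *)
Lemma normalizing_matrix (k : C) (B : 'M[C]_(1 + 3, 3)) : k != 0 -> (forall c : 'cV[C]_3, B *m c = 0 -> c = 0) ->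
  exists2 G : 'M[C]_(1 + 3), G \in unitmx & G *m B = col_mx 0 k%:M.
Proof.
move=> k0 Binj.
have full : row_full B.
  rewrite -[_ B]/(\rank B == 3%N) -mxrank_tr -[_ == _]/(row_free B^T); apply: inj_row_free => v v0.
  by rewrite -[v]trmxK (Binj v^T) ?trmx0 // -[B]trmxK -trmx_mul v0 trmx0.
have /row_fullP[Y YB] := full.
have : kermx B != 0 by rewrite kermx_eq0 /row_free (eqP full).
move=> /rowV0Pn[e /sub_kermxP eB e0].
exists (col_mx e (k *: Y)); last by rewrite mul_col_mx eB -scalemxAl YB scalemx1.
rewrite -row_free_unit; apply: inj_row_free => u uG.
have uE := hsubmxK u.
have r0 : rsubmx u = 0.
  have := congr1 (mulmx^~ B) uG; rewrite -{1}uE mul_row_col mul0mx mulmxDl -!mulmxA eB mulmx0 add0r.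
  rewrite -scalemxAl YB scalemx1 mul_mx_scalar => /eqP; rewrite scaler_eq0 (negbTE k0) /=.
  by move=> /eqP.
move: uG; rewrite -uE mul_row_col r0 mul0mx addr0 [lsubmx u]mx11_scalar mul_scalar_mx => /eqP.
by rewrite scaler_eq0 (negbTE e0) orbF => /eqP ->; rewrite raddf0 row_mx0.
Qed.

End GenericRank.

(** * Solving the complexified real equations for w *)

Section ComplexEquation.
Context {R : realType}.
Local Notation C := R[i].
Local Notation mc := (map_mx (real_complex R)).
Local Notation vec := 'rV[C]_(1 + (1 + 3)).
Local Notation V8 := 'rV[R]_((1 + 3) + (1 + 3)).
Local Notation cmx := (map_mx Num.conj).

Lemma conj_pointE (p : 'rV[C]_(1 + 3)) : conj_point p = row_mx (lsubmx p) (cvec p).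
Proof.
rewrite /conj_point /triple /zcoord /wcoord scalar_mx11; congr row_mx.
rewrite -{3}[p]hsubmxK cvec_row_mx; congr row_mx.
by apply/matrixP => i j; rewrite (ord1 i) (ord1 j) !mxE.
Qed.

Lemma near_conj_point (P : set vec) : (\forall x \near (0 : vec), P x) ->
  \forall p \near (0 : 'rV[C]_(1 + 3)), P (conj_point p).
Proof.
move=> /near_nrm[r r0 rP]; apply/near_nrm; exists (r / 2); first by rewrite divr_gt0.
move=> p; rewrite subr0 => pr; apply: rP; rewrite subr0 conj_pointE nrm_row_mx nrm_cvec.
have : nrm (lsubmx p) <= nrm p by rewrite -{2}[p]hsubmxK nrm_row_mx lerDl nrm_ge0.
by lra.
Qed.

Local Notation k := ((2 * 'i)^-1 : C).

Lemma k_neq0 : k != 0.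
Proof. by rewrite invr_eq0 mulf_neq0 // ?pnatr_eq0 // neq0Ci. Qed.

Lemma conj_k : k^* = - k.
Proof. by rewrite fmorphV rmorphM rmorph_nat /= conjCi mulrN invrN. Qed.

(** Sends (P, Q) to ((P + Q)/2, (P - Q)/(2i)), the real and imaginary parts of P when Q is its
    conjugate; P and Q become independent in the complexification. *)
Definition real_part_mx : 'M[C]_((1 + 3) + (1 + 3)) :=
  block_mx (2^-1)%:M k%:M (2^-1)%:M (- k)%:M.

Lemma mul_real_part (P Q : 'rV[C]_(1 + 3)) :
  row_mx P Q *m real_part_mx = row_mx (2^-1 *: (P + Q)) (k *: (P - Q)).
Proof.
by rewrite mul_row_block !mul_mx_scalar scaleNr -!scalerDr -scalerBr.
Qed.

Lemma rc_real_part (q : V8) : rc q = row_mx (complex_point q) (cvec (complex_point q)) *m real_part_mx.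
Proof.
rewrite mul_real_part -{1}[q]hsubmxK row_mx_rc; congr row_mx; apply/rowP => j; rewrite !mxE.
  by apply/eqP; rewrite eq_complex /=; apply/andP; split; apply/eqP; field.
have i0 : ('i : C) != 0 by exact: neq0Ci.
apply: (mulfI (_ : 2 * 'i != 0)); first by rewrite mulf_neq0 ?pnatr_eq0.
rewrite [RHS]mulrA divff ?mul1r ?mulf_neq0 ?pnatr_eq0 //.
by apply/eqP; rewrite eq_complex /=; apply/andP; split; apply/eqP; ring.
Qed.

Lemma cvec_mul_real_part (P Q : 'rV[C]_(1 + 3)) :
  cvec (row_mx P Q *m real_part_mx) = row_mx (cvec Q) (cvec P) *m real_part_mx.
Proof.
rewrite !mul_real_part cvec_row_mx !cvecZ cvecD cvecB conj_k fmorphV rmorph_nat.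
by rewrite [cvec Q + _]addrC scaleNr -scalerN opprB.
Qed.

(* Coordinates ((z, zeta, omega), w) of C^8 to the pair ((z, w), (zeta, omega)). *)
Definition pair_mx : 'M[C]_((1 + (1 + 3)) + 3, (1 + 3) + (1 + 3)) :=
  row_mx (row_mx (col_mx (col_mx 1%:M 0) 0) (col_mx 0 1%:M)) (col_mx (col_mx 0 1%:M) 0).

Lemma mul_pair_mx (a : 'rV[C]_1) (b : 'rV[C]_(1 + 3)) (w : 'rV[C]_3) :
  row_mx (row_mx a b) w *m pair_mx = row_mx (row_mx a w) b.
Proof. by rewrite !mul_mx_row !mul_row_col !mulmx0 !mulmx1 ?addr0 ?add0r. Qed.

(** The antiholomorphic involution that exchanges z with zeta and w with omega while conjugating;
    its fixed points are the points of C^4. *)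
Definition conj_swap (x : 'rV[C]_((1 + (1 + 3)) + 3)) : 'rV[C]_((1 + (1 + 3)) + 3) :=
  let y := lsubmx x in
  cvec (row_mx (triple (y 0 zetai) (y 0 zi) (rsubmx x)) (rsubmx (rsubmx y))).

Lemma conj_swapE z zeta omega w : conj_swap (row_mx (triple z zeta omega) w) =
  row_mx (triple zeta^* z^* (cvec w)) (cvec omega).
Proof.
by rewrite /conj_swap row_mxKl row_mxKr triple_z triple_zeta triple_w cvec_row_mx cvec_triple.
Qed.

Lemma near_conj_swap (P : set 'rV[C]_((1 + (1 + 3)) + 3)) :
  (\forall x \near (0 : 'rV[C]_((1 + (1 + 3)) + 3)), P x) ->
  \forall x \near (0 : 'rV[C]_((1 + (1 + 3)) + 3)), P (conj_swap x).
Proof.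
move=> h; pose f (x : 'rV[C]_((1 + (1 + 3)) + 3)) :=
  row_mx (triple (lsubmx x 0 zetai) (lsubmx x 0 zi) (rsubmx x)) (rsubmx (rsubmx (lsubmx x))).
have fh : holom 0 f.
  apply: holom_row_mx; last by apply: holom_rsub; apply: holom_rsub; apply: holom_lsub; exact: holom_id.
  apply: holom_triple; last by apply: holom_rsub; exact: holom_id.
    exact: (holom_lsub (@holom_id _ _ _)).
  exact: (holom_lsub (@holom_id _ _ _)).
have f0 : f 0 = 0 by rewrite /f !raddf0 !mxE triple0 row_mx0.
apply: (near_holo (P := fun x => P (cvec x)) fh); rewrite f0; apply: near_cvec.
by rewrite cvec0.
Qed.

(** After the change [G], the complexified equation has linear part w - omega, so it can be solved
    for w. The symmetry in the conclusion expresses that [rho] is real; it is the raw form of the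
    reality condition. *)
Lemma complex_equation (M : set 'rV[C]_(1 + 3)) (rho : V8 -> 'rV[R]_3) :
  local_equation M rho -> CR_generic M rho ->
  exists (G : 'M[C]_(1 + 3)) (Theta : vec -> 'rV[C]_3), [/\ G \in unitmx,
    holom 0 Theta /\ Theta 0 = 0, sdm 0 Theta (col_mx 0 (col_mx 0 1%:M)),
    (\forall x \near (0 : 'rV[C]_((1 + (1 + 3)) + 3)),
      rsubmx x = Theta (lsubmx x) <->
      rsubmx (conj_swap x) = Theta (lsubmx (conj_swap x))) &
    (forall v : V8, v *m jacobian rho 0 = \row_j complex.Im (wcoord (complex_point v *m invmx G) 0 j)) /\
    \forall q \near (0 : V8), let p := complex_point q *m invmx G in
      M (complex_point q) <-> wcoord p = Theta (conj_point p)].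
Proof.
move=> [M0 /ram_analytic rr Mrho rk] gen.
have M0' : M (complex_point 0) by rewrite complex_point0.
have rho0 : rho 0 = 0 by exact/(nbhs_singleton Mrho).
have [F [Fh Fc Frho F0 FA]] := complexification rr.
rewrite rho0 !rc0 in F0 Fh FA.
set A := jacobian rho 0 in FA *.
have Binj := generic_complex_rank (nbhs_singleton rk M0') (nbhs_singleton gen M0').
set Jx := mc (usubmx A) in Binj; set Jy := mc (dsubmx A) in Binj.
pose B := 2^-1 *: Jx + k *: Jy.
have kE : k = 2^-1 * - 'i by rewrite invfM invCi.
have {}Binj (c : 'cV[C]_3) : B *m c = 0 -> c = 0.
  have BE : B = 2^-1 *: (Jx - 'i *: Jy) by rewrite /B kE scalerBr -scalerA scaleNr scalerN.
  move=> Bc; apply: Binj; move: Bc; rewrite BE -scalemxAl => /eqP.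
  by rewrite scaler_eq0 invr_eq0 pnatr_eq0 /= => /eqP.
have [G Gu GB] := normalizing_matrix k_neq0 Binj.
have cB : cmx B = 2^-1 *: Jx - k *: Jy.
  have cr (m n : nat) (X : 'M[R]_(m, n)) : cmx (mc X) = mc X by apply/matrixP => a b; rewrite !mxE conj_real.
  by rewrite map_mxD !map_mxZ !cr /= conj_k fmorphV rmorph_nat scaleNr.
have mulB (P Q : 'rV[C]_(1 + 3)) : row_mx P Q *m real_part_mx *m mc A = P *m B + Q *m cmx B.
  have -> : mc A = col_mx Jx Jy by rewrite -[A in LHS]vsubmxK map_col_mx.
  rewrite mul_real_part mul_row_col -!scalemxAl mulmxDl mulmxBl cB !mulmxDr mulmxN -!scalemxAr.
  move: (P *m Jx) (Q *m Jx) (P *m Jy) (Q *m Jy) => s t u v.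
  by apply/rowP => i; rewrite !mxE; ring.
have k2 : 2 * 'i * k = 1 by rewrite divff // mulf_neq0 ?pnatr_eq0 ?neq0Ci.
have rcA (v : V8) : rc (v *m A) = rc v *m mc A by rewrite rc_mulmx.
pose W := pair_mx *m block_mx G 0 0 (cmx G) *m real_part_mx.
have WE (a : 'rV[C]_1) (b : 'rV[C]_(1 + 3)) (w : 'rV[C]_3) : row_mx (row_mx a b) w *m W = row_mx (row_mx a w *m G) (b *m cmx G) *m real_part_mx.
  by rewrite /W !mulmxA mul_pair_mx mul_row_block !mulmx0 addr0 add0r.
(* The factor 2i compensates k = 1/(2i), making the derivative in w the identity. *)
pose H x := (2 * 'i) *: F (x *m W).
have Hh : holom 0 H.
  apply: holomZ; apply: holom_comp; first exact: holom_mulmxr (@holom_id _ _ _).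
  by rewrite mul0mx.
have H0 : H 0 = 0 by rewrite /H mul0mx F0 scaler0.
pose HA := (2 * 'i) *: (W *m mc A).
have HAd : sdm 0 H HA.
  apply: sdmZ; apply: (sdm_comp (sdm_linear _ _)); rewrite mul0mx; exact: FA.
have GBm (a : 'rV[C]_1) w : row_mx a w *m G *m B = k *: w.
  by rewrite -mulmxA GB mul_row_col mulmx0 add0r mul_mx_scalar.
have GBc (b : 'rV[C]_(1 + 3)) : b *m cmx G *m cmx B = - k *: rsubmx b.
  rewrite -mulmxA -map_mxM GB map_col_mx map_mx0 map_scalar_mx /= -{1}[b]hsubmxK.
  by rewrite mul_row_col mulmx0 add0r mul_mx_scalar conj_k.
have HAE (a : 'rV[C]_1) (b : 'rV[C]_(1 + 3)) (w : 'rV[C]_3) : row_mx (row_mx a b) w *m HA = w - rsubmx b.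
  rewrite /HA -scalemxAr mulmxA WE mulB GBm GBc scaleNr -scalerBr scalerA k2.
  by rewrite scale1r.
have HA1 : dsubmx HA = 1%:M.
  apply: mulmx_eq => u; rewrite mulmx1.
  have := HAE 0 0 u; rewrite raddf0 subr0 row_mx0 -{1}[HA]vsubmxK mul_row_col mul0mx add0r.
  by [].
have [T [Th T0 HT]] := implicit_function Hh H0 HAd HA1.
exists G, T; split=> //.
- have [D TD] := holom_sdm Th.
  suff -> : col_mx 0 (col_mx 0 1%:M) = D by [].
  have g0 : row_mx (0 : vec) (T 0) = 0 by rewrite T0 row_mx0.
  have near0 : \forall x \near (0 : vec), H (row_mx x (T x)) = 0.
    have := near_holo (p := 0 : vec) (P := fun v => H v = 0 <-> rsubmx v = T (lsubmx v))
      (holom_row_mx (@holom_id _ _ _) Th).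
    by rewrite g0 => /(_ HT); apply: filterS => x; rewrite row_mxKl row_mxKr => -[_]; apply.
  have c1 : sdm 0 (fun x => H (row_mx x (T x))) (row_mx 1%:M D *m HA).
    by apply: (sdm_comp (sdm_row_mx (sdm_id _) TD)); rewrite g0.
  have z : row_mx 1%:M D *m HA = 0.
    by apply: sdm_unique (sdm_eq near0 c1) (sdm_cst _ _).
  apply: mulmx_eq => u; have := congr1 (mulmx u) z; rewrite mulmx0 mulmxA mul_mx_row mulmx1.
  rewrite -{1}[u]hsubmxK HAE => /subr0_eq ->.
  by rewrite -[u]hsubmxK mul_row_col mulmx0 add0r row_mxKr -[rsubmx u]hsubmxK mul_row_col mulmx0 add0r mulmx1 row_mxKr.
(* The complexified [rho] commutes with conjugation; the sign comes from the conjugate of 2i. *)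
- have Hc x : H (conj_swap x) = - cvec (H x).
    rewrite -[x]hsubmxK -[lsubmx x]triple_eta conj_swapE.
    move: (_ 0 zi) (_ 0 zetai) (rsubmx (rsubmx _)) (rsubmx x) => z zeta omega w.
    rewrite /H cvecZ -Fc /triple !WE cvec_mul_real_part !cvec_mulmx !cvec_row_mx.
    have cG : cmx (cmx G) = G by apply/matrixP => a b; rewrite !mxE conjCK.
    have cs (a : C) : cvec a%:M = a^*%:M :> 'rV[C]_1.
      by apply/matrixP => a' b; rewrite (ord1 a') (ord1 b) !mxE.
    rewrite cG !cs rmorphM rmorph_nat /= conjCi mulrN scaleNr opprK.
    by [].
  apply: filterS2 HT (near_conj_swap HT) => x <- <-; rewrite Hc.
  split=> [->|/eqP]; first by rewrite cvec0 oppr0.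
  by rewrite oppr_eq0 => /eqP h; rewrite -[H x]cvecK h cvec0.
split=> [v|].
  apply: rc_inj; rewrite rcA rc_real_part mulB.
  set p := complex_point v *m invmx G.
  have -> : complex_point v = row_mx (lsubmx p) (rsubmx p) *m G by rewrite hsubmxK mulmxKV.
  rewrite GBm cvec_mulmx GBc cvec_row_mx row_mxKr /wcoord.
  move: (rsubmx p) => w; apply/rowP => j; rewrite !mxE.
  rewrite kE; case: (w 0 j) => a b; apply/eqP; rewrite eq_complex /=.
  by apply/andP; split; apply/eqP; field.
have pr : ranm 0 (fun q : V8 => let p := complex_point q *m invmx G in
    row_mx (row_mx (lsubmx p) (cvec p)) (rsubmx p)).
  have p1 : ranm 0 (fun q : V8 => complex_point q *m invmx G).
    apply: (ranm_comp (H := fun y => y *m invmx G) (ranm_complex_point _)).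
    exact: holom_mulmxr (@holom_id _ _ _).
  have p2 : ranm 0 (fun q : V8 => lsubmx (complex_point q *m invmx G)).
    by apply: (ranm_comp (H := fun y => lsubmx y) p1); exact: holom_lsub (@holom_id _ _ _).
  have p3 : ranm 0 (fun q : V8 => rsubmx (complex_point q *m invmx G)).
    by apply: (ranm_comp (H := fun y => rsubmx y) p1); exact: holom_rsub (@holom_id _ _ _).
  by apply: ranm_row_mx p3; apply: ranm_row_mx p2 (ranm_conj p1).
have HT' := ranm_near_comp (P := fun v => H v = 0 <-> rsubmx v = T (lsubmx v)) pr.
rewrite /= complex_point0 mul0mx !raddf0 cvec0 !row_mx0 in HT'.
apply: filterS3 Mrho Frho (HT' HT) => q Mq Fq; rewrite /= row_mxKl row_mxKr Mq.
set p := complex_point q *m invmx G; rewrite /wcoord conj_pointE => <-.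
have -> : H (row_mx (row_mx (lsubmx p) (cvec p)) (rsubmx p)) = (2 * 'i) *: rc (rho q).
  rewrite /H WE hsubmxK -cvec_mulmx /p mulmxKV // -rc_real_part Fq.
  by [].
split=> [->|/eqP]; first by rewrite rc0 scaler0.
rewrite scaler_eq0 mulf_eq0 pnatr_eq0 (negbTE (neq0Ci _)) /= => /eqP.
by rewrite -rc0 => /rc_inj.
Qed.

End ComplexEquation.

(** * Normal coordinates *)

Section NormalCoordinates.
Context {R : realType}.
Local Notation C := R[i].
Local Notation vec := 'rV[C]_(1 + (1 + 3)).
Local Notation pt := 'rV[C]_(1 + 3).
Local Notation cmx := (map_mx Num.conj).

Lemma sdm_conj n m (p : 'rV[C]_n) (F : 'rV[C]_n -> 'rV[C]_m) A :
  sdm (cvec p) F A -> sdm p (fun x => cvec (F (cvec x))) (cmx A).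
Proof.
move=> /sdm_nrm FA; apply/sdm_nrm => e /FA[r r0 h]; exists r => // x y px py.
have pc z : pd p r z -> pd (cvec p) r (cvec z).
  by move=> pz i; rewrite !mxE -rmorphB cn_conj; exact: pz.
have := h _ _ (pc _ px) (pc _ py); rewrite -cvecB nrm_cvec; apply: le_trans.
have cA : cmx (cmx A) = A by apply/matrixP => a b; rewrite !mxE conjCK.
rewrite -[leLHS]nrm_cvec; move: (F _) (F _) => a b.
by rewrite [cvec (_ - _ *m _)]cvecB cvec_mulmx cA [cvec (cvec _ - _)]cvecB !cvecK.
Qed.

Lemma swapE (x : vec) : swap x = row_mx (lsubmx (rsubmx x)) (row_mx (lsubmx x) (rsubmx (rsubmx x))).
Proof. by rewrite /swap /triple -zcE -zetaE !scalar_mx11. Qed.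

Lemma conj_swap_row_mx (x : vec) w : conj_swap (row_mx x w) =
  cvec (row_mx (row_mx (lsubmx (rsubmx x)) (row_mx (lsubmx x) w)) (rsubmx (rsubmx x))).
Proof. by rewrite /conj_swap row_mxKl row_mxKr /triple -zcE -zetaE !scalar_mx11. Qed.

Context (Theta : vec -> 'rV[C]_3) (Th : holom 0 Theta) (T0 : Theta 0 = 0).
Context (TD : sdm 0 Theta (col_mx 0 (col_mx 0 1%:M))).
Context (Tsym : \forall x \near (0 : 'rV[C]_((1 + (1 + 3)) + 3)),
  rsubmx x = Theta (lsubmx x) <-> rsubmx (conj_swap x) = Theta (lsubmx (conj_swap x))).

Definition conj_map n m (F : 'rV[C]_n -> 'rV[C]_m) x := cvec (F (cvec x)).
Let Tb := conj_map Theta.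

Lemma holom_conj_map n m (F : 'rV[C]_n -> 'rV[C]_m) : holom 0 F -> holom 0 (conj_map F).
Proof. by move=> Fh; apply: holom_conj; rewrite cvec0. Qed.

Lemma conj_map0 n m (F : 'rV[C]_n -> 'rV[C]_m) : F 0 = 0 -> conj_map F 0 = 0.
Proof. by move=> F0; rewrite /conj_map cvec0 F0 cvec0. Qed.

Let Tbh : holom 0 Tb := holom_conj_map Th.
Let Tb0 : Tb 0 = 0 := conj_map0 T0.

(** On the complexified manifold, w = Theta(z, zeta, omega) and omega = Tb(zeta, z, w) are the same
    equation; here its points are parametrized by (z, zeta, omega). *)
Lemma sym1 : \forall x \near (0 : vec),
  Tb (row_mx (lsubmx (rsubmx x)) (row_mx (lsubmx x) (Theta x))) = rsubmx (rsubmx x).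
Proof.
have h : holom 0 (fun x : vec => row_mx x (Theta x)) by apply: holom_row_mx Th; exact: holom_id.
have := near_holo (P := fun x => rsubmx x = Theta (lsubmx x) <->
  rsubmx (conj_swap x) = Theta (lsubmx (conj_swap x))) h.
rewrite T0 row_mx0 => /(_ Tsym); apply: filterS => x.
rewrite conj_swap_row_mx row_mxKl row_mxKr cvec_row_mx row_mxKl row_mxKr.
by move=> [/(_ erefl) e _]; rewrite /Tb /conj_map -e cvecK.
Qed.

(** The other parametrization of the complexified manifold, by (z, zeta, w). *)
Lemma sym2 : \forall x \near (0 : vec),
  Theta (row_mx (lsubmx x) (row_mx (lsubmx (rsubmx x)) (Tb (swap x)))) = rsubmx (rsubmx x).
Proof.
have hT : holom 0 (fun x : vec => Tb (swap x)).
  by apply: holom_comp; [exact: holom_swap|rewrite swap0; exact: Tbh].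
have h : holom 0 (fun x : vec => row_mx (row_mx (lsubmx x) (row_mx (lsubmx (rsubmx x)) (Tb (swap x)))) (rsubmx (rsubmx x))).
  apply: holom_row_mx; last exact: holom_omega.
  apply: holom_row_mx; first by apply: holom_lsub; exact: holom_id.
  by apply: holom_row_mx hT; apply: holom_lsub; apply: holom_rsub; exact: holom_id.
have := near_holo (P := fun x => rsubmx x = Theta (lsubmx x) <->
  rsubmx (conj_swap x) = Theta (lsubmx (conj_swap x))) h.
rewrite swap0 Tb0 !raddf0 !row_mx0 => /(_ Tsym); apply: filterS => x.
rewrite conj_swap_row_mx !row_mxKl !row_mxKr !row_mxKl cvec_row_mx row_mxKl row_mxKr.
move=> [_ e]; apply/esym/e.
by rewrite /Tb /conj_map cvecK swapE.
Qed.

(* The new coordinate is w' = (omega + Theta(0, 0, omega)) / 2 where omega = Tb(0, z, w), that is,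
   where (z, w) and (0, omega) are conjugate points; the symmetrization makes w' and its
   conjugate agree both for z = 0 and for zeta = 0. *)
Let half : pt -> pt := fun p => row_mx 0 (Tb (row_mx 0 p)).
Let phi (p : pt) : 'rV[C]_3 := 2^-1 *: (Tb (row_mx 0 p) + Theta (row_mx 0 (half p))).
Let Phi (p : pt) : pt := row_mx (lsubmx p) (phi p).

Let row0h n m (p : 'rV[C]_n) (F : 'rV[C]_n -> 'rV[C]_m) : holom p F -> holom p (fun x => row_mx (0 : 'rV[C]_1) (F x)).
Proof. by move=> Fh; apply: holom_row_mx Fh; exact: holom_cst. Qed.

Lemma phi_holom : holom 0 phi.
Proof.
have h1 : holom 0 (fun p : pt => Tb (row_mx 0 p)).
  by apply: holom_comp; [apply: row0h; exact: holom_id|rewrite row_mx0].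
apply: holomZ; apply: (holomD h1); apply: holom_comp; first exact: row0h (row0h h1).
by rewrite /half !row_mx0 Tb0 !row_mx0.
Qed.

Lemma phi0 : phi 0 = 0.
Proof. by rewrite /phi /half !row_mx0 Tb0 !row_mx0 T0 addr0 scaler0. Qed.

Lemma phi_sdm : sdm 0 phi (col_mx 0 1%:M).
Proof.
pose D : 'M[C]_(1 + (1 + 3), 3) := col_mx 0 (col_mx 0 1%:M).
have cD : cmx D = D by rewrite !map_col_mx !map_mx0 map_mx1.
have TbD : sdm 0 Tb D by rewrite -cD; apply: sdm_conj; rewrite cvec0.
have r0 n m (F : 'rV[C]_n -> 'rV[C]_m) A : sdm 0 F A -> sdm 0 (fun x => row_mx (0 : 'rV[C]_1) (F x)) (row_mx 0 A).
  by apply: sdm_row_mx; exact: sdm_cst.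
have h1 : sdm 0 (fun p : pt => Tb (row_mx 0 p)) (col_mx 0 1%:M).
  have : sdm 0 (fun p : pt => Tb (row_mx 0 p)) (row_mx 0 1%:M *m D).
    by apply: (sdm_comp (r0 _ _ _ _ (sdm_id _))); rewrite row_mx0.
  by rewrite mul_row_col mulmx0 add0r mul1mx.
have h2 : sdm 0 (fun p => Theta (row_mx 0 (half p))) (col_mx 0 1%:M).
  have : sdm 0 (fun p => Theta (row_mx 0 (half p))) (row_mx 0 (row_mx 0 (col_mx 0 1%:M)) *m D).
    apply: (sdm_comp (r0 _ _ _ _ (r0 _ _ _ _ h1))).
    by rewrite /half !row_mx0 Tb0 !row_mx0.
  by rewrite !mul_row_col !mulmx0 !add0r mulmx1.
have hh (A : 'M[C]_(1 + 3, 3)) : 2^-1 *: (A + A) = A.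
  by apply/matrixP => a b; rewrite !mxE; field.
by have := sdmZ (2^-1) (sdmD h1 h2); rewrite hh.
Qed.

Lemma Phi_holom : holom 0 Phi.
Proof. by apply: holom_row_mx phi_holom; apply: holom_lsub; exact: holom_id. Qed.

Lemma Phi0 : Phi 0 = 0.
Proof. by rewrite /Phi phi0 raddf0 row_mx0. Qed.

Lemma Phi_sdm : sdm 0 Phi 1%:M.
Proof.
have l : sdm 0 (fun p : pt => lsubmx p) (col_mx 1%:M 0).
  apply: eqf_sdm (sdm_linear 0 _) => x.
  by rewrite -{1}[x]hsubmxK mul_row_col mulmx1 mulmx0 addr0.
have := sdm_row_mx l phi_sdm.
by rewrite -[row_mx _ _]/(row_mx (col_mx 1%:M 0) (col_mx 0 1%:M)) -block_mxEh -scalar_mx_block.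
Qed.

Lemma normal_coordinates : exists (F : pt -> pt) (Theta' : vec -> 'rV[C]_3),
  [/\ local_coordinates F, (forall p, lsubmx (F p) = lsubmx p) /\ sdm 0 F 1%:M,
      holom 0 Theta' /\ reality_condition Theta',
      normality_conditions (fun x => Theta' x - rsubmx (rsubmx x)) &
      \forall p \near (0 : pt), wcoord p = Theta (conj_point p) <->
        wcoord (F p) = Theta' (conj_point (F p))].
Proof.
have [Psi [Psih Psi0 PsiPhi PhiPsi]] := inverse_function Phi_holom Phi0 Phi_sdm.
pose Psib := conj_map Psi; pose Phib := conj_map Phi.
have Psibh := holom_conj_map Psih; have Psib0 := conj_map0 Psi0.
have Phibh := holom_conj_map Phi_holom; have Phib0 := conj_map0 Phi0.
have PsibPhib : \forall p \near (0 : pt), Psib (Phib p) = p.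
  have := near_cvec (p := 0 : pt) (P := fun p => Psi (Phi p) = p); rewrite cvec0 => /(_ PsiPhi).
  by apply: filterS => p e; rewrite /Psib /Phib /conj_map cvecK e cvecK.
have PhibPsib : \forall p \near (0 : pt), Phib (Psib p) = p.
  have := near_cvec (p := 0 : pt) (P := fun p => Phi (Psi p) = p); rewrite cvec0 => /(_ PhiPsi).
  by apply: filterS => p e; rewrite /Psib /Phib /conj_map cvecK e cvecK.
have lPhib p : lsubmx (Phib p) = lsubmx p.
  rewrite /Phib /conj_map /Phi cvec_row_mx row_mxKl.
  by apply/matrixP => i j; rewrite !mxE conjCK.
have rPhib p : rsubmx (Phib p) = 2^-1 *: (Theta (row_mx 0 p) + Tb (row_mx 0 (row_mx 0 (Theta (row_mx 0 p))))).
  have c0 : cvec (0 : 'rV[C]_1) = 0 by exact: cvec0.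
  rewrite /Phib /conj_map /Phi cvec_row_mx row_mxKr /phi cvecZ fmorphV rmorph_nat cvecD.
  by rewrite /half /Tb /conj_map !cvec_row_mx !c0 !cvecK.
pose U (x : vec) : pt := row_mx (lsubmx x) (Theta x).
have Uh : holom 0 U by apply: holom_row_mx Th; apply: holom_lsub; exact: holom_id.
have U0 : U 0 = 0 by rewrite /U T0 raddf0 row_mx0.
pose V (x : vec) : vec := row_mx (lsubmx x) (Psib (rsubmx x)).
have Vh : holom 0 V.
  apply: holom_row_mx; first by apply: holom_lsub; exact: holom_id.
  by apply: holom_comp; [apply: holom_rsub; exact: holom_id|rewrite raddf0].
have V0 : V 0 = 0 by rewrite /V !raddf0 [Psib 0]Psib0 row_mx0.
(* Transport of the equation: [V] takes the conjugate variables back to the old coordinates, [U]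
   forms the old point (z, w) with w given by Theta, and [phi] reads its new w-coordinate. *)
pose Theta' x := phi (U (V x)).
have UVh : holom 0 (fun x => U (V x)) by apply: (holom_comp Vh); rewrite V0.
have UV0 : U (V 0) = 0 by rewrite V0.
have T'h : holom 0 Theta'.
  by apply: (holom_comp UVh); rewrite UV0; exact: phi_holom.
exists Phi, Theta'; split.
- split; [exact: (iffRL (holom_analytic _ _) Phi_holom)|exact: Phi0|].
  by exists Psi; split; [exact: (iffRL (holom_analytic _ _) Psih)| | |].
- by split=> [p|]; [rewrite /Phi row_mxKl|exact: Phi_sdm].
- split; first exact: T'h.
  apply/(reality_conditionP T'h).
  (* Here x stands for (z, zeta, w') with w' new. [Psi (q x)] is the old point (z, w), [y x] is
     (zeta, z, w), and [pi x] is its old partner (zeta, Tb(zeta, z, w)); [sym2] then returns to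
     w. *)
  pose q (x : vec) : pt := row_mx (lsubmx x) (rsubmx (rsubmx x)).
  have qh : holom 0 q.
    by apply: holom_row_mx; [apply: holom_lsub; exact: holom_id|exact: holom_omega].
  have q0 : q 0 = 0 by rewrite /q !raddf0 row_mx0.
  pose ze (x : vec) := lsubmx (rsubmx x).
  have zh : holom 0 ze by apply: holom_lsub; apply: holom_rsub; exact: holom_id.
  pose y x : vec := row_mx (ze x) (Psi (q x)).
  have yh : holom 0 y by apply: (holom_row_mx zh); apply: (holom_comp qh); rewrite q0.
  have y0 : y 0 = 0 by rewrite /y q0 Psi0 /ze !raddf0 row_mx0.
  pose pi x : pt := row_mx (ze x) (Tb (y x)).
  have pih : holom 0 pi by apply: (holom_row_mx zh); apply: (holom_comp yh); rewrite y0.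
  have pi0 : pi 0 = 0 by rewrite /pi y0 Tb0 /ze !raddf0 row_mx0.
  have syh : holom 0 (fun x => swap (y x)).
    by apply: (holom_comp yh); exact: holom_swap.
  have n1 := near_holo (P := fun p => Phi (Psi p) = p) qh; rewrite q0 in n1.
  have n2 := near_holo (P := fun p => Psib (Phib p) = p) pih; rewrite pi0 in n2.
  have n3 := near_holo syh (P := fun x =>
    Theta (row_mx (lsubmx x) (row_mx (lsubmx (rsubmx x)) (Tb (swap x)))) = rsubmx (rsubmx x)).
  rewrite y0 swap0 in n3.
  apply: filterS3 (n1 PhiPsi) (n2 PsibPhib) (n3 sym2) => x e1 e2 e3.
  have lPsi : lsubmx (Psi (q x)) = lsubmx x.
    by have := congr1 lsubmx e1; rewrite /Phi /q !row_mxKl.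
  have e3' : Theta (row_mx (lsubmx x) (pi x)) = rsubmx (Psi (q x)).
    have sy : swap (y x) = row_mx (lsubmx x) (row_mx (ze x) (rsubmx (Psi (q x)))).
      by rewrite swapE /y row_mxKr row_mxKl lPsi.
    have ssy : swap (row_mx (lsubmx x) (row_mx (ze x) (rsubmx (Psi (q x))))) = y x.
      by rewrite swapE !row_mxKr !row_mxKl -lPsi hsubmxK.
    by move: e3; rewrite sy ssy !row_mxKr !row_mxKl.
  have inner : cvec (Theta' (cvec (swap x))) = rsubmx (Phib (pi x)).
    rewrite swapE cvec_row_mx /Theta' /V row_mxKl row_mxKr /Psib /conj_map cvecK -/(q x).
    by rewrite /Phib /conj_map /Phi cvec_row_mx row_mxKr /U row_mxKl -cvec_row_mx -/(y x) /pi cvec_row_mx /Tb /conj_map cvecK.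
  rewrite inner.
  have -> : triple (x 0 zi) (x 0 zetai) (rsubmx (Phib (pi x))) = row_mx (lsubmx x) (Phib (pi x)).
    rewrite /triple -zcE -zetaE !scalar_mx11 -[in RHS](hsubmxK (Phib _)) lPhib.
    by rewrite {3}/pi row_mxKl.
  rewrite /Theta' /V row_mxKl row_mxKr e2 /U row_mxKl e3' -lPsi hsubmxK.
  by have := congr1 rsubmx e1; rewrite /Phi /q !row_mxKr.
(* For z = 0 the two summands of [phi] and of its conjugate are interchanged, because Theta(0, 0, .)
   and Tb(0, 0, .) are mutually inverse. For zeta = 0, [sym1] at [x3] gives Tb(0, z, Theta) = omega
   whatever z is, and both sides become half of omega + Theta(0, 0, omega). *)
- pose x1 (x : vec) : vec := row_mx 0 (Psib (rsubmx x)).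
  have rh : holom 0 (fun x : vec => rsubmx x) by apply: holom_rsub; exact: holom_id.
  have x1h : holom 0 x1 by apply: row0h; apply: (holom_comp rh); rewrite raddf0.
  have x10 : x1 0 = 0 by rewrite /x1 raddf0 [Psib 0]Psib0 row_mx0.
  pose x2 (x : vec) : vec := row_mx 0 (row_mx 0 (Theta (x1 x))).
  have x2h : holom 0 x2.
    by apply: row0h; apply: row0h; apply: (holom_comp x1h); rewrite x10.
  have x20 : x2 0 = 0 by rewrite /x2 x10 T0 !row_mx0.
  pose p3 (x : vec) : pt := row_mx 0 (rsubmx (rsubmx x)).
  have p3h : holom 0 p3 by apply: row0h; exact: holom_omega.
  have p30 : p3 0 = 0 by rewrite /p3 !raddf0 row_mx0.
  pose x3 (x : vec) : vec := row_mx (lsubmx x) (Psib (p3 x)).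
  have x3h : holom 0 x3.
    apply: holom_row_mx; first by apply: holom_lsub; exact: holom_id.
    by apply: (holom_comp p3h); rewrite p30.
  have x30 : x3 0 = 0 by rewrite /x3 p30 raddf0 [Psib 0]Psib0 row_mx0.
  pose x4 (x : vec) : vec := row_mx 0 (Psib (p3 x)).
  have x4h : holom 0 x4 by apply: row0h; apply: (holom_comp p3h); rewrite p30.
  have x40 : x4 0 = 0 by rewrite /x4 p30 [Psib 0]Psib0 row_mx0.
  have n1 := near_holo (P := fun p => Phib (Psib p) = p) rh; rewrite raddf0 in n1.
  have n2 := near_holo x2h (P := fun x =>
    Theta (row_mx (lsubmx x) (row_mx (lsubmx (rsubmx x)) (Tb (swap x)))) = rsubmx (rsubmx x)).
  have n3 := near_holo (P := fun p => Phib (Psib p) = p) p3h; rewrite p30 in n3.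
  have n4 := near_holo x3h (P := fun x =>
    Tb (row_mx (lsubmx (rsubmx x)) (row_mx (lsubmx x) (Theta x))) = rsubmx (rsubmx x)).
  have n5 := near_holo x4h (P := fun x =>
    Tb (row_mx (lsubmx (rsubmx x)) (row_mx (lsubmx x) (Theta x))) = rsubmx (rsubmx x)).
  rewrite x20 in n2; rewrite x30 in n4; rewrite x40 in n5.
  have n6 : \forall x \near (0 : vec), Phib (Psib (rsubmx x)) = rsubmx x /\
      Theta (row_mx (lsubmx (x2 x)) (row_mx (lsubmx (rsubmx (x2 x))) (Tb (swap (x2 x))))) = rsubmx (rsubmx (x2 x)).
    by apply: filterS2 (n1 PhibPsib) (n2 sym2).
  have n7 : \forall x \near (0 : vec),
      Tb (row_mx (lsubmx (rsubmx (x3 x))) (row_mx (lsubmx (x3 x)) (Theta (x3 x)))) = rsubmx (rsubmx (x3 x)) /\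
      Tb (row_mx (lsubmx (rsubmx (x4 x))) (row_mx (lsubmx (x4 x)) (Theta (x4 x)))) = rsubmx (rsubmx (x4 x)).
    by apply: filterS2 (n4 sym1) (n5 sym1).
  apply: filterS3 n6 (n3 PhibPsib) n7 => x [e1 e2] e3 [e4 e5] /=.
  have s0 : (0 : C)%:M = 0 :> 'rV[C]_1 by exact: raddf0.
  rewrite !triple_w zcE zetaE /triple s0 -zcE -zetaE !scalar_mx11 hsubmxK.
  have lp3 : lsubmx (Psib (p3 x)) = 0.
    by have := congr1 lsubmx e3; rewrite lPhib /p3 row_mxKl.
  split; apply/eqP; rewrite subr_eq0; apply/eqP; rewrite /Theta' /V row_mxKl row_mxKr.
    rewrite /U row_mxKl -[row_mx 0 (Psib _)]/(x1 x).
    have -> : rsubmx (rsubmx x) = rsubmx (Phib (Psib (rsubmx x))) by rewrite e1.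
    rewrite rPhib -/(x1 x) /phi /half -/(x2 x); congr (_ *: _); rewrite addrC; congr (_ + _).
    by move: e2; rewrite /x2 !row_mxKl !row_mxKr !row_mxKl swapE !row_mxKl !row_mxKr !row_mxKl.
  rewrite -/(p3 x) -/(x3 x) /U {1}/x3 row_mxKl.
  have -> : rsubmx (rsubmx x) = rsubmx (Phib (Psib (p3 x))) by rewrite e3 /p3 row_mxKr.
  rewrite rPhib -/(x4 x) /phi /half.
  move: e4; rewrite {1 2 4}/x3 !row_mxKr row_mxKl lp3 => ->.
  move: e5; rewrite {1 2 4}/x4 !row_mxKr row_mxKl lp3 => ->.
  rewrite addrC; congr (_ *: (Theta _ + _)).
  by rewrite /x4 -[in RHS](hsubmxK (Psib _)) lp3.
(* [Phi] is inverted both at p and at the point with the same z and with w given by Theta; so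
   equality of their new w-coordinates forces equality of the old ones. *)
have n1 := near_conj_point (P := fun x => Psi (Phi (U x)) = U x).
have n2 := near_holo (P := fun p => Psi (Phi p) = p) Uh; rewrite U0 in n2.
apply: filterS2 PsiPhi (n1 (n2 PsiPhi)) => p e1 e2.
have -> : Theta' (conj_point (Phi p)) = phi (U (conj_point p)).
  rewrite /Theta' /V conj_pointE row_mxKl row_mxKr /Phi row_mxKl -/(Phi p) /Psib /conj_map cvecK e1.
  by rewrite -conj_pointE.
have -> : wcoord (Phi p) = phi p by rewrite /wcoord row_mxKr.
have lU : lsubmx (U (conj_point p)) = lsubmx p by rewrite /U row_mxKl conj_pointE row_mxKl.
have rU : rsubmx (U (conj_point p)) = Theta (conj_point p) by rewrite /U row_mxKr.
split=> [e|e].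
  by congr phi; rewrite -[LHS]hsubmxK -[RHS]hsubmxK lU rU -e.
have : Phi p = Phi (U (conj_point p)) by rewrite /Phi lU e.
by move=> /(congr1 Psi); rewrite e1 e2 => pU; rewrite -rU -pU.
Qed.

End NormalCoordinates.

(** * Maximally minimal manifolds have a normal form *)

Section SecondOrder.
Context {R : realType}.
Local Notation C := R[i].
Local Notation vec := 'rV[C]_(1 + (1 + 3)).

Lemma near_lipschitz n (f : 'rV[C]_n -> C) : holo 0 f -> exists2 K : R, 0 < K &
  \forall x \near (0 : 'rV[C]_n), cn (f x - f 0) <= K * nrm x.
Proof.
move=> /holo_lipschitz[K [r [K0 r0 h]]]; exists K => //.
apply/near_pd; exists r => // x px; rewrite -[x in nrm x]subr0.
by apply: h => //; exact: pd_center.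
Qed.

(** The Hadamard quotients between x and 0 are Lipschitz in x, which makes the error of the linear
    approximation quadratic. *)
Lemma holo_taylor1 n (f : 'rV[C]_n -> C) : holo 0 f -> exists (d : 'I_n -> C) (K : R),
  0 < K /\ \forall x \near (0 : 'rV[C]_n), cn (f x - f 0 - \sum_i x 0 i * d i) <= K * nrm x ^+ 2.
Proof.
move=> /holo_hadamard[S [Sh [r r0 rS]]].
have Sh' i : holo 0 (fun x => S i (row_mx x 0)).
  by apply: (holo_comp (holom_row_mx (@holom_id _ _ _) (holom_cst 0 0))); exact: Sh.
have H i : exists K : R, 0 < K /\
    \forall x \near (0 : 'rV[C]_n), cn (S i (row_mx x 0) - S i (row_mx 0 0)) <= K * nrm x.
  by have [K ? ?] := near_lipschitz (Sh' i); exists K.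
have [K KP] := choice H.
exists (fun i => S i (row_mx 0 0)), (1 + \sum_i K i); split.
  by rewrite ltr_pwDl // sumr_ge0 // => i _; have [/ltW] := KP i.
have n1 := near_all (fun i => (KP i).2).
have n2 := iffRL (near_pd (0 : 'rV[C]_n) _) (ex_intro2 _ _ r r0 (fun x h => h)).
apply: filterS2 n1 n2 => x Sx px; rewrite (rS _ _ px (pd_center _ r0)).
have -> : \sum_i (x 0 i - (0 : 'rV[C]_n) 0 i) * S i (row_mx x 0) - \sum_i x 0 i * S i (row_mx 0 0) =
    \sum_i x 0 i * (S i (row_mx x 0) - S i (row_mx 0 0)).
  by rewrite -sumrB; apply: eq_bigr => i _; rewrite mxE subr0 mulrBr.
have : cn (\sum_i x 0 i * (S i (row_mx x 0) - S i (row_mx 0 0))) <= \sum_i nrm x * (K i * nrm x).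
  apply: le_trans (cn_sum _ _ _) _; apply: ler_sum => i _; rewrite cnM.
  by apply: ler_pM; rewrite ?cn_ge0 ?cn_le_nrm //; exact: Sx.
move=> /le_trans; apply; rewrite -mulr_sumr -mulr_suml mulrCA -expr2 ler_wpM2r ?sqr_ge0 //.
by rewrite lerDr.
Qed.

Lemma cn_triple_diag (z : C) : nrm (triple z z^* 0 : vec) = 2 * cn z.
Proof.
rewrite /triple !nrm_row_mx nrm0 addr0 /nrm !big_ord1 !mxE !mulr1n cn_conj; ring.
Qed.

Lemma near_diag (P : set vec) : (\forall x \near (0 : vec), P x) ->
  exists2 r : R, 0 < r & forall z : C, cn z < r -> P (triple z z^* 0).
Proof.
move=> /near_nrm[r r0 rP]; exists (r / 2); first by rewrite divr_gt0.
by move=> z zr; apply: rP; rewrite subr0 cn_triple_diag; lra.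
Qed.

(** At x = (z, zbar, 0) the reality condition, divided by |z|^2, says that Q(Y x) is minus the
    conjugate of Q(x). The points x and Y x differ by the conjugate of Theta(x), of size O(|z|^2),
    so 2 Re Q(x) is the real part of a difference of that size. *)
Lemma reality_factor (Theta : vec -> 'rV[C]_3) (Q : 'I_3 -> vec -> C) :
  holom 0 Theta -> (forall j, holo 0 (Q j)) ->
  (\forall x \near (0 : vec), forall j, Theta x 0 j = rsubmx (rsubmx x) 0 j + x 0 zi * x 0 zetai * Q j x) ->
  reality_condition Theta ->
  exists K r : R, 0 < r /\ forall z j, z != 0 -> cn z < r ->
    `|complex.Re (Q j (triple z z^* 0))| <= K * cn z ^+ 2.
Proof.
move=> Th Qh TQ /(iffLR (reality_conditionP Th)) re.
have T0 : Theta 0 = 0.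
  by apply/rowP => j; rewrite (nbhs_singleton TQ) !mxE !mul0r addr0.
pose Y (x : vec) : vec := triple (x 0 zi) (x 0 zetai) (cvec (Theta (cvec (swap x)))).
have Yh : holom 0 Y.
  apply: holom_triple; [exact: holo_coord|exact: holo_coord|].
  have := holom_comp (@holom_swap R 0) (_ : holom (swap 0) (fun x => cvec (Theta (cvec x)))).
  by rewrite swap0; apply; apply: holom_conj; rewrite cvec0.
have Y0 : Y 0 = 0 by rewrite /Y swap0 cvec0 T0 cvec0 !mxE triple0.
have [r1 r10 h1] := near_diag TQ.
have nY := near_holo (P := fun x => forall j, Theta x 0 j =
  rsubmx (rsubmx x) 0 j + x 0 zi * x 0 zetai * Q j x) Yh.
rewrite Y0 in nY; have [r2 r20 h2] := near_diag (nY TQ).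
have [r3 r30 h3] := near_diag re.
have H j : exists K : R, 0 < K /\ \forall x \near (0 : vec), cn (Q j x - Q j (Y x)) <= K * nrm (x - Y x) /\ cn (Q j x) <= K.
  have [K [r [K0 r0 h]]] := holo_lipschitz (Qh j).
  have n1 := iffRL (near_pd (0 : vec) _) (ex_intro2 _ _ r r0 (fun x h => h)).
  have n2 := near_holo (P := fun x => pd 0 r x) Yh; rewrite Y0 in n2.
  have [d d0 dP] := holo_cont (Qh j) ltr01.
  have n3 := iffRL (near_pd (0 : vec) _) (ex_intro2 _ _ d d0 dP).
  have C0 := cn_ge0 (Q j 0).
  exists (K + 1 + cn (Q j 0)); split; first by lra.
  apply: filterS3 n1 (n2 n1) n3 => x p1 p2 p3; split.
    by apply: le_trans (h _ _ p1 p2) _; rewrite ler_wpM2r ?nrm_ge0 //; lra.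
  by have := cnD (Q j x - Q j 0) (Q j 0); rewrite subrK; lra.
have [K KP] := choice H.
have [r4 r40 h4] := near_diag (near_all (fun j => (KP j).2)).
pose r := Num.min (Num.min r1 r2) (Num.min r3 r4).
pose L := \sum_j K j.
have K0 j : 0 <= K j by have [/ltW] := KP j.
have KL j : K j <= L by rewrite /L (bigD1 j) //= lerDl sumr_ge0.
exists (L * L), r; split; first by rewrite !lt_min r10 r20 r30.
move=> z j z0; rewrite !lt_min => /andP[/andP[/h1 e1 /h2 e2] /andP[/h3 e3 /h4 e4]].
set x := triple z z^* 0 in e1 e2 e3 e4 *.
have sx : cvec (swap x) = x by rewrite /swap triple_z triple_zeta triple_w cvec_triple conjCK cvec0.
have Yx : Y x = triple z z^* (cvec (Theta x)) by rewrite /Y sx triple_z triple_zeta.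
have Tx i : Theta x 0 i = z * z^* * Q i x by rewrite e1 triple_w triple_z triple_zeta mxE add0r.
have zz : z * z^* != 0 by rewrite mulf_neq0 // conjC_eq0.
have e5 : (Q j x)^* + Q j (Y x) = 0.
  have := e2 j; rewrite -e3 triple_w Yx triple_w triple_z triple_zeta -Yx mxE [cvec _ 0 j]mxE Tx.
  rewrite !rmorphM /= conjCK [z^* * z]mulrC -mulrDr => /esym/eqP.
  by rewrite mulf_eq0 (negbTE zz) /= => /eqP.
have e6 : 2 * complex.Re (Q j x) = complex.Re (Q j x - Q j (Y x)).
  by have -> : Q j (Y x) = - (Q j x)^*; [apply/eqP; rewrite -addr_eq0 addrC e5|case: (Q j x) => a b /=; ring].
have dist : nrm (x - Y x) <= cn z ^+ 2 * L.
  rewrite Yx /x /triple !opp_row_mx !add_row_mx !subrr sub0r !nrm_row_mx !nrm0 !add0r nrmN nrm_cvec.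
  rewrite /nrm /L mulr_sumr; apply: ler_sum => i _; rewrite Tx !cnM cn_conj -expr2.
  by rewrite ler_wpM2l ?sqr_ge0 //; have [_] := e4 i.
have [h5 _] := e4 j; have h6 := Re_le_cn (Q j x - Q j (Y x)).
have L0 : 0 <= L by apply: sumr_ge0.
have h7 : K j * nrm (x - Y x) <= L * (cn z ^+ 2 * L).
  by apply: ler_pM; rewrite ?nrm_ge0 ?K0 ?KL.
have h8 : 0 <= `|complex.Re (Q j x)| by exact: normr_ge0.
move: h6; rewrite -e6 normrM (gtr0_norm (_ : 0 < 2 :> R)) // => h6.
have -> : L * L * cn z ^+ 2 = L * (cn z ^+ 2 * L) by ring.
lra.
Qed.

(** The affine part of q on the diagonal has real part O(|z|^2), hence zero. Testing the directions
    1 and i gives exactly the real conditions that leave i times a real affine form. *)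
Lemma imaginary_expansion (q : vec -> C) (K r : R) : holo 0 q -> 0 < r ->
  (forall z, z != 0 -> cn z < r -> `|complex.Re (q (triple z z^* 0))| <= K * cn z ^+ 2) ->
  exists (a b c L s : R), [/\ 0 < s, 0 < L & forall z, cn z < s ->
    cn (q (triple z z^* 0) - 'i * (a + b * complex.Re z + c * complex.Im z)%:C%C) <= L * cn z ^+ 2].
Proof.
move=> qh r0 qK; have [d [L [L0 h]]] := holo_taylor1 qh.
have [s s0 sP] := near_diag h.
pose b1 := d zi; pose c1 := d zetai.
have sumE (z : C) : \sum_i (triple z z^* 0 : vec) 0 i * d i = z * b1 + z^* * c1.
  rewrite big_split_ord /= big_ord1 -/zi triple_z big_split_ord /= big_ord1 -/zetai triple_zeta.
  rewrite big1 ?addr0 // => i _.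
  by rewrite /triple !row_mxEr mxE mul0r.
pose t0 (nu : C) (t : R) : C := t%:C%C * nu.
have real nu : cn nu = 1 -> complex.Re (q 0) = 0 /\ complex.Re (nu * b1 + nu^* * c1) = 0.
  move=> nu1; apply: small_affine_eq0 => e e0.
  have KL0 : 0 < `|K| + 4 * L by have := normr_ge0 K; lra.
  exists (Num.min (Num.min r s) (e / (`|K| + 4 * L))).
    by rewrite !lt_min r0 s0 divr_gt0.
  move=> t /andP[tp]; rewrite !lt_min ltr_pdivlMr // => /andP[/andP[tr ts] te].
  have zt : cn (t0 nu t) = t by rewrite cnM nu1 mulr1 cn_real gtr0_norm.
  have z0 : t0 nu t != 0 by rewrite -cn_gt0 zt.
  have h1 := qK _ z0; rewrite zt in h1; have {}h1 := h1 tr.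
  have h2 := sP (t0 nu t); rewrite zt in h2; have {}h2 := h2 ts.
  rewrite sumE cn_triple_diag zt in h2.
  have h3 := le_trans (Re_le_cn _) h2.
  have h4 : complex.Re (q (triple (t0 nu t) (t0 nu t)^* 0) - q 0 - (t0 nu t * b1 + (t0 nu t)^* * c1)) =
      complex.Re (q (triple (t0 nu t) (t0 nu t)^* 0)) - (complex.Re (q 0) + t * complex.Re (nu * b1 + nu^* * c1)).
    rewrite /t0; case: (q (triple _ _ _)) => x1 y1; case: (q 0) => x2 y2.
    by case: (nu) => x3 y3; case: (b1) => x4 y4; case: (c1) => x5 y5 /=; ring.
  rewrite h4 in h3; have KK := ler_norm K.
  move: h1 h3; set X := complex.Re (q _); set Y := complex.Re (q 0) + _ => h1 h3.
  have h5 : `|Y| <= `|X| + `|X - Y| by rewrite -{1}[Y](subKr X) ler_normB.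
  have h6 : K * t ^+ 2 <= `|K| * t ^+ 2 by rewrite ler_wpM2r ?sqr_ge0.
  have h7 : (`|K| + 4 * L) * t ^+ 2 <= e * t by rewrite expr2 mulrA ler_wpM2r ?(ltW tp) // mulrC ltW.
  lra.
have [q00 r1] := real 1 (cn_nat 1).
have cni : cn ('i : C) = 1.
  by apply: (@complexI R); rewrite -normCE normCi.
have [_ r2] := real 'i cni.
exists (complex.Im (q 0)), (complex.Im (b1 + c1)), (complex.Re (b1 - c1)), (4 * L), s; split=> //.
  by lra.
move=> z /sP; rewrite sumE cn_triple_diag => h1.
have -> : 4 * L * cn z ^+ 2 = L * (2 * cn z) ^+ 2 by ring.
apply: le_trans h1; rewrite le_eqVlt; apply/orP; left; apply/eqP; congr cn.
move: q00 r1 r2; case: (q (triple _ _ _)) => x1 y1; case: (q 0) => x2 y2.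
case: (z) => x3 y3; case: (b1) => x4 y4; case: (c1) => x5 y5 /= q00 r1 r2.
by apply/eqP; rewrite eq_complex /=; apply/andP; split; apply/eqP; nra.
Qed.

End SecondOrder.

(** * Independence of the leading coefficients *)

Section Nondegeneracy.
Context {R : realType}.
Local Notation C := R[i].
Local Notation vec := 'rV[C]_(1 + (1 + 3)).
Local Notation pt := 'rV[C]_(1 + 3).
Local Notation V8 := 'rV[R]_((1 + 3) + (1 + 3)).
Local Notation J := (cplx_structure (1 + 3) : 'M[R]_((1 + 3) + (1 + 3))).

Context (M : set pt) (rho : V8 -> 'rV[R]_3).
Local Notation N := (@complex_point R (1 + 3) @^-1` M).
Context (local : local_equation M rho) (minimal : maximally_minimal M rho).
Context (G : 'M[C]_(1 + 3)) (Gu : G \in unitmx).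
Context (jac0 : forall v : V8, v *m jacobian rho 0 =
  \row_j complex.Im (wcoord (complex_point v *m invmx G) 0 j)).
Context (F : pt -> pt) (Fh : holom 0 F) (F0 : F 0 = 0) (Fl : forall p, lsubmx (F p) = lsubmx p).
Context (FD : sdm 0 F 1%:M).
Context (Theta : vec -> 'rV[C]_3) (Q : 'I_3 -> vec -> C) (Qh : forall j, holo 0 (Q j)).
Context (TQ : \forall x \near (0 : vec), forall j,
  Theta x 0 j = rsubmx (rsubmx x) 0 j + x 0 zi * x 0 zetai * Q j x).
Let point (q : V8) : pt := F (complex_point q *m invmx G).
Context (MT : \forall q \near (0 : V8), M (complex_point q) <-> wcoord (point q) = Theta (conj_point (point q))).
Context (al be ga : 'I_3 -> R) (L s0 : R) (s00 : 0 < s0).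
Context (Qexp : forall j z, cn z < s0 ->
  cn (Q j (triple z z^* 0) - 'i * (al j + be j * complex.Re z + ga j * complex.Im z)%:C%C) <= L * cn z ^+ 2).
Context (c : 'I_3 -> R) (alc : \sum_j al j * c j = 0) (bec : \sum_j be j * c j = 0) (gac : \sum_j ga j * c j = 0).

Let D : 'M[C]_(1 + 3, 1) := col_mx 0 (\col_j (c j)%:C%C).
Let h (P : pt) : C := (F (P *m invmx G) *m D) 0 0.
Let zc (q : V8) : C := zcoord (complex_point q *m invmx G).
Let a (q : V8) : R := complex.Re (zc q).
Let b (q : V8) : R := complex.Im (zc q).
Let s (q : V8) : R := a q ^+ 2 + b q ^+ 2.
Let k (x : vec) : C := \sum_j Q j x * (c j)%:C%C.
Let g (q : V8) : R := complex.Im (k (conj_point (point q))) / 2.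
Let f (q : V8) : R := s q * g q.
Let u (q : V8) : R := complex.Re (h (complex_point q)).
Let v (q : V8) : R := complex.Im (h (complex_point q)).

Let Gh (p : pt) : holom p (fun P : pt => P *m invmx G) := holom_mulmxr _ (@holom_id _ _ p).

Lemma hE P : h P = \sum_j wcoord (F (P *m invmx G)) 0 j * (c j)%:C%C.
Proof.
rewrite /h /D -[F _]hsubmxK mul_row_col mulmx0 add0r mxE /wcoord row_mxKr.
by apply: eq_bigr => j _; rewrite [(\col_i _) j 0]mxE.
Qed.

Lemma h_holo : holo 0 h.
Proof.
have FG : holom 0 (fun P : pt => F (P *m invmx G)).
  by apply: (holom_comp (@Gh 0)); rewrite mul0mx.
exact: (holom_mulmxr D FG 0).
Qed.

Lemma complex_point_G : ranm 0 (fun q : V8 => complex_point q *m invmx G).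
Proof. by apply: (ranm_comp (H := fun y : pt => y *m invmx G) (ranm_complex_point _)); exact: Gh. Qed.

Lemma point_ranm : ranm 0 point.
Proof. by apply: (ranm_comp complex_point_G); rewrite complex_point0 mul0mx. Qed.

Lemma point0 : point 0 = 0. Proof. by rewrite /point complex_point0 mul0mx. Qed.

Lemma zc_ran : ran 0 zc.
Proof. by apply: eqf_ran (complex_point_G (lshift 3 0)) => q; rewrite /zc /zcoord [RHS]mxE. Qed.

Let ar : ra 0 a := ra_Re zc_ran.
Let br : ra 0 b := ra_Im zc_ran.
Lemma zc0 : zc 0 = 0. Proof. by rewrite /zc complex_point0 mul0mx /zcoord raddf0 mxE. Qed.
Let a0 : a 0 = 0. Proof. by rewrite /a zc0. Qed.
Let b0 : b 0 = 0. Proof. by rewrite /b zc0. Qed.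
Let sE (q : V8) : s q = a q ^+ 2 + b q ^+ 2. Proof. by []. Qed.
Let sr : ra 0 s := ra_sqmod ar br sE.

Lemma conj_point_ranm : ranm 0 (fun q => conj_point (point q)).
Proof.
have pr := point_ranm.
have zr : ran 0 (fun q => zcoord (point q)).
  by apply: eqf_ran (pr (lshift 3 0)) => q; rewrite /zcoord [RHS]mxE.
apply: ranm_triple zr (ran_conj zr) _; apply: ranm_conj => j.
by apply: eqf_ran (pr (rshift 1 j)) => q; rewrite /wcoord [RHS]mxE.
Qed.

Lemma conj_point0 : conj_point 0 = 0 :> vec.
Proof. by rewrite conj_pointE raddf0 cvec0 row_mx0. Qed.

Lemma k_holo : holo 0 k.
Proof. by apply: holo_sum => j; apply: holoM; [exact: Qh|exact: holo_cst]. Qed.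

Lemma g_ra : ra 0 g.
Proof.
apply: raM; last exact: ra_cst.
by apply: ra_Im; apply: (ran_comp conj_point_ranm); rewrite point0 conj_point0; exact: k_holo.
Qed.

Lemma f_ra : ra 0 f. Proof. exact: raM sr g_ra. Qed.
Lemma u_ra : ra 0 u.
Proof. by apply: ra_Re; apply: (ran_comp (ranm_complex_point _)); rewrite complex_point0; exact: h_holo. Qed.
Lemma v_ra : ra 0 v.
Proof. by apply: ra_Im; apply: (ran_comp (ranm_complex_point _)); rewrite complex_point0; exact: h_holo. Qed.

Lemma zcoord_point q : zcoord (point q) = zc q.
Proof. by rewrite /zcoord /point Fl. Qed.

(** The imaginary part of w = wbar + z zbar Q is Im w = |z|^2 Im Q / 2; the combination with
    coefficients c, where [h] is the holomorphic function c . w, gives v = f. *)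
Lemma on_manifold : \forall q \near (0 : V8), N q -> v q = f q.
Proof.
have h1 := ranm_near_comp (P := fun x => forall j, Theta x 0 j = rsubmx (rsubmx x) 0 j + x 0 zi * x 0 zetai * Q j x)
  conj_point_ranm.
rewrite point0 conj_point0 in h1.
apply: filterS2 MT (h1 TQ) => q Mq Tq /Mq e.
have ej j : complex.Im (wcoord (point q) 0 j) = s q * (complex.Im (Q j (conj_point (point q))) / 2).
  have := Tq j; rewrite -e {1 2 3}/conj_point triple_w triple_z triple_zeta zcoord_point [cvec _ 0 j]mxE.
  rewrite /s /a /b; case: (zc q) => x y; case: (wcoord _ 0 j) => w1 w2; case: (Q j _) => q1 q2.
  by move=> /eqP; rewrite eq_complex /= => /andP[_ /eqP e2]; lra.
rewrite /v hE /f /g /k !raddf_sum /= mulr_suml mulr_sumr; apply: eq_bigr => j _.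
have imM (z : C) (t : R) : complex.Im (z * t%:C%C) = complex.Im z * t by case: z => z1 z2 /=; ring.
by rewrite !imM [complex.Im (wcoord _ 0 j)]ej; ring.
Qed.

Lemma N_regular : regular N rho 0.
Proof. by have [_ /ram_analytic rr Mrho rk] := local; split; [exact: rr|exact: Mrho|exact: rk]. Qed.

Lemma N0 : N 0.
Proof. by rewrite /preimage /= complex_point0; have [] := local. Qed.

Lemma uf_test_pair : test_pair N rho 0 u f.
Proof.
split; [exact: u_ra|exact: f_ra|].
have n1 : \forall q \near (0 : V8), holo (complex_point q) h.
  apply: (ranm_near_comp (P := fun P => holo P h) (ranm_complex_point _)).
  by rewrite complex_point0; exact: holo_near h_holo.
have n2 : \forall q \near (0 : V8), ra q v /\ ra q f by apply: filterS2 (ra_near v_ra) (ra_near f_ra).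
have n3 : \forall q \near (0 : V8), regular N rho q /\ \forall x \near q, N x -> v x = f x.
  by apply: filterS2 (regular_near N_regular) (nbhs_interior on_manifold).
apply: filterS3 n1 n2 n3 => q hq [vr fr] [rq vf] Nq w wT.
rewrite (cauchy_riemann hq w) -/v.
exact: (eq_derivative rq Nq vr fr vf (complex_tangent_tangent (complex_tangentJ wT))).
Qed.

Lemma g0 : g 0 = 0.
Proof.
have Qj j : complex.Im (Q j 0) = al j.
  have := Qexp j (z := 0); rewrite cn0 => /(_ s00); rewrite expr0n mulr0 rmorph0 triple0 /=.
  rewrite !mulr0 !addr0 => h0; have : cn (Q j 0 - 'i * (al j)%:C%C) = 0.
    by apply/eqP; rewrite eq_le h0 cn_ge0.
  move=> /eqP; rewrite cn_eq0 subr_eq0 => /eqP ->.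
  by rewrite /=; ring.
rewrite /g point0 conj_point0 /k raddf_sum /=.
have -> : \sum_j complex.Im (Q j 0 * (c j)%:C%C) = \sum_j al j * c j; last by rewrite alc mul0r.
by apply: eq_bigr => j _; rewrite -Qj; case: (Q j 0) => x y /=; ring.
Qed.

Lemma complex_tangent0 (w : V8) : (w <= complex_tangent rho 0)%MS -> wcoord (complex_point w *m invmx G) = 0.
Proof.
move=> wT; have e1 := complex_tangent_tangent wT.
have e2 := complex_tangent_tangent (complex_tangentJ wT).
rewrite jac0 in e1; rewrite jac0 complex_pointJ -scalemxAl in e2.
apply/rowP => j; have := congr1 (fun A : 'rV[R]_3 => A 0 j) e1; have := congr1 (fun A : 'rV[R]_3 => A 0 j) e2.
rewrite /wcoord !mxE; case: (\sum_i _) => x y /= h1 h2.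
by apply/eqP; rewrite eq_complex /= h2 eqxx andbT; apply/eqP; lra.
Qed.

(** A complex tangent vector at 0 has no w-part, and F is tangent to the identity; so the ray stays
    within o(t) of the points with w = 0. There the contraction of Q with c is O(t^2), its affine
    coefficients being killed by c. *)
Lemma dg0 (w : V8) : (w <= complex_tangent rho 0)%MS -> (w *m grad g 0) 0 0 = 0.
Proof.
move=> /complex_tangent0 w0.
set p := complex_point w *m invmx G in w0.
have [K [r [K0 r0 kK]]] := holo_lipschitz k_holo.
have pE t : complex_point (t *: w) *m invmx G = t%:C%C *: p by rewrite complex_pointZ -scalemxAl.
have ln : nrm p + 1 > 0 by rewrite ltr_wpDl ?nrm_ge0.
apply: (proj2 (directional_derivative_unique (b := 0) g_ra _)) => e e0.
(* Chosen so that the Lipschitz constant [K] turns the error e' t |p| of the linear approximation of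
   [F] into at most e t. *)
pose e' := e / (K * (nrm p + 1)).
have e'0 : 0 < e' by rewrite divr_gt0 // mulr_gt0.
have [r1 r10 FP] := iffLR (sdm_nrm _ _ _) FD e' e'0.
pose T := \sum_j `|L| * `|c j|.
have T0 : 0 <= T by apply: sumr_ge0 => j _; rewrite mulr_ge0.
set nu := zcoord p.
have nup : cn nu <= nrm p by rewrite /nu /zcoord mxE; exact: cn_le_nrm.
have nu0 := cn_ge0 nu.
have T1 : 0 < T * cn nu ^+ 2 + 1 by rewrite ltr_wpDl // mulr_ge0 ?sqr_ge0.
have e1 : 0 < 2 * (1 + e') * (nrm p + 1) by rewrite !mulr_gt0 // ltr_pwDl // ltW.
exists (Num.min (Num.min (r1 / (nrm p + 1)) (r / (2 * (1 + e') * (nrm p + 1))))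
  (Num.min (s0 / (nrm p + 1)) (e / (T * cn nu ^+ 2 + 1)))).
  by rewrite !lt_min !divr_gt0.
move=> t /andP[t0]; rewrite !lt_min !ltr_pdivlMr // => /andP[/andP[tr1 tr] /andP[ts te]].
rewrite subr0 mulr0 subr0.
have np := nrm_ge0 p.
have nt : nrm (t%:C%C *: p) = t * nrm p by rewrite nrmZ cn_real gtr0_norm.
have p1 : pd 0 r1 (t%:C%C *: p) by apply: nrm_pd; rewrite subr0 nt; nra.
have := FP _ _ p1 (pd_center 0 r10); rewrite F0 !subr0 mulmx1 nt => Fp.
set pp := F _ in Fp *.
have lpp : lsubmx pp = t%:C%C *: lsubmx p by rewrite /pp Fl; apply/matrixP => x y; rewrite !mxE.
have zpp : zcoord pp = t%:C%C * nu by rewrite /zcoord lpp mxE.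
have cz : cn (t%:C%C * nu) = t * cn nu by rewrite cnM cn_real gtr0_norm.
have npp : nrm pp <= (1 + e') * (t * nrm p).
  by have := nrmD (pp - t%:C%C *: p) (t%:C%C *: p); rewrite subrK nt; lra.
have wpp : nrm (wcoord pp) <= e' * (t * nrm p).
  apply: le_trans Fp; have -> : wcoord pp = rsubmx (pp - t%:C%C *: p).
    rewrite /wcoord linearB linearZ /= -[rsubmx p]/(wcoord p) w0 scaler0 subr0 //.
  by rewrite -[X in _ <= nrm X]hsubmxK nrm_row_mx lerDr nrm_ge0.
pose x0 : vec := triple (t%:C%C * nu) (t%:C%C * nu)^* 0.
have px : pd 0 r (conj_point pp).
  apply: nrm_pd; rewrite subr0 conj_pointE nrm_row_mx nrm_cvec.
  have : nrm (lsubmx pp) <= nrm pp by rewrite -[X in _ <= nrm X]hsubmxK nrm_row_mx lerDl nrm_ge0.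
  by have := mulr_gt0 t0 e'0; nra.
have px0 : pd 0 r x0.
  apply: nrm_pd; rewrite subr0 cn_triple_diag cz.
  by have := mulr_gt0 t0 e'0; nra.
have dist : nrm (conj_point pp - x0) = nrm (wcoord pp).
  rewrite /conj_point zpp /x0 /triple !opp_row_mx !add_row_mx !subrr subr0 !nrm_row_mx.
  by rewrite !nrm0 !add0r nrm_cvec.
have k1 := kK _ _ px px0; rewrite dist in k1.
have Ke : K * (e' * (t * nrm p)) <= e * t.
  have -> : e = K * (e' * (nrm p + 1)) by rewrite /e'; field; rewrite ?gt_eqF.
  have := mulr_gt0 K0 (mulr_gt0 e'0 t0); nra.
have k2 : cn (k (conj_point pp) - k x0) <= e * t.
  by apply: le_trans k1 _; apply: le_trans Ke; rewrite ler_wpM2l // ltW.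
have k3 : `|complex.Im (k x0)| <= T * cn nu ^+ 2 * t ^+ 2.
  pose z := t%:C%C * nu.
  pose err j := complex.Im (Q j x0) - (al j + be j * complex.Re z + ga j * complex.Im z).
  have Ek : complex.Im (k x0) = \sum_j err j * c j.
    have imM (y : C) (x : R) : complex.Im (y * x%:C%C) = complex.Im y * x by case: y => y1 y2 /=; ring.
    rewrite /k raddf_sum /= /err.
    under [RHS]eq_bigr do rewrite mulrBl !mulrDl.
    rewrite sumrB !big_split /= alc.
    have -> : \sum_i be i * complex.Re z * c i = 0.
      by under eq_bigr do rewrite mulrAC; rewrite -mulr_suml bec mul0r.
    have -> : \sum_i ga i * complex.Im z * c i = 0.
      by under eq_bigr do rewrite mulrAC; rewrite -mulr_suml gac mul0r.
    by rewrite !addr0 subr0; apply: eq_bigr => j _; rewrite imM.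
  rewrite Ek; apply: le_trans (ler_norm_sum _ _ _) _.
  rewrite /T !mulr_suml; apply: ler_sum => j _; rewrite normrM.
  have err1 : `|err j| <= `|L| * (t * cn nu) ^+ 2.
    have := Qexp j (z := z); rewrite /z cz => /(_ _) Qb.
    have Qb' : cn (Q j x0 - 'i * (al j + be j * complex.Re z + ga j * complex.Im z)%:C%C) <= L * (t * cn nu) ^+ 2.
      by apply: Qb; nra.
    have LL : L * (t * cn nu) ^+ 2 <= `|L| * (t * cn nu) ^+ 2 by rewrite ler_wpM2r ?sqr_ge0 ?ler_norm.
    apply: le_trans LL; apply: le_trans Qb'; apply: le_trans (Im_le_cn _).
    rewrite /err; move: (_ + _ + _) => w'.
    by case: (Q j x0) => x y /=; rewrite mul0r mul1r add0r.
  have -> : `|L| * `|c j| * cn nu ^+ 2 * t ^+ 2 = `|L| * (t * cn nu) ^+ 2 * `|c j| by ring.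
  by rewrite ler_wpM2r.
have k4 : T * cn nu ^+ 2 * t ^+ 2 <= e * t.
  have : T * cn nu ^+ 2 * t <= e by nra.
  move=> /(ler_wpM2r (ltW t0)); apply: le_trans.
  by rewrite le_eqVlt; apply/orP; left; apply/eqP; ring.
have -> : g (t *: w) = complex.Im (k (conj_point pp)) / 2 by rewrite /g /point pE.
have k5 : `|complex.Im (k (conj_point pp))| <= 2 * (e * t).
  have -> : complex.Im (k (conj_point pp)) = complex.Im (k (conj_point pp) - k x0) + complex.Im (k x0).
    by case: (k _) => x y; case: (k _) => x' y' /=; ring.
  apply: le_trans (ler_normD _ _) _.
  by have := Im_le_cn (k (conj_point pp) - k x0); lra.
by rewrite normrM (gtr0_norm (_ : 0 < 2^-1)) ?invr_gt0 //; lra.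
Qed.

Lemma grad_f0 : grad f 0 = 0.
Proof.
rewrite (gradM sr g_ra) g0 (sqmod0 a0 b0 sE).
by rewrite !scale0r addr0.
Qed.

Lemma section_dg0 Z : section N rho 0 Z -> Dx Z g 0 = 0.
Proof. by move=> [_ /nbhs_singleton ZT]; rewrite Dx_grad dg0 //; exact: ZT N0. Qed.

Let fE (q : V8) : f q = s q * g q. Proof. by []. Qed.

Lemma iterated_grad_u l W : (l < 3)%N ->
  iterated_bracket N (complex_tangent rho) 0 l W -> W 0 *m grad u 0 = 0.
Proof.
move=> lk Wl; apply/matrixP => i j; rewrite (ord1 i) (ord1 j) [RHS]mxE -Dx_grad.
have uf := uf_test_pair; have reg := N_regular.
case: l lk Wl => [|[|[|//]]] _.
- move=> /local_sectionE Xs; rewrite (nbhs_singleton (test_section uf Xs) N0).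
  by rewrite Dx_grad grad_f0 mulmx0 mxE.
- move=> [X [V [/local_sectionE Xs /local_sectionE Vs ->]]].
  have [Xr _] := Xs; have [Vr _] := Vs.
  rewrite (test_bracket reg uf Xs Vs N0) /bracket1.
  rewrite (jet2_sqmod_mul ar br a0 b0 sE fE Xr (ram_rotate Vr) g_ra).
  rewrite (jet2_sqmod_mul ar br a0 b0 sE fE Vr (ram_rotate Xr) g_ra).
  by rewrite g0 !mulr0 subrr.
move=> [X [V' [/local_sectionE Xs [Y [V [/local_sectionE Ys /local_sectionE Vs ->]]] ->]]].
have [Xr _] := Xs; have [Vr _] := Vs; have [Yr _] := Ys.
have rXs := section_rotate Xs; have rYs := section_rotate Ys; have rVs := section_rotate Vs.
have [rXr _] := rXs; have [rYr _] := rYs; have [rVr _] := rVs.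
rewrite (test_bracket2 reg uf Xs Ys Vs N0) (bracket2E f_ra Xr Yr Vr).
have J3 (A B E : V8 -> V8) : section N rho 0 A -> section N rho 0 B -> section N rho 0 E ->
    Dx A (Dx B (Dx E f)) 0 = 0.
  move=> As Bs Es; have [Ar _] := As; have [Br _] := Bs; have [Er _] := Es.
  rewrite (jet3_sqmod_mul ar br a0 b0 sE fE Ar Br Er g_ra g0).
  by rewrite (section_dg0 As) (section_dg0 Bs) (section_dg0 Es) !mulr0 !addr0 mulr0.
by rewrite (J3 _ _ _ Xs Ys rVs) (J3 _ _ _ Xs Vs rYs) (J3 _ _ _ Ys Vs rXs) (J3 _ _ _ Vs Ys rXs) !subrr.
Qed.

(** Rank 5 makes D^3 M the whole tangent space at 0, so the derivative of u vanishes on the tangent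
    vector whose normalized w-part is c. Its value there is the sum of the squares of the c_j. *)
Lemma leading_coefficients_nondegenerate j : c j = 0.
Proof.
have [_ _ [B [Bf BP]]] := nbhs_singleton minimal N0.
rewrite -[X in bracket_fibre X]/N in BP.
have rk : \rank (jacobian rho 0) = 3%N.
  by have [_ _ /nbhs_singleton rk] := N_regular; exact: rk N0.
have Bfib i : bracket_fibre N (complex_tangent rho) 3 0 (row i B).
  by apply/BP; exact: row_sub.
have BT : (B <= tangent rho 0)%MS.
  apply/row_subP => i; rewrite sub_tangent; apply/eqP.
  apply: bracket_fibre_ker (Bfib i) => l W lk.
  exact: iterated_tangent N_regular N0 lk.
have TB : (tangent rho 0 <= B)%MS.
  rewrite -(mxrank_leqif_sup BT).2 mxrank_ker rk; move: Bf; rewrite /row_free => /eqP ->.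
  by [].
pose w : 'rV[R]_3 := \row_i c i.
have [v0 v0E] := complex_point_surj (row_mx 0 (rc w) *m G).
have v0w : complex_point v0 *m invmx G = row_mx 0 (rc w) by rewrite v0E mulmxK.
have v0T : v0 *m jacobian rho 0 = 0.
  by rewrite jac0 v0w /wcoord row_mxKr; apply/rowP => i; rewrite !mxE.
have v0u : v0 *m grad u 0 = 0.
  have : (v0 <= B)%MS by apply: submx_trans TB; rewrite sub_tangent v0T.
  move=> /BP; apply: bracket_fibre_ker => l W lk; exact: iterated_grad_u.
have hd : sdm 0 (fun P : pt => F (P *m invmx G) *m D) (invmx G *m 1%:M *m D).
  by apply: sdm_mulmxr; apply: (sdm_comp (sdm_linear 0 (invmx G))); rewrite mul0mx.
have := (complex_point_grad (q := 0 : V8) (h := h) (d := fun i => (invmx G *m 1%:M *m D) i 0) _ v0).1.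
rewrite complex_point0 => /(_ (hd 0)); rewrite -/u v0u mxE.
have -> : \sum_i complex_point v0 0 i * (invmx G *m 1%:M *m D) i 0 = (complex_point v0 *m (invmx G *m 1%:M *m D)) 0 0.
  by rewrite [RHS]mxE.
rewrite mulmx1 mulmxA v0w mul_row_col mul0mx add0r mxE raddf_sum /=.
move=> /esym/eqP; rewrite psumr_eq0 => [/allP h0|i _]; last first.
  by rewrite !mxE /= mul0r subr0 -expr2 sqr_ge0.
have := h0 j (mem_index_enum j); rewrite !mxE /= mul0r subr0 => /eqP/eqP.
by rewrite mulf_eq0 orbb => /eqP.
Qed.

End Nondegeneracy.

(** * Linear normalization of the leading coefficients *)

Section NormalForm.
Context {R : realType}.
Local Notation C := R[i].
Local Notation vec := 'rV[C]_(1 + (1 + 3)).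
Local Notation pt := 'rV[C]_(1 + 3).
Local Notation V8 := 'rV[R]_((1 + 3) + (1 + 3)).
Local Notation mc := (map_mx (real_complex R)).

Lemma near_complex_point (P : set pt) : (\forall q \near (0 : V8), P (complex_point q)) ->
  \forall p \near (0 : pt), P p.
Proof.
move=> /near_rc; rewrite rc0 => -[r r0 rP].
have [K K0 KP] := nrm_mulmx (real_part_mx : 'M[C]_((1 + 3) + (1 + 3))).
have K1 : 0 < 2 * (K + 1) by rewrite mulr_gt0 // ltr_wpDl.
apply/near_nrm; exists (r / (2 * (K + 1))); first by rewrite divr_gt0.
move=> p; rewrite subr0 ltr_pdivlMr // => pr; have [q qp] := complex_point_surj p.
rewrite -qp; apply: rP; apply: nrm_pd; rewrite subr0 rc_real_part qp.
apply: le_lt_trans (KP _) _; rewrite nrm_row_mx nrm_cvec.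
by have := nrm_ge0 p; nra.
Qed.

(** The rows alpha, beta, gamma form an invertible matrix K, and S is the inverse of K times diag(2,
    4, 4). The constants come from 2i, 2i(z + zbar) = 4i x and 2(z - zbar) = 4i y. *)
Lemma leading_matrix_unit (al be ga : 'I_3 -> R) :
  (forall c : 'I_3 -> R, \sum_j al j * c j = 0 -> \sum_j be j * c j = 0 -> \sum_j ga j * c j = 0 ->
    forall j, c j = 0) ->
  exists S : 'M[R]_3, S \in unitmx /\ forall j (x y : R),
    \sum_i (al i + be i * x + ga i * y) * S i j = [:: 2; 4 * x; 4 * y]`_j.
Proof.
move=> inj; pose K : 'M[R]_3 := \matrix_(i, j) [:: al j; be j; ga j]`_i.
have Ku : K \in unitmx.
  rewrite -unitmx_tr -row_free_unit; apply: inj_row_free => v vK.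
  have h i : \sum_j K i j * v 0 j = 0.
    have := congr1 (fun A : 'rV[R]_3 => A 0 i) vK; rewrite [RHS]mxE mxE; apply: etrans.
    by apply: eq_bigr => j _; rewrite [K^T _ _]mxE mulrC.
  apply/rowP => j; rewrite [RHS]mxE; apply: (inj (fun j => v 0 j)).
  - by apply: etrans (h 0); apply: eq_bigr => i _; rewrite mxE.
  - by apply: etrans (h 1); apply: eq_bigr => i _; rewrite mxE.
  - by apply: etrans (h 2); apply: eq_bigr => i _; rewrite mxE.
pose d : 'rV[R]_3 := \row_i [:: 2; 4; 4]`_i.
exists (invmx K *m diag_mx d); split.
  rewrite unitmx_mul unitmx_inv Ku unitmxE det_diag unitfE.
  apply/prodf_neq0 => i _; rewrite mxE; case: i => [[|[|[|//]]] ip] /=; exact: lt0r_neq0.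
move=> j x y; set S := _ *m _.
have KS : K *m S = diag_mx d by rewrite mulmxA mulmxV // mul1mx.
pose w : 'rV[R]_3 := \row_i [:: 1; x; y]`_i.
have -> : \sum_i (al i + be i * x + ga i * y) * S i j = (w *m K *m S) 0 j.
  rewrite mxE; apply: eq_bigr => i _; congr (_ * _); rewrite mxE !big_ord_recl big_ord0 !mxE /=.
  by ring.
rewrite -mulmxA KS mul_mx_diag !mxE; case: j => [[|[|[|//]]] jp] /=; ring.
Qed.

Section LinearChange.
Context (Theta : vec -> 'rV[C]_3) (Th : holom 0 Theta) (re : reality_condition Theta).
Context (nT : normality_conditions (fun x => Theta x - rsubmx (rsubmx x))).
Context (Q : 'I_3 -> vec -> C) (Qh : forall j, holo 0 (Q j)).
Context (TQ : \forall x \near (0 : vec), forall j,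
  Theta x 0 j = rsubmx (rsubmx x) 0 j + x 0 zi * x 0 zetai * Q j x).
Context (al be ga : 'I_3 -> R) (L s0 : R) (s00 : 0 < s0) (L0 : 0 < L).
Context (Qexp : forall j z, cn z < s0 ->
  cn (Q j (triple z z^* 0) - 'i * (al j + be j * complex.Re z + ga j * complex.Im z)%:C%C) <= L * cn z ^+ 2).
Context (S : 'M[R]_3) (Su : S \in unitmx) (SE : forall j (x y : R),
    \sum_i (al i + be i * x + ga i * y) * S i j = [:: 2; 4 * x; 4 * y]`_j).

Let Sc : 'M[C]_3 := mc S.
Let Si : 'M[C]_3 := mc (invmx S).
Let ScSi : Sc *m Si = 1%:M. Proof. by rewrite -map_mxM mulmxV // map_mx1. Qed.
Let SiSc : Si *m Sc = 1%:M. Proof. by rewrite -map_mxM mulVmx // map_mx1. Qed.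

Let sg (x : vec) : vec := triple (x 0 zi) (x 0 zetai) (rsubmx (rsubmx x) *m Si).
Let Theta2 x := Theta (sg x) *m Sc.
Definition changed_remainder (x : vec) : 'rV[C]_3 :=
  Theta2 x - rsubmx (rsubmx x) - cubic_model (x 0 zi) (x 0 zetai).
Local Notation Pi := changed_remainder.

Lemma sg_triple z zeta w : sg (triple z zeta w) = triple z zeta (w *m Si).
Proof. by rewrite /sg triple_z triple_zeta triple_w. Qed.

Lemma sg_holom : holom 0 sg.
Proof.
by apply: holom_triple; [exact: holo_coord|exact: holo_coord|]; apply: holom_mulmxr; exact: holom_omega.
Qed.

Lemma sg0 : sg 0 = 0.
Proof. by rewrite /sg !mxE !raddf0 mul0mx triple0. Qed.

Lemma Theta2_holom : holom 0 Theta2.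
Proof. by apply: holom_mulmxr; apply: (holom_comp sg_holom); rewrite sg0. Qed.

Lemma changed_remainder_holom : holom 0 Pi.
Proof.
apply: holomB; first by apply: holomB; [exact: Theta2_holom|exact: holom_omega].
move=> j; apply: (@eqf_holo _ _ _ (fun x : vec => x 0 zi * x 0 zetai * model_factor j (x 0 zi) (x 0 zetai))).
  by move=> x; rewrite cubic_modelE.
by apply: holoM; [apply: holoM; exact: holo_coord|exact: holo_model_factor].
Qed.

Lemma changed_solved_rhs x : solved_rhs Pi x = Theta2 x.
Proof.
rewrite /solved_rhs /Pi zcE zetaE; move: (cubic_model _ _) (rsubmx (rsubmx x)) (Theta2 x) => s t u.
by apply/rowP => j; rewrite !mxE; ring.
Qed.

Lemma cvec_real m (w : 'rV[C]_m) k (A : 'M[R]_(m, k)) : cvec (w *m mc A) = cvec w *m mc A.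
Proof. by apply: cvec_mulmx_real => i j; rewrite mxE conj_real. Qed.

(** The matrix S is real, so the change of w commutes with conjugation and carries the reality
    condition of [Theta] to that of [Theta2]. *)
Lemma changed_reality : reality_condition (solved_rhs Pi).
Proof.
have -> : solved_rhs Pi = Theta2 by apply/funext => x; exact: changed_solved_rhs.
apply/(reality_conditionP Theta2_holom).
have := near_holo (P := fun x => rsubmx (rsubmx x) =
  Theta (triple (x 0 zi) (x 0 zetai) (cvec (Theta (cvec (swap x)))))) sg_holom.
rewrite sg0 => /(_ (iffLR (reality_conditionP Th) re)); apply: filterS => x.
have [z [zeta [w ->]]] : exists z zeta w, x = triple z zeta w.
  by exists (x 0 zi), (x 0 zetai), (rsubmx (rsubmx x)); rewrite triple_eta.
have cT y : cvec (Theta2 y) = cvec (Theta (sg y)) *m Sc by exact: cvec_real.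
rewrite cT {1}/Theta2 !sg_triple /swap !triple_z !triple_zeta !triple_w !cvec_triple !sg_triple.
rewrite cvec_real => e; rewrite -[_ *m Sc *m Si]mulmxA ScSi mulmx1 -/Si -e.
by rewrite -mulmxA SiSc mulmx1.
Qed.

Lemma changed_normality : normality_conditions Pi.
Proof.
have := near_holo (P := fun x => let z := lsubmx x 0 0 in
    let zeta := lsubmx (rsubmx x) 0 0 in let omega := rsubmx (rsubmx x) in
    Theta (triple 0 zeta omega) - rsubmx (rsubmx (triple 0 zeta omega)) = 0 /\
    Theta (triple z 0 omega) - rsubmx (rsubmx (triple z 0 omega)) = 0) sg_holom.
rewrite sg0 => /(_ nT); apply: filterS => x /=.
rewrite !zcE !zetaE /sg triple_z triple_zeta !triple_w => -[/subr0_eq e1 /subr0_eq e2].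
have cm (z zeta : C) : z * zeta = 0 -> cubic_model z zeta = 0.
  by move=> h; apply/rowP => j; rewrite cubic_modelE h mul0r mxE.
rewrite /Pi /Theta2 !triple_z !triple_zeta !triple_w !sg_triple e1 e2 -mulmxA SiSc mulmx1 subrr.
by rewrite !cm ?mul0r ?mulr0 ?subr0.
Qed.

Let Qrow x : 'rV[C]_3 := \row_i Q i x.
Let factor_row (z zeta : C) : 'rV[C]_3 := \row_j model_factor j z zeta.

Lemma changed_factor : \forall x \near (0 : vec),
  Pi x = (x 0 zi * x 0 zetai) *: (Qrow (sg x) *m Sc - factor_row (x 0 zi) (x 0 zetai)).
Proof.
have := near_holo (P := fun x => forall j,
  Theta x 0 j = rsubmx (rsubmx x) 0 j + x 0 zi * x 0 zetai * Q j x) sg_holom.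
rewrite sg0 => /(_ TQ); apply: filterS => x Tx.
have -> : Pi x = Theta (sg x) *m Sc - rsubmx (rsubmx x) - (x 0 zi * x 0 zetai) *: factor_row (x 0 zi) (x 0 zetai).
  by rewrite /Pi /Theta2; congr (_ - _); apply/rowP => j; rewrite cubic_modelE !mxE.
have -> : Theta (sg x) = rsubmx (rsubmx x) *m Si + (x 0 zi * x 0 zetai) *: Qrow (sg x).
  by apply/rowP => j; rewrite Tx {1 2 3}/sg triple_w triple_z triple_zeta [RHS]mxE [X in _ = _ + X]mxE [Qrow _ 0 j]mxE.
rewrite mulmxDl -mulmxA SiSc mulmx1 -scalemxAl scalerBr.
by congr (_ - _); rewrite addrAC subrr add0r.
Qed.

(** The factored remainder is split at w = 0: [A] is its value there, and [B] is the variation in w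
    of the factor of z zbar. *)
Let A (p : pt) : 'rV[C]_3 := (zcoord p * (zcoord p)^*) *:
  (Qrow (triple (zcoord p) (zcoord p)^* 0) *m Sc - factor_row (zcoord p) (zcoord p)^*).
Let B (p : pt) : 'rV[C]_3 :=
  (Qrow (sg (conj_point p)) - Qrow (triple (zcoord p) (zcoord p)^* 0)) *m Sc.

(** S sends the affine part of Q exactly to [factor_row], so that z zbar multiplies only the
    quadratic error of [Qexp]. *)
Lemma A_bound : A =O_ (0 : pt) (fun p => zcoord p ^+ 4).
Proof.
apply/bigO_scalarP; have [K K0 KP] := nrm_mulmx Sc.
exists (3 * L * (K + 1)); first by rewrite !mulr_gt0 // ltr_wpDl.
have zs : \forall p \near (0 : pt), cn (zcoord p) < s0.
  apply/near_nrm; exists s0 => // p; rewrite subr0; apply: le_lt_trans.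
  by rewrite /zcoord mxE; exact: cn_le_nrm.
apply: filterS zs => p ps j; set z := zcoord p in ps *.
pose err : 'rV[C]_3 := \row_i (Q i (triple z z^* 0) - 'i * (al i + be i * complex.Re z + ga i * complex.Im z)%:C%C).
have -> : A p = (z * z^*) *: (err *m Sc).
  rewrite /A -/z; congr (_ *: _).
  have -> : Qrow (triple z z^* 0) =
      err + 'i *: rc (\row_i (al i + be i * complex.Re z + ga i * complex.Im z)).
    by apply/rowP => i; rewrite !mxE subrK.
  rewrite mulmxDl -addrA -[RHS]addr0; congr (_ + _); apply/eqP; rewrite subr_eq0; apply/eqP.
  rewrite -scalemxAl -rc_mulmx; apply/rowP => i; rewrite !mxE.
  under eq_bigr do rewrite mxE.
  rewrite SE /model_factor; case: (z) => x y.
  by case: i => [[|[|[|//]]] ip] /=; apply/eqP; rewrite eq_complex /=; apply/andP; split; apply/eqP; ring.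
rewrite mxE cnX !cnM cn_conj.
have e1 : nrm err <= 3 * (L * cn z ^+ 2).
  rewrite /nrm; apply: (@le_trans _ _ (\sum_(i < 3) L * cn z ^+ 2)).
    by apply: ler_sum => i _; rewrite mxE; exact: Qexp.
  by rewrite sumr_const card_ord mulr_natl.
have e2 : cn ((err *m Sc) 0 j) <= (K + 1) * (3 * (L * cn z ^+ 2)).
  apply: le_trans (cn_le_nrm _ j) _; apply: le_trans (KP _) _.
  by apply: ler_pM; rewrite ?nrm_ge0 // lerDl.
rewrite (_ : 3 * L * (K + 1) * cn z ^+ 4 = cn z * cn z * ((K + 1) * (3 * (L * cn z ^+ 2)))); last by ring.
by rewrite ler_wpM2l // mulr_ge0 ?cn_ge0.
Qed.

(** The two arguments of Q differ only in their last block, by a linear image of wbar, and Q is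
    Lipschitz. *)
Lemma B_bound : B =O_ (0 : pt) (@wcoord R).
Proof.
apply/bigO_vectorP; have [K K0 KP] := nrm_mulmx Sc; have [K' K'0 KP'] := nrm_mulmx Si.
pose x0 (x : vec) : vec := triple (x 0 zi) (x 0 zetai) 0.
have x0h : holom 0 x0 by apply: holom_triple; [exact: holo_coord|exact: holo_coord|exact: holom_cst].
have x00 : x0 0 = 0 by rewrite /x0 !mxE triple0.
have H i : exists l : R, 0 < l /\ \forall x \near (0 : vec), cn (Q i (sg x) - Q i (x0 x)) <= l * nrm (sg x - x0 x).
  have [l [r [l0 r0 h]]] := holo_lipschitz (Qh i); exists l; split=> //.
  have n0 := iffRL (near_pd (0 : vec) _) (ex_intro2 _ _ r r0 (fun x h => h)).
  have n1 := near_holo (P := fun x => pd 0 r x) sg_holom; rewrite sg0 in n1.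
  have n2 := near_holo (P := fun x => pd 0 r x) x0h; rewrite x00 in n2.
  by apply: filterS2 (n1 n0) (n2 n0) => x; exact: h.
have [l lP] := choice H.
have l0 i : 0 <= l i by have [/ltW] := lP i.
have sl : 0 <= \sum_i l i by apply: sumr_ge0.
exists ((K + 1) * ((\sum_i l i + 1) * (K' + 1))).
  by rewrite !mulr_gt0 // ltr_wpDl.
apply: filterS (near_conj_point (near_all (fun i => (lP i).2))) => p hp j.
set w := wcoord p.
have x0E : x0 (conj_point p) = triple (zcoord p) (zcoord p)^* 0.
  by rewrite /x0 /conj_point triple_z triple_zeta.
have dist : nrm (sg (conj_point p) - x0 (conj_point p)) <= K' * nrm w.
  rewrite /x0 /conj_point sg_triple triple_z triple_zeta /triple !opp_row_mx !add_row_mx !subrr subr0.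
  by rewrite !nrm_row_mx !nrm0 !add0r; apply: le_trans (KP' _) _; rewrite nrm_cvec.
have e1 : nrm (Qrow (sg (conj_point p)) - Qrow (triple (zcoord p) (zcoord p)^* 0)) <= (\sum_i l i + 1) * ((K' + 1) * nrm w).
  apply: (@le_trans _ _ (\sum_i l i * ((K' + 1) * nrm w))).
    rewrite /nrm; apply: ler_sum => i _; rewrite !mxE.
    have h1 := hp i; rewrite {1}x0E in h1.
    apply: le_trans h1 _; apply: ler_wpM2l => //; apply: le_trans dist _.
    by rewrite ler_wpM2r ?nrm_ge0 // lerDl.
  by rewrite -mulr_suml ler_wpM2r ?lerDl // mulr_ge0 ?nrm_ge0 // addr_ge0.
apply: le_trans (cn_le_nrm _ j) _; rewrite /B; apply: le_trans (KP _) _.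
rewrite -!mulrA; apply: ler_pM; rewrite ?nrm_ge0 ?lerDl //.
Qed.

Lemma changed_admissible : admissible_remainder Pi.
Proof.
split; [exact: (iffRL (holom_analytic _ _) changed_remainder_holom)| |exact: changed_reality|exact: changed_normality].
exists A, B; split; [|exact: A_bound|exact: B_bound].
apply: filterS (near_conj_point changed_factor) => p; rewrite -/(conj_point p) => ->.
rewrite {1 2 4 5}/conj_point triple_z triple_zeta /A /B -scalerDr mulmxBl.
congr (_ *: _); move: (_ *m Sc) (Qrow (triple _ _ _) *m Sc) (factor_row _ _) => s t u.
by apply/rowP => j; rewrite !mxE; ring.
Qed.

Definition change_mx : 'M[C]_(1 + 3) := block_mx 1%:M 0 0 Sc.

Lemma change_mx_unit : change_mx \in unitmx.
Proof.
have : change_mx *m block_mx 1%:M 0 0 Si = 1%:M.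
  by rewrite mulmx_block !mulmx0 !mul0mx !addr0 add0r mulmx1 ScSi -scalar_mx_block.
by move=> /mulmx1_unit[].
Qed.

Lemma changed_membership (p : pt) :
  wcoord p = Theta (conj_point p) <-> defining_equations Pi (p *m change_mx).
Proof.
have pE : p *m change_mx = row_mx (lsubmx p) (wcoord p *m Sc).
  by rewrite -{1}[p]hsubmxK mul_row_block !mulmx0 addr0 add0r mulmx1.
rewrite defining_equationsP changed_solved_rhs pE /Theta2.
have -> : sg (conj_point (row_mx (lsubmx p) (wcoord p *m Sc))) = conj_point p.
  rewrite /conj_point sg_triple /zcoord /wcoord row_mxKl row_mxKr cvec_real.
  by rewrite -mulmxA ScSi mulmx1.
rewrite [X in _ <-> X = _]/wcoord row_mxKr.
split=> [->//|/(congr1 (mulmx^~ Si))].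
by rewrite -!mulmxA ScSi !mulmx1.
Qed.

End LinearChange.
End NormalForm.

(** * Existence of the normal form *)

Section Representation.
Context {R : realType}.
Local Notation C := R[i].
Local Notation vec := 'rV[C]_(1 + (1 + 3)).
Local Notation pt := 'rV[C]_(1 + 3).
Local Notation V8 := 'rV[R]_((1 + 3) + (1 + 3)).

Lemma local_coordinates_linear n (F : 'rV[C]_n -> 'rV[C]_n) (A B : 'M[C]_n) :
  A \in unitmx -> B \in unitmx -> local_coordinates F ->
  local_coordinates (fun p => F (p *m A) *m B).
Proof.
move=> Au Bu [/holom_analytic Fh F0 [E [/holom_analytic Eh E0 EF FE]]].
have lin (X : 'M[C]_n) : holom 0 (fun p : 'rV[C]_n => p *m X) by exact: holom_mulmxr _ (@holom_id _ _ 0).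
have comp (G : 'rV[C]_n -> 'rV[C]_n) (X Y : 'M[C]_n) : holom 0 G -> holom 0 (fun p => G (p *m X) *m Y).
  move=> Gh; have h : holom (0 *m X) G by rewrite mul0mx.
  exact: (holom_mulmxr Y (holom_comp (lin X) h)).
split; [exact: (iffRL (holom_analytic _ _) (comp _ _ _ Fh))|by rewrite mul0mx F0 mul0mx|].
exists (fun p => E (p *m invmx B) *m invmx A); split.
- exact: (iffRL (holom_analytic _ _) (comp _ _ _ Eh)).
- by rewrite mul0mx E0 mul0mx.
- have := near_holo (P := fun p => E (F p) = p) (lin A); rewrite mul0mx => /(_ EF).
  by apply: filterS => p e; rewrite (mulmxK Bu) e (mulmxK Au).
- have := near_holo (P := fun p => F (E p) = p) (lin (invmx B)); rewrite mul0mx => /(_ FE).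
  by apply: filterS => p e; rewrite (mulmxKV Au) e (mulmxKV Bu).
Qed.

Lemma maximally_minimal_representation (M : set pt) : maximally_minimal_CR_generic_M5 M ->
  exists (Phi : pt -> pt) (Pi : vec -> 'rV[C]_3),
    [/\ local_coordinates Phi, admissible_remainder Pi
      & \forall p \near (0 : pt), M p <-> defining_equations Pi (Phi p)].
Proof.
move=> [rho [loc gen minimal]].
have [G [T0 [Gu [T0h T00] T0D T0s [jac0 MT0]]]] := complex_equation loc gen.
have [F [T [Fc [Fl FD] [Th re] nT FT]]] := normal_coordinates T0h T00 T0D T0s.
have [Fa F0 _] := Fc; have Fh := iffLR (holom_analytic _ _) Fa.
have Ph : holom 0 (fun x => T x - rsubmx (rsubmx x)) by apply: (holomB Th); exact: holom_omega.
have [Q [Qh PQ]] := normal_factor Ph nT.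
have TQ : \forall x \near (0 : vec), forall j,
    T x 0 j = rsubmx (rsubmx x) 0 j + x 0 zi * x 0 zetai * Q j x.
  apply: filterS PQ => x Px j; rewrite -Px.
  by rewrite [X in _ = _ + X]mxE [X in _ + (_ + X)]mxE addrC subrK.
have Gq : ranm 0 (fun q : V8 => complex_point q *m invmx G).
  apply: (ranm_comp (H := fun y : pt => y *m invmx G) (ranm_complex_point _)).
  exact: holom_mulmxr _ (@holom_id _ _ _).
have MT : \forall q \near (0 : V8), M (complex_point q) <->
    wcoord (F (complex_point q *m invmx G)) = T (conj_point (F (complex_point q *m invmx G))).
  have := ranm_near_comp (P := fun p => wcoord p = T0 (conj_point p) <->
    wcoord (F p) = T (conj_point (F p))) Gq.
  rewrite complex_point0 mul0mx => /(_ FT) FT'.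
  by apply: filterS2 MT0 FT' => q /= e1 e2; rewrite e1 e2.
have [K [r [r0 QRe]]] := reality_factor Th Qh TQ re.
have H j : exists w : (R * R * R) * (R * R), [/\ 0 < w.2.2, 0 < w.2.1 & forall z, cn z < w.2.2 ->
    cn (Q j (triple z z^* 0) - 'i * (w.1.1.1 + w.1.1.2 * complex.Re z + w.1.2 * complex.Im z)%:C%C) <= w.2.1 * cn z ^+ 2].
  have [a [b [c [L [s [? ? h]]]]]] := imaginary_expansion (Qh j) r0 (QRe^~ j).
  by exists ((a, b, c), (L, s)).
have [w wP] := choice H.
pose al j := (w j).1.1.1; pose be j := (w j).1.1.2; pose ga j := (w j).1.2.
pose L := \sum_j (w j).2.1.
have L0 j : 0 < (w j).2.1 by have [] := wP j.
have LL j : (w j).2.1 <= L by rewrite /L (bigD1 j) //= lerDl sumr_ge0 // => i _; exact: ltW.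
have [s0 s00 Qexp] : exists2 s0 : R, 0 < s0 & forall j z, cn z < s0 ->
    cn (Q j (triple z z^* 0) - 'i * (al j + be j * complex.Re z + ga j * complex.Im z)%:C%C) <= L * cn z ^+ 2.
  apply: common_radius => [j a b ba h z zb|j]; first by apply: h; exact: lt_le_trans zb ba.
  have [s0 _ h] := wP j; exists (w j).2.2 => // z /h /le_trans; apply.
  by rewrite ler_wpM2r ?sqr_ge0.
have Lp : 0 < L by apply: lt_le_trans (L0 0) (LL 0).
have inj (c : 'I_3 -> R) : \sum_j al j * c j = 0 -> \sum_j be j * c j = 0 -> \sum_j ga j * c j = 0 ->
    forall j, c j = 0.
  by move=> h1 h2 h3; exact: (leading_coefficients_nondegenerate loc minimal Gu jac0 Fh F0 Fl FD Qh TQ MT s00 Qexp h1 h2 h3).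
have [S [Su SE]] := leading_matrix_unit inj.
exists (fun p => F (p *m invmx G) *m change_mx S), (changed_remainder T S); split.
- apply: local_coordinates_linear; [by rewrite unitmx_inv|exact: change_mx_unit|exact: Fc].
- exact: (changed_admissible Th re nT Qh TQ s00 Lp Qexp Su SE).
apply: near_complex_point; apply: filterS MT => q ->.
exact: changed_membership.
Qed.

End Representation.

Theorem proposition1p1 (R : realType) :
  (forall M : set 'rV[R[i]]_(1 + 3), maximally_minimal_CR_generic_M5 M ->
     exists (Phi : 'rV[R[i]]_(1 + 3) -> 'rV[R[i]]_(1 + 3))
            (Pi : 'rV[R[i]]_(1 + (1 + 3)) -> 'rV[R[i]]_3),
       [/\ local_coordinates Phi,
           admissible_remainder Pi
         & \forall p \near (0 : 'rV[R[i]]_(1 + 3)),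
             M p <-> defining_equations Pi (Phi p)]) /\
  (forall Pi : 'rV[R[i]]_(1 + (1 + 3)) -> 'rV[R[i]]_3,
     admissible_remainder Pi ->
     maximally_minimal_CR_generic_M5 [set p | defining_equations Pi p]).
Proof.
split; [exact: maximally_minimal_representation|exact: admissible_maximally_minimal].
Qed.
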